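(* For every partition $\eta$, as identities of symmetric functions in $\mathbf x=(x_1,x_2,\dots)$, $$\sum_\lambda b^{el}_\lambda P_{\lambda/\eta}(\mathbf x;q,t)=\Theta_{el}(\mathbf x)\sum_\mu b^{el}_\mu Q_{\eta/\mu}(\mathbf x;q,t),\qquad\sum_\lambda b^{oa}_\lambda P_{\lambda/\eta}(\mathbf x;q,t)=\Theta_{oa}(\mathbf x)\sum_\mu b^{oa}_\mu Q_{\eta/\mu}(\mathbf x;q,t),$$ where $\lambda,\mu$ range over all partitions.
   Context: $P_{\lambda/\mu}(\cdot;q,t)$, $Q_{\lambda/\mu}(\cdot;q,t)$ are the skew Macdonald symmetric functions in Macdonald's normalization, $q,t\in(0,1)$. For a box $s=(i,j)\in\lambda$: arm $a_\lambda(s)=\lambda_i-j$, leg $l_\lambda(s)=\lambda'_j-i$, $b_\lambda(s;q,t)=\frac{1-q^{a_\lambda(s)}t^{l_\lambda(s)+1}}{1-q^{a_\lambda(s)+1}t^{l_\lambda(s)}}$; $b_\lambda^{el}$ (resp. $b_\lambda^{oa}$) is the product of $b_\lambda(s;q,t)$ over boxes with $l_\lambda(s)$ even (resp. $a_\lambda(s)$ odd). With $(a;q)_\infty=\prod_{k\ge0}(1-aq^k)$, $$\Theta_{el}(\mathbf x)=\prod_i\frac{(tx_i;q)_\infty}{(x_i;q)_\infty}\prod_{i<j}\frac{(tx_ix_j;q)_\infty}{(x_ix_j;q)_\infty},\qquad\Theta_{oa}(\mathbf x)=\prod_i\frac{(qtx_i^2;q^2)_\infty}{(1-x_i)(q^2x_i^2;q^2)_\infty}\prod_{i<j}\frac{(tx_ix_j;q)_\infty}{(x_ix_j;q)_\infty}.$$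 (These equal $\sum_\lambda b_\lambda^{el}P_\lambda(\mathbf x)$ and $\sum_\lambda b_\lambda^{oa}P_\lambda(\mathbf x)$ respectively, identities from Macdonald's book.) *)

(* Defs.v *)
From HB Require Import structures.
From mathcomp Require Import all_boot all_order all_algebra.
From mathcomp Require Import finmap multiset.
From mathcomp Require Import all_classical all_reals all_analysis.
Set Implicit Arguments. Unset Strict Implicit. Unset Printing Implicit Defensive.
Import Order.TTheory GRing.Theory Num.Theory.
Import numFieldNormedType.Exports.
Local Open Scope classical_set_scope.
Local Open Scope ring_scope.

Definition is_part (s : seq nat) : bool := sorted geq s && (0%N \notin s).

Record part := Part { parts :> seq nat; _ : is_part parts }.
HB.instance Definition _ := [isSub for parts].
HB.instance Definition _ := [Countable of part by <:].

Definition dominates (lam mu : part) : Prop :=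
  sumn lam = sumn mu /\ forall k, (sumn (take k mu) <= sumn (take k lam))%N.

(* Rows and columns are numbered from 0: the box (i, j) below is the box
   (i+1, j+1) of the usual convention, and [conj_part lam j] is lam'_(j+1). *)
Definition conj_part (lam : part) (j : nat) : nat := count (fun r => (j < r)%N) lam.
Definition arm (lam : part) (i j : nat) : nat := (nth 0 lam i - j.+1)%N.
Definition leg (lam : part) (i j : nat) : nat := (conj_part lam j - i.+1)%N.

Section Coefficients.
Variables (R : realType) (q t : R).

Definition bbox (lam : part) (i j : nat) : R :=
  (1 - q ^+ arm lam i j * t ^+ (leg lam i j).+1) /
  (1 - q ^+ (arm lam i j).+1 * t ^+ leg lam i j).

Definition b_el (lam : part) : R :=
  \prod_(i < size lam) \prod_(j < nth 0%N lam i | ~~ odd (leg lam i j)) bbox lam i j.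

Definition b_oa (lam : part) : R :=
  \prod_(i < size lam) \prod_(j < nth 0%N lam i | odd (arm lam i j)) bbox lam i j.

Definition zqt (lam : part) : R :=
  \prod_(r <- undup lam)
     (r ^ count_mem r lam * (count_mem r lam)`!)%:R
  * \prod_(r <- (lam : seq nat)) ((1 - q ^+ r) / (1 - t ^+ r)).

End Coefficients.

(* Formal power series in x_0, x_1, x_2, ... : a monomial is the multiset of its
   variables, so that [a i] is the exponent of x_i in [a] and [a `+` b] is the
   product of [a] and [b]; a series is the family of its coefficients. *)
Definition monom : choiceType := {mset nat}%mset.
Definition fps (R : realType) : Type := monom -> R.

Section Fps.
Variable R : realType.
Implicit Types (f g : fps R) (m a : monom).

Definition fterm (c : R) m : fps R := fun a => if a == m then c else 0.
Definition fone : fps R := fterm 1 mset0.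
Definition fmul f g : fps R := fun a =>
  \sum_(p \in [set p : monom * monom | (p.1 `+` p.2)%mset = a]) f p.1 * g p.2.

(* The quotient: the series [h] with [h * g = f]; it is unique if [g] is nonzero
   and exists if the constant term of [g] is nonzero. *)
Definition fdiv f g : fps R := xget (fun=> 0) [set h : fps R | fmul h g = f].

Definition flim (u : nat -> fps R) : fps R := fun a => limn (fun N => u N a).

(* (c x^m; q)_oo *)
Definition qpoch (c : R) m (q : R) : fps R :=
  flim (fun N => \big[fmul/fone]_(k < N)
                   (fun a => fone a - fterm (c * q ^+ k) m a)).

Variables q t : R.

Definition cross_factor : fps R :=
  flim (fun N => \big[fmul/fone]_(j < N) \big[fmul/fone]_(i < j)
     fdiv (qpoch t [mset nat_of_ord i; nat_of_ord j]%mset q)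
          (qpoch 1 [mset nat_of_ord i; nat_of_ord j]%mset q)).

Definition Theta_el : fps R :=
  fmul (flim (fun N => \big[fmul/fone]_(i < N)
          fdiv (qpoch t [mset nat_of_ord i]%mset q)
               (qpoch 1 [mset nat_of_ord i]%mset q)))
       cross_factor.

Definition Theta_oa : fps R :=
  fmul (flim (fun N => \big[fmul/fone]_(i < N)
          fdiv (qpoch (q * t) (msetn 2 (nat_of_ord i)) (q ^+ 2))
               (fmul (fun a => fone a - fterm 1 [mset nat_of_ord i]%mset a)
                     (qpoch (q ^+ 2) (msetn 2 (nat_of_ord i)) (q ^+ 2)))))
       cross_factor.

End Fps.

Section Symmetric.
Variable R : realType.

(* m_lam: the sum of all distinct monomials whose nonzero exponents are,
   up to order, the parts of lam. *)
Definition msym (lam : part) : fps R :=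
  fun a => (perm_eq [seq a i | i <- finsupp a] lam)%:R.

Definition psum (r : nat) : fps R :=
  fun a => \sum_(i \in [set: nat]) fterm (1 : R) (msetn r i) a.

Definition psym (lam : part) : fps R :=
  \big[@fmul R/fone R]_(r <- (lam : seq nat)) psum r.

(* The coordinates of a symmetric function in the basis of the p_lam. *)
Definition pcoord (f : fps R) : part -> R :=
  xget (fun=> 0) [set c : part -> R |
    finite_set [set lam | c lam != 0] /\
    f = (fun a => \sum_(lam \in [set: part]) c lam * psym lam a)].

Variables q t : R.

(* The bilinear form on symmetric functions for which
   <p_lam, p_mu> = delta_(lam, mu) z_lam(q, t). *)
Definition scal (f g : fps R) : R :=
  \sum_(lam \in [set: part]) pcoord f lam * pcoord g lam * zqt q t lam.

(* The family P_lam(q, t): it is unitriangular on the m_mu for the dominance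
   order, and orthogonal. For q, t in (0, 1) there is exactly one such family. *)
Definition is_macdonaldP (P : part -> fps R) : Prop :=
  (forall lam : part, exists u : part -> R,
     P lam = (fun a => msym lam a +
       \sum_(mu \in [set mu | dominates lam mu /\ mu <> lam]) u mu * msym mu a)) /\
  (forall lam mu : part, lam <> mu -> scal (P lam) (P mu) = 0).

Variable P : part -> fps R.

Definition macdonaldQ (lam : part) : fps R :=
  fun a => (scal (P lam) (P lam))^-1 * P lam a.

(* Sums over all partitions are taken coefficient by coefficient: P_nu and
   P_(lam/mu) being homogeneous of degrees |nu| and |lam| - |mu|, only finitely
   many partitions contribute to a given coefficient. *)
(* <P_(lam/mu), Q_nu> = <P_lam, Q_mu Q_nu> for all nu *)
Definition skewP (lam mu : part) : fps R := fun a =>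
  \sum_(nu \in [set: part])
     scal (P lam) (fmul (macdonaldQ mu) (macdonaldQ nu)) * P nu a.

(* <Q_(lam/mu), P_nu> = <Q_lam, P_mu P_nu> for all nu *)
Definition skewQ (lam mu : part) : fps R := fun a =>
  \sum_(nu \in [set: part])
     scal (macdonaldQ lam) (fmul (P mu) (P nu)) * macdonaldQ nu a.

End Symmetric.

(* Main.v *)
(** Macdonald functions are treated as polynomials in the power sums
    pi = (p_1, p_2, ...), and identities between series in pi, graded by a
    variable z, are proved by comparing logarithmic derivatives z d/dz.

    Put S(pi) = sum_lam b_lam P_lam(pi), for b = b^el or b^oa. The logarithmic
    derivative of Theta is quadratic in the power sums, and its polarization is
    that of the Cauchy kernel K = sum_lam P_lam(pi) Q_lam(pi'). Hence
    S(pi + pi') = S(pi) S(pi') K(pi, pi'), and comparing the coefficients of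
    P_eta(pi') gives the theorem, provided that S = Theta.

    This is Macdonald's identity. His q-difference operator takes the same
    value on K in both sets of variables, so that the P_lam are eigenfunctions;
    evaluating the eigenvalue equations at the points (q^(lam_i) t^(n-i))_i
    gives the symmetry P_lam(u_mu) / P_lam(u_0) = P_mu(u_lam) / P_mu(u_0), hence
    the Pieri rule for e_r, and the duality (q, t) -> (t, q) gives the norms.
    For vertical strips added to partitions with even rows the Pieri
    coefficients are quotients of b^oa. So S^oa is the product of sum_r e_r and
    of the sum Phi over partitions with even rows, and adding a variable y of
    the dual alphabet multiplies Phi by sum_r y^r e_r, e_r in degree 2r; this
    determines the logarithmic derivative of Phi. The case of b^el follows by
    duality. *)

From HB Require Import structures.
Require Import Defs.
From mathcomp Require Import all_boot all_order all_algebra all_fingroup.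
From mathcomp Require Import boolp zify ring lra.
Set Implicit Arguments. Unset Strict Implicit. Unset Printing Implicit Defensive.
Import Order.TTheory GRing.Theory Num.Theory.

(** * Partitions *)

(** Identities between symmetric functions are checked on values: at all sequences [pi], in n
    variables for every n, or only at the points u_kap = (q^(kap_i) t^(n-i))_i. These points do two
    jobs. They separate the P_kap, even if only the kap that are smaller than mu in size or
    dominated by mu are used; this allows the symmetry to be proved by induction on mu. And
    multiplying the coordinates in a set I of rows by q sends u_nu to u_(nu + I), while the
    coefficient of that shift vanishes at u_nu unless nu + I is a partition: so an eigenvalue
    equation becomes a recursion along vertical strips.

    Logarithmic derivatives replace exponentials: a series with constant term 1 is recovered from
    its own by a recursion that divides by positive integers, and infinite products become limits of
    explicit coefficients. In S(pi + pi') the kernel occurs with z^2 for z, since its part of degree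
    r in either alphabet has total degree 2r.

    Parity selects the strips: every partition is in one way an even one with boxes added in some
    rows, and exactly one set of added boxes makes all rows of a given partition even. *)

Notation prow lam i := (nth 0%N (parts lam) i).

Section Partitions.
Implicit Types (lam mu nu : part) (s : seq nat).

Lemma ltn_ext a b : (forall m, (m < a) = (m < b)) -> a = b.
Proof.
move=> H; apply/eqP; rewrite eqn_leq (leqNgt a) (leqNgt b).
by rewrite (H b) -(H a) !ltnn.
Qed.

Lemma part_sorted lam : sorted geq lam.
Proof. by case: lam => s /= /andP[]. Qed.
Lemma part_neq0 lam : 0 \notin (lam : seq nat).
Proof. by case: lam => s /= /andP[]. Qed.

Lemma geq_total : total geq. Proof. by move=> x y; exact: leq_total. Qed.
Lemma geq_trans : transitive geq. Proof. by move=> x y z /= xy yz; apply: leq_trans yz xy. Qed.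
Lemma geq_anti : antisymmetric geq.
Proof. by move=> x y /= /andP[xy yx]; apply/eqP; rewrite eqn_leq yx. Qed.

Lemma sorted_nth_leq s i j : sorted geq s -> i <= j -> nth 0 s j <= nth 0 s i.
Proof.
move=> ss ij; case: (ltnP j (size s)) => [js|sj]; last by rewrite nth_default.
have := sorted_leq_nth geq_trans (fun x => leqnn x) 0 ss.
by move=> /(_ i j); apply; rewrite ?inE // (leq_ltn_trans ij).
Qed.

Lemma prow_anti lam i j : i <= j -> prow lam j <= prow lam i.
Proof. exact/sorted_nth_leq/part_sorted. Qed.

Lemma prow_gt0 lam i : (0 < prow lam i) = (i < size lam).
Proof.
case: (ltnP i (size lam)) => h; last by rewrite nth_default.
by rewrite lt0n; apply: contraNneq (part_neq0 lam) => <-; exact: mem_nth.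
Qed.

Lemma part_eq lam mu : (forall i, prow lam i = prow mu i) -> lam = mu.
Proof.
move=> e; apply/val_inj/(@eq_from_nth _ 0) => //.
apply/eqP; rewrite eqn_leq; apply/andP; split; rewrite leqNgt -prow_gt0.
  by rewrite e prow_gt0 ltnn.
by rewrite -e prow_gt0 ltnn.
Qed.

Lemma is_part_norm s : is_part (sort geq [seq x <- s | 0 < x]).
Proof.
rewrite /is_part (sort_sorted geq_total) /=.
by rewrite mem_sort mem_filter ltnn.
Qed.
Definition mkpart s : part := Part (is_part_norm s).

Lemma sorted_filter_nth s i : sorted geq s -> nth 0 [seq x <- s | 0 < x] i = nth 0 s i.
Proof.
elim: s i => [|x s IH] i //= ss; case: ltnP => h.
  by case: i => [|i] //=; apply: IH; exact: path_sorted ss.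
have -> : s = nseq (size s) 0.
  have := order_path_min geq_trans ss.
  elim: s {IH ss} => //= y s IH /andP[yx /IH <-].
  by have -> : y = 0 by move: (leq_trans yx h); rewrite leqn0 => /eqP.
move: h; rewrite leqn0 => /eqP ->.
rewrite -[0 :: nseq _ _]/(nseq (size s).+1 0) nth_nseq if_same.
rewrite (eq_in_filter (a2 := pred0)) ?filter_pred0 ?nth_nil //.
by move=> y; rewrite mem_nseq => /andP[_ /eqP->].
Qed.

Lemma mkpart_nth s i : sorted geq s -> prow (mkpart s) i = nth 0 s i.
Proof.
move=> ss; rewrite /= sorted_sort ?sorted_filter_nth //; first exact: geq_trans.
exact: (sorted_filter geq_trans).
Qed.

Lemma mkpart_id lam : mkpart lam = lam.
Proof. by apply: part_eq => i; rewrite mkpart_nth ?part_sorted. Qed.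

Lemma mkpartP s s' :
  (mkpart s == mkpart s') = perm_eq [seq x <- s | 0 < x] [seq x <- s' | 0 < x].
Proof.
rewrite -val_eqE /=; apply/eqP/idP; last first.
  by move/(perm_sortP geq_total geq_trans geq_anti).
by move/(perm_sortP geq_total geq_trans geq_anti).
Qed.

Lemma mkpart_perm s s' : perm_eq s s' -> mkpart s = mkpart s'.
Proof. by move=> p; apply/eqP; rewrite mkpartP perm_filter. Qed.

Lemma perm_mkpart s : perm_eq (mkpart s) [seq x <- s | 0 < x].
Proof. by rewrite /= perm_sort. Qed.

Lemma sumn_filter0 s : sumn [seq x <- s | 0 < x] = sumn s.
Proof. by elim: s => //= -[|x] s IH //=; rewrite IH. Qed.

Lemma sumn_mkpart s : sumn (mkpart s) = sumn s.
Proof. by rewrite (perm_sumn (perm_mkpart s)) sumn_filter0. Qed.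

Lemma sumn_nth s n : size s <= n -> sumn s = \sum_(i < n) nth 0 s i.
Proof.
move=> sn; rewrite sumnE (big_nth 0) big_mkord.
rewrite (big_ord_widen _ (fun i => nth 0 s i) sn) big_mkcond /=.
by apply: eq_bigr => i _; case: ltnP => // h; rewrite nth_default.
Qed.

Lemma sumn_take s k : sumn (take k s) = \sum_(i < k) nth 0 s i.
Proof.
rewrite (@sumn_nth _ k); last by rewrite size_take_min geq_minl.
by apply: eq_bigr => i _; rewrite nth_take.
Qed.

Lemma prow_le_sumn lam i : prow lam i <= sumn lam.
Proof.
case: (ltnP i (size lam)) => h; last by rewrite nth_default.
by rewrite (sumn_nth (leqnn _)) (bigD1 (Ordinal h)) //= leq_addr.
Qed.

Lemma size_le_sumn lam : size lam <= sumn lam.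
Proof.
rewrite (sumn_nth (leqnn _)) -{1}[size lam]card_ord -sum1_card.
by apply: leq_sum => i _; rewrite prow_gt0.
Qed.

Lemma sumn0_part lam : sumn lam = 0 -> lam = mkpart [::].
Proof.
move=> h; apply: part_eq => i; rewrite mkpart_nth // nth_nil.
by have := prow_le_sumn lam i; rewrite h leqn0 => /eqP.
Qed.

Definition pof (f : nat -> nat) n : part := mkpart (mkseq f n).

Lemma sorted_mkseq f n : (forall i, i.+1 < n -> f i.+1 <= f i) -> sorted geq (mkseq f n).
Proof.
move=> H; apply/(sortedP 0) => i; rewrite size_mkseq => h.
by rewrite !nth_mkseq ?(ltnW h) //=; apply: H.
Qed.

Lemma prow_pof f n i : (forall i, i.+1 < n -> f i.+1 <= f i) ->
  prow (pof f n) i = if i < n then f i else 0.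
Proof.
move=> H; rewrite mkpart_nth ?sorted_mkseq //.
case: ltnP => h; first by rewrite nth_mkseq.
by rewrite nth_default // size_mkseq.
Qed.

Lemma size_mkpart s : size (mkpart s) <= size s.
Proof. by rewrite (perm_size (perm_mkpart s)) size_filter count_size. Qed.

Lemma pof_prow lam n : size lam <= n -> pof (fun i => prow lam i) n = lam.
Proof.
move=> h; apply: part_eq => i; rewrite prow_pof; last by move=> *; exact: prow_anti.
by case: ltnP => // ni; rewrite nth_default // (leq_trans h).
Qed.

(** The index type ['I_d.-1.+1] is ['I_d] kept nonempty for [inord]; for d = 0 no row is read and
    only the empty partition remains. *)
Definition PD d : seq part :=
  [seq lam : part <- undup [seq pof (fun i => (f : {ffun 'I_d.-1.+1 -> 'I_d.+1}) (inord i)) d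
                    | f <- enum predT] | sumn (parts lam) == d].

Lemma PD_uniq d : uniq (PD d).
Proof. by rewrite filter_uniq ?undup_uniq. Qed.

Lemma mem_PD d lam : (lam \in PD d) = (sumn lam == d).
Proof.
rewrite mem_filter mem_undup andb_idr // => /eqP sd; apply/mapP.
exists [ffun i : 'I_d.-1.+1 => inord (prow lam i)]; first by rewrite mem_enum.
have sz : size lam <= d by rewrite -sd size_le_sumn.
rewrite -{1}(pof_prow sz); congr mkpart; apply/eq_in_map => j.
rewrite mem_iota /= add0n => jd.
have d0 : 0 < d by apply: leq_trans jd.
have hr : prow lam j < d.+1 by rewrite ltnS -sd prow_le_sumn.
by rewrite ffunE !inordK // prednK.
Qed.

Lemma PD0 : PD 0 = [:: mkpart [::]].
Proof.
apply: perm_small_eq => //; apply: uniq_perm; rewrite ?PD_uniq // => lam.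
rewrite mem_PD inE; apply/eqP/eqP => [/sumn0_part//|->]; exact: sumn_mkpart.
Qed.

Definition eshape n (f : 'I_n -> nat) : part := mkpart [seq f i | i <- enum 'I_n].

Lemma nth_map_enum n (f : 'I_n -> nat) (i : 'I_n) : nth 0 [seq f j | j <- enum 'I_n] i = f i.
Proof. by rewrite (nth_map i) ?nth_ord_enum // size_enum_ord. Qed.

Lemma prow_eshape n (f : 'I_n -> nat) (i : 'I_n) :
  (forall i j : 'I_n, i <= j -> f j <= f i) -> prow (eshape f) i = f i.
Proof.
move=> H; rewrite mkpart_nth ?nth_map_enum //.
apply/(sortedP 0) => j; rewrite size_map size_enum_ord => jn.
have jn' := ltnW jn.
rewrite -[j.+1]/(val (Ordinal jn)) -[j in nth _ _ j]/(val (Ordinal jn')) !nth_map_enum.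
by apply: H => /=.
Qed.

Lemma size_eshape n (f : 'I_n -> nat) : size (eshape f) <= n.
Proof. by apply: leq_trans (size_mkpart _) _; rewrite size_map size_enum_ord. Qed.

Lemma eshape_prow n lam : size lam <= n -> eshape (fun i : 'I_n => prow lam i) = lam.
Proof.
move=> h; apply: part_eq => i; case: (ltnP i n) => ni; last first.
  by rewrite !nth_default // (leq_trans _ ni) // size_eshape.
by rewrite -[i]/(val (Ordinal ni)) prow_eshape // => *; exact: prow_anti.
Qed.

Lemma sumn_eshape n (f : 'I_n -> nat) : sumn (eshape f) = \sum_i f i.
Proof. by rewrite sumn_mkpart sumnE big_map big_enum. Qed.

Lemma eq_eshape n (f g : 'I_n -> nat) : f =1 g -> eshape f = eshape g.
Proof. by move=> e; congr mkpart; exact: eq_map. Qed.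

(** Forming the shape forgets the order and the zeros; the number of zeros is recovered from the
    common length n. *)
Lemma perm_eshape_seq n (f g : 'I_n -> nat) : eshape f = eshape g ->
  perm_eq [seq f i | i <- enum 'I_n] [seq g i | i <- enum 'I_n].
Proof.
move=> /eqP; rewrite mkpartP => p.
set s := map _ _ in p *; set s' := map _ _ in p *.
have sz : size s = size s' by rewrite !size_map.
have H (r : seq nat) : perm_eq r ([seq x <- r | 0 < x] ++ nseq (size r - count (fun x => 0 < x) r) 0).
  elim: r => //= -[|x] r IH /=.
    rewrite perm_sym -[nseq _ _]/(nseq _ 0) subSn ?count_size //= perm_catC /= perm_cons.
    by rewrite perm_sym perm_sym perm_catC perm_sym.
  by rewrite perm_cons add1n subSS.
rewrite (perm_trans (H s)) // perm_sym (perm_trans (H s')) // perm_sym.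
by rewrite sz -!size_filter (perm_size p) perm_cat2r.
Qed.

Lemma eshape_perm n (f : 'I_n -> nat) (w : 'S_n) : eshape (fun i => f (w i)) = eshape f.
Proof.
apply: mkpart_perm; rewrite (map_comp f w); apply: perm_map.
apply: uniq_perm; rewrite ?enum_uniq ?(map_inj_uniq perm_inj) ?enum_uniq // => i.
rewrite mem_enum; apply/mapP; exists ((w^-1)%g i); rewrite ?mem_enum // permKV //.
Qed.

Lemma eshape_permP n (f g : 'I_n -> nat) : eshape f = eshape g ->
  exists w : 'S_n, forall i, f i = g (w i).
Proof.
move=> /perm_eshape_seq; set F := [tuple f i | i < n]; set G := [tuple g i | i < n].
move=> p; have /tuple_permP[w e] : perm_eq F G by [].
exists w => i; have := congr1 (fun s => nth 0 s i) e.
rewrite -[X in nth _ X i = _]/[seq f i | i <- enum 'I_n] nth_map_enum => ->.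
by rewrite nth_map_enum (tnth_nth 0) /= nth_map_enum.
Qed.

(** With c = [nth 0 s' k], any k entries sum to at most k c plus the total excess of all entries
    over c, a quantity blind to the order; the first k entries of the sorted sequence attain it. *)
Lemma sorted_top s s' k : perm_eq s s' -> sorted geq s' -> sumn (take k s) <= sumn (take k s').
Proof.
move=> p ss'; case: (leqP (size s) k) => [h|h].
  by rewrite !take_oversize ?(perm_sumn p) // -(perm_size p).
set c := nth 0 s' k.
have split r : sumn [seq x - c | x <- take k r] <= sumn [seq x - c | x <- r].
  by rewrite -{2}(cat_take_drop k r) map_cat sumn_cat leq_addr.
have up r : size (take k r) <= k -> sumn (take k r) <= sumn [seq x - c | x <- take k r] + k * c.
  move=> hk; apply: (@leq_trans (sumn [seq x - c | x <- take k r] + size (take k r) * c)).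
    by elim: (take k r) => //= x t IH; lia.
  by rewrite leq_add2l leq_mul2r hk orbT.
apply: leq_trans (up s _) _; first by rewrite size_take_min geq_minl.
apply: leq_trans (leq_add (split s) (leqnn _)) _.
rewrite (perm_sumn (perm_map _ p)) -{1}(cat_take_drop k s') map_cat sumn_cat.
have -> : sumn [seq x - c | x <- drop k s'] = 0.
  apply/eqP; rewrite -leqn0 sumnE big_map big_seq big1_idem // => x.
  move/(nthP 0) => [i]; rewrite size_drop nth_drop => hi <-.
  by apply/eqP; rewrite subn_eq0; apply: sorted_nth_leq; rewrite ?leq_addr.
have hs' : size (take k s') = k by rewrite size_takel // -(perm_size p) ltnW.
have H x : x \in take k s' -> c <= x.
  move/(nthP 0) => [i]; rewrite hs' => hi <-; rewrite nth_take //.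
  by apply: sorted_nth_leq => //; exact: ltnW.
rewrite addn0 -{2}hs'; elim: (take k s') H => //= x t IH H.
have cx : c <= x by apply: H; rewrite mem_head.
have /IH h' : forall y, y \in t -> c <= y by move=> y yt; apply: H; rewrite inE yt orbT.
by rewrite mulSn; lia.
Qed.

Lemma sum_ord_swap n k (F : nat -> nat) :
  \sum_(i < n | i < k) F i = \sum_(i < k | i < n) F i.
Proof.
rewrite (big_ord_widen_cond (maxn n k) (fun i => i < k) F (leq_maxl n k)).
rewrite (big_ord_widen_cond (maxn n k) (fun i => i < n) F (leq_maxr n k)).
by apply: eq_bigl => i; rewrite andbC.
Qed.

Lemma sumn_take_ord n s k : size s <= n ->
  sumn (take k s) = \sum_(i < n | i < k) nth 0 s i.
Proof.
move=> sn; rewrite sum_ord_swap sumn_take [RHS]big_mkcond /=.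
by apply: eq_bigr => i _; case: ltnP => // h; rewrite nth_default // (leq_trans sn).
Qed.

Lemma eshape_top n (f : 'I_n -> nat) k :
  \sum_(i < n | i < k) f i <= sumn (take k (eshape f)).
Proof.
have -> : \sum_(i < n | i < k) f i = sumn (take k [seq f i | i <- enum 'I_n]).
  rewrite (@sumn_take_ord n); last by rewrite size_map size_enum_ord.
  by apply: eq_bigr => i _; rewrite nth_map_enum.
have -> : sumn (take k (eshape f)) = sumn (take k (sort geq [seq f i | i <- enum 'I_n])).
  rewrite !sumn_take; apply: eq_bigr => i _.
  rewrite /eshape (_ : mkpart _ = mkpart (sort geq [seq f i | i <- enum 'I_n])).
    by rewrite mkpart_nth // (sort_sorted geq_total).
  by apply: mkpart_perm; rewrite perm_sym perm_sort.
by apply: sorted_top; rewrite ?(sort_sorted geq_total) // perm_sym perm_sort.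
Qed.

Lemma eq_prefix_sums n (f g : 'I_n -> nat) :
  (forall k, k <= n -> \sum_(i < n | i < k) f i = \sum_(i < n | i < k) g i) -> f =1 g.
Proof.
move=> H i.
have S (h : 'I_n -> nat) : \sum_(j < n | j < i.+1) h j = h i + \sum_(j < n | j < i) h j.
  rewrite (bigD1 i) //=; congr (_ + _); apply: eq_bigl => j.
  by rewrite ltnS (ltn_neqAle j i) andbC.
by have := H i.+1 (ltn_ord i); rewrite !S (H i (ltnW (ltn_ord i))) => /addIn.
Qed.

Lemma dominatesP n lam mu : size lam <= n -> size mu <= n -> sumn lam = sumn mu ->
  (forall k, k <= n -> \sum_(i < n | i < k) prow mu i <= \sum_(i < n | i < k) prow lam i) ->
  dominates lam mu.
Proof.
move=> sl sm e H; split=> // k; case: (leqP k n) => h.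
  by rewrite !(@sumn_take_ord n) //; apply: H.
by rewrite !take_oversize ?e // (leq_trans _ (ltnW h)).
Qed.

Lemma dominates_refl lam : dominates lam lam. Proof. by []. Qed.
Lemma dominates_trans lam mu nu :
  dominates lam mu -> dominates mu nu -> dominates lam nu.
Proof.
move=> [e1 h1] [e2 h2]; split=> [|k]; first by rewrite e1.
by apply: leq_trans (h2 k) (h1 k).
Qed.
Lemma dominates_anti lam mu : dominates lam mu -> dominates mu lam -> lam = mu.
Proof.
move=> [_ h1] [_ h2]; apply: part_eq => i.
have H k : \sum_(j < k) prow lam j = \sum_(j < k) prow mu j.
  by apply/eqP; rewrite -!sumn_take eqn_leq h1 h2.
by have := H i.+1; rewrite !big_ord_recr /= H => /addnI.
Qed.
Lemma dominates_sumn lam mu : dominates lam mu -> sumn lam = sumn mu.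
Proof. by case. Qed.

Lemma dominates_size lam mu : dominates lam mu -> size lam <= size mu.
Proof.
move=> [e h]; rewrite leqNgt; apply/negP => lt.
have := h (size mu); rewrite take_size -e -{1}(cat_take_drop (size mu) lam) sumn_cat.
rewrite -{2}[sumn (take _ _)]addn0 leq_add2l leqn0 => /eqP.
rewrite (drop_nth 0 lt) /= => /eqP; rewrite addn_eq0 => /andP[h0 _].
by move: lt; rewrite -prow_gt0 lt0n h0.
Qed.

(** Strictly increasing for dominance, so that inductions along the dominance order become
    inductions on natural numbers. *)
Definition dom_rank lam := \sum_(k < sumn lam) sumn (take k lam).
Lemma dom_rank_lt lam mu : dominates lam mu -> lam <> mu -> dom_rank mu < dom_rank lam.
Proof.
move=> D ne; rewrite ltn_neqAle; apply/andP; split; last first.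
  by rewrite /dom_rank (dominates_sumn D); apply: leq_sum => k _; case: D.
apply: contra_not_neq ne => e; apply: (dominates_anti D); split=> [|k].
  by rewrite (dominates_sumn D).
have H : forall k, k < sumn lam -> sumn (take k mu) = sumn (take k lam).
  case: D => es h; move: e; rewrite /dom_rank -es => e k' hk.
  apply/eqP; move: e => /eqP; rewrite eq_sym.
  have := (fun j (_ : true) => leqif_eq (h (nat_of_ord j))) : forall j : 'I_(sumn lam), _.
  move=> L; have := (leqif_sum L).2; rewrite eq_sym => -> /forallP /(_ (Ordinal hk)) /=.
  by [].
case: (ltnP k (sumn lam)) => hk; first by rewrite H.
by rewrite !take_oversize ?(dominates_sumn D) // (leq_trans (size_le_sumn _)) // -?(dominates_sumn D).
Qed.

Lemma conj_partP lam i j : (i < conj_part lam j) = (j < prow lam i).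
Proof.
have: sorted geq lam by exact: part_sorted.
rewrite /conj_part; elim: (lam : seq nat) i => [|x s IH] i /= ss.
  by rewrite nth_nil.
case: i => [|i] /=; last first.
  have ss' := path_sorted ss; case: (ltnP j x) => h; first by rewrite add1n ltnS IH.
  rewrite add0n; have -> : count (fun r => j < r) s = 0.
    apply/eqP; rewrite -leqn0 leqNgt -has_count; apply/hasP => -[y ys jy].
    have /allP/(_ y ys) /= := order_path_min geq_trans ss.
    by move=> yx; move: (leq_trans jy (leq_trans yx h)); rewrite ltnn.
  apply/esym/negbTE; rewrite -leqNgt; apply: leq_trans h.
  by apply: (@sorted_nth_leq (x :: s) 0 i.+1).
case: (ltnP j x) => h; first by rewrite add1n.
rewrite add0n; apply/negbTE; rewrite -leqNgt leqn0.
rewrite -leqn0 leqNgt -has_count; apply/hasPn => y ys; rewrite -leqNgt.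
by have /allP/(_ y ys) /= := order_path_min geq_trans ss => /leq_trans ->.
Qed.

Lemma conj_part_anti lam i j : i <= j -> conj_part lam j <= conj_part lam i.
Proof.
move=> ij; apply: sub_count => r /=; exact: leq_ltn_trans.
Qed.

Definition cpart lam : part := pof (conj_part lam) (prow lam 0).

Lemma prow_cpart lam j : prow (cpart lam) j = conj_part lam j.
Proof.
rewrite prow_pof; last by move=> i _; exact: conj_part_anti.
by case: ltnP => // h; apply/esym/eqP; rewrite -leqn0 leqNgt conj_partP -leqNgt.
Qed.

Lemma conj_part_cpart lam j : conj_part (cpart lam) j = prow lam j.
Proof.
by apply: ltn_ext => m; rewrite conj_partP prow_cpart conj_partP.
Qed.

Lemma cpartK : involutive cpart.
Proof. by move=> lam; apply: part_eq => i; rewrite prow_cpart conj_part_cpart. Qed.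

Lemma size_cpart lam : size (cpart lam) = prow lam 0.
Proof.
by apply: ltn_ext => m; rewrite -prow_gt0 prow_cpart conj_partP.
Qed.

Lemma sum_ltn_ord n m : \sum_(j < n) (j < m) = minn n m.
Proof.
elim: n => [|n IH]; first by rewrite big_ord0 min0n.
by rewrite big_ord_recr /= IH; case: ltnP; lia.
Qed.

(** The first k columns meet row i in min(k, lam_i) boxes. *)
Lemma sumn_take_cpart lam n k : size lam <= n ->
  sumn (take k (cpart lam)) = \sum_(i < n) minn k (prow lam i).
Proof.
move=> sn; rewrite sumn_take.
under eq_bigr do rewrite prow_cpart.
have E j : conj_part lam j = \sum_(i < n) (j < prow lam i).
  rewrite -(minn_idPr (_ : conj_part lam j <= n)) -?sum_ltn_ord; last first.
    by apply: leq_trans sn; exact: count_size.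
  by apply: eq_bigr => i _; rewrite conj_partP.
under eq_bigr do rewrite E.
by rewrite exchange_big /=; apply: eq_bigr => i _; rewrite sum_ltn_ord.
Qed.

Lemma sumn_cpart lam : sumn (cpart lam) = sumn lam.
Proof.
rewrite -{1}[cpart lam : seq nat](take_oversize (leqnn _)).
rewrite (@sumn_take_cpart _ (size lam)) // (sumn_nth (leqnn _)).
by apply: eq_bigr => i _; rewrite size_cpart; apply/minn_idPr/prow_anti.
Qed.

(** Since min(k, x) = x - (x - k)_+, it suffices that the rows of mu have no more total excess over
    k than those of lam. For mu this excess is a prefix sum over the r rows longer than k, minus r
    k, and the prefix sums of lam are at least as large. *)
Lemma dominates_cpart lam mu : dominates lam mu -> dominates (cpart mu) (cpart lam).
Proof.
move=> D; split=> [|k]; first by rewrite !sumn_cpart (dominates_sumn D).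
have sz := dominates_size D; pose n := size mu.
rewrite !(@sumn_take_cpart _ n) //.
have M (nu : part) : size nu <= n ->
    \sum_(i < n) minn k (prow nu i) + \sum_(i < n) (prow nu i - k) = sumn nu.
  move=> h; rewrite (sumn_nth h) -big_split /=; apply: eq_bigr => i _; lia.
have := M lam sz; have := M mu (leqnn _); rewrite (dominates_sumn D) => <- e.
rewrite -(leq_add2r (\sum_(i < n) (prow lam i - k))) e leq_add2l.
pose r := conj_part mu k.
have rn : r <= n by exact: count_size.
have -> : \sum_(i < n) (prow mu i - k) = \sum_(i < r) prow mu i - r * k.
  have -> : \sum_(i < n) (prow mu i - k) = \sum_(i < r) (prow mu i - k).
    rewrite [RHS](big_ord_widen _ (fun i => prow mu i - k) rn) [RHS]big_mkcond.
    by apply: eq_bigr => i _; rewrite conj_partP; case: ltnP => // h; apply/eqP; rewrite subn_eq0.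
  apply/eqP; rewrite -(eqn_add2r (r * k)) subnK; last first.
    rewrite -[r in r * k]card_ord -sum_nat_const; apply: leq_sum => i _.
    by apply: ltnW; rewrite -conj_partP.
  rewrite -[r in r * k]card_ord -sum_nat_const -big_split /=.
  by apply/eqP/eq_bigr => i _; rewrite subnK // ltnW // -conj_partP.
apply: (@leq_trans (\sum_(i < r) prow lam i - r * k)).
  by apply: leq_sub2r; rewrite -!sumn_take; case: D.
rewrite leq_subLR -[r in r * k]card_ord -sum_nat_const.
apply: (@leq_trans (\sum_(i < r) k + \sum_(i < r) (prow lam i - k))).
  by rewrite -big_split /=; apply: leq_sum => i _; lia.
rewrite leq_add2l (big_ord_widen _ (fun i => prow lam i - k) rn) big_mkcond /=.
by apply: leq_sum => i _; case: ifP.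
Qed.

(* nu + (1 ^ r) *)
Definition addcol nu r : part := pof (fun i => prow nu i + (i < r)) (maxn (size nu) r).

Lemma prow_addcol nu r i : prow (addcol nu r) i = prow nu i + (i < r).
Proof.
rewrite prow_pof; last first.
  move=> j _; apply: leq_add; first exact: prow_anti.
  by case: (ltnP j.+1 r) => // h; rewrite (ltnW h).
case: ltnP => //; rewrite geq_max => /andP[h1 h2].
by rewrite nth_default // ltnNge h2.
Qed.

Lemma sumn_addcol nu r : sumn (addcol nu r) = sumn nu + r.
Proof.
rewrite (@sumn_nth _ (maxn (size nu) r)); last first.
  by rewrite (leq_trans (size_mkpart _)) // size_mkseq.
under eq_bigr do rewrite prow_addcol.
by rewrite big_split /= -(sumn_nth (leq_maxl _ _)) sum_ltn_ord (minn_idPr (leq_maxr _ _)).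
Qed.

Lemma size_addcol nu r : size (addcol nu r) = maxn (size nu) r.
Proof.
apply: ltn_ext => m; rewrite -prow_gt0 prow_addcol leq_max -prow_gt0.
by case: (prow nu m) => //=; case: (m < r).
Qed.

Lemma take_addcol nu r k : sumn (take k (addcol nu r)) = sumn (take k nu) + minn k r.
Proof.
by rewrite !sumn_take -sum_ltn_ord -big_split; apply: eq_bigr => i _; rewrite prow_addcol.
Qed.

Lemma dominates_addcol lam mu r : dominates lam mu -> dominates (addcol lam r) (addcol mu r).
Proof.
by move=> [e h]; split=> [|k]; rewrite ?sumn_addcol ?e // !take_addcol leq_add2r.
Qed.

Lemma addcol_inj r : injective (addcol ^~ r).
Proof.
move=> lam mu e; apply: part_eq => i; apply/eqP.
by rewrite -(eqn_add2r (i < r)) -!prow_addcol e.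
Qed.

Lemma addcol_ex lam : lam != mkpart [::] ->
  exists nu, [/\ lam = addcol nu (size lam), (sumn nu < sumn lam) & size nu <= size lam].
Proof.
move=> ne; pose nu := pof (fun i => (prow lam i).-1) (size lam).
have E : lam = addcol nu (size lam).
  apply: part_eq => i; rewrite prow_addcol prow_pof; last first.
    by move=> j _; have := @prow_anti lam j j.+1 (leqnSn _); lia.
  by rewrite -prow_gt0; case: (prow lam i) => // m; rewrite addn1.
exists nu; split=> //; last by rewrite (leq_trans (size_mkpart _)) // size_mkseq.
rewrite [in X in _ < X]E sumn_addcol -[X in X < _]addn0 ltn_add2l lt0n.
apply: contraNneq ne => /size0nil h; apply/eqP/val_inj => /=; by rewrite h.
Qed.

Lemma cpart_addcol nu r : size nu <= r ->
  cpart (addcol nu r) = mkpart (r :: (cpart nu : seq nat)).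
Proof.
move=> h; apply: part_eq => i; rewrite prow_cpart mkpart_nth; last first.
  change (path geq r (cpart nu)); rewrite (path_sortedE geq_trans) part_sorted andbT.
  apply/allP => x /(nthP 0) [j _ <-]; change (prow (cpart nu) j <= r).
  by rewrite prow_cpart (leq_trans (count_size _ _)).
apply: ltn_ext => m; rewrite conj_partP prow_addcol; case: i => [|i] /=.
  by case: (ltnP m r) => mr; rewrite ?addn1 // nth_default // (leq_trans h).
rewrite prow_cpart conj_partP; case: (ltnP m r) => mr; first by rewrite addn1 ltnS.
by rewrite nth_default // (leq_trans h).
Qed.

End Partitions.
Arguments mkpart : simpl never.
Arguments pof : simpl never.
Arguments addcol : simpl never.
Arguments cpart : simpl never.
Arguments eshape : simpl never.

Local Open Scope ring_scope.

(** * Power series in one variable *)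

(** A record rather than a bare function, so that its multiplication can be the Cauchy product. *)
Record ps (R : comNzRingType) : Type := Ps { co : nat -> R }.
HB.instance Definition _ (R : comNzRingType) := gen_eqMixin (ps R).
HB.instance Definition _ (R : comNzRingType) := gen_choiceMixin (ps R).

Section PowerSeries.
Variable R : comNzRingType.
Implicit Types (f g h : ps R).

Lemma psP f g : (forall d, co f d = co g d) -> f = g.
Proof. by case: f g => [f] [g] /= e; congr Ps; apply/funext. Qed.

Definition ps_zero : ps R := Ps (fun=> 0).
Definition ps_opp f : ps R := Ps (fun d => - co f d).
Definition ps_add f g : ps R := Ps (fun d => co f d + co g d).
Definition ps_one : ps R := Ps (fun d => (d == 0%N)%:R).
Definition ps_mul f g : ps R :=
  Ps (fun d => \sum_(i < d.+1) co f i * co g (d - i)%N).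

Fact ps_addA : associative ps_add.
Proof. by move=> f g h; apply: psP => d /=; rewrite addrA. Qed.
Fact ps_addC : commutative ps_add.
Proof. by move=> f g; apply: psP => d /=; rewrite addrC. Qed.
Fact ps_add0 : left_id ps_zero ps_add.
Proof. by move=> f; apply: psP => d /=; rewrite add0r. Qed.
Fact ps_addN : left_inverse ps_zero ps_opp ps_add.
Proof. by move=> f; apply: psP => d /=; rewrite addNr. Qed.

HB.instance Definition _ := GRing.isZmodule.Build (ps R)
  ps_addA ps_addC ps_add0 ps_addN.

Definition ps_trunc n f : {poly R} := \poly_(i < n.+1) co f i.

(** Up to degree n a product depends on the truncations only, so associativity and commutativity
    come from polynomials. *)
Lemma ps_mulE n d f g : (d <= n)%N ->
  co (ps_mul f g) d = (ps_trunc n f * ps_trunc n g)`_d.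
Proof.
move=> dn; rewrite coefM /=; apply: eq_bigr => i _.
by rewrite !coef_poly !ltnS (leq_trans (leq_subr _ _) dn) (leq_trans (leq_ord i) dn).
Qed.

Fact ps_mulA : associative ps_mul.
Proof.
move=> f g h; apply: psP => d.
transitivity ((ps_trunc d f * (ps_trunc d g * ps_trunc d h))`_d).
  rewrite coefM /=; apply: eq_bigr => i _.
  rewrite -[\sum_(_ < _) _]/(co (ps_mul g h) (d - i)) (ps_mulE _ _ (leq_subr i d)).
  by rewrite coef_poly ltn_ord.
rewrite mulrA coefM /=; apply: eq_bigr => i _.
rewrite -[\sum_(_ < _) _ in RHS]/(co (ps_mul f g) i) (ps_mulE _ _ (leq_ord i)).
by rewrite [X in _ * X]coef_poly ltnS leq_subr.
Qed.

Fact ps_mulC : commutative ps_mul.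
Proof.
by move=> f g; apply: psP => d; rewrite !(ps_mulE _ _ (leqnn d)) mulrC.
Qed.

Fact ps_mul1 : left_id ps_one ps_mul.
Proof.
move=> f; apply: psP => d /=.
rewrite big_ord_recl /= mul1r subn0 big1 ?addr0 // => i _.
by rewrite /bump /= mul0r.
Qed.

Fact ps_mulDl : left_distributive ps_mul +%R.
Proof.
move=> f g h; apply: psP => d /=; rewrite -big_split /=.
by apply: eq_bigr => i _; rewrite mulrDl.
Qed.

Fact ps_one_neq0 : ps_one != 0.
Proof.
apply/eqP => /(congr1 (fun f => co f 0)) /= /eqP.
by rewrite oner_eq0.
Qed.

HB.instance Definition _ := GRing.Zmodule_isComNzRing.Build (ps R)
  ps_mulA ps_mulC ps_mul1 ps_mulDl ps_one_neq0.

Lemma co1 d : co (1 : ps R) d = (d == 0%N)%:R. Proof. by []. Qed.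
Lemma coD f g d : co (f + g) d = co f d + co g d. Proof. by []. Qed.
Lemma coN f d : co (- f) d = - co f d. Proof. by []. Qed.
Lemma coM f g d : co (f * g) d = \sum_(i < d.+1) co f i * co g (d - i)%N.
Proof. by []. Qed.
Lemma coM0 f g : co (f * g) 0 = co f 0 * co g 0.
Proof. by rewrite coM big_ord_recl big_ord0 addr0. Qed.
Lemma co_sum I (r : seq I) (P : pred I) (F : I -> ps R) d :
  co (\sum_(i <- r | P i) F i) d = \sum_(i <- r | P i) co (F i) d.
Proof. by apply: (big_morph (fun f => co f d)). Qed.

Definition psC (c : R) : ps R := Ps (fun d => if d == 0%N then c else 0).
Definition ps_poly (p : {poly R}) : ps R := Ps (fun d => p`_d).

Lemma coCM c f d : co (psC c * f) d = c * co f d.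
Proof.
rewrite coM big_ord_recl /= subn0 big1 ?addr0 // => i _.
by rewrite /bump /= mul0r.
Qed.

Lemma ps_polyD p r : ps_poly (p + r) = ps_poly p + ps_poly r.
Proof. by apply: psP => d; rewrite /= coefD. Qed.
Lemma ps_polyM p r : ps_poly (p * r) = ps_poly p * ps_poly r.
Proof. by apply: psP => d; rewrite coM /= coefM. Qed.
Lemma ps_poly1 : ps_poly 1 = 1.
Proof. by apply: psP => d; rewrite /= coef1. Qed.
Lemma ps_poly0 : ps_poly 0 = 0.
Proof. by apply: psP => d; rewrite /= coef0. Qed.
Lemma ps_polyC c : ps_poly c%:P = psC c.
Proof. by apply: psP => d; rewrite /= coefC. Qed.
Lemma ps_poly_prod I (r : seq I) (P : pred I) (F : I -> {poly R}) :
  ps_poly (\prod_(i <- r | P i) F i) = \prod_(i <- r | P i) ps_poly (F i).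
Proof. by apply: (big_morph _ ps_polyM ps_poly1). Qed.
Lemma ps_poly_sum I (r : seq I) (P : pred I) (F : I -> {poly R}) :
  ps_poly (\sum_(i <- r | P i) F i) = \sum_(i <- r | P i) ps_poly (F i).
Proof. by apply: (big_morph _ ps_polyD ps_poly0). Qed.

Lemma psCM a b : psC (a * b) = psC a * psC b.
Proof. by apply: psP => d; rewrite coCM /=; case: eqP; rewrite ?mulr0. Qed.
Lemma psCD a b : psC (a + b) = psC a + psC b.
Proof. by apply: psP => d; rewrite coD /=; case: eqP; rewrite ?addr0. Qed.
Lemma psC1 : psC 1 = 1.
Proof. by apply: psP => d /=; case: eqP. Qed.
Lemma psC0 : psC 0 = 0.
Proof. by apply: psP => d /=; case: eqP. Qed.
Lemma psC_sum I (r : seq I) (P : pred I) (F : I -> R) :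
  psC (\sum_(i <- r | P i) F i) = \sum_(i <- r | P i) psC (F i).
Proof. by apply: (big_morph _ psCD psC0). Qed.

Lemma ps_mulI f f' g : co g 0 = 1 -> f * g = f' * g -> f = f'.
Proof.
move=> g0 e; apply: psP => d; elim/ltn_ind: d => d IH.
have := congr1 (fun h => co h d) e; rewrite /= !big_ord_recr /= subnn g0 !mulr1.
rewrite (eq_bigr (fun i : 'I_d => co f' i * co g (d - i)%N)); last first.
  by move=> i _; rewrite IH.
by move/addrI.
Qed.

Definition euler f : ps R := Ps (fun d => d%:R * co f d).

Lemma eulerM f g : euler (f * g) = euler f * g + f * euler g.
Proof.
apply: psP => d; rewrite coD !coM /= mulr_sumr -big_split /=.
apply: eq_bigr => i _; rewrite -{1}(subnKC (leq_ord i)) natrD; ring.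
Qed.

Lemma euler1 : euler 1 = 0.
Proof. by apply: psP => -[|d] /=; rewrite ?mul0r ?mulr0. Qed.

Lemma euler_odeM f g A B : euler f = A * f -> euler g = B * g ->
  euler (f * g) = (A + B) * (f * g).
Proof. by move=> ef eg; rewrite eulerM ef eg; ring. Qed.

Lemma euler_ode_prod (I : Type) (r : seq I) (P : pred I) (F A : I -> ps R) :
  (forall i, P i -> euler (F i) = A i * F i) ->
  euler (\prod_(i <- r | P i) F i) =
    (\sum_(i <- r | P i) A i) * \prod_(i <- r | P i) F i.
Proof.
move=> H; elim: r => [|i r IH]; first by rewrite !big_nil euler1 mul0r.
by rewrite !big_cons; case: ifP => // Pi; apply: euler_odeM => //; apply: H.
Qed.

(* c z / (1 - c z) *)
Definition geom (c : R) : ps R := Ps (fun d => if d == 0%N then 0 else c ^+ d).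
Definition lin (c : R) : ps R := ps_poly (1 - c *: 'X).
Arguments lin : simpl never.

Lemma co_lin c d : co (lin c) d = if d == 0%N then 1 else if d == 1%N then - c else 0.
Proof.
rewrite /lin /= coefB coef1 coefZ coefX.
by case: d => [|[|d]] /=; rewrite ?mulr0 ?subr0 ?mulr1 ?sub0r.
Qed.

Lemma co_linM c f d : co (lin c * f) d = co f d - (if d is d'.+1 then c * co f d' else 0).
Proof.
rewrite coM (eq_bigr (fun i : 'I_d.+1 => (if i == 0%N :> nat then 1 else
  if i == 1%N :> nat then - c else 0) * co f (d - i)%N)); last first.
  by move=> i _; rewrite co_lin.
rewrite big_ord_recl /= mul1r subn0.
case: d => [|d]; first by rewrite big_ord0 addr0 subr0.
rewrite big_ord_recl /= subSS subn0 big1 ?addr0 ?mulNr //= => i _.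
by rewrite mul0r.
Qed.

Lemma euler_lin c : euler (lin c) = - geom c * lin c.
Proof.
rewrite mulrC; apply: psP => d; rewrite co_linM coN.
rewrite /euler; cbn [co]; rewrite co_lin.
case: d => [|[|d]] /=; rewrite ?mul0r ?oppr0 ?subr0 ?mul1r ?mulr0 ?expr1 //.
- by rewrite addr0.
- by rewrite subr0.
- by rewrite mulrN opprK [c ^+ d.+2]exprS addNr.
Qed.

Lemma lin0 c : co (lin c) 0 = 1. Proof. by rewrite co_lin. Qed.

Lemma co0_prod (I : Type) (r : seq I) (P : pred I) (F : I -> ps R) :
  (forall i, P i -> co (F i) 0 = 1) -> co (\prod_(i <- r | P i) F i) 0 = 1.
Proof.
move=> H; elim: r => [|i r IH]; first by rewrite big_nil.
by rewrite big_cons; case: ifP => // Pi; rewrite coM0 H // IH mulr1.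
Qed.

Definition dil (s : R) f : ps R := Ps (fun d => s ^+ d * co f d).

Lemma dilM s f g : dil s (f * g) = dil s f * dil s g.
Proof.
apply: psP => d; rewrite coM /= mulr_sumr; apply: eq_bigr => i _.
rewrite -{1}(subnKC (leq_ord i)) exprD; ring.
Qed.

End PowerSeries.

Section Ode.
Variable R : numDomainType.
Implicit Types (f g A : ps R).

(** As A has no constant term, d + 1 times the coefficient of degree d + 1 is a combination of
    coefficients of degree at most d. *)
Lemma ode_uniq A f g : co A 0 = 0 -> co f 0 = co g 0 ->
  euler f = A * f -> euler g = A * g -> f = g.
Proof.
move=> A0 fg0 ef eg; apply: psP => d; elim/ltn_ind: d => -[|d] IH //.
have H h : euler h = A * h ->
    d.+1%:R * co h d.+1 = \sum_(i < d.+1) co A i.+1 * co h (d - i)%N.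
  move=> /(congr1 (fun h => co h d.+1)) /= ->.
  by rewrite big_ord_recl A0 mul0r add0r; apply: eq_bigr => i _; rewrite /bump /= subSS.
apply: (@mulfI _ d.+1%:R); first by rewrite pnatr_eq0.
rewrite (H f) // (H g) //; apply: eq_bigr => i _; congr (_ * _); apply: IH.
by rewrite ltnS leq_subr.
Qed.

End Ode.

(** * Monomial and elementary symmetric polynomials *)

Lemma sum_seq_delta (V : nmodType) (T : eqType) (s : seq T) (a : T) (F : T -> V) :
  uniq s -> \sum_(k <- s) (if k == a then F k else 0) = if a \in s then F a else 0.
Proof.
move=> us; case: ifP => [ain|/negbT nin]; last first.
  rewrite big_seq big1 // => k ks; case: eqP => // e.
  by rewrite -e ks in nin.
rewrite (bigD1_seq a) //= eqxx big1 ?addr0 // => k /negbTE ->; by [].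
Qed.

(** * Triangularity for the dominance order *)

Section Triangular.
Variables (R : comNzRingType) (X : Type).
Implicit Types (g : part -> X -> R) (f : X -> R) (lam mu kap : part).

(** The functions live on an arbitrary [X], which may then be the set of points where a denominator
    does not vanish. The coefficients are only claimed to exist; their uniqueness comes from
    interpolation. *)
Definition TriC g f lam (c : R) : Prop := exists u : part -> R,
  [/\ u lam = c, (forall mu, u mu != 0 -> dominates lam mu)
   & forall x, f x = \sum_(mu <- PD (sumn lam)) u mu * g mu x].
Definition Tri g f lam := TriC g f lam 1.

Lemma Tri_refl g lam : Tri g (g lam) lam.
Proof.
exists (fun mu => (mu == lam)%:R); split; first by rewrite eqxx.
  by move=> mu; case: (eqVneq mu lam) => [->|_]; rewrite ?eqxx.
move=> x; under eq_bigr do rewrite mulr_natl mulrb.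
by rewrite sum_seq_delta ?PD_uniq // mem_PD eqxx.
Qed.

Lemma eq_Tri g f f' lam c : f =1 f' -> TriC g f lam c -> TriC g f' lam c.
Proof. by move=> e [u [u1 u2 u3]]; exists u; split=> // x; rewrite -e. Qed.

(** Composes two triangular expansions along a monotone relabelling [phi]; the third hypothesis
    keeps the lower terms of f from reaching the leading index [phi lam]. With [phi] the identity
    this is transitivity, with [phi] adding a column it handles multiplication by e_r. *)
Lemma TriC_comb g (h : part -> X -> R) (phi : part -> part) f lam d c0 k :
  (forall mu, sumn mu = sumn lam -> sumn (phi mu) = d) ->
  (forall mu nu, dominates mu nu -> dominates (phi mu) (phi nu)) ->
  (forall mu, sumn mu = sumn lam -> dominates lam mu ->
     dominates (phi mu) (phi lam) -> mu = lam) ->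
  (forall mu, sumn mu = sumn lam -> TriC g (h mu) (phi mu) (k mu)) ->
  TriC h f lam c0 -> TriC g f (phi lam) (c0 * k lam).
Proof.
move=> phid phiD phiI Hh [u [u1 u2 u3]].
have /choice[c Hc] : forall mu, exists c : part -> R, sumn mu = sumn lam ->
    [/\ c (phi mu) = k mu, (forall nu, c nu != 0 -> dominates (phi mu) nu)
     & forall x, h mu x = \sum_(nu <- PD d) c nu * g nu x].
  move=> mu; case: (eqVneq (sumn mu) (sumn lam)) => [e|/eqP ne]; last by exists (fun=> 0).
  by have [c] := Hh mu e; rewrite phid // => Hc; exists c.
exists (fun kap => \sum_(mu <- PD (sumn lam)) u mu * c mu kap); split.
- rewrite (bigD1_seq lam) ?PD_uniq ?mem_PD //= u1.
  have [-> _ _] := Hc lam erefl.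
  rewrite big_seq_cond big1 ?addr0 // => mu; rewrite mem_PD => /andP[/eqP e ne].
  have [_ c2 _] := Hc mu e.
  case: (eqVneq (u mu) 0) => [->|/u2 D]; first by rewrite mul0r.
  case: (eqVneq (c mu (phi lam)) 0) => [->|/c2 D']; first by rewrite mulr0.
  by rewrite (phiI mu e D D') eqxx in ne.
- move=> kap; apply: contra_neqP => nD; rewrite big_seq big1 // => mu.
  rewrite mem_PD => /eqP e; have [_ c2 _] := Hc mu e.
  case: (eqVneq (u mu) 0) => [->|/u2 D]; first by rewrite mul0r.
  case: (eqVneq (c mu kap) 0) => [->|/c2 D']; first by rewrite mulr0.
  by case: nD; apply: dominates_trans D'; apply: phiD.
- move=> x; rewrite u3 phid //.
  under [RHS]eq_bigr do rewrite mulr_suml.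
  rewrite [RHS]exchange_big /= [LHS]big_seq [RHS]big_seq; apply: eq_bigr => mu.
  rewrite mem_PD => /eqP e; have [_ _ ->] := Hc mu e.
  by rewrite mulr_sumr; apply: eq_bigr => nu _; rewrite mulrA.
Qed.

Lemma TriC_trans g (h : part -> X -> R) f lam c k :
  (forall mu, sumn mu = sumn lam -> TriC g (h mu) mu (k mu)) -> TriC h f lam c ->
  TriC g f lam (c * k lam).
Proof.
move=> H; apply: (@TriC_comb g h id f lam (sumn lam)) => // mu _ D D'.
exact: dominates_anti.
Qed.

Lemma Tri_trans g (h : part -> X -> R) f lam c :
  (forall mu, sumn mu = sumn lam -> Tri g (h mu) mu) -> TriC h f lam c -> TriC g f lam c.
Proof. by move=> H Hf; have := TriC_trans H Hf; rewrite mulr1. Qed.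

(** Solve the expansion of h_lam for its leading term g_lam; the lower g_mu are known by induction
    on [dom_rank]. *)
Lemma Tri_inv g (h : part -> X -> R) d :
  (forall mu, sumn mu = d -> Tri g (h mu) mu) ->
  forall mu, sumn mu = d -> Tri h (g mu) mu.
Proof.
move=> H mu; have [m] := ubnP (dom_rank mu); elim: m mu => // m IH lam.
rewrite ltnS => lm ld; have [u [u1 u2 u3]] := H lam ld.
have /choice[c Hc] : forall mu, exists c : part -> R, dominates lam mu -> mu <> lam ->
    [/\ c mu = 1, (forall nu, c nu != 0 -> dominates mu nu)
     & forall x, g mu x = \sum_(nu <- PD d) c nu * h nu x].
  move=> mu; case: (EM (dominates lam mu /\ mu <> lam)) => [[D ne]|nD]; last first.
    by exists (fun=> 0) => D ne; case: nD.
  have e : sumn mu = d by rewrite -ld (dominates_sumn D).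
  have lt : (dom_rank mu < m)%N.
    by apply: leq_trans lm; apply: dom_rank_lt => // e'; apply: ne.
  by have [c] := IH mu lt e; rewrite e => Hc; exists c.
exists (fun kap => (kap == lam)%:R - \sum_(mu <- PD d | mu != lam) u mu * c mu kap); split.
- rewrite eqxx big1_seq ?subr0 // => mu /andP[ne _].
  case: (eqVneq (u mu) 0) => [->|/u2 D]; first by rewrite mul0r.
  have [_ c2 _] := Hc mu D (elimN eqP ne).
  case: (eqVneq (c mu lam) 0) => [->|/c2 D']; first by rewrite mulr0.
  by rewrite (dominates_anti D D') eqxx in ne.
- move=> kap; case: (eqVneq kap lam) => [->//|ne]; apply: contra_neqP => nD.
  rewrite sub0r big1_seq ?oppr0 // => mu /andP[ne' _].
  case: (eqVneq (u mu) 0) => [->|/u2 D]; first by rewrite mul0r.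
  have [_ c2 _] := Hc mu D (elimN eqP ne').
  case: (eqVneq (c mu kap) 0) => [->|/c2 D']; first by rewrite mulr0.
  by case: nD; apply: dominates_trans D'.
- move=> x; rewrite ld; under eq_bigr do rewrite mulrBl mulr_suml.
  rewrite big_split /= sumrN exchange_big /=.
  under eq_bigr do rewrite mulr_natl mulrb.
  rewrite sum_seq_delta ?PD_uniq // mem_PD ld eqxx u3 ld.
  rewrite (bigD1_seq lam) ?PD_uniq ?mem_PD ?ld //= u1 mul1r.
  apply/esym/eqP; rewrite -addrA addrC eq_sym -subr_eq subrr eq_sym subr_eq0; apply/eqP.
  apply: eq_bigr => mu ne.
  case: (eqVneq (u mu) 0) => [->|/u2 D].
    by rewrite mul0r big1 // => nu _; rewrite !mul0r.
  have [_ _ ->] := Hc mu D (elimN eqP ne).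
  by rewrite mulr_sumr; apply: eq_bigr => nu _; rewrite mulrA.
Qed.

End Triangular.

Section Monomials.
Variable R : realFieldType.
Variable n : nat.
Implicit Types (x : 'I_n -> R) (lam mu nu kap : part).

Definition mon x (al : 'I_n -> nat) : R := \prod_i x i ^+ al i.

Definition mm lam x : R :=
  \sum_(al : {ffun 'I_n -> 'I_(sumn lam).+1} | eshape (fun i => al i : nat) == lam)
    mon x (fun i => al i).

Lemma eq_mon x (al be : 'I_n -> nat) : al =1 be -> mon x al = mon x be.
Proof. by move=> e; apply: eq_bigr => i _; rewrite e. Qed.

Lemma shape_le_sumn (al : 'I_n -> nat) lam i : eshape al = lam -> (al i <= sumn lam)%N.
Proof. by move=> <-; rewrite sumn_eshape (bigD1 i) //= leq_addr. Qed.

Lemma mmE B lam x : (sumn lam <= B)%N ->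
  mm lam x = \sum_(al : {ffun 'I_n -> 'I_B.+1} | eshape (fun i => al i : nat) == lam)
    mon x (fun i => al i).
Proof.
move=> lB; rewrite (reindex_onto
  (fun al : {ffun 'I_n -> 'I_(sumn lam).+1} => [ffun i => inord (al i) : 'I_B.+1])
  (fun al : {ffun 'I_n -> 'I_B.+1} => [ffun i => inord (al i) : 'I_(sumn lam).+1])) /=; last first.
  move=> al /eqP e; apply/ffunP => i; rewrite !ffunE; apply/val_inj.
  have h := shape_le_sumn i e.
  have h1 : (inord (al i) : 'I_(sumn lam).+1) = al i :> nat by rewrite inordK.
  by rewrite /= inordK h1 // ltn_ord.
have E (al : {ffun 'I_n -> 'I_(sumn lam).+1}) i :
    ([ffun i => inord (al i) : 'I_B.+1] i : nat) = al i.
  by rewrite ffunE inordK // ltnS (leq_trans (leq_ord _)).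
apply: eq_big => [al|al _]; last by apply: eq_mon => i; rewrite E.
rewrite (eq_eshape (E al)); case: eqP => //= _; apply/esym/eqP/ffunP => i.
by apply/val_inj; rewrite ffunE /= E inordK.
Qed.

Lemma mm_big lam x : (n < size lam)%N -> mm lam x = 0.
Proof.
move=> h; rewrite /mm big_pred0 // => al; apply/eqP => e.
by have := size_eshape (fun i => al i : nat); rewrite e leqNgt h.
Qed.

Definition pad B kap : {ffun 'I_n -> 'I_B.+1} := [ffun i : 'I_n => inord (prow kap i)].

(** Coefficients invariant under permutations are constant on orbits, and [pad B kap] represents the
    orbit of shape kap. *)
Lemma group_shape d B (c : {ffun 'I_n -> 'I_B.+1} -> R) x : (d <= B)%N ->
  (forall (ga : {ffun 'I_n -> 'I_B.+1}) (w : 'S_n), c [ffun i => ga (w i)] = c ga) ->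
  (forall ga : {ffun 'I_n -> 'I_B.+1}, c ga != 0 -> (\sum_i ga i = d)%N) ->
  \sum_(ga : {ffun 'I_n -> 'I_B.+1}) c ga * mon x (fun i => ga i) =
    \sum_(kap <- PD d) c (pad B kap) * mm kap x.
Proof.
move=> dB cw cd.
transitivity (\sum_(ga : {ffun 'I_n -> 'I_B.+1}) \sum_(kap <- PD d)
    (if kap == eshape (fun i => ga i : nat) then c ga * mon x (fun i => ga i) else 0)).
  apply: eq_bigr => ga _; rewrite sum_seq_delta ?PD_uniq // mem_PD sumn_eshape.
  by case: (eqVneq (c ga) 0) => [->|/cd ->]; rewrite ?mul0r ?if_same ?eqxx.
rewrite exchange_big /= big_seq [RHS]big_seq; apply: eq_bigr => kap.
rewrite mem_PD => /eqP kd; rewrite (mmE x (B := B)) ?kd // mulr_sumr -big_mkcond /=.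
apply: eq_big => [ga|ga /eqP e]; first by rewrite eq_sym.
congr (_ * _).
have sk : (size kap <= n)%N by rewrite e size_eshape.
have [w Hw] := eshape_permP (etrans (esym e) (esym (eshape_prow sk))).
rewrite -(cw (pad B kap) w); congr c; apply/ffunP => i; apply/val_inj.
by rewrite !ffunE /= inordK ?Hw // ltnS (leq_trans (prow_le_sumn _ _)) ?kd.
Qed.

Definition ee r x : R := \sum_(I : {set 'I_n} | #|I| == r) \prod_(i in I) x i.

Definition addI (al : 'I_n -> nat) (I : {set 'I_n}) : 'I_n -> nat :=
  fun i => (al i + (i \in I))%N.

Lemma mon_addI x al I : mon x (addI al I) = (\prod_(i in I) x i) * mon x al.
Proof.
rewrite /mon [X in X * _]big_mkcond -big_split /=; apply: eq_bigr => i _.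
by rewrite /addI; case: (i \in I); rewrite ?addn1 ?exprS // addn0 mul1r.
Qed.

Lemma sum_addI al I : (\sum_i addI al I i = \sum_i al i + #|I|)%N.
Proof.
rewrite big_split /= -sum1_card; congr addn.
by rewrite [RHS]big_mkcond; apply: eq_bigr => i _; case: (i \in I).
Qed.

Lemma pre_addI al I k :
  (\sum_(i < n | i < k) addI al I i = \sum_(i < n | i < k) al i + #|[set i in I | i < k]|)%N.
Proof.
rewrite big_split /= -sum1_card; congr (_ + _)%N.
rewrite big_mkcond [RHS]big_mkcond; apply: eq_bigr => i _.
by rewrite inE; case: (i \in I); case: (i < k)%N.
Qed.

Lemma card_lt_set (I : {set 'I_n}) k : (#|[set i in I | (i < k)%N]| <= minn k #|I|)%N.
Proof.
rewrite leq_min; apply/andP; split; last first.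
  by apply/subset_leq_card/subsetP => i; rewrite inE => /andP[].
apply: (@leq_trans #|[set i : 'I_n | (i < k)%N]|).
  by apply/subset_leq_card/subsetP => i; rewrite !inE => /andP[].
rewrite -sum1_card; under eq_bigl do rewrite inE.
rewrite (sum_ord_swap n k (fun=> 1%N)) big_mkcond /=.
by rewrite -[X in (_ <= X)%N]card_ord -sum1_card; apply: leq_sum => i _; case: ifP.
Qed.

(** The number of ways to write the monomial x^ga as a monomial of e_r times one of m_nu, as an
    element of R. *)
Definition e_coef r nu (ga : 'I_n -> nat) : R :=
  \sum_(p : {set 'I_n} * {ffun 'I_n -> 'I_(sumn nu).+1} |
      (#|p.1| == r) && (eshape (fun i => p.2 i : nat) == nu) &&
      [forall i, addI (fun i => p.2 i) p.1 i == ga i]) 1.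

Lemma e_coef_perm r nu ga (w : 'S_n) : e_coef r nu (fun i => ga (w i)) = e_coef r nu ga.
Proof.
rewrite /e_coef (reindex_onto
  (fun p : {set 'I_n} * {ffun 'I_n -> 'I_(sumn nu).+1} => (w @^-1: p.1, [ffun i => p.2 (w i)]))
  (fun p => ((w^-1)%g @^-1: p.1, [ffun i => p.2 ((w^-1)%g i)]))) /=; last first.
  move=> [I al] _ /=; congr pair; first by apply/setP => i; rewrite !inE permK.
  by apply/ffunP => i; rewrite !ffunE permK.
apply: eq_bigl => -[I al] /=.
rewrite (_ : _ == (I, al)) ?andbT; last first.
  apply/eqP; congr pair; first by apply/setP => i; rewrite !inE permKV.
  by apply/ffunP => i; rewrite !ffunE permKV.
have -> : #|w @^-1: I| = #|I|.
  rewrite -(card_imset (w @^-1: I) (@perm_inj _ w)); congr #|pred_of_set _|.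
  apply/setP => i; apply/imsetP/idP => [[j jI ->]|iI]; first by rewrite inE in jI.
  by exists ((w^-1)%g i); rewrite ?inE permKV.
have -> : eshape (fun i => [ffun i => al (w i)] i : nat) = eshape (fun i => al i : nat).
  rewrite -(eshape_perm (fun i => al i : nat) w); apply: eq_eshape => i.
  by rewrite ffunE.
congr (_ && _); apply/forallP/forallP => H i; last first.
  by rewrite -(eqP (H (w i))) /addI inE ffunE.
by have := H ((w^-1)%g i); rewrite /addI inE ffunE permKV.
Qed.

Lemma ee_mm r nu x : ee r x * mm nu x =
  \sum_(kap <- PD (sumn nu + r)) e_coef r nu (fun i => prow kap i) * mm kap x.
Proof.
set B := (sumn nu + r)%N.
pose ga0 (p : {set 'I_n} * {ffun 'I_n -> 'I_(sumn nu).+1}) : {ffun 'I_n -> 'I_B.+1} :=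
  [ffun i => inord (addI (fun i => p.2 i) p.1 i)].
have Hga (p : {set 'I_n} * {ffun 'I_n -> 'I_(sumn nu).+1}) :
    #|p.1| = r -> forall i : 'I_n, (ga0 p i : nat) = addI (fun i => p.2 i) p.1 i.
  move=> pr i; rewrite ffunE inordK // ltnS leq_add ?leq_ord //.
  by case: (boolP (i \in p.1)) => // ip; rewrite -pr (cardD1 i) ip.
transitivity (\sum_(ga : {ffun 'I_n -> 'I_B.+1}) e_coef r nu (fun i => ga i) * mon x (fun i => ga i)).
  rewrite /ee /mm big_distrlr pair_big_dep /=.
  rewrite (partition_big ga0 predT) //=; apply: eq_bigr => ga _.
  rewrite /e_coef mulr_suml; apply: eq_big => [p|p].
    case: eqP => //= pr; case: eqP => //= _.
    apply/eqP/forallP => [<- i|H]; first by rewrite Hga.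
    by apply/ffunP => i; apply/val_inj; rewrite /= Hga // (eqP (H i)).
  move=> /andP[/andP[/eqP pr _] /eqP <-]; rewrite mul1r.
  by rewrite (eq_mon x (Hga p pr)) mon_addI.
rewrite (group_shape (d := B)) //; last first.
- move=> ga; apply: contra_neq_eq => h; rewrite /e_coef big1 // => p.
  move=> /andP[/andP[/eqP pr /eqP ps] /forallP H].
  case/eqP: h; rewrite -(eq_bigr _ (fun i _ => eqP (H i))) sum_addI pr.
  by rewrite -(sumn_eshape (fun i => p.2 i)) ps.
- move=> ga w; rewrite -(e_coef_perm _ _ (fun i => ga i) w); congr e_coef.
  by apply/funext => i; rewrite ffunE.
rewrite big_seq [RHS]big_seq; apply: eq_bigr => kap; rewrite mem_PD => /eqP kd.
congr (e_coef _ _ _ * _); apply/funext => i; rewrite ffunE inordK // ltnS.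
by rewrite -kd prow_le_sumn.
Qed.

(** A set of r rows meets the first k rows in at most min(k, r) of them, and the prefix sums of a
    vector are at most those of its sorted form. *)
Lemma e_coef_dom r nu kap : sumn kap = (sumn nu + r)%N -> (size kap <= n)%N ->
  e_coef r nu (fun i => prow kap i) != 0 -> dominates (addcol nu r) kap.
Proof.
move=> e sk; apply: contra_neqP => nD; rewrite /e_coef big_pred0 // => -[I al] /=.
apply/negP => /andP[/andP[/eqP Ir /eqP sh] /forallP H]; apply: nD.
split=> [|k]; first by rewrite sumn_addcol.
rewrite (sumn_take_ord k sk) -(eq_bigr _ (fun i _ => eqP (H i))) pre_addI take_addcol -Ir.
apply: leq_add (card_lt_set I k).
by have := eshape_top (fun i => al i : nat) k; rewrite sh.
Qed.

(** All the inequalities behind [e_coef_dom] are equalities here, which forces the exponent vector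
    to be sorted and the set to consist of the first r rows. *)
Lemma e_coef_top r nu : (r <= n)%N -> (size nu <= n)%N ->
  e_coef r nu (fun i => prow (addcol nu r) i) = 1.
Proof.
move=> rn sn; pose I0 := [set i : 'I_n | (i < r)%N].
pose al0 := [ffun i : 'I_n => inord (prow nu i) : 'I_(sumn nu).+1].
have Eal i : (al0 i : nat) = prow nu i by rewrite ffunE inordK // ltnS prow_le_sumn.
have cI : #|I0| = r.
  rewrite -sum1_card; under eq_bigl do rewrite inE.
  rewrite (sum_ord_swap n r (fun=> 1%N)) (eq_bigl xpredT) ?sum1_card ?card_ord // => i.
  by rewrite (leq_trans (ltn_ord i)).
rewrite /e_coef (big_pred1 (I0, al0)) // => -[I al]; cbn [fst snd].
apply/idP/eqP; last first.
  case=> -> ->; rewrite cI eqxx (eq_eshape Eal) eshape_prow // eqxx.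
  by apply/forallP => i; rewrite prow_addcol /addI Eal inE.
move=> /andP[/andP[/eqP Ir /eqP sh] /forallP H].
have pre k : (k <= n)%N -> (\sum_(i < n | i < k) al i = \sum_(i < n | i < k) prow nu i)%N.
  move=> kn; apply/eqP; rewrite eqn_leq; apply/andP; split.
    rewrite -(sumn_take_ord k sn).
    by have := eshape_top (fun i => al i : nat) k; rewrite sh.
  have := pre_addI (fun i => al i) I k; rewrite (eq_bigr _ (fun i _ => eqP (H i))).
  rewrite -(@sumn_take_ord n (addcol nu r) k); last by rewrite size_addcol geq_max sn.
  rewrite take_addcol (sumn_take_ord k sn) => e.
  by rewrite -(leq_add2r (minn k r)) e leq_add2l -Ir card_lt_set.
have e := eq_prefix_sums pre.
congr pair; last by apply/ffunP => i; apply/val_inj; rewrite /= Eal e.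
apply/setP => i; rewrite inE; have := H i; rewrite /addI e prow_addcol eqn_add2l.
by case: (i \in I); case: (i < r)%N.
Qed.

Lemma Tri_ee r nu f : Tri mm f nu -> Tri mm (fun x => ee r x * f x) (addcol nu r).
Proof.
rewrite /Tri => Hf; pose h mu x := ee r x * mm mu x.
have: TriC h (fun x => ee r x * f x) nu 1.
  case: Hf => u [u1 u2 u3]; exists u; split=> // x; rewrite u3 mulr_sumr.
  by apply: eq_bigr => mu _; rewrite /h mulrCA.
move=> Hf'; have := @TriC_comb _ _ mm h (addcol ^~ r) _ nu (sumn nu + r) 1 (fun=> 1) _ _ _ _ Hf'.
rewrite mulr1; apply.
- by move=> mu e; rewrite sumn_addcol e.
- by move=> mu mu'; exact: dominates_addcol.
- by move=> mu _ D D'; apply: (addcol_inj (r := r)); apply: dominates_anti D' (dominates_addcol r D).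
(* With more than n rows the leading monomial function is zero, and so is the product: m_mu or e_r
   vanishes in n variables. *)
move=> mu _; have [sz|sz] := leqP (size (addcol mu r)) n; last first.
  exists (fun kap => (kap == addcol mu r)%:R); split; first by rewrite eqxx.
    by move=> kap; case: (eqVneq kap (addcol mu r)) => [->|_]; rewrite ?eqxx.
  move=> x; under eq_bigr do rewrite mulr_natl mulrb.
  rewrite sum_seq_delta ?PD_uniq // mem_PD eqxx mm_big // /h.
  move: sz; rewrite size_addcol leq_max => /orP[sz|sz]; first by rewrite mm_big ?mulr0.
  rewrite /ee big_pred0 ?mul0r // => I; apply/eqP => e.
  by have := max_card (mem I); rewrite e card_ord leqNgt sz.
move: (sz); rewrite size_addcol geq_max => /andP[sm rn].
exists (fun kap => if (size kap <= n)%N && (sumn kap == sumn mu + r)%N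
                   then e_coef r mu (fun i => prow kap i) else 0); split.
- by rewrite sz sumn_addcol eqxx e_coef_top.
- by move=> kap; case: ifP => [/andP[h1 /eqP h2]|_]; [exact: e_coef_dom | rewrite eqxx].
move=> x; rewrite /h ee_mm sumn_addcol big_seq [RHS]big_seq; apply: eq_bigr => kap.
rewrite mem_PD => ->; rewrite andbT; case: (leqP (size kap) n) => // sk.
by rewrite mm_big // !mulr0.
Qed.

End Monomials.

(** * Macdonald's operator *)

Section Alternants.
Variable R : realFieldType.
Variable n : nat.
Implicit Types (x : 'I_n -> R) (al be : 'I_n -> nat) (lam mu nu kap : part).

Definition alt al x : R := \det (\matrix_(i, j) x i ^+ al j).
Definition dlt (i : 'I_n) : nat := (n.-1 - i)%N.
Definition va x : R := alt dlt x.
Definition scl (I : {set 'I_n}) (s : R) x : 'I_n -> R :=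
  fun i => (if i \in I then s else 1) * x i.

Lemma altE al x : alt al x = \sum_(w : 'S_n) (-1) ^+ w * \prod_i x i ^+ al (w i).
Proof.
by rewrite /alt /determinant; apply: eq_bigr => w _; congr (_ * _);
  apply: eq_bigr => i _; rewrite mxE.
Qed.

Lemma eq_alt al be x : al =1 be -> alt al x = alt be x.
Proof.
by move=> e; rewrite !altE; apply: eq_bigr => w _; congr (_ * _);
  apply: eq_bigr => i _; rewrite e.
Qed.

Lemma alt_perm al (w : 'S_n) x : alt (fun i => al (w i)) x = (-1) ^+ w * alt al x.
Proof.
have -> : alt (fun i => al (w i)) x = \det (col_perm w (\matrix_(i, j) x i ^+ al j)).
  by congr (\det _); apply/matrixP => i j; rewrite !mxE.
by rewrite col_permE det_mulmx det_perm odd_permV mulrC.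
Qed.

Lemma alt_eq0 al i j x : i != j -> al i = al j -> alt al x = 0.
Proof.
move=> ij e; rewrite /alt -det_tr.
by apply: (determinant_alternate ij) => k; rewrite !mxE e.
Qed.

Lemma dlt_anti (i j : 'I_n) : (i <= j)%N -> (dlt j <= dlt i)%N.
Proof. by rewrite /dlt; lia. Qed.

Lemma dlt_inj : injective dlt.
Proof. by move=> i j; rewrite /dlt => e; apply/val_inj => /=; have := ltn_ord i; have := ltn_ord j; lia. Qed.

(** The alternant a_(kap + delta): the Schur polynomial of kap times the Vandermonde determinant. *)
Definition agl kap x : R :=
  if (size kap <= n)%N then alt (fun i => dlt i + prow kap i)%N x else 0.

(** If delta + al has distinct entries, a permutation w sorts it into delta + be. Permuting the
    decreasing vector delta does not raise its prefix sums, so those of be are at most those of al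
    permuted by w, hence of al sorted. If be is al sorted, all of this is equality, and w = 1. *)
Lemma alt_sort (al : 'I_n -> nat) : (forall x, alt (fun i => dlt i + al i)%N x = 0) \/
  exists (b : bool) (be : part), [/\ (size be <= n)%N, dominates (eshape al) be,
     (forall x, alt (fun i => dlt i + al i)%N x = (-1) ^+ b * agl be x) &
     be = eshape al -> (forall i, al i = prow be i) /\ b = false].
Proof.
pose ga i := (dlt i + al i)%N.
have [/injectiveP gi|/injectivePn[i [j ij e]]] := boolP (injectiveb ga); last first.
  by left=> x; apply: (alt_eq0 x ij e).
right; pose g i := prow (eshape ga) i.
have [w Hw] := eshape_permP (eshape_prow (size_eshape ga)).
have gd (i : nat) : (i.+1 < n)%N -> (g i.+1 < g i)%N.
  move=> h; pose i1 := Ordinal h; pose i0 := Ordinal (ltnW h).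
  rewrite ltn_neqAle /g prow_anti // andbT.
  apply/eqP => e; have := gi (w i1) (w i0).
  by rewrite -(Hw i1) -(Hw i0) e => /(_ erefl)/perm_inj/(congr1 val) /= /eqP; rewrite eqn_leq ltnn.
have gl (i : nat) : (i < n)%N -> (n.-1 - i <= g i)%N.
  move=> h; have [m] := ubnP (n.-1 - i); elim: m i h => // m IH i h; rewrite ltnS => hm.
  case: (ltnP i.+1 n) => h1; last by lia.
  have := gd i h1; have := IH i.+1 h1; lia.
pose be := pof (fun i => g i - (n.-1 - i))%N n.
have Hbe (i : 'I_n) : (dlt i + prow be i)%N = ga (w i).
  rewrite -Hw prow_pof ?ltn_ord; last by move=> j h; have := gd j h; lia.
  by rewrite subnKC ?gl.
have sb : (size be <= n)%N by rewrite (leq_trans (size_mkpart _)) ?size_mkseq.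
have Dpre k : (\sum_(i < n | i < k) dlt (w i) <= \sum_(i < n | i < k) dlt i)%N.
  have := eshape_top (fun i => dlt (w i)) k; rewrite eshape_perm (sumn_take_ord _ (size_eshape _)).
  by under [X in (_ <= X)%N]eq_bigr do rewrite (prow_eshape _ dlt_anti).
have Apre k : (\sum_(i < n | i < k) al (w i) <= \sum_(i < n | i < k) prow (eshape al) i)%N.
  have := eshape_top (fun i => al (w i)) k; rewrite eshape_perm.
  by rewrite (sumn_take_ord _ (size_eshape _)).
have E k : (\sum_(i < n | i < k) dlt i + \sum_(i < n | i < k) prow be i =
    \sum_(i < n | i < k) dlt (w i) + \sum_(i < n | i < k) al (w i))%N.
  by rewrite -!big_split /=; apply: eq_bigr => i _; rewrite Hbe.
have sumE : sumn (eshape al) = sumn be.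
  rewrite sumn_eshape -(eshape_prow sb) sumn_eshape.
  have U (F : 'I_n -> nat) : (\sum_(i < n | i < n) F i = \sum_(i < n) F i)%N.
    by apply: eq_bigl => i; rewrite ltn_ord.
  have := E n; rewrite !U.
  rewrite -(reindex_inj (h := w) (F := dlt) (P := xpredT) perm_inj) /=.
  rewrite -(reindex_inj (h := w) (F := al) (P := xpredT) perm_inj) /=.
  by move/addnI.
exists (odd_perm w), be; split => //.
- apply: (dominatesP (size_eshape al) sb sumE) => k _.
  by have := E k; have := Dpre k; have := Apre k; lia.
- move=> x; rewrite /agl sb (eq_alt x Hbe) alt_perm mulrA -signr_addb addbb mul1r.
  exact: eq_alt.
move=> eb; have pd : (fun i => dlt (w i)) =1 dlt.
  apply: eq_prefix_sums => k _.
  by have := E k; have := Dpre k; have := Apre k; rewrite -eb; lia.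
have w1 : w = 1%g by apply/permP => i; rewrite perm1; exact: dlt_inj (pd i).
split; last by rewrite w1 odd_perm1.
by move=> i; have := Hbe i; rewrite w1 perm1 => /addnI.
Qed.

(** Within the orbit of kap only the sorted vector produces the alternant of kap itself, so its
    coefficient leads. *)
Lemma TriC_alt kap (c : {ffun 'I_n -> 'I_(sumn kap).+1} -> R) c0 :
  ((size kap <= n)%N -> forall al : {ffun 'I_n -> 'I_(sumn kap).+1},
     (forall i, al i = prow kap i :> nat) -> c al = c0) ->
  TriC agl (fun x => \sum_(al : {ffun 'I_n -> 'I_(sumn kap).+1} |
     eshape (fun i => al i : nat) == kap) c al * alt (fun i => dlt i + al i)%N x) kap c0.
Proof.
move=> Hc; have [sk|sk] := leqP (size kap) n; last first.
  exists (fun mu => if mu == kap then c0 else 0); split; first by rewrite eqxx.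
    by move=> mu; case: (eqVneq mu kap) => [->|_]; rewrite ?eqxx.
  move=> x; rewrite big_pred0; last first.
    move=> al; apply/eqP => e; have := size_eshape (fun i => al i : nat).
    by rewrite e leqNgt sk.
  rewrite big1 // => mu _; case: eqP => [->|_]; last by rewrite mul0r.
  by rewrite /agl leqNgt sk mulr0.
have /choice[d Hd] : forall al : {ffun 'I_n -> 'I_(sumn kap).+1}, exists d : part -> R,
    eshape (fun i => al i : nat) = kap ->
    [/\ d kap = [forall i, al i == prow kap i :> nat]%:R,
        (forall mu, d mu != 0 -> dominates kap mu) &
        forall x, alt (fun i => dlt i + al i)%N x = \sum_(mu <- PD (sumn kap)) d mu * agl mu x].
  move=> al; case: forallP => [F|nF].
    exists (fun mu => if mu == kap then 1 else 0) => _; split; first by rewrite eqxx.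
      by move=> mu; case: (eqVneq mu kap) => [->|_]; rewrite ?eqxx.
    move=> x; under eq_bigr do rewrite (fun_if (fun r => r * _)) mul1r mul0r.
    rewrite sum_seq_delta ?PD_uniq // mem_PD eqxx /agl sk.
    by apply: eq_alt => i; rewrite (eqP (F i)).
  have [H|[b [be [h1 h2 h3 h4]]]] := alt_sort (fun i => al i : nat).
    exists (fun=> 0) => e; split=> [|mu|x]; rewrite ?eqxx //.
    by rewrite H big1 // => mu _; rewrite mul0r.
  exists (fun mu => if mu == be then (-1) ^+ b else 0) => e; split.
  - case: eqP => // ke; case: nF => i.
    by have [F _] := h4 (etrans (esym ke) (esym e)); rewrite F ke.
  - by move=> mu; case: (eqVneq mu be) => [->|_]; rewrite ?eqxx // -e.
  - move=> x; under eq_bigr do rewrite (fun_if (fun r => r * _)) mul0r.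
    by rewrite sum_seq_delta ?PD_uniq // mem_PD -(dominates_sumn h2) e eqxx h3.
exists (fun mu => \sum_(al : {ffun 'I_n -> 'I_(sumn kap).+1} |
  eshape (fun i => al i : nat) == kap) c al * d al mu); split.
- pose al0 := [ffun i : 'I_n => inord (prow kap i) : 'I_(sumn kap).+1].
  have E0 i : al0 i = prow kap i :> nat by rewrite ffunE inordK // ltnS prow_le_sumn.
  have s0 : eshape (fun i => al0 i : nat) = kap by rewrite (eq_eshape E0) eshape_prow.
  rewrite (bigD1 al0) /=; last by apply/eqP.
  have [-> _ _] := Hd al0 s0; rewrite (Hc sk) //.
  have -> : [forall i, al0 i == prow kap i :> nat] by apply/forallP => i; rewrite E0.
  rewrite mulr1 big1 ?addr0 // => al /andP[/eqP sal ne].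
  have [-> _ _] := Hd al sal; case: forallP => [F|_]; last by rewrite mulr0.
  by case/eqP: ne; apply/ffunP => i; apply/val_inj; rewrite /= E0 (eqP (F i)).
- move=> mu; apply: contra_neqP => nD; rewrite big1 // => al /eqP sal.
  have [_ d2 _] := Hd al sal.
  by case: (eqVneq (d al mu) 0) => [->|/d2]; rewrite ?mulr0.
- move=> x; under [RHS]eq_bigr do rewrite mulr_suml.
  rewrite [RHS]exchange_big /=; apply: eq_bigr => al /eqP sal.
  have [_ _ ->] := Hd al sal; rewrite mulr_sumr.
  by apply: eq_bigr => mu _; rewrite mulrA.
Qed.

Lemma va_scl I t x : va (scl I t x) =
  \sum_(w : 'S_n) (-1) ^+ w * (\prod_(i in I) t ^+ dlt (w i) * \prod_i x i ^+ dlt (w i)).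
Proof.
rewrite /va altE; apply: eq_bigr => w _; congr (_ * _).
rewrite [X in _ = X * _]big_mkcond -big_split /=; apply: eq_bigr => i _.
by rewrite /scl exprMn; case: (i \in I); rewrite ?expr1n.
Qed.

Lemma mon_scl I q x al : mon (scl I q x) al = (\prod_(i in I) q ^+ al i) * mon x al.
Proof.
rewrite /mon [X in _ = X * _]big_mkcond -big_split /=; apply: eq_bigr => i _.
by rewrite /scl exprMn; case: (i \in I); rewrite ?expr1n.
Qed.

Lemma sum_set_prod (X : R) (F : 'I_n -> R) :
  \sum_(I : {set 'I_n}) X ^+ #|I| * \prod_(i in I) F i = \prod_i (1 + X * F i).
Proof.
under [RHS]eq_bigr do rewrite addrC.
rewrite bigA_distr; apply: eq_bigr => I _.
by rewrite -big_mkcond /= big_split /= prodr_const.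
Qed.

Variables (q t X : R).

(** For a fixed permutation w and exponent vector al, the sum over I factors into a product over the
    variables. Relabelling al by w makes this product independent of w, and the signed sum over w
    becomes an alternant. *)
Lemma mac_expand kap x :
  \sum_(I : {set 'I_n}) X ^+ #|I| * (va (scl I t x) * mm kap (scl I q x)) =
  \sum_(al : {ffun 'I_n -> 'I_(sumn kap).+1} | eshape (fun i => al i : nat) == kap)
     (\prod_i (1 + X * (t ^+ dlt i * q ^+ al i))) * alt (fun i => dlt i + al i)%N x.
Proof.
pose A := {ffun 'I_n -> 'I_(sumn kap).+1}.
transitivity (\sum_(w : 'S_n) \sum_(al : A | eshape (fun i => al i : nat) == kap)
    (-1) ^+ w * (\prod_i (1 + X * (t ^+ dlt (w i) * q ^+ al i)) *
    \prod_i x i ^+ (dlt (w i) + al i))).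
  transitivity (\sum_(I : {set 'I_n}) \sum_(w : 'S_n)
      \sum_(al : A | eshape (fun i => al i : nat) == kap)
      (-1) ^+ w * (X ^+ #|I| * (\prod_(i in I) (t ^+ dlt (w i) * q ^+ al i)) *
      \prod_i x i ^+ (dlt (w i) + al i))).
    apply: eq_bigr => I _; rewrite va_scl /mm mulr_suml mulr_sumr.
    apply: eq_bigr => w _; rewrite !mulr_sumr; apply: eq_bigr => al _.
    rewrite mon_scl big_split /=.
    have -> : \prod_i x i ^+ (dlt (w i) + al i) = \prod_i x i ^+ dlt (w i) * mon x (fun i => al i).
      by rewrite /mon -big_split; apply: eq_bigr => i _; rewrite exprD.
    move: (mon _ _) (\prod_(i in I) q ^+ al i) (\prod_(i in I) _) (\prod_i _).
    by move: (X ^+ _) ((-1) ^+ w) => a b c d e f; ring.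
  rewrite exchange_big; apply: eq_bigr => w _; rewrite exchange_big.
  apply: eq_bigr => al _; rewrite -sum_set_prod mulr_suml mulr_sumr.
  apply: eq_bigr => I _; move: (\prod_(i in I) _) (\prod_i _) (X ^+ _) ((-1) ^+ w).
  by move=> a b c d; ring.
transitivity (\sum_(w : 'S_n) \sum_(al : A | eshape (fun i => al i : nat) == kap)
    (-1) ^+ w * (\prod_i (1 + X * (t ^+ dlt i * q ^+ al i)) *
    \prod_i x i ^+ (dlt (w i) + al (w i)))).
  apply: eq_bigr => w _.
  have inj : {in [pred al : A | true] &, injective (fun al : A => [ffun i => al (w i)])}.
    move=> al be _ _ /ffunP e; apply/ffunP => i; have := e ((w^-1)%g i).
    by rewrite !ffunE permKV.
  rewrite (reindex (fun al : A => [ffun i => al (w i)])) /=; last first.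
    exists (fun al : A => [ffun i => al ((w^-1)%g i)]) => al _; apply/ffunP => i;
    by rewrite !ffunE ?permK ?permKV.
  apply: eq_big => [al|al _].
    rewrite -(eshape_perm (fun i => al i : nat) w); congr (_ == _).
    by apply: eq_eshape => i; rewrite ffunE.
  congr (_ * (_ * _)); last by apply: eq_bigr => i _; rewrite ffunE.
  rewrite [RHS](reindex_inj (@perm_inj _ w)) /=.
  by apply: eq_bigr => i _; rewrite ffunE.
rewrite exchange_big /=; apply: eq_bigr => al _; rewrite altE mulr_sumr.
by apply: eq_bigr => w _; rewrite mulrCA.
Qed.

Definition evl kap : R := \prod_(i < n) (1 + X * (t ^+ dlt i * q ^+ prow kap i)).

(* Macdonald's operator; the coefficient of X^r is his D_n^r. *)
Definition Dop (f : ('I_n -> R) -> R) x : R :=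
  \sum_(I : {set 'I_n}) X ^+ #|I| * (va (scl I t x) / va x * f (scl I q x)).

End Alternants.

Section Triangularity.
Variables (R : realFieldType) (n : nat).
Implicit Types (kap lam mu : part).

Lemma Tri_agl kap : Tri (@agl R n) (fun x => va x * mm kap x) kap.
Proof.
rewrite /Tri; apply: (eq_Tri (f := fun x =>
  \sum_(al : {ffun 'I_n -> 'I_(sumn kap).+1} | eshape (fun i => al i : nat) == kap)
     (1 : R) * alt (fun i => dlt i + al i)%N x)); last exact: TriC_alt.
(* At X = 0 only the empty set of shifts survives. *)
move=> x; have := mac_expand 1 1 0 kap x.
rewrite (bigD1 set0) //= cards0 expr0 mul1r big1 ?addr0; last first.
  by move=> I; rewrite -cards_eq0 => /negbTE I0; rewrite expr0n I0 mul0r.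
have e : scl set0 1 x = x by apply/funext => i; rewrite /scl inE mul1r.
rewrite e => ->; apply: eq_bigr => al _.
by rewrite big1 // => i _; rewrite mul0r addr0.
Qed.

Definition dist (x : 'I_n -> R) := va x != 0.
Notation X' := {x : 'I_n -> R | dist x}.

(** After multiplication by the Vandermonde determinant, the m_mu and their images are both
    triangular in the alternants; the first triangularity is inverted and the determinant cancelled,
    which is possible on [X']. *)
Lemma TriC_Dop_mm (q t X : R) kap :
  TriC (fun mu (x : X') => mm mu (val x)) (fun x : X' => Dop q t X (mm kap) (val x))
    kap (evl n q t X kap).
Proof.
pose h mu (x : X') := va (val x) * mm mu (val x).
have H1 : TriC h (fun x : X' => \sum_(I : {set 'I_n}) X ^+ #|I| *
    (va (scl I t (val x)) * mm kap (scl I q (val x)))) kap (evl n q t X kap).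
  have Hi mu : sumn mu = sumn kap -> Tri h (fun x => agl mu (val x)) mu.
    apply: (@Tri_inv _ _ (fun mu (x : X') => agl mu (val x)) h (sumn kap)) => nu _.
    have [u [u1 u2 u3]] := Tri_agl nu; exists u; split=> // x; exact: u3.
  apply: (Tri_trans Hi).
  have [c [u1 u2 u3]] : TriC (@agl R n) (fun x =>
    \sum_(al : {ffun 'I_n -> 'I_(sumn kap).+1} | eshape (fun i => al i : nat) == kap)
     (\prod_i (1 + X * (t ^+ dlt i * q ^+ al i))) * alt (fun i => dlt i + al i)%N x)
     kap (evl n q t X kap).
    by apply: TriC_alt => _ al e; apply: eq_bigr => i _; rewrite e.
  by exists c; split=> // x; rewrite mac_expand u3.
case: H1 => u [u1 u2 u3]; exists u; split=> // x.
have vx : va (val x) != 0 := valP x.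
apply: (mulfI vx); rewrite [RHS]mulr_sumr.
under [RHS]eq_bigr do rewrite mulrCA.
rewrite -u3 /Dop mulr_sumr; apply: eq_bigr => I _.
by rewrite mulrCA; congr (_ * _); rewrite mulrA mulrCA divff // mulr1.
Qed.

Lemma TriC_Dop (q t X : R) (P : part -> ('I_n -> R) -> R) lam :
  (forall mu, sumn mu = sumn lam -> Tri (@mm R n) (P mu) mu) ->
  TriC (fun mu (x : X') => P mu (val x)) (fun x : X' => Dop q t X (P lam) (val x))
    lam (evl n q t X lam).
Proof.
move=> H.
have H' mu : sumn mu = sumn lam -> Tri (fun mu (x : X') => P mu (val x)) (fun x => mm mu (val x)) mu.
  apply: (@Tri_inv _ _ (fun mu (x : X') => mm mu (val x)) _ (sumn lam)) => nu e.
  by have [u [u1 u2 u3]] := H nu e; exists u; split=> // x; exact: u3.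
apply: (Tri_trans H').
rewrite -[evl _ _ _ _ _]mul1r.
apply: (@TriC_trans _ _ _ (fun mu (x : X') => Dop q t X (mm mu) (val x))).
  by move=> mu _; exact: TriC_Dop_mm.
have [u [u1 u2 u3]] := H lam erefl; exists u; split=> // x.
rewrite /Dop; under eq_bigr do rewrite u3 !mulr_sumr.
rewrite exchange_big; apply: eq_bigr => mu _; rewrite mulr_sumr.
by apply: eq_bigr => I _; rewrite !mulrA; congr (_ * _); rewrite mulrC !mulrA.
Qed.

End Triangularity.

(** * Interpolation *)

Lemma seq_max_ind (T : eqType) (s : seq T) (f : T -> nat) (Q : T -> Prop) :
  (forall x, x \in s -> (forall y, y \in s -> (f x < f y)%N -> Q y) -> Q x) ->
  forall x, x \in s -> Q x.
Proof.
move=> H x xs; pose M := (\sum_(y <- s) f y)%N.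
have fM y : y \in s -> (f y <= M)%N by move=> ys; rewrite /M (big_rem y) //= leq_addr.
have [m] := ubnP (M - f x); elim: m x xs => // m IH x xs; rewrite ltnS => hm.
apply: H => // y ys lt; apply: IH => //.
by have := fM y ys; lia.
Qed.

Definition PDle d : seq part := flatten [seq PD e | e <- iota 0 d.+1].

Lemma mem_PDle d lam : (lam \in PDle d) = (sumn lam <= d)%N.
Proof.
apply/flatten_mapP/idP => [[e]|h].
  by rewrite mem_iota mem_PD /= add0n ltnS => h /eqP ->.
by exists (sumn lam); rewrite ?mem_PD // mem_iota.
Qed.

Lemma PDle_uniq d : uniq (PDle d).
Proof.
rewrite /PDle; elim: d.+1 0%N => //= m IH e.
rewrite cat_uniq PD_uniq IH andbT /=; apply/hasPn => lam /flatten_mapP[e'].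
rewrite mem_iota => /andP[h _]; rewrite mem_PD => /eqP e1; rewrite mem_PD e1.
by rewrite gtn_eqF.
Qed.

Lemma big_PDle (V : nmodType) d (F : part -> V) :
  \sum_(lam <- PDle d) F lam = \sum_(e < d.+1) \sum_(lam <- PD e) F lam.
Proof.
by rewrite /PDle big_flatten big_map -(big_mkord xpredT (fun e => \sum_(lam <- PD e) F lam)) /index_iota subn0.
Qed.

Section Elementary.
Variable R : realFieldType.

Lemma ee_coef n r (x : 'I_n -> R) : (\prod_i (1 + x i *: 'X))`_r = ee r x.
Proof.
under eq_bigr do rewrite addrC.
rewrite bigA_distr coef_sum /ee [RHS]big_mkcond; apply: eq_bigr => I _.
rewrite -big_mkcond /= scaler_prod prodr_const coefZ coefXn eq_sym.
by case: eqP; rewrite ?mulr1 ?mulr0.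
Qed.

Lemma ee0 n (x : 'I_n -> R) : ee 0 x = 1.
Proof.
rewrite /ee (big_pred1 set0) ?big_set0 // => I; exact: cards_eq0.
Qed.

Lemma ee_full n (x : 'I_n -> R) : ee n x = \prod_i x i.
Proof.
rewrite /ee (big_pred1 setT) => [|I]; first by apply: eq_bigl => i; rewrite inE.
apply/eqP/eqP => [e|->]; last by rewrite cardsT card_ord.
by apply/eqP; rewrite eqEcard subsetT cardsT card_ord e leqnn.
Qed.

Lemma ee_big n r (x : 'I_n -> R) : (n < r)%N -> ee r x = 0.
Proof.
move=> h; rewrite /ee big_pred0 // => I; apply/eqP => e.
by have := max_card (mem I); rewrite e card_ord leqNgt h.
Qed.

Lemma eeZ n r (c : R) (x : 'I_n -> R) : ee r (fun i => c * x i) = c ^+ r * ee r x.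
Proof.
rewrite /ee mulr_sumr; apply: eq_bigr => I /eqP <-.
by rewrite big_split /= prodr_const.
Qed.

Lemma ee_restrict n r (x : 'I_n.+1 -> R) : x ord_max = 0 ->
  ee r x = ee r (fun i : 'I_n => x (widen_ord (leqnSn n) i)).
Proof.
by move=> x0; rewrite -!ee_coef big_ord_recr /= x0 scale0r addr0 mulr1.
Qed.

(** Split each factor 1 + (y_i + h) X as y_i X + (1 + h X): choosing the first part s times leaves
    (1 + h X)^(n - s). *)
Lemma ee_shift n r h : (r <= n)%N -> exists c : nat -> R,
  forall y : 'I_n -> R, ee r (fun i => y i + h) = ee r y + \sum_(s < r) c s * ee s y.
Proof.
move=> rn; exists (fun s => ((1 + h *: 'X : {poly R}) ^+ (n - s))`_(r - s)) => y.
rewrite -ee_coef.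
have -> : \prod_(i < n) (1 + (y i + h) *: 'X) =
    \prod_(i < n) (y i *: 'X + (1 + h *: 'X)) :> {poly R}.
  by apply: eq_bigr => i _; rewrite scalerDl addrCA addrC -addrA.
rewrite bigA_distr coef_sum.
transitivity (\sum_(s < r.+1) ((1 + h *: 'X : {poly R}) ^+ (n - s))`_(r - s) * ee s y).
  under [RHS]eq_bigr do rewrite /ee mulr_sumr big_mkcond /=.
  rewrite [RHS]exchange_big /=; apply: eq_bigr => I _.
  rewrite (bigID (mem I)) /=.
  rewrite (eq_bigr (fun i => y i *: 'X)); last by move=> i ->.
  have -> : \prod_(i < n | i \notin I) (if i \in I then y i *: 'X else 1 + h *: 'X) =
      (1 + h *: 'X) ^+ (n - #|I|) :> {poly R}.
    rewrite (eq_bigr (fun=> 1 + h *: 'X)) => [|i /negbTE -> //].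
    rewrite prodr_const; congr (_ ^+ _).
    have e := cardC (mem I); rewrite card_ord in e.
    apply: (@addnI #|I|); rewrite subnKC; first by rewrite -[RHS]e.
    by rewrite -[X in (_ <= X)%N]e leq_addr.
  rewrite scaler_prod prodr_const -scalerAl coefZ.
  rewrite coefXnM; case: ltnP => h'.
    rewrite mulr0 big1 // => s _; case: eqP => // e.
    by have := ltn_ord s; rewrite ltnS -e leqNgt h'.
  rewrite (bigD1 (Ordinal (h' : (#|I| < r.+1)%N))) //= eqxx [X in _ = _ + X]big1 => [|s /eqP ne].
    by rewrite addr0 mulrC.
  by case: eqP => // e; case: ne; apply/val_inj.
by rewrite big_ord_recr /= subnn -[X in _ + X * _]horner_coef0 hornerE /= !hornerE expr1n mul1r addrC.
Qed.

End Elementary.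

Lemma sum_PDle_widen (R : nzRingType) d d' (s F : part -> R) : (d <= d')%N ->
  (forall rho, s rho != 0 -> (sumn rho <= d)%N) ->
  \sum_(rho <- PDle d) s rho * F rho = \sum_(rho <- PDle d') s rho * F rho.
Proof.
move=> dd Hs; rewrite !big_PDle -!(big_mkord xpredT (fun e => \sum_(rho <- PD e) s rho * F rho)).
rewrite [RHS](@big_cat_nat _ _ _ d.+1) //= [X in _ = _ + X]big_nat_cond [X in _ = _ + X]big1 ?addr0 // => e.
rewrite andbT => /andP[h _]; rewrite big_seq big1 // => rho; rewrite mem_PD => /eqP e'.
case: (eqVneq (s rho) 0) => [->|/Hs]; first by rewrite mul0r.
by rewrite e' leqNgt h.
Qed.

(** * Products of elementary symmetric polynomials and translations of the variables *)

Section ElementaryBasis.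
Variables (R : realFieldType) (n : nat).
Implicit Types (x y : 'I_n -> R) (kap nu rho : part).

(* The product of the e_r over the columns of kap. *)
Definition eb kap x : R :=
  if (size kap <= n)%N then \prod_(r < n) ee r.+1 x ^+ (prow kap r - prow kap r.+1) else 0.

Lemma eb_addcol nu r x : (size nu <= n)%N -> (r <= n)%N ->
  eb (addcol nu r) x = ee r x * eb nu x.
Proof.
move=> sn rn; rewrite /eb size_addcol geq_max sn rn /=.
case: r rn => [|r] rn.
  rewrite ee0 mul1r; apply: eq_bigr => r _; congr (_ ^+ _).
  by rewrite !prow_addcol !addn0.
rewrite (bigD1 (Ordinal rn)) //= [in RHS](bigD1 (Ordinal rn)) //= mulrA.
congr (_ * _).
  rewrite -exprS !prow_addcol ltnSn ltnn addn0; congr (_ ^+ _).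
  by have := @prow_anti nu r r.+1 (leqnSn _); lia.
apply: eq_bigr => j /eqP ne; congr (_ ^+ _); rewrite !prow_addcol.
have {}ne : (j : nat) <> r by move=> e; apply: ne; apply/val_inj.
by case: (ltnP j.+1 r.+1) => h1; case: (ltnP j r.+1) => h2; lia.
Qed.

Lemma eb0 x : eb (mkpart [::]) x = 1.
Proof. by rewrite /eb /= big1 // => i _; rewrite nth_nil expr0. Qed.

Lemma Tri_eb kap : Tri (@mm R n) (eb kap) kap.
Proof.
have [m] := ubnP (sumn kap); elim: m kap => // m IH kap; rewrite ltnS => km.
have [sk|sk] := leqP (size kap) n; last first.
  apply: (eq_Tri (f := mm kap)); last exact: Tri_refl.
  by move=> x; rewrite mm_big // /eb leqNgt sk.
have [->|/addcol_ex[nu [e lt sn]]] := eqVneq kap (mkpart [::]).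
  apply: (eq_Tri (f := mm (mkpart [::]))); last exact: Tri_refl.
  move=> x; rewrite eb0 /mm.
  rewrite (big_pred1 [ffun=> ord0]) => [|al].
    by rewrite /mon big1 // => i _; rewrite ffunE expr0.
  apply/eqP/eqP => [e|->].
    have /esym/eqP : 0%N = \sum_i (al i : nat) by rewrite -sumn_eshape e sumn_mkpart.
    rewrite sum_nat_eq0 => /forallP H.
    by apply/ffunP => i; rewrite ffunE; apply/val_inj/eqP; exact: H.
  apply: sumn0_part; rewrite sumn_eshape big1 // => i _; by rewrite ffunE.
rewrite e; apply: (eq_Tri (f := fun x => ee (size kap) x * eb nu x)).
  by move=> x; rewrite eb_addcol // (leq_trans sn).
by apply: Tri_ee; apply: IH; apply: leq_trans lt km.
Qed.

Definition LowS d (f : ('I_n -> R) -> R) : Prop := exists s : part -> R,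
  (forall rho, s rho != 0 -> (size rho <= n)%N && (sumn rho < d)%N) /\
  forall y, f y = \sum_(rho <- PDle d) s rho * eb rho y.

Lemma eq_LowS d f g : f =1 g -> LowS d f -> LowS d g.
Proof. by move=> e [s [s1 s2]]; exists s; split=> // y; rewrite -e. Qed.

Lemma LowS_widen d d' f : (d <= d')%N -> LowS d f -> LowS d' f.
Proof.
move=> dd [s [s1 s2]]; exists s; split.
  by move=> rho /s1 /andP[-> h]; apply: leq_trans dd.
move=> y; rewrite s2; apply: sum_PDle_widen => // rho /s1 /andP[_]; exact: ltnW.
Qed.

Lemma LowSD d f g : LowS d f -> LowS d g -> LowS d (fun y => f y + g y).
Proof.
move=> [s [s1 s2]] [s' [s1' s2']]; exists (fun rho => s rho + s' rho); split.
  move=> rho; apply: contra_neqT => h.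
  have -> : s rho = 0 by apply/eqP; apply: contraNT h => /s1.
  by rewrite add0r; apply/eqP; apply: contraNT h => /s1'.
by move=> y; rewrite s2 s2' -big_split; apply: eq_bigr => rho _; rewrite mulrDl.
Qed.

Lemma LowSZ d c f : LowS d f -> LowS d (fun y => c * f y).
Proof.
move=> [s [s1 s2]]; exists (fun rho => c * s rho); split.
  by move=> rho; rewrite mulf_eq0 negb_or => /andP[_ /s1].
by move=> y; rewrite s2 mulr_sumr; apply: eq_bigr => rho _; rewrite mulrA.
Qed.

Lemma LowS0 d : LowS d (fun=> 0).
Proof.
exists (fun=> 0); split=> [rho|y]; first by rewrite eqxx.
by rewrite big1 // => rho _; rewrite mul0r.
Qed.

Lemma LowS_sum d (I : Type) (r : seq I) (f : I -> ('I_n -> R) -> R) :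
  (forall i, LowS d (f i)) -> LowS d (fun y => \sum_(i <- r) f i y).
Proof.
move=> H; elim: r => [|i r IH].
  by apply: (eq_LowS _ (LowS0 d)) => y; rewrite big_nil.
by apply: (eq_LowS _ (LowSD (H i) IH)) => y; rewrite big_cons.
Qed.

Lemma LowS_eb d kap : (size kap <= n)%N -> (sumn kap < d)%N -> LowS d (eb kap).
Proof.
move=> sk kd; exists (fun rho => if rho == kap then 1 else 0); split.
  by move=> rho; case: (eqVneq rho kap) => [->|_]; rewrite ?eqxx ?sk.
move=> y; under eq_bigr do rewrite (fun_if (fun r => r * _)) mul1r mul0r.
by rewrite sum_seq_delta ?PDle_uniq // mem_PDle ltnW.
Qed.

Lemma LowS_ee d r f : (r <= n)%N -> LowS d f -> LowS (d + r) (fun y => ee r y * f y).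
Proof.
move=> rn [s [s1 s2]].
apply: (eq_LowS (f := fun y => \sum_(rho <- PDle d) s rho * (ee r y * eb rho y))).
  by move=> y; rewrite s2 mulr_sumr; apply: eq_bigr => rho _; rewrite mulrCA.
apply: LowS_sum => rho; case: (eqVneq (s rho) 0) => [->|/s1 /andP[h1 h2]].
  by apply: (eq_LowS _ (LowS0 _)) => y; rewrite mul0r.
apply: LowSZ; apply: (eq_LowS (f := eb (addcol rho r))) => [y|]; first by rewrite eb_addcol.
by apply: LowS_eb; rewrite ?size_addcol ?geq_max ?h1 // sumn_addcol ltn_add2r.
Qed.

Lemma eb_shift kap (h : R) : (size kap <= n)%N ->
  LowS (sumn kap) (fun y => eb kap (fun i => y i + h) - eb kap y).
Proof.
have [m] := ubnP (sumn kap); elim: m kap => // m IH kap; rewrite ltnS => km sk.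
have [->|/addcol_ex[nu [e lt snu]]] := eqVneq kap (mkpart [::]).
  by apply: (eq_LowS _ (LowS0 _)) => y; rewrite !eb0 subrr.
have sn : (size nu <= n)%N := leq_trans snu sk.
have [c Hc] := ee_shift h sk.
have Lnu := IH nu (leq_trans lt km) sn.
set r := size kap in e sk Hc *.
rewrite [in LowS _]e sumn_addcol.
apply: (eq_LowS (f := fun y =>
   ee r y * (eb nu (fun i => y i + h) - eb nu y) +
   \sum_(s <- enum 'I_r) c s * (ee s y * (eb nu (fun i => y i + h) - eb nu y) + ee s y * eb nu y))).
  move=> y; rewrite e !eb_addcol // Hc big_enum /= mulrDl mulrBr -!addrA; congr (_ + _).
  rewrite addrC; congr (_ + _); rewrite mulr_suml.
  by apply: eq_bigr => s _; rewrite -mulrDr subrK mulrA.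
apply: LowSD; first exact: LowS_ee.
apply: LowS_sum => s; apply: LowSZ; have sr := ltn_ord s.
have sn' : (s <= n)%N := leq_trans (ltnW sr) sk.
apply: LowSD.
  by apply: LowS_widen (LowS_ee sn' Lnu); rewrite leq_add2l ltnW.
apply: (eq_LowS (f := eb (addcol nu s))) => [y|]; first by rewrite eb_addcol.
by apply: LowS_eb; rewrite ?size_addcol ?geq_max ?sn // sumn_addcol ltn_add2l.
Qed.

(** A translation changes [eb kap] by terms of lower degree only, and these are all allowed in K. So
    coordinates supported on K stay there, and the change of coordinates, unitriangular for the
    degree, is injective. *)
Lemma eb_change (K : part -> Prop) d (a : part -> R) (h : R) :
  (forall kap, (size kap <= n)%N -> (sumn kap < d)%N -> K kap) ->
  (forall kap, a kap != 0 -> [/\ K kap, (size kap <= n)%N & (sumn kap <= d)%N]) ->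
  exists a' : part -> R,
  [/\ (forall kap, a' kap != 0 -> [/\ K kap, (size kap <= n)%N & (sumn kap <= d)%N]),
      ((forall kap, a' kap = 0) -> forall kap, a kap = 0) &
      forall y, \sum_(kap <- PDle d) a kap * eb kap (fun i => y i + h) =
                \sum_(kap <- PDle d) a' kap * eb kap y].
Proof.
move=> K1 K2.
have /choice[s Hs] : forall kap, exists s : part -> R, a kap != 0 ->
    [/\ s kap = 1, (forall rho, s rho != 0 -> rho != kap ->
         (size rho <= n)%N && (sumn rho < sumn kap)%N)
      & forall y, eb kap (fun i => y i + h) = \sum_(rho <- PDle d) s rho * eb rho y].
  move=> kap; case: (eqVneq (a kap) 0) => [_|/K2[_ sk kd]]; first by exists (fun=> 0).
  have [s [s1 s2]] := eb_shift h sk.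
  exists (fun rho => (rho == kap)%:R + s rho) => _; split.
  - by rewrite eqxx; case: (eqVneq (s kap) 0) => [->|/s1]; rewrite ?addr0 // ltnn andbF.
  - by move=> rho; case: (eqVneq rho kap) => // _; rewrite /= add0r => /s1.
  - move=> y; under eq_bigr do rewrite mulrDl mulr_natl mulrb.
    rewrite big_split /= sum_seq_delta ?PDle_uniq // mem_PDle kd.
    have <- : \sum_(rho <- PDle (sumn kap)) s rho * eb rho y = \sum_(rho <- PDle d) s rho * eb rho y.
      by apply: sum_PDle_widen => // rho /s1 /andP[_]; exact: ltnW.
    by rewrite -s2 addrC subrK.
exists (fun rho => \sum_(kap <- PDle d) a kap * s kap rho); split.
- move=> rho; apply: contra_neqP => nK; rewrite big1 // => kap _.
  case: (eqVneq (a kap) 0) => [->|ak]; first by rewrite mul0r.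
  have [s1 s2 _] := Hs kap ak; have [k1 k2 k3] := K2 kap ak.
  case: (eqVneq (s kap rho) 0) => [->|/s2 h']; first by rewrite mulr0.
  case: nK; case: (eqVneq rho kap) => [-> //|/h' /andP[h1 h2]].
  have h3 := leq_trans h2 k3; split; rewrite ?(ltnW h3) //; exact: K1.
- move=> H kap; case: (eqVneq (a kap) 0) => // ak0; have [_ _ kd] := K2 kap ak0.
  have kP : kap \in PDle d by rewrite mem_PDle.
  move: kap kP {ak0 kd}.
  apply: (seq_max_ind (f := fun kap : part => sumn kap)) => kap kP IH.
  apply/eqP/contraT => ak; have := H kap.
  rewrite (bigD1_seq kap) ?PDle_uniq //=; have [-> _ _] := Hs kap ak.
  rewrite mulr1 big_seq_cond big1 ?addr0 => [e|rho /andP[rP ne]]; first by rewrite e eqxx in ak.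
  case: (eqVneq (a rho) 0) => [->|ar]; first by rewrite mul0r.
  have [_ s2 _] := Hs rho ar.
  case: (eqVneq (s rho kap) 0) => [->|/s2 h']; first by rewrite mulr0.
  have /h' /andP[_ lt] : kap != rho by rewrite eq_sym.
  by rewrite (IH rho rP lt) eqxx in ar.
- move=> y; under [RHS]eq_bigr do rewrite mulr_suml.
  rewrite [RHS]exchange_big /=; apply: eq_bigr => kap _.
  case: (eqVneq (a kap) 0) => [->|ak].
    by rewrite mul0r big1 // => rho _; rewrite !mul0r.
  have [_ _ ->] := Hs kap ak; rewrite mulr_sumr.
  by apply: eq_bigr => rho _; rewrite mulrA.
Qed.

End ElementaryBasis.

Section Interpolation.
Variables (R : realFieldType) (q t : R).
Implicit Types kap mu rho : part.
Hypotheses (q0 : 0 < q) (q1 : q < 1) (t0 : 0 < t) (t1 : t < 1).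

Definition pt n (kap : part) : 'I_n -> R := fun i => q ^+ prow kap i * t ^+ (n.-1 - i).

Lemma eb_restrict n kap (x : 'I_n.+1 -> R) : x ord_max = 0 ->
  eb kap x = if (size kap <= n)%N then eb kap (fun i : 'I_n => x (widen_ord (leqnSn n) i)) else 0.
Proof.
move=> x0; rewrite /eb; case: (leqP (size kap) n) => sk.
  rewrite (leq_trans sk) // big_ord_recr /= nth_default // sub0n expr0 mulr1.
  by apply: eq_bigr => r _; rewrite ee_restrict.
case: leqP => // sk'.
rewrite big_ord_recr /= ee_full (bigD1 ord_max) //= x0 mul0r expr0n.
rewrite (_ : prow kap n.+1 = 0)%N ?subn0; last by rewrite nth_default.
by rewrite gtn_eqF ?mulr0 // prow_gt0.
Qed.

Lemma pt_widen n kap (i : 'I_n) :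
  pt kap (widen_ord (leqnSn n) i : 'I_n.+1) = t * @pt n kap i.
Proof.
rewrite /pt /= mulrCA -exprS; congr (_ * _ ^+ _).
by have := ltn_ord i; lia.
Qed.

Lemma pt_addcol n kap (i : 'I_n) : pt (addcol kap n) i = q * pt kap i.
Proof. by rewrite /pt prow_addcol ltn_ord addn1 exprS mulrA. Qed.

Lemma pt_gt0 n kap (i : 'I_n) : 0 < pt kap i.
Proof. by rewrite mulr_gt0 ?exprn_gt0. Qed.

Lemma pt_le1 n kap (i : 'I_n) : pt kap i <= 1.
Proof. by rewrite mulr_ile1 ?exprn_ge0 ?exprn_ile1 // ltW. Qed.

(* The points [c u_k], [k] in [K], separate the symmetric polynomials spanned by
   the [e_k(x - b)], [k] in [K]. Moving [b] to [c] and setting x_n = c kills the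
   [k] of length [n]; the other coefficients vanish by induction on [n], and
   dividing by e_n(x - c) lowers the degree. *)
Lemma eb_separated n d (K : part -> Prop) (a : part -> R) (c b : R) : c != 0 ->
  (forall kap, (size kap <= n)%N -> (sumn kap < d)%N -> K kap) ->
  (forall kap, a kap != 0 -> [/\ K kap, (size kap <= n)%N & (sumn kap <= d)%N]) ->
  (forall kap, K kap -> (size kap <= n)%N -> (sumn kap <= d)%N ->
     \sum_(rho <- PDle d) a rho * eb rho (fun i : 'I_n => c * pt kap i - b) = 0) ->
  forall kap, a kap = 0.
Proof.
elim: n d K a c b => [|n IHn] d K a c b c0 K1 K2 H.
  move=> kap; apply/eqP/contraT => ak; have [k1 k2 k3] := K2 kap ak.
  have e0 rho : (size rho <= 0)%N -> rho = mkpart [::].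
    by rewrite leqn0 => /eqP/size0nil h; apply/val_inj.
  have := H kap k1 k2 k3; rewrite (bigD1_seq kap) ?PDle_uniq ?mem_PDle //=.
  rewrite big1 ?addr0 => [|rho ne]; last first.
    case: (eqVneq (a rho) 0) => [->|/K2[_ /e0 h _]]; first by rewrite mul0r.
    by rewrite h (e0 kap k2) eqxx in ne.
  by rewrite (e0 kap k2) eb0 mulr1 => e; rewrite (e0 kap k2) e eqxx in ak.
have [m] := ubnP d; elim: m d K a c b c0 K1 K2 H => // m IHm d K a c b c0 K1 K2 H.
rewrite ltnS => dm.
have [a' [K2' aa' Ha']] := eb_change (c - b) K1 K2.
apply: aa'.
have H' kap : K kap -> (size kap <= n.+1)%N -> (sumn kap <= d)%N ->
    \sum_(rho <- PDle d) a' rho * eb rho (fun i : 'I_n.+1 => c * pt kap i - c) = 0.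
  move=> k1 k2 k3; rewrite -Ha' -[RHS](H kap k1 k2 k3); apply: eq_bigr => rho _.
  by congr (_ * eb _ _); apply/funext => i; rewrite addrA subrK.
have small kap : (size kap <= n)%N -> a' kap = 0.
  move=> sk; pose a2 rho := if (size rho <= n)%N then a' rho else 0.
  suff : a2 kap = 0 by rewrite /a2 sk.
  apply: (IHn d K a2 (c * t) c) => {kap sk}.
  - by rewrite mulf_neq0 // gt_eqF.
  - by move=> kap sk; apply: K1; apply: leqW.
  - by move=> kap; rewrite /a2; case: ifP => sk; rewrite ?eqxx // => /K2'[h1 _ h3].
  move=> kap k1 k2 k3; rewrite -[RHS](H' kap k1 (leqW k2) k3); apply: eq_bigr => rho _.
  rewrite /a2 eb_restrict; last first.
    by rewrite /pt /= nth_default // expr0 subnn expr0 !mulr1 subrr.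
  case: ifP => _; last by rewrite mul0r mulr0.
  by congr (_ * eb _ _); apply/funext => i; rewrite pt_widen mulrA.
(* Every remaining kap has n + 1 rows, hence a full column; removing it lowers the degree by n + 1
   and replaces c by c q in the points. *)
move=> kap; apply/eqP/contraT => ak; have [k1 k2 k3] := K2' kap ak.
have big rho : a' rho != 0 -> size rho = n.+1.
  move=> ar; have [_ h _] := K2' rho ar; apply/eqP; rewrite eqn_leq h ltnNge.
  by apply: contraNN ar => /small ->.
have nd : (n.+1 <= d)%N by rewrite -(big kap ak) (leq_trans (size_le_sumn _)).
have [|nu [e _ _]] := @addcol_ex kap.
  by apply: contraNneq ak => e; apply/eqP/small; rewrite e.
rewrite (big kap ak) in e.
suff : a' (addcol nu n.+1) = 0 by rewrite -e => h; rewrite h eqxx in ak.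
apply: (IHm (d - n.+1)%N (fun kap => K (addcol kap n.+1)) (fun kap => a' (addcol kap n.+1))
          (c * q) c).
- by rewrite mulf_neq0 // gt_eqF.
- move=> rho h1 h2; apply: K1; first by rewrite size_addcol geq_max h1 leqnn.
  by rewrite sumn_addcol; lia.
- move=> rho /K2'[h1 h2 h3]; split=> //; last by rewrite sumn_addcol in h3; lia.
  by move: h2; rewrite size_addcol geq_max => /andP[].
- move=> rho h1 h2 h3.
  have := H' (addcol rho n.+1) h1; rewrite size_addcol geq_max h2 leqnn sumn_addcol.
  have -> : (sumn rho + n.+1 <= d)%N by lia.
  move=> /(_ isT isT).
  have -> : (fun i : 'I_n.+1 => c * pt (addcol rho n.+1) i - c) = (fun i => c * q * pt rho i - c).
    by apply/funext => i; rewrite pt_addcol mulrA.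
  set y := (fun i : 'I_n.+1 => c * q * pt rho i - c) => H0.
  (* No coordinate c q u - c vanishes, because u <= 1 and q < 1. *)
  have ey : ee n.+1 y != 0.
    rewrite ee_full; apply/prodf_neq0 => i _; rewrite /y -mulrA -{2}[c]mulr1 -mulrBr mulf_neq0 //.
    rewrite subr_eq0 lt_eqF // (le_lt_trans _ q1) // -[leRHS]mulr1 ler_wpM2l ?pt_le1 //.
    exact: ltW.
  suff: ee n.+1 y * \sum_(k <- PDle (d - n.+1)) a' (addcol k n.+1) * eb k y = 0.
    by move/eqP; rewrite mulf_eq0 (negbTE ey) => /eqP.
  rewrite -[RHS]H0 mulr_sumr.
  have addE (nu' : part) : (size nu' <= n.+1)%N -> ee n.+1 y * (a' (addcol nu' n.+1) * eb nu' y) =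
      a' (addcol nu' n.+1) * eb (addcol nu' n.+1) y.
    by move=> h; rewrite eb_addcol // mulrCA.
  transitivity (\sum_(rho <- [seq addcol k n.+1 | k <- PDle (d - n.+1)]) a' rho * eb rho y).
    rewrite big_map; apply: eq_bigr => nu' _; case: (leqP (size nu') n.+1) => [/addE //|h].
    rewrite [eb nu' _]/eb leqNgt h !mulr0 [eb _ _]/eb size_addcol geq_max leqNgt h /=.
    by rewrite mulr0.
  rewrite [RHS](bigID (fun k => k \in [seq addcol k n.+1 | k <- PDle (d - n.+1)])) /=.
  rewrite [X in _ + X]big_seq_cond [X in _ + X]big1 ?addr0; last first.
    move=> k /andP[]; rewrite mem_PDle => kd nk.
    apply/eqP; rewrite mulf_eq0; apply/orP; left; apply: contraNT nk => ak'.
    have [|nu' [e' _ _]] := @addcol_ex k.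
      by apply: contraNneq ak' => e'; apply/eqP/small; rewrite e'.
    rewrite (big k ak') in e'; apply/mapP; exists nu'; rewrite ?mem_PDle //.
    by move: kd; rewrite e' sumn_addcol; lia.
  rewrite -[RHS]big_filter; apply: perm_big; apply: uniq_perm.
  + by rewrite map_inj_uniq ?PDle_uniq //; exact: addcol_inj.
  + by rewrite filter_uniq // PDle_uniq.
  move=> k; rewrite mem_filter; case: mapP => //= -[nu']; rewrite mem_PDle => h ->.
  by rewrite mem_PDle sumn_addcol; apply/esym; lia.
- by lia.
Qed.

(** [K] is closed under passing to dominated partitions, so the coordinates of the combination in
    the basis [eb] are supported on [K] too, and vanish by [eb_separated]. The transition being
    unitriangular, the original coordinates vanish from the top of the dominance order down. *)
Lemma Tri_separated n (P : part -> ('I_n -> R) -> R) mu (a : part -> R) :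
  (forall kap, Tri (@mm R n) (P kap) kap) ->
  let K kap := (sumn kap < sumn mu)%N \/ dominates mu kap in
  (forall kap, a kap != 0 -> K kap /\ (size kap <= n)%N) ->
  (forall kap, K kap -> (size kap <= n)%N ->
     \sum_(rho <- PDle (sumn mu)) a rho * P rho (pt kap) = 0) ->
  forall kap, a kap = 0.
Proof.
move=> HP K K2 H.
have HT kap : Tri (@eb R n) (P kap) kap.
  apply: Tri_trans (HP kap) => rho e; apply: (@Tri_inv _ _ (@mm R n)) e => nu _.
  exact: Tri_eb.
have [w Hw] := choice HT.
pose a' rho := if (size rho <= n)%N then \sum_(kap <- PDle (sumn mu)) a kap * w kap rho else 0.
have Kle kap : K kap -> (sumn kap <= sumn mu)%N.
  by case=> [/ltnW //|/dominates_sumn ->].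
have Ksum kap rho : K kap -> dominates kap rho -> K rho.
  by move=> [h|h] D; [left; rewrite -(dominates_sumn D) | right; exact: dominates_trans D].
have E x : \sum_(rho <- PDle (sumn mu)) a rho * P rho x =
           \sum_(rho <- PDle (sumn mu)) a' rho * eb rho x.
  transitivity (\sum_(rho <- PDle (sumn mu)) (\sum_(kap <- PDle (sumn mu)) a kap * w kap rho) * eb rho x).
    under [RHS]eq_bigr do rewrite mulr_suml.
    rewrite [RHS]exchange_big /=; apply: eq_bigr => kap _.
    case: (eqVneq (a kap) 0) => [->|/K2[/Kle kd _]].
      by rewrite mul0r big1 // => rho _; rewrite !mul0r.
    have [_ w2 ->] := Hw kap; rewrite mulr_sumr.
    transitivity (\sum_(rho <- PDle (sumn mu)) (if rho \in PD (sumn kap) then a kap * (w kap rho * eb rho x) else 0)).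
      rewrite -big_mkcond -big_filter; apply: perm_big; apply: uniq_perm.
      - exact: PD_uniq.
      - by rewrite filter_uniq ?PDle_uniq.
      move=> rho; rewrite mem_PD mem_filter /= mem_PD mem_PDle; case: eqP => //= ->.
      by rewrite kd.
    apply: eq_bigr => rho _; rewrite mem_PD; case: eqP => [_|ne]; first by rewrite mulrA.
    case: (eqVneq (w kap rho) 0) => [->|/w2/dominates_sumn e]; first by rewrite mulr0 mul0r.
    by case: ne.
  by apply: eq_bigr => rho _; rewrite /a'; case: ifP => // sk; rewrite /eb sk !mulr0.
have a'K rho : a' rho != 0 -> [/\ K rho, (size rho <= n)%N & (sumn rho <= sumn mu)%N].
  rewrite /a'; case: ifP => [sr|_]; last by rewrite eqxx.
  apply: contra_neqP => nK; rewrite big1 // => kap _.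
  case: (eqVneq (a kap) 0) => [->|/K2[h1 h2]]; first by rewrite mul0r.
  case: (eqVneq (w kap rho) 0) => [->|]; first by rewrite mulr0.
  have [_ w2 _] := Hw kap => /w2 D; case: nK.
  have Kr := Ksum _ _ h1 D; split=> //; exact: Kle.
have a'0 : forall kap, a' kap = 0.
  apply: (@eb_separated n (sumn mu) K a' 1 0) => //; first exact: oner_neq0.
    by move=> kap _ h; left.
  move=> kap h1 h2 h3; rewrite -[RHS](H kap h1 h2) E; apply: eq_bigr => rho _.
  by congr (_ * eb _ _); apply/funext => i; rewrite mul1r subr0.
move=> kap; case: (eqVneq (a kap) 0) => // /K2[/Kle kd _].
have kP : kap \in PDle (sumn mu) by rewrite mem_PDle.
move: kap kP {kd}; apply: (seq_max_ind (f := dom_rank)) => kap kP IH.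
apply/eqP/contraT => ak; have [Kk sk] := K2 kap ak.
have := a'0 kap; rewrite /a' sk (bigD1_seq kap) ?PDle_uniq //=.
have [-> _ _] := Hw kap; rewrite mulr1 big_seq_cond big1 ?addr0 => [e|rho /andP[rP ne]].
  by rewrite e eqxx in ak.
case: (eqVneq (w rho kap) 0) => [->|]; first by rewrite mulr0.
have [_ w2 _] := Hw rho => /w2 D.
by rewrite (IH rho rP) ?mul0r //; apply: (dom_rank_lt D); apply/eqP.
Qed.

End Interpolation.

(** * Power sums and the Cauchy kernel *)

(** A right inverse of a square matrix is a left inverse; the rows and columns are indexed by the
    entries of [s]. *)
Lemma seq_inverse (R : comNzRingType) (T : eqType) (s : seq T) (A B : T -> T -> R) :
  uniq s ->
  (forall i j, i \in s -> j \in s -> \sum_(k <- s) A i k * B j k = (i == j)%:R) ->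
  forall i j, i \in s -> j \in s -> \sum_(k <- s) A k i * B k j = (i == j)%:R.
Proof.
move=> us H; pose m := size s; pose f (i : 'I_m) := tnth (in_tuple s) i.
have fin i : f i \in s by exact: mem_tnth.
have finj i j : (f i == f j) = (i == j).
  apply/eqP/eqP => [|-> //]; rewrite /f !(tnth_nth (f i)) /= => /eqP.
  by rewrite nth_uniq // => /eqP /val_inj.
pose MA := \matrix_(i < m, j < m) A (f i) (f j).
pose MB := \matrix_(i < m, j < m) B (f j) (f i).
have E1 : MA *m MB = 1%:M.
  apply/matrixP => i j; rewrite !mxE -finj -(H _ _ (fin i) (fin j)).
  by rewrite (big_tnth _ _ s); apply: eq_bigr => k _; rewrite !mxE.
have /matrixP E2 := mulmx1C E1.
move=> i j /(tnthP (in_tuple s))[i' ->] /(tnthP (in_tuple s))[j' ->].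
have := E2 j' i'; rewrite !mxE -/(f i') -/(f j') finj eq_sym => <-.
by rewrite (big_tnth _ _ s); apply: eq_bigr => k _; rewrite !mxE mulrC.
Qed.

Section PowerSums.
Variable R : realFieldType.
Implicit Types (pi : nat -> R) (lam mu nu be ga : part).

Definition pm be pi : R := \prod_(r <- (be : seq nat)) pi r.
Definition px n (x : 'I_n -> R) : nat -> R := fun r => \sum_i x i ^+ r.

Definition ins r ga : part := mkpart (r :: (ga : seq nat)).

Lemma perm_ins r ga : (0 < r)%N -> perm_eq (ins r ga) (r :: (ga : seq nat)).
Proof.
move=> r0; rewrite (perm_trans (perm_mkpart _)) //= r0 perm_cons.
rewrite (all_filterP _) //; apply/allP => x xg; rewrite lt0n.
by apply: contraNneq (part_neq0 ga) => <-.
Qed.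

Lemma pm_perm be (s : seq nat) pi : perm_eq be s -> pm be pi = \prod_(r <- s) pi r.
Proof. by move=> p; rewrite /pm (perm_big _ p). Qed.

Lemma pm_ins r ga pi : (0 < r)%N -> pm (ins r ga) pi = pi r * pm ga pi.
Proof. by move=> r0; rewrite (pm_perm _ (perm_ins ga r0)) big_cons. Qed.

Lemma sumn_ins r ga : sumn (ins r ga) = (r + sumn ga)%N.
Proof. exact: sumn_mkpart. Qed.

Lemma part_perm lam mu : perm_eq lam mu -> lam = mu.
Proof. by move=> p; rewrite -(mkpart_id lam) -(mkpart_id mu) (mkpart_perm p). Qed.

Lemma perm_mkpart0 (s : seq nat) : 0%N \notin s -> perm_eq (mkpart s) s.
Proof.
move=> h; rewrite (permPl (perm_mkpart _)) (all_filterP _) //.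
by apply/allP => x xs; rewrite lt0n; apply: contraNneq h => <-.
Qed.

Lemma ins_inj r : (0 < r)%N -> injective (ins r).
Proof.
move=> r0 ga ga' e; have := perm_ins ga' r0; rewrite -e.
by rewrite (permPl (perm_ins ga r0)) perm_cons => /part_perm.
Qed.

Lemma ins_rem r be : r \in (be : seq nat) -> be = ins r (mkpart (rem r be)).
Proof.
move=> rb; have r0 : (0 < r)%N.
  by rewrite lt0n; apply: contraNneq (part_neq0 be) => <-.
apply: part_perm; rewrite (permPl (perm_to_rem rb)) perm_sym.
rewrite (permPl (perm_ins _ r0)) perm_cons perm_mkpart0 //.
by apply: contra (part_neq0 be) => /mem_rem.
Qed.

Lemma part_le be r : r \in (be : seq nat) -> (0 < r <= sumn be)%N.
Proof.
move=> rb; apply/andP; split; last by rewrite sumnE (big_rem r) //= leq_addr.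
by rewrite lt0n; apply: contraNneq (part_neq0 be) => <-.
Qed.

Lemma sumn_count be : sumn be = (\sum_(r < (sumn be).+1) r * count_mem (r : nat) be)%N.
Proof.
rewrite {1}sumnE.
transitivity (\sum_(x <- (be : seq nat)) \sum_(r < (sumn be).+1) (if x == r then r : nat else 0))%N.
  rewrite big_seq [RHS]big_seq; apply: eq_bigr => x /part_le /andP[_ xd].
  rewrite (bigD1 (Ordinal (xd : (x < (sumn be).+1)%N))) //= eqxx big1 ?addn0 // => r /eqP ne.
  by case: eqP => // e; case: ne; apply/val_inj.
rewrite exchange_big /=; apply: eq_bigr => r _.
by rewrite -big_mkcond /= -sum1_count big_distrr /=; apply: eq_bigr => x _; rewrite muln1.
Qed.

Variables (q t : R).
Hypotheses (q0 : 0 < q) (q1 : q < 1) (t0 : 0 < t) (t1 : t < 1).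

Definition zz be : R :=
  \prod_(r <- undup be) (r ^ count_mem r be * (count_mem r be)`!)%:R
  * \prod_(r <- (be : seq nat)) ((1 - q ^+ r) / (1 - t ^+ r)).

Lemma subX_gt0 (a : R) r : 0 < a -> a < 1 -> (0 < r)%N -> 0 < 1 - a ^+ r.
Proof. by move=> a0 a1 r0; rewrite subr_gt0 exprn_ilt1 ?ltW // -?lt0n // -lt0n. Qed.

Lemma zz_gt0 be : 0 < zz be.
Proof.
rewrite /zz mulr_gt0 //; rewrite big_seq prodr_gt0 // => r.
  rewrite mem_undup => /part_le /andP[r0 _].
  by rewrite ltr0n muln_gt0 expn_gt0 r0 fact_gt0.
by move=> /part_le /andP[r0 _]; rewrite divr_gt0 ?subX_gt0.
Qed.

Lemma prod_undup (s : seq nat) (F : nat -> nat -> R) N :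
  (forall r, F r 0%N = 1) -> (forall x, x \in s -> (x < N)%N) ->
  \prod_(r <- undup s) F r (count_mem r s) = \prod_(r < N) F r (count_mem (r : nat) s).
Proof.
move=> F0 sN; rewrite -(big_mkord xpredT (fun r => F r (count_mem r s))).
rewrite [RHS](bigID (mem s)) /= [X in _ = _ * X]big1 ?mulr1 => [|r nr]; last first.
  by rewrite (count_memPn nr) F0.
rewrite -[RHS]big_filter; apply: perm_big; apply: uniq_perm.
- exact: undup_uniq.
- by rewrite filter_uniq ?iota_uniq.
move=> r; rewrite mem_undup mem_filter mem_iota subn0 add0n /=.
by case rs: (r \in s) => //=; rewrite sN.
Qed.

Lemma zz_ins r ga : (0 < r)%N ->
  zz (ins r ga) = (r * (count_mem r ga).+1)%:R * ((1 - q ^+ r) / (1 - t ^+ r)) * zz ga.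
Proof.
move=> r0; have p := perm_ins ga r0; rewrite /zz (perm_big _ p) big_cons.
pose F r m : R := (r ^ m * m`!)%:R; pose N := (r + sumn ga).+1.
pose cnt k := count_mem k (ins r ga).
have cntE k : cnt k = ((r == k) + count_mem k ga)%N by rewrite /cnt (seq.permP p).
have F0 k : F k 0%N = 1 by rewrite /F expn0 fact0.
have rN : (r < N)%N by rewrite ltnS leq_addr.
have -> : \prod_(k <- undup (ins r ga)) (k ^ count_mem k (ins r ga) * (count_mem k (ins r ga))`!)%:R =
    \prod_(k < N) F k (cnt k).
  rewrite (@prod_undup _ F N) // => x xi.
  by rewrite ltnS -sumn_ins; case/andP: (@part_le (ins r ga) x xi).
have -> : \prod_(k <- undup ga) (k ^ count_mem k ga * (count_mem k ga)`!)%:R =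
    \prod_(k < N) F k (count_mem (k : nat) ga).
  rewrite (@prod_undup _ F N) // => x /part_le/andP[_ h].
  by rewrite ltnS (leq_trans h) // leq_addl.
rewrite (bigD1 (Ordinal rN)) //= [in RHS](bigD1 (Ordinal rN)) //=.
rewrite [X in _ * X * _ = _](eq_bigr (fun k : 'I_N => F k (count_mem (k : nat) ga))); last first.
  move=> k /eqP ne; rewrite cntE; case: eqP => // e.
  by case: ne; apply/val_inj.
have -> : F r (cnt r) = (r * (count_mem r ga).+1)%:R * F r (count_mem r ga).
  by rewrite cntE eqxx add1n /F expnS factS -natrM; congr (_%:R); ring.
by ring.
Qed.

Definition Kd d pi pi' : R := \sum_(be <- PD d) pm be pi * pm be pi' / zz be.
Definition Ker pi pi' : ps R := Ps (fun d => Kd d pi pi').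
Definition qt k : R := (1 - t ^+ k) / (1 - q ^+ k).
(** The kernel is exp(sum_k qt_k p_k p'_k z^k / k); this is z d/dz of the exponent. *)
Definition logK pi pi' : ps R :=
  Ps (fun k => if k == 0%N then 0 else qt k * pi k * pi' k).

Lemma big_PD_ins r d (F : part -> R) : (0 < r <= d)%N ->
  \sum_(be <- PD d | r \in (be : seq nat)) F be = \sum_(ga <- PD (d - r)%N) F (ins r ga).
Proof.
move=> /andP[r0 rd]; rewrite -(big_map (ins r) xpredT F) -[LHS]big_filter; apply: perm_big.
apply: uniq_perm.
- by rewrite filter_uniq ?PD_uniq.
- by rewrite map_inj_uniq ?PD_uniq //; exact: ins_inj.
move=> be; rewrite mem_filter mem_PD /=; apply/andP/mapP => [[rb /eqP e]|[ga]].
  exists (mkpart (rem r be)); last exact: ins_rem.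
  by rewrite mem_PD -(eqn_add2l r) -sumn_ins -ins_rem // e subnKC.
rewrite mem_PD => /eqP e ->; rewrite sumn_ins e subnKC // eqxx; split=> //.
by rewrite (perm_mem (perm_ins ga r0)) mem_head.
Qed.

(** Write |be| = sum_r r m_r(be), with m_r the multiplicity of r, and remove one part r from be: the
    factor r m_r cancels against the quotient of the two values of [zz]. *)
Lemma euler_Ker pi pi' : euler (Ker pi pi') = logK pi pi' * Ker pi pi'.
Proof.
apply: psP => d; rewrite coM /= mulr_sumr.
transitivity (\sum_(be <- PD d) \sum_(r < d.+1)
    (r * count_mem (r : nat) be)%:R * (pm be pi * pm be pi' / zz be)).
  rewrite big_seq [RHS]big_seq; apply: eq_bigr => be; rewrite mem_PD => /eqP e.
  by rewrite -mulr_suml -natr_sum -{1}e {1}(sumn_count be) e.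
rewrite exchange_big /=; apply: eq_bigr => -[r rd] _ /=.
case: (posnP r) => [->|r0] /=.
  by rewrite mul0r big1 // => be _; rewrite mul0n mul0r.
rewrite (bigID (fun be : part => r \in (be : seq nat))) /= [X in _ + X]big1 ?addr0; last first.
  by move=> be /count_memPn ->; rewrite muln0 mul0r.
rewrite big_PD_ins; last by rewrite r0.
rewrite /Kd mulr_sumr; apply: eq_bigr => ga _.
rewrite !pm_ins // zz_ins // (seq.permP (perm_ins ga r0)) /= eqxx add1n /qt.
have z0 : zz ga != 0 by rewrite gt_eqF ?zz_gt0.
have a0 : 1 - q ^+ r != 0 by rewrite gt_eqF ?subX_gt0.
have b0 : 1 - t ^+ r != 0 by rewrite gt_eqF ?subX_gt0.
have c0 : (r * (count_mem r ga).+1)%:R != 0 :> R by rewrite pnatr_eq0 muln_eq0 gtn_eqF.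
move: c0; set c := (_ * _)%:R; clearbody c => c0.
by field; rewrite z0 a0 b0 c0.
Qed.

Lemma Ker0 pi pi' : co (Ker pi pi') 0 = 1.
Proof.
rewrite /= /Kd PD0 big_seq1 /pm /zz (_ : parts (mkpart [::]) = [::]) //.
by rewrite [undup _]/= !big_nil !mul1r invr1.
Qed.

Lemma logK0 pi pi' : co (logK pi pi') 0 = 0. Proof. by []. Qed.

Lemma KerD pi pi1 pi' : Ker (fun r => pi r + pi1 r) pi' = Ker pi pi' * Ker pi1 pi'.
Proof.
apply: (@ode_uniq _ (logK (fun r => pi r + pi1 r) pi')) => //.
- by rewrite coM0 !Ker0 mulr1.
- exact: euler_Ker.
rewrite (euler_odeM (euler_Ker _ _) (euler_Ker _ _)); congr (_ * _).
by apply: psP => d; rewrite coD /=; case: eqP; rewrite ?addr0 // => _; ring.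
Qed.

(** Polynomials in p_1, p_2, ..., homogeneous of degree d when p_r has degree r. By [wpoly_dense]
    such a function vanishes once it vanishes on the power sums of d variables. *)
Definition wpoly d (f : (nat -> R) -> R) : Prop :=
  exists c : part -> R, forall pi, f pi = \sum_(be <- PD d) c be * pm be pi.

Lemma eq_wpoly d f g : f =1 g -> wpoly d f -> wpoly d g.
Proof. by move=> e [c H]; exists c => pi; rewrite -e. Qed.

Lemma wpoly_pm be : wpoly (sumn be) (pm be).
Proof.
exists (fun ga => if ga == be then 1 else 0) => pi.
under eq_bigr do rewrite (fun_if (fun r => r * _)) mul1r mul0r.
by rewrite sum_seq_delta ?PD_uniq // mem_PD eqxx.
Qed.

Lemma wpoly0 d : wpoly d (fun=> 0).
Proof. by exists (fun=> 0) => pi; rewrite big1 // => be _; rewrite mul0r. Qed.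

Lemma wpolyD d f g : wpoly d f -> wpoly d g -> wpoly d (fun pi => f pi + g pi).
Proof.
move=> [c Hc] [e He]; exists (fun be => c be + e be) => pi.
by rewrite Hc He -big_split; apply: eq_bigr => be _; rewrite mulrDl.
Qed.

Lemma wpolyZ d a f : wpoly d f -> wpoly d (fun pi => a * f pi).
Proof.
move=> [c Hc]; exists (fun be => a * c be) => pi.
by rewrite Hc mulr_sumr; apply: eq_bigr => be _; rewrite mulrA.
Qed.

Lemma wpoly_sum d (I : Type) (r : seq I) (P : pred I) (f : I -> (nat -> R) -> R) :
  (forall i, P i -> wpoly d (f i)) -> wpoly d (fun pi => \sum_(i <- r | P i) f i pi).
Proof.
move=> H; elim: r => [|i r IH].
  by apply: (eq_wpoly _ (wpoly0 d)) => pi; rewrite big_nil.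
case Pi: (P i); last by apply: (eq_wpoly _ IH) => pi; rewrite big_cons Pi.
by apply: (eq_wpoly _ (wpolyD (H i Pi) IH)) => pi; rewrite big_cons Pi.
Qed.

Lemma wpoly_sum_seq d (I : eqType) (r : seq I) (f : I -> (nat -> R) -> R) :
  (forall i, i \in r -> wpoly d (f i)) -> wpoly d (fun pi => \sum_(i <- r) f i pi).
Proof.
move=> H; apply: (eq_wpoly (f := fun pi => \sum_(i <- r | i \in r) f i pi)).
  by move=> pi; rewrite [RHS]big_seq.
exact: wpoly_sum.
Qed.

Definition cup be ga : part := mkpart ((be : seq nat) ++ (ga : seq nat)).
Lemma pm_cup be ga pi : pm (cup be ga) pi = pm be pi * pm ga pi.
Proof.
rewrite /pm -big_cat; apply: perm_big; apply: perm_mkpart0.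
by rewrite mem_cat negb_or !part_neq0.
Qed.
Lemma sumn_cup be ga : sumn (cup be ga) = (sumn be + sumn ga)%N.
Proof. by rewrite sumn_mkpart sumn_cat. Qed.

Lemma wpolyM d e f g : wpoly d f -> wpoly e g -> wpoly (d + e)%N (fun pi => f pi * g pi).
Proof.
move=> [c Hc] [c' Hc'].
apply: (eq_wpoly (f := fun pi => \sum_(be <- PD d) \sum_(ga <- PD e) (c be * c' ga) * pm (cup be ga) pi)).
  move=> pi; rewrite Hc Hc' mulr_suml; apply: eq_bigr => be _.
  by rewrite mulr_sumr; apply: eq_bigr => ga _; rewrite pm_cup; ring.
apply: wpoly_sum_seq => be; rewrite mem_PD => /eqP bd.
apply: wpoly_sum_seq => ga; rewrite mem_PD => /eqP ge.
by apply: wpolyZ; rewrite -bd -ge -sumn_cup; exact: wpoly_pm.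
Qed.

Lemma wpoly_coord k : (0 < k)%N -> wpoly k (fun pi => pi k).
Proof.
move=> k0; have e : sumn (mkpart [:: k]) = k by rewrite sumn_mkpart /= addn0.
have := wpoly_pm (mkpart [:: k]); rewrite e; apply: eq_wpoly => pi.
rewrite (pm_perm _ (perm_mkpart0 _)) ?big_seq1 // inE eq_sym -lt0n //.
Qed.

Lemma wpoly1 : wpoly 0 (fun=> 1).
Proof.
have := wpoly_pm (mkpart [::]); rewrite sumn_mkpart; apply: eq_wpoly => pi.
by rewrite /pm /= big_nil.
Qed.

Lemma wpoly_scale d f (s : nat -> R) : wpoly d f -> wpoly d (fun pi => f (fun r => s r * pi r)).
Proof.
move=> [c Hc]; exists (fun be => c be * pm be s) => pi.
by rewrite Hc; apply: eq_bigr => be _; rewrite /pm big_split /=; ring.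
Qed.

End PowerSums.

(* A family with the two defining properties of the Macdonald functions, given by
   its coordinates in the basis of the p_be. *)
Record macdata (R : realFieldType) (q t : R) (c : part -> part -> R) (N : part -> R) : Prop := MacData {
  mac_N0 : forall lam, N lam != 0;
  mac_orth : forall lam mu : part, sumn lam = sumn mu ->
    \sum_(be <- PD (sumn lam)) c lam be * c mu be * zz q t be = (lam == mu)%:R * N lam;
  mac_tri : forall n (lam : part), Tri (@mm R n)
    (fun x => \sum_(be <- PD (sumn lam)) c lam be * pm be (px x)) lam }.

Section MacFunctions.
Variables (R : realFieldType) (q t : R).
Hypotheses (q0 : 0 < q) (q1 : q < 1) (t0 : 0 < t) (t1 : t < 1).
Variables (c : part -> part -> R) (N : part -> R).
Hypothesis H : macdata q t c N.
Implicit Types (pi : nat -> R) (lam mu nu be ga : part).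

(* [pi] is the sequence of the values of p_1, p_2, ..., which are independent variables. *)
Definition Pf lam pi : R := \sum_(be <- PD (sumn lam)) c lam be * pm be pi.
Definition Qf lam pi : R := Pf lam pi / N lam.

Lemma wpoly_Pf lam : wpoly (sumn lam) (Pf lam).
Proof. by exists (c lam). Qed.

Lemma Tri_Pf n lam : Tri (@mm R n) (fun x => Pf lam (px x)) lam.
Proof. exact: (mac_tri H). Qed.

Lemma mac_dual d be ga : be \in PD d -> ga \in PD d ->
  \sum_(lam <- PD d) c lam be * (c lam ga * zz q t ga / N lam) = (be == ga)%:R.
Proof.
move: be ga; apply: (@seq_inverse _ _ _ c (fun lam ga => c lam ga * zz q t ga / N lam)).
  exact: PD_uniq.
move=> lam mu; rewrite !mem_PD => /eqP ld /eqP md.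
transitivity ((\sum_(be <- PD d) c lam be * c mu be * zz q t be) / N mu).
  by rewrite mulr_suml; apply: eq_bigr => be _; rewrite !mulrA.
rewrite -ld (mac_orth H) ?ld ?md //; case: eqP => [->|_]; last by rewrite !mul0r.
by rewrite mul1r divff // (mac_N0 H).
Qed.

(** The Cauchy identity: every pair of dual bases gives the same kernel, and the p_be with the p_be
    / zz_be form such a pair. *)
Lemma Ker_Pf d pi pi' : Kd q t d pi pi' = \sum_(lam <- PD d) Pf lam pi * Qf lam pi'.
Proof.
have inv := @mac_dual d.
transitivity (\sum_(be <- PD d) \sum_(ga <- PD d)
    (be == ga)%:R / zz q t ga * (pm be pi * pm ga pi')).
  rewrite /Kd big_seq [RHS]big_seq; apply: eq_bigr => be bd.
  rewrite (bigD1_seq be) ?PD_uniq //= eqxx big1 ?addr0 => [|ga /negbTE ne]; last first.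
    by rewrite eq_sym ne !mul0r.
  by rewrite mul1r mulrC.
transitivity (\sum_(be <- PD d) \sum_(ga <- PD d) \sum_(lam <- PD d)
    c lam be * pm be pi * (c lam ga * pm ga pi' / N lam)).
  rewrite big_seq [RHS]big_seq; apply: eq_bigr => be bd.
  rewrite big_seq [RHS]big_seq; apply: eq_bigr => ga gd.
  rewrite -(inv be ga bd gd) !mulr_suml; apply: eq_bigr => lam _.
  have z0 : zz q t ga != 0 by rewrite gt_eqF ?zz_gt0.
  have n0 := mac_N0 H lam.
  by field; rewrite z0 n0.
under eq_bigr do rewrite exchange_big /=.
rewrite exchange_big /= big_seq [RHS]big_seq; apply: eq_bigr => lam.
rewrite mem_PD => /eqP ld; rewrite /Qf /Pf ld mulr_suml; apply: eq_bigr => be _.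
by rewrite !mulr_suml mulr_sumr.
Qed.

Lemma wpoly_expand d f : wpoly d f ->
  exists a : part -> R, forall pi, f pi = \sum_(lam <- PD d) a lam * Pf lam pi.
Proof.
move=> [e He].
exists (fun lam => \sum_(be <- PD d) e be * zz q t be * c lam be / N lam) => pi.
have inv := @mac_dual d.
transitivity (\sum_(be <- PD d) \sum_(ga <- PD d) (be == ga)%:R * e ga * pm be pi).
  rewrite He big_seq [RHS]big_seq; apply: eq_bigr => be bd.
  rewrite (bigD1_seq be) ?PD_uniq //= eqxx mul1r big1 ?addr0 // => ga /negbTE ne.
  by rewrite eq_sym ne !mul0r.
transitivity (\sum_(be <- PD d) \sum_(ga <- PD d) \sum_(lam <- PD d)
    e ga * zz q t ga * c lam ga / N lam * (c lam be * pm be pi)).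
  rewrite big_seq [RHS]big_seq; apply: eq_bigr => be bd.
  rewrite big_seq [RHS]big_seq; apply: eq_bigr => ga gd.
  rewrite -(inv be ga bd gd) !mulr_suml; apply: eq_bigr => lam _.
  by ring.
rewrite exchange_big /=; under eq_bigr do rewrite exchange_big /=.
rewrite exchange_big /= big_seq [RHS]big_seq; apply: eq_bigr => lam.
rewrite mem_PD => /eqP ld; rewrite /Pf ld mulr_suml; apply: eq_bigr => ga _.
by rewrite mulr_sumr.
Qed.

Lemma dominates_1row d mu : sumn mu = d -> dominates (mkpart [:: d]) mu.
Proof.
move=> e; have sd : sumn (mkpart [:: d]) = d by rewrite sumn_mkpart /= addn0.
split=> [|k]; first by rewrite sd.
case: k => [|k]; first by rewrite !take0.
have -> : sumn (take k.+1 (mkpart [:: d])) = d.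
  rewrite take_oversize ?sd // (leq_trans (size_mkpart _)) //.
by rewrite -e -{2}(cat_take_drop k.+1 mu) sumn_cat leq_addr.
Qed.

(** The one-row partition (d) dominates all partitions of d, so for mu = (d) the set [K] of
    [Tri_separated] contains every partition of size at most d. *)
Lemma Tri_indep n d (P : part -> ('I_n -> R) -> R) (a : part -> R) :
  (forall kap, Tri (@mm R n) (P kap) kap) ->
  (forall mu, \sum_(lam <- PDle d) a lam * P lam (pt q t mu) = 0) ->
  forall lam, (sumn lam <= d)%N -> (size lam <= n)%N -> a lam = 0.
Proof.
move=> HP H0 lam ld ln; have sd : sumn (mkpart [:: d]) = d by rewrite sumn_mkpart /= addn0.
pose a' lam := if (sumn lam <= d)%N && (size lam <= n)%N then a lam else 0.
suff : a' lam = 0 by rewrite /a' ld ln.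
have Pbig (kap : part) x : (n < size kap)%N -> P kap x = 0.
  move=> h; have [u [_ u2 ->]] := HP kap; rewrite big1 // => mu _.
  case: (eqVneq (u mu) 0) => [->|/u2/dominates_size h']; first by rewrite mul0r.
  by rewrite mm_big ?mulr0 // (leq_trans h h').
apply: (Tri_separated q0 q1 t0 t1 (mu := mkpart [:: d]) (P := P)) => // [kap|kap _ _].
  rewrite /a'; case: ifP => [/andP[h1 h2] _|]; last by rewrite eqxx.
  split=> //; move: h1; rewrite leq_eqVlt => /orP[/eqP e|h]; last by left; rewrite sd.
  by right; exact: dominates_1row.
rewrite sd -[RHS](H0 kap) big_seq [RHS]big_seq; apply: eq_bigr => rho.
rewrite mem_PDle /a' => ->; case: leqP => //= h.
by rewrite Pbig ?mulr0 ?mul0r.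
Qed.

Lemma Pf_indep d (a : part -> R) :
  (forall x : 'I_d -> R, \sum_(lam <- PDle d) a lam * Pf lam (px x) = 0) ->
  forall lam, (sumn lam <= d)%N -> a lam = 0.
Proof.
move=> H0 lam ld; apply: (@Tri_indep d d (fun lam x => Pf lam (px x)) a) => //.
- exact: Tri_Pf.
- by rewrite (leq_trans (size_le_sumn _)).
Qed.

Lemma sum_PD_PDle (V : nmodType) d (F : part -> V) :
  \sum_(lam <- PD d) F lam = \sum_(lam <- PDle d) (if sumn lam == d then F lam else 0).
Proof.
rewrite -big_mkcond -[RHS]big_filter; apply: perm_big; apply: uniq_perm.
- exact: PD_uniq.
- by rewrite filter_uniq ?PDle_uniq.
by move=> lam; rewrite mem_PD mem_filter mem_PDle; case: eqP => //= ->; rewrite leqnn.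
Qed.

Lemma Pf_indep_eq d (a : part -> R) :
  (forall x : 'I_d -> R, \sum_(lam <- PD d) a lam * Pf lam (px x) = 0) ->
  forall lam, sumn lam = d -> a lam = 0.
Proof.
move=> H0 lam ld; pose a' lam := if sumn lam == d then a lam else 0.
suff : a' lam = 0 by rewrite /a' ld eqxx.
apply: (@Pf_indep d) => [x|]; last by rewrite ld.
rewrite -[RHS](H0 x) sum_PD_PDle; apply: eq_bigr => mu _.
by rewrite /a'; case: eqP; rewrite ?mul0r.
Qed.

Lemma wpoly_dense d f : wpoly d f -> (forall x : 'I_d -> R, f (px x) = 0) ->
  forall pi, f pi = 0.
Proof.
move=> /wpoly_expand[a Ha] f0 pi; rewrite Ha big_seq big1 // => lam.
rewrite mem_PD => /eqP ld; rewrite (@Pf_indep_eq d a) ?mul0r // => x.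
by rewrite -Ha.
Qed.

End MacFunctions.

(** * Self-adjointness and eigenfunctions *)

(** Negative arguments are the convenient ones: with x and y positive they keep 1 - z x y
    positive. *)
Lemma poly_eq_neg (R : realFieldType) (p r : {poly R}) :
  (forall z, z < 0 -> p.[z] = r.[z]) -> p = r.
Proof.
move=> H; apply/eqP; rewrite -subr_eq0; apply/eqP.
apply: (@roots_geq_poly_eq0 _ _ [seq - (k.+1)%:R | k <- iota 0 (size (p - r))]).
- apply/allP => z /mapP[k _ ->]; rewrite /root hornerD hornerN H ?subrr //.
  by rewrite oppr_lt0 ltr0n.
- rewrite map_inj_uniq ?iota_uniq // => i j /oppr_inj /eqP.
  by rewrite eqr_nat eqSS => /eqP.
- by rewrite size_map size_iota.
Qed.

(** * Cauchy determinants *)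

Section Cauchy.
Variables (R : realFieldType) (n : nat).
Implicit Types (x y : 'I_n -> R) (z : R).

(** Column k lists the coefficients of prod_(k' <> k) (1 - z y_k' X). Up to sign and a power of z
    the determinant [bb] is the Vandermonde determinant of y, but only its nonvanishing and its
    relation to [va] are used. *)
Definition bmx z y : 'M[R]_n :=
  \matrix_(j, k) (\prod_(k' | k' != k) (1 - (z * y k') *: 'X))`_(dlt j).
Definition bb z y : R := \det (bmx z y).
Definition omx z x y : 'M[R]_n := \matrix_(i, k) \prod_(k' | k' != k) (1 - z * x i * y k').

(** The matrix product evaluates at the x_i the polynomials of degree less than n stored in the
    columns of [bmx]. *)
Lemma va_bb z x y : va x * bb z y = \det (omx z x y).
Proof.
rewrite /va /alt /bb -det_mulmx; congr (\det _); apply/matrixP => i k.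
rewrite !mxE; set p := fun k : 'I_n => \prod_(k' | k' != k) (1 - (z * y k') *: 'X).
transitivity ((p k).[x i]); last first.
  rewrite horner_prod; apply: eq_bigr => k' _.
  by rewrite !hornerE; ring.
have sp : (size (p k) <= n)%N.
  apply: leq_trans (size_poly_prod_leq _ _) _.
  have : (\sum_(k' | k' != k) size (1 - (z * y k') *: 'X)%R <= \sum_(k' < n | k' != k) 2)%N.
    apply: leq_sum => k' _; apply: leq_trans (size_polyD _ _) _.
    rewrite size_polyN geq_max size_poly1 /=; apply: leq_trans (size_scale_leq _ _) _.
    by rewrite size_polyX.
  rewrite sum_nat_const; have -> : #|[pred k' : 'I_n | k' != k]| = n.-1.
    by rewrite cardC1 card_ord.
  by have := ltn_ord k; lia.
rewrite (horner_coef_wide _ sp) (reindex_inj rev_ord_inj) /=; apply: eq_bigr => j _.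
rewrite !mxE mulrC /p; congr (_ * _ ^+ _); first congr (_`_ _); rewrite /dlt /=; have := ltn_ord j; lia.
Qed.

Definition pdist x := (forall i, x i != 0) /\ injective x.

(** At x_i = 1 / (z y_i) every off-diagonal entry contains a zero factor. Through [va_bb] this one
    evaluation shows that neither [va] nor [bb] vanishes. *)
Lemma det_omx_diag z x y : z != 0 -> pdist y -> (forall i, x i = (z * y i)^-1) ->
  \det (omx z x y) != 0.
Proof.
move=> z0 [y0 yi] xE.
have -> : omx z x y = diag_mx (\row_k \prod_(k' | k' != k) (1 - y k' / y k)).
  apply/matrixP => i k; rewrite !mxE; have [->|ne] := eqVneq i k; last first.
    rewrite mulr0n (bigD1 i) //= {1}xE (_ : _ - _ = 0) ?mul0r //.
    by field; rewrite z0 y0.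
  by rewrite mulr1n; apply: eq_bigr => k' _; rewrite xE; field; rewrite z0 y0.
rewrite det_diag; apply/prodf_neq0 => k _; rewrite mxE; apply/prodf_neq0 => k' ne.
rewrite subr_eq0 eq_sym; apply: contra_neq ne => e.
by apply: yi; rewrite -[RHS]mul1r -e divfK.
Qed.

Lemma va_neq0 x : pdist x -> va x != 0.
Proof.
move=> xd; pose y i := (x i)^-1.
have yd : pdist y.
  case: xd => x0 xi; split=> [i|i j /invr_inj /xi //]; by rewrite invr_neq0.
have := @det_omx_diag 1 x y (oner_neq0 _) yd (fun i => _).
rewrite -va_bb mulf_eq0 negb_or => /(_ (fun i => _))/andP[] // i.
by rewrite mul1r invrK.
Qed.

Lemma bb_neq0 z y : z != 0 -> pdist y -> bb z y != 0.
Proof.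
move=> z0 yd; have := @det_omx_diag z (fun i => (z * y i)^-1) y z0 yd (fun i => erefl).
by rewrite -va_bb mulf_eq0 negb_or => /andP[].
Qed.

Definition cmx z x y : 'M[R]_n := \matrix_(i, k) (1 - z * x i * y k)^-1.

Lemma cauchy z x y : (forall i k, 1 - z * x i * y k != 0) ->
  va x * bb z y = (\prod_i \prod_k (1 - z * x i * y k)) * \det (cmx z x y).
Proof.
move=> H; rewrite va_bb.
have -> : omx z x y = diag_mx (\row_i \prod_k (1 - z * x i * y k)) *m cmx z x y.
  apply/matrixP => i k; rewrite mul_diag_mx !mxE [in RHS](bigD1 k) //=.
  by rewrite mulrAC divff // mul1r.
by rewrite det_mulmx det_diag; congr (_ * _); apply: eq_bigr => i _; rewrite mxE.
Qed.

Lemma det_rows (A B : 'M[R]_n) (X : R) :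
  \sum_(I : {set 'I_n}) X ^+ #|I| * \det (\matrix_(i, k) (if i \in I then B i k else A i k)) =
  \det (A + X *: B).
Proof.
rewrite /determinant; under eq_bigr do rewrite mulr_sumr.
rewrite exchange_big; apply: eq_bigr => w _.
under eq_bigr do rewrite mulrCA.
rewrite -mulr_sumr; congr (_ * _).
under [RHS]eq_bigr do rewrite !mxE addrC.
rewrite bigA_distr; apply: eq_bigr => I _.
have -> : X ^+ #|I| = \prod_(i in I) X by rewrite prodr_const.
rewrite big_mkcond -big_split /=; apply: eq_bigr => i _.
by rewrite mxE; case: (i \in I); rewrite ?mul1r.
Qed.

Variables (t X : R).
Hypothesis t0 : 0 < t.

Lemma scl_gt0 (I : {set 'I_n}) s x : 0 < s -> (forall i, 0 < x i) -> forall i, 0 < scl I s x i.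
Proof. by move=> s0 x0 i; rewrite /scl mulr_gt0 //; case: ifP. Qed.

Lemma nonvanishing z x y i k : z < 0 -> (forall i, 0 < x i) -> (forall i, 0 < y i) ->
  1 - z * x i * y k != 0.
Proof.
move=> z0 x0 y0; rewrite gt_eqF // -mulrA -mulNr addr_gt0 // mulr_gt0 ?oppr_gt0 //.
exact: mulr_gt0.
Qed.

Definition Ssum z x y : R := \sum_(I : {set 'I_n})
  X ^+ #|I| * (va (scl I t x) / \prod_i \prod_k (1 - z * scl I t x i * y k)).

(** Each summand gives a Cauchy determinant with the variables in I scaled by t. Multilinearity in
    the rows adds them up to one determinant, and transposing it exchanges x and y. *)
Lemma Ssum_det z x y : z < 0 -> (forall i, 0 < x i) -> (forall i, 0 < y i) ->
  Ssum z x y * bb z y =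
  \det (\matrix_(i, k) ((1 - z * x i * y k)^-1 + X * (1 - z * (t * x i) * y k)^-1)).
Proof.
move=> z0 x0 y0.
have -> : \matrix_(i, k) ((1 - z * x i * y k)^-1 + X * (1 - z * (t * x i) * y k)^-1) =
    cmx z x y + X *: cmx z (fun i => t * x i) y by apply/matrixP => i k; rewrite !mxE.
rewrite -det_rows /Ssum mulr_suml; apply: eq_bigr => I _.
rewrite -mulrA; congr (_ * _); rewrite mulrAC cauchy => [|i k]; last first.
  by apply: nonvanishing => //; exact: scl_gt0.
rewrite mulrAC divff ?mul1r; last first.
  apply/prodf_neq0 => i _; apply/prodf_neq0 => k _.
  by apply: nonvanishing => //; exact: scl_gt0.
congr (\det _); apply/matrixP => i k; rewrite !mxE /scl.
by case: ifP => _; rewrite ?mul1r.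
Qed.

Lemma Ssum_sym z x y : z < 0 -> (forall i, 0 < x i) -> (forall i, 0 < y i) ->
  injective x -> injective y -> Ssum z x y / va x = Ssum z y x / va y.
Proof.
move=> z0 x0 y0 xi yi.
have xd : pdist x by split=> // i; rewrite gt_eqF.
have yd : pdist y by split=> // i; rewrite gt_eqF.
have vx := va_neq0 xd; have vy := va_neq0 yd.
have z0' : z != 0 by rewrite lt_eqF.
have by0 := bb_neq0 z0' yd; have bx0 := bb_neq0 z0' xd.
have E1 : va x * bb z y = va y * bb z x.
  have nv (u v : 'I_n -> R) : (forall i, 0 < u i) -> (forall i, 0 < v i) -> forall i k, 1 - z * u i * v k != 0.
    by move=> u0 v0 i k; apply: nonvanishing.
  rewrite (cauchy (nv x y x0 y0)) (cauchy (nv y x y0 x0)).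
  rewrite exchange_big /=; congr (_ * _).
    by apply: eq_bigr => i _; apply: eq_bigr => k _; ring.
  rewrite -det_tr; congr (\det _); apply/matrixP => i k; rewrite !mxE.
  by congr (_^-1); ring.
have E2 : Ssum z x y * bb z y = Ssum z y x * bb z x.
  rewrite !Ssum_det // -det_tr; congr (\det _); apply/matrixP => i k; rewrite !mxE.
  by congr (_^-1 + _ * _^-1); ring.
apply: (mulIf (mulf_neq0 vx by0)).
rewrite [in RHS]E1 mulrA divfK // [RHS]mulrA divfK //.
Qed.

(** Scaling x_i by q multiplies the kernel by prod_k (1 - x_i y_k z) / (1 - t x_i y_k z). Hence
    [Spoly] is the operator applied to the kernel, divided by the kernel and multiplied by all the 1
    - t x_i y_k z: a polynomial in z free of q. *)
Definition pfac (I : {set 'I_n}) x y : {poly R} :=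
  \prod_i \prod_k (1 - ((if i \in I then 1 else t) * x i * y k) *: 'X).
Definition Spoly x y : {poly R} := \sum_(I : {set 'I_n})
  (X ^+ #|I| * (va (scl I t x) / va x)) *: pfac I x y.

Lemma Spoly_sym x y : (forall i, 0 < x i) -> (forall i, 0 < y i) ->
  injective x -> injective y -> Spoly x y = Spoly y x.
Proof.
move=> x0 y0 xi yi; apply: (@poly_eq_neg R) => z z0.
have E (u v : 'I_n -> R) : (forall i, 0 < u i) -> (forall i, 0 < v i) ->
    (Spoly u v).[z] = Ssum z u v / va u *
    \prod_i \prod_k ((1 - z * u i * v k) * (1 - z * (t * u i) * v k)).
  move=> u0 v0; rewrite /Spoly /Ssum horner_sum !mulr_suml; apply: eq_bigr => I _.
  rewrite hornerZ -!mulrA; congr (_ * (_ * _)); rewrite mulrCA; congr (_ * _).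
  set A := \prod_i \prod_k _; have A0 : A != 0.
    apply/prodf_neq0 => i _; apply/prodf_neq0 => k _.
    by apply: nonvanishing => //; exact: scl_gt0.
  apply: (mulfI A0); rewrite mulrA divff // mul1r.
  rewrite horner_prod /A -big_split; apply: eq_bigr => i _ /=.
  rewrite horner_prod -big_split; apply: eq_bigr => k _ /=.
  rewrite hornerD hornerN hornerZ hornerX -polyC1 hornerC /scl.
  by case: (i \in I); move: (u i) (v k) => a b; ring.
rewrite !E // Ssum_sym //; congr (_ * _); rewrite exchange_big.
by apply: eq_bigr => i _; apply: eq_bigr => k _ /=; move: (x k) (y i) => a b; ring.
Qed.

End Cauchy.

Section Eigen.
Variables (R : realFieldType) (q t : R).
Hypotheses (q0 : 0 < q) (q1 : q < 1) (t0 : 0 < t) (t1 : t < 1).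
Variables (c : part -> part -> R) (N : part -> R).
Hypothesis H : macdata q t c N.
Implicit Types (pi : nat -> R) (lam mu nu kap : part).
Local Notation P := (Pf c).
Local Notation Q := (Qf c N).

Section Fixed.
Variables (n : nat) (X : R).
Implicit Types (x y : 'I_n -> R) (I : {set 'I_n}).

(** The scaling adds (q^m - 1) sum_(i in I) x_i^m to p_m, and the denominator of [qt] cancels, which
    leaves the logarithmic derivatives of linear factors. *)
Lemma Ker_scl I x y :
  Ker q t (px (scl I q x)) (px y) * \prod_(i in I) \prod_k lin (t * x i * y k) =
  Ker q t (px x) (px y) * \prod_(i in I) \prod_k lin (x i * y k).
Proof.
have Lode a : euler (\prod_(i in I) \prod_k lin (a * x i * y k)) =
    (\sum_(i in I) \sum_k - geom (a * x i * y k)) * \prod_(i in I) \prod_k lin (a * x i * y k).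
  apply: euler_ode_prod => i _; apply: euler_ode_prod => k _; exact: euler_lin.
have L0 a : co (\prod_(i in I) \prod_k lin (a * x i * y k)) 0 = 1.
  by apply: co0_prod => i _; apply: co0_prod => k _; exact: lin0.
under [in RHS]eq_bigr do under eq_bigr do rewrite -[x _]mul1r.
apply: (@ode_uniq _ (logK q t (px (scl I q x)) (px y) + \sum_(i in I) \sum_k - geom (t * x i * y k))).
- rewrite coD logK0 add0r co_sum big1 // => i _; rewrite co_sum big1 // => k _.
  by rewrite coN /= oppr0.
- by rewrite !coM0 !Ker0 !L0.
- exact: euler_odeM (euler_Ker q0 q1 t0 t1 _ _) (Lode t).
rewrite (euler_odeM (euler_Ker q0 q1 t0 t1 _ _) (Lode 1)); congr (_ * _).
apply: psP => d; rewrite !coD !co_sum /=.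
case: d => [|d].
  by rewrite !big1 // => i _; rewrite co_sum big1 // => k _; rewrite coN /= oppr0.
set m := d.+1.
have E a : \sum_(i in I) co (\sum_k - geom (a * x i * y k)) m =
    - (a ^+ m * (\sum_(i in I) x i ^+ m) * px y m).
  rewrite mulr_sumr mulr_suml -sumrN; apply: eq_bigr => i _.
  rewrite co_sum /px mulr_sumr -sumrN; apply: eq_bigr => k _.
  by rewrite coN /= !exprMn.
rewrite !E expr1n mul1r.
have -> : px (scl I q x) m = px x m + (q ^+ m - 1) * \sum_(i in I) x i ^+ m.
  rewrite /px mulr_sumr [X in _ + X]big_mkcond -big_split; apply: eq_bigr => i _.
  by rewrite /scl exprMn; case: (i \in I); rewrite ?expr1n /=; ring.
have a0 : 1 - q ^+ m != 0 by rewrite gt_eqF // subX_gt0.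
move: (\sum_(i in I) _) (px x m) (px y m) a0 => s a b.
rewrite /qt {1 3}/m /=; move: (q ^+ m) (t ^+ m) => u v a0.
by field.
Qed.

Definition Dker x y : ps R := \sum_(I : {set 'I_n})
  psC (X ^+ #|I| * (va (scl I t x) / va x)) * Ker q t (px (scl I q x)) (px y).

Lemma Dker_sym x y : (forall i, 0 < x i) -> (forall i, 0 < y i) ->
  injective x -> injective y -> Dker x y = Dker y x.
Proof.
move=> x0 y0 xi yi.
pose W u v := \prod_(i < n) \prod_(k < n) @lin R (t * u i * v k).
have W0 u v : co (W u v) 0 = 1.
  by apply: co0_prod => i _; apply: co0_prod => k _; exact: lin0.
have E (u v : 'I_n -> R) : Dker u v * W u v = ps_poly (Spoly t X u v) * Ker q t (px u) (px v).
  rewrite /Dker /Spoly ps_poly_sum !mulr_suml; apply: eq_bigr => I _.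
  rewrite -mul_polyC ps_polyM ps_polyC -!mulrA; congr (_ * _).
  have -> : W u v = (\prod_(i in I) \prod_k lin (t * u i * v k)) *
      \prod_(i | i \notin I) \prod_k lin (t * u i * v k) by rewrite /W (bigID (mem I)).
  rewrite mulrA Ker_scl -mulrA mulrC; congr (_ * _).
  rewrite /pfac ps_poly_prod [RHS](bigID (mem I)) /=; congr (_ * _).
    apply: eq_bigr => i iI; rewrite iI ps_poly_prod; apply: eq_bigr => k _.
    by rewrite mul1r.
  apply: eq_bigr => i /negbTE iI; rewrite iI ps_poly_prod; exact: eq_bigr.
have Wsym u v : W u v = W v u.
  rewrite /W exchange_big; apply: eq_bigr => i _; apply: eq_bigr => k _.
  by congr lin; rewrite /=; ring.
have Ksym pi pi' : Ker q t pi pi' = Ker q t pi' pi.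
  by apply: psP => d; apply: eq_bigr => be _; congr (_ / _); rewrite mulrC.
apply: (ps_mulI (W0 x y)); rewrite E Spoly_sym // Ksym Wsym E.
done.
Qed.

End Fixed.

Lemma Dop_sym n X d (x y : 'I_n -> R) : (forall i, 0 < x i) -> (forall i, 0 < y i) ->
  injective x -> injective y ->
  \sum_(lam <- PD d) Dop q t X (fun u => P lam (px u)) x * Q lam (px y) =
  \sum_(lam <- PD d) P lam (px x) * (Dop q t X (fun u => P lam (px u)) y / N lam).
Proof.
move=> x0 y0 xi yi.
have E (u v : 'I_n -> R) : co (Dker X u v) d =
    \sum_(lam <- PD d) Dop q t X (fun u => P lam (px u)) u * Q lam (px v).
  rewrite /Dker co_sum /Dop.
  under [RHS]eq_bigr do rewrite mulr_suml.
  rewrite [RHS]exchange_big; apply: eq_bigr => I _.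
  rewrite coCM -[co (Ker _ _ _ _) d]/(Kd _ _ _ _ _) (Ker_Pf q0 q1 t0 t1 H) mulr_sumr; apply: eq_bigr => lam _.
  by rewrite !mulrA.
rewrite -E (Dker_sym X x0 y0 xi yi) E; apply: eq_bigr => lam _.
by rewrite /Qf mulrCA mulrC -!mulrA; congr (_ * _); rewrite mulrC.
Qed.

Lemma pt_inj n kap : injective (@pt R q t n kap).
Proof.
have lt (i j : 'I_n) : (i < j)%N -> pt q t kap i < pt q t kap j.
  move=> ij; rewrite /pt.
  apply: (@le_lt_trans _ _ (q ^+ prow kap j * t ^+ (n.-1 - i))).
    apply: ler_wpM2r; first by rewrite exprn_ge0 // ltW.
    by apply: ler_wiXn2l; [exact: ltW | exact: ltW | apply: prow_anti; exact: ltnW].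
  rewrite ltr_pM2l ?exprn_gt0 // ltr_iXn2l //.
  by have := ltn_ord j; lia.
move=> i j e; apply/val_inj; case: (ltngtP i j) => //= /lt; by rewrite e ltxx.
Qed.

Lemma pt_dist n kap : va (@pt R q t n kap) != 0.
Proof.
by apply: va_neq0; split=> [i|]; [rewrite gt_eqF ?pt_gt0 | exact: pt_inj].
Qed.

Lemma Pf_big n lam (x : 'I_n -> R) : (n < size lam)%N -> P lam (px x) = 0.
Proof.
move=> h; have [u [_ u2 ->]] := Tri_Pf H n lam; rewrite big1 // => mu _.
case: (eqVneq (u mu) 0) => [->|/u2/dominates_size h']; first by rewrite mul0r.
by rewrite mm_big ?mulr0 // (leq_trans h h').
Qed.

(** The matrix e of the operator on the P_mu is triangular, and self-adjointness makes e(mu, nu) /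
    N(mu) symmetric in mu and nu; so e is diagonal. *)
Lemma Pf_eigen n X lam (x : 'I_n -> R) : va x != 0 -> (size lam <= n)%N ->
  Dop q t X (fun u => P lam (px u)) x = evl n q t X lam * P lam (px x).
Proof.
move=> vx sl; set d := sumn lam.
have T mu : Tri (@mm R n) (fun x => P mu (px x)) mu by exact: (Tri_Pf H).
have /choice[e He] := fun mu => @TriC_Dop R n q t X (fun lam u => P lam (px u)) mu (fun nu _ => T nu).
have eE mu (y : 'I_n -> R) : va y != 0 -> Dop q t X (fun u => P mu (px u)) y =
    \sum_(nu <- PD (sumn mu)) e mu nu * P nu (px y).
  by move=> vy; have [_ _ h] := He mu; exact: h (exist _ y vy).
pose g mu nu := e mu nu / N mu - e nu mu / N nu.
have g0 mu nu : sumn mu = d -> sumn nu = d -> (size mu <= n)%N -> (size nu <= n)%N -> g mu nu = 0.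
  move=> md nd sm sn.
  have S a b : \sum_(mu <- PD d) \sum_(nu <- PD d) g mu nu * P nu (px (@pt R q t n a)) * P mu (px (@pt R q t n b)) = 0.
    have := @Dop_sym n X d (pt q t a) (pt q t b) (fun i => pt_gt0 q0 t0 a i)
      (fun i => pt_gt0 q0 t0 b i) (@pt_inj n a) (@pt_inj n b).
    move=> /eqP; rewrite -subr_eq0 => /eqP E0; rewrite -[RHS]E0.
    under eq_bigr do under eq_bigr do rewrite !mulrBl.
    under eq_bigr do rewrite sumrB.
    rewrite sumrB; congr (_ - _).
      rewrite big_seq [RHS]big_seq; apply: eq_bigr => k; rewrite mem_PD => /eqP kd.
      rewrite eE ?pt_dist // kd mulr_suml; apply: eq_bigr => l _.
      by rewrite /Qf mulrAC [in RHS]mulrA mulrAC; ring.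
    rewrite exchange_big big_seq [RHS]big_seq; apply: eq_bigr => k; rewrite mem_PD => /eqP kd.
    rewrite eE ?pt_dist // kd; move: (P k _) => p.
    rewrite mulr_suml mulr_sumr; apply: eq_bigr => l _.
    by rewrite /=; ring.
  (* The relation S is bilinear; independence at the points is applied to one alphabet after the
     other. *)
  have ind (F : part -> R) :
      (forall a, \sum_(k <- PD d) F k * P k (px (@pt R q t n a)) = 0) ->
      forall k : part, sumn k = d -> (size k <= n)%N -> F k = 0.
    move=> F0 k kd kn.
    pose F' (k : part) := if sumn k == d then F k else 0.
    suff : F' k = 0 by rewrite /F' kd eqxx.
    apply: (@Tri_indep _ q t q0 q1 t0 t1 n d (fun mu x => P mu (px x)) F' T) => //; last by rewrite kd.
    move=> a; rewrite -[RHS](F0 a) sum_PD_PDle; apply: eq_bigr => l _.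
    by rewrite /F'; case: eqP; rewrite ?mul0r.
  apply: (ind (fun nu => g mu nu)) => // a.
  apply: (ind (fun mu => \sum_(k <- PD d) g mu k * P k (px (@pt R q t n a)))) => // b.
  rewrite -[RHS](S a b); apply: eq_bigr => k _; by rewrite mulr_suml.
rewrite eE // -/d (bigD1_seq lam) ?PD_uniq ?mem_PD //=.
have [-> e2 _] := He lam.
rewrite big_seq_cond big1 ?addr0 // => nu /andP[]; rewrite mem_PD => /eqP nd ne.
case: (leqP (size nu) n) => sn; last by rewrite Pf_big ?mulr0.
case: (eqVneq (e lam nu) 0) => [->|/[dup] el /e2 D]; first by rewrite mul0r.
have [_ e2' _] := He nu.
have en : e nu lam = 0.
  apply/eqP; apply: contraNT ne => /e2' D'; apply/eqP; exact: dominates_anti D' D.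
have := g0 lam nu erefl nd sl sn; rewrite /g en mul0r subr0 => /eqP.
by rewrite mulf_eq0 invr_eq0 (negbTE el) (negbTE (mac_N0 H lam)).
Qed.

End Eigen.

(** * Symmetry and the Pieri rule *)

Lemma part_dom_ind (Q : part -> Prop) :
  (forall mu : part, (forall kap : part, (sumn kap < sumn mu)%N -> Q kap) ->
     (forall kap, dominates mu kap -> kap <> mu -> Q kap) -> Q mu) -> forall mu, Q mu.
Proof.
move=> H mu; have [m] := ubnP (sumn mu); elim: m mu => // m IH mu; rewrite ltnS => lm.
have [k] := ubnP (dom_rank mu); elim: k mu lm => // k IHk mu lm; rewrite ltnS => lk.
apply: H => [kap lt|kap D ne]; first by apply: IH; apply: leq_trans lt lm.
apply: IHk; first by rewrite -(dominates_sumn D).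
by apply: leq_trans lk; apply: dom_rank_lt => // e; apply: ne.
Qed.

Lemma sum_partition_seq (R : nzRingType) (T : eqType) (s : seq T) (I : finType) (P : pred I)
    (f : I -> T) (F : I -> R) (G : T -> R) : uniq s -> (forall i, P i -> f i \in s) ->
  \sum_(i | P i) F i * G (f i) = \sum_(k <- s) (\sum_(i | P i && (f i == k)) F i) * G k.
Proof.
move=> us H; under [RHS]eq_bigr do rewrite mulr_suml.
under [RHS]eq_bigr do rewrite big_mkcondr /=.
rewrite [RHS]exchange_big /=; apply: eq_bigr => i Pi.
under [RHS]eq_bigr do rewrite eq_sym.
by rewrite (sum_seq_delta (f i) (fun k => F i * G k)) // H.
Qed.

(** * Vertical strips as sets of rows *)

Section VerticalStrips.
Variable n : nat.
Implicit Types (nu : part) (I : {set 'I_n}).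

(* [nu] with a box added in each row of [I]; [eshape] sorts the rows, so this needs [good nu I]. *)
Definition vs nu I : part := eshape (addI (fun i : 'I_n => prow nu i) I).
Definition good nu I := [forall i : 'I_n, forall j : 'I_n,
  (i <= j)%N ==> (prow nu j + (j \in I) <= prow nu i + (i \in I))%N].

Lemma goodP nu I : reflect (forall i j : 'I_n, (i <= j)%N ->
   (prow nu j + (j \in I) <= prow nu i + (i \in I))%N) (good nu I).
Proof.
apply: (iffP idP) => [/forallP H i j ij|H].
  by have /forallP/(_ j)/implyP := H i; apply.
by apply/forallP => i; apply/forallP => j; apply/implyP => /H.
Qed.

Lemma prow_vs nu I (i : 'I_n) : good nu I -> prow (vs nu I) i = (prow nu i + (i \in I))%N.
Proof. by move=> /goodP H; rewrite prow_eshape. Qed.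

Lemma sumn_vs nu I : (size nu <= n)%N -> sumn (vs nu I) = (sumn nu + #|I|)%N.
Proof.
by move=> sn; rewrite sumn_eshape sum_addI -sumn_eshape eshape_prow.
Qed.

Lemma size_vs nu I : (size (vs nu I) <= n)%N.
Proof. exact: size_eshape. Qed.

Lemma vs_inj nu I J : good nu I -> good nu J -> vs nu I = vs nu J -> I = J.
Proof.
move=> gI gJ e; apply/setP => i; have := prow_vs i gI; rewrite e prow_vs // => /addnI.
by case: (i \in I) (i \in J) => [] [].
Qed.

Lemma vs_dom nu I : (size nu <= n)%N -> (#|I| <= n)%N -> good nu I ->
  dominates (addcol nu #|I|) (vs nu I).
Proof.
move=> sn rn g; apply: (@dominatesP n).
- by rewrite size_addcol geq_max sn.
- exact: size_vs.
- by rewrite sumn_addcol sumn_vs.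
move=> k kn; under eq_bigr do rewrite prow_vs //.
have -> := pre_addI (fun i : 'I_n => prow nu i) I k.
under [leqRHS]eq_bigr do rewrite prow_addcol.
rewrite big_split leq_add2l /=; apply: leq_trans (card_lt_set I k) _.
rewrite (sum_ord_swap n k (fun i => (i < #|I|)%N : nat)) (eq_bigl xpredT).
  by rewrite sum_ltn_ord.
by move=> i; rewrite (leq_trans (ltn_ord i)).
Qed.

Definition top r : {set 'I_n} := [set i : 'I_n | (i < r)%N].

Lemma card_top r : (r <= n)%N -> #|top r| = r.
Proof.
by move=> rn; rewrite /top cardsE -sum1_card big_mkcond sum_ltn_ord; apply/minn_idPr.
Qed.

Lemma good_top nu r : good nu (top r).
Proof.
apply/goodP => i j ij; rewrite !inE; have := prow_anti nu ij.
by case: (ltnP j r) => h; case: (ltnP i r) => h'; lia.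
Qed.

Lemma vs_top nu r : (size nu <= n)%N -> (r <= n)%N -> vs nu (top r) = addcol nu r.
Proof.
move=> sn rn; have e : (size (addcol nu r) <= n)%N by rewrite size_addcol geq_max sn.
rewrite -(eshape_prow e); apply: eq_eshape => i.
by rewrite /addI prow_addcol inE.
Qed.

(* The obstruction to [good] is already visible on consecutive rows. *)
Lemma bad_adjacent nu I : ~~ good nu I -> exists i j : 'I_n,
  [/\ j = i.+1 :> nat, prow nu i = prow nu j, i \notin I & j \in I].
Proof.
move=> /forallPn[i /forallPn[j]]; rewrite negb_imply -ltnNge => /andP[ij h].
have := prow_anti nu ij => h'.
have iI : i \notin I by move: h; case: (i \in I); case: (j \in I); lia.
have jI : j \in I by move: h iI; case: (i \in I); case: (j \in I); lia.
have e : prow nu i = prow nu j by move: h; rewrite (negbTE iI) jI; lia.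
have [m] := ubnP (j - i); elim: m j ij jI e {h h'} => // m IH j ij jI e.
have lt : (i < j)%N.
  by rewrite ltn_neqAle ij andbT; apply: contraNneq iI => /val_inj ->.
have ltj : (j.-1 < n)%N by have := ltn_ord j; lia.
rewrite ltnS => lm; pose k := Ordinal ltj.
have ek : prow nu k = prow nu j.
  have := @prow_anti nu i k; have := @prow_anti nu k j; rewrite /=; lia.
case kI : (k \in I); last by exists k, j; rewrite kI; split => //=; lia.
by apply: (IH k) => //=; rewrite ?ek //; lia.
Qed.

End VerticalStrips.

(** * Coefficients of the operator at the interpolation points *)

Section Factors.
Variables (R : realFieldType) (q t : R).
Hypotheses (q0 : 0 < q) (q1 : q < 1) (t0 : 0 < t) (t1 : t < 1).

Definition bfac a l : R := (1 - q ^+ a * t ^+ l.+1) / (1 - q ^+ a.+1 * t ^+ l).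
(** The factor by which b changes when one more row reaches below the box, bringing its leg from l -
    1 to l. *)
Definition hfac a l : R := bfac a l / bfac a l.-1.
Definition rho D l : R := \prod_(s < D) ((1 - q ^+ s * t ^+ l.+1) / (1 - q ^+ s * t ^+ l)).

Lemma subXX_gt0 a l : (0 < a + l)%N -> 0 < 1 - q ^+ a * t ^+ l.
Proof.
have le1 (x : R) k : 0 < x -> x < 1 -> x ^+ k <= 1 by move=> x0 x1; rewrite exprn_ile1 ?ltW.
rewrite subr_gt0; case: a => [|a] h.
  by rewrite mul1r exprn_ilt1 ?ltW //; lia.
apply: (@le_lt_trans _ _ (q ^+ a.+1)); last by rewrite exprn_ilt1 ?ltW.
by rewrite ler_piMr ?le1 // exprn_ge0 // ltW.
Qed.

Lemma bfac_gt0 a l : 0 < bfac a l.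
Proof. by rewrite divr_gt0 // subXX_gt0 //; lia. Qed.

Lemma rho_gt0 D l : (0 < l)%N -> 0 < rho D l.
Proof. by move=> l0; apply: prodr_gt0 => s _; rewrite divr_gt0 // subXX_gt0 //; lia. Qed.

Variable n : nat.
Implicit Types (nu lam : part) (I : {set 'I_n}) (x : 'I_n -> R).

(** The constant s is left unspecified: it cancels in the quotient that defines [AI]. *)
Lemma va_prod : exists s : R, s != 0 /\ forall x : 'I_n -> R,
  va x = s * \prod_(i : 'I_n) \prod_(j : 'I_n | (i < j)%N) (x j - x i).
Proof.
exists ((-1) ^+ (perm (@rev_ord_inj n))); split=> [|x]; first by rewrite signr_eq0.
rewrite /va (_ : alt _ x = alt (fun i => (perm (@rev_ord_inj n) i : nat)) x); last first.
  by apply: eq_alt => i; rewrite permE /dlt /=; have := ltn_ord i; lia.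
rewrite (alt_perm (fun i : 'I_n => i : nat)); congr (_ * _).
rewrite /alt -det_tr; transitivity (\det (Vandermonde n (\row_i x i))).
  by congr (\det _); apply/matrixP => i j; rewrite !mxE.
rewrite det_Vandermonde; apply: eq_bigr => i _; apply: eq_bigr => j _.
by rewrite !mxE.
Qed.

Definition AI I x : R := va (scl I t x) / va x.

(** The contribution to A_I(u_nu) of two rows at distance l whose lengths differ by D; [a] and [b]
    tell whether the upper and the lower row lie in I. *)
Definition Afac D l (a b : bool) : R :=
  if a then (if b then t else (1 - q ^+ D * t ^+ l.+1) / (1 - q ^+ D * t ^+ l))
  else if b then t * (1 - q ^+ D * t ^+ l.-1) / (1 - q ^+ D * t ^+ l) else 1.

Lemma AI_pt nu I : AI I (pt q t nu) = \prod_(i : 'I_n) \prod_(j : 'I_n | (i < j)%N)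
  Afac (prow nu i - prow nu j) (j - i) (i \in I) (j \in I).
Proof.
have [s [s0 vE]] := va_prod; rewrite /AI !vE invfM mulrACA divff // mul1r -prodf_div.
apply: eq_bigr => i _; rewrite -prodf_div; apply: eq_bigr => j ij.
have pi0 := pt_gt0 q0 t0 nu j.
have -> : pt q t nu i = q ^+ (prow nu i - prow nu j) * t ^+ (j - i) * pt q t nu j.
  rewrite /pt mulrACA -!exprD; congr (_ ^+ _ * _ ^+ _); have := prow_anti nu (ltnW ij).
    by lia.
  by have := ltn_ord j; lia.
rewrite /scl; have [l l0] : exists l, (j - i = l.+1)%N by exists (j - i).-1; lia.
have -> : pt q t nu i = q ^+ (prow nu i - prow nu j) * t ^+ (j - i) * pt q t nu j.
  rewrite /pt mulrACA -!exprD; congr (_ ^+ _ * _ ^+ _); have := prow_anti nu (ltnW ij).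
    by lia.
  by have := ltn_ord j; lia.
rewrite l0 /= /Afac; have := @subXX_gt0 (prow nu i - prow nu j) l.+1.
rewrite addnS => /(_ isT); rewrite !exprS.
move: (q ^+ _) (t ^+ l) (pt _ _ _ j) pi0 => a b c c0 ab.
have h : c - a * (t * b) * c != 0.
  by rewrite -{1}[c]mul1r -mulrBl mulf_neq0 // gt_eqF.
have h' : 1 - a * (t * b) != 0 by rewrite gt_eqF.
by case: ifP => _; case: ifP => _; rewrite ?mul1r; field; rewrite ?h ?h'.
Qed.

(** Two adjacent equal rows of which only the lower one lies in I contribute the factor 1 - q^0 t^0
    = 0. *)
Lemma AI_bad nu I : ~~ good nu I -> AI I (pt q t nu) = 0.
Proof.
move=> /bad_adjacent[i [j [ji e iI jI]]]; rewrite AI_pt.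
have f0 : Afac (prow nu i - prow nu j) (j - i) (i \in I) (j \in I) = 0.
  by rewrite (negbTE iI) jI e subnn ji subSnn /Afac /= expr0 mulr1 subrr mulr0 mul0r.
by rewrite (bigD1 i) //= (bigD1 j) ?ji //= -ji f0 !mul0r.
Qed.

(** The principal specialization P_lam(t^(n-1), ..., t, 1), as [pv_sym_Vf] will show for at most n
    rows. *)
Definition Vf lam : R := \prod_(i : 'I_n) \prod_(j : 'I_n | (i < j)%N)
  (t ^+ prow lam j * rho (prow lam i - prow lam j) (j - i)).

Lemma Vf_gt0 lam : 0 < Vf lam.
Proof.
apply: prodr_gt0 => i _; apply: prodr_gt0 => j ij.
by rewrite mulr_gt0 ?exprn_gt0 ?rho_gt0 // subn_gt0.
Qed.

(** Macdonald's psi', the coefficient of P_(nu + I) in e_r P_nu. *)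
Definition psi nu I : R := \prod_(i : 'I_n) \prod_(j : 'I_n | (i < j)%N)
  if (i \notin I) && (j \in I) then hfac (prow nu i - prow nu j).-1 (j - i) else 1.

(** Pair by pair: the difference of two rows changes by at most one, and the quotient of the two
    [Vf] absorbs the factor of A_I, except for [hfac] when the difference drops. *)
Lemma AI_Vf nu I : good nu I -> AI I (pt q t nu) * Vf nu = psi nu I * Vf (vs nu I).
Proof.
move=> g; rewrite AI_pt /Vf /psi -!big_split; apply: eq_bigr => i _ /=.
rewrite -!big_split; apply: eq_bigr => j ij /=.
rewrite !prow_vs //; have /goodP/(_ i j (ltnW ij)) := g; have := prow_anti nu (ltnW ij).
have [l ->] : exists l, (j - i = l.+1)%N by exists (j - i).-1; lia.
set m := prow nu j => le.
have [D ->] : exists D, prow nu i = (m + D)%N by exists (prow nu i - m)%N; lia.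
rewrite addKn /Afac; case: (i \in I); case: (j \in I) => /= h.
- by rewrite (_ : m + D + 1 - (m + 1) = D)%N ?addn1 ?exprS; [ring | lia].
- rewrite (_ : m + D + 1 - (m + 0) = D.+1)%N; last by lia.
  by rewrite addn0 /rho big_ord_recr /= mul1r; ring.
- case: D le h => [|D] le h; first by lia.
  rewrite (_ : m + D.+1 + 0 - (m + 1) = D)%N; last by lia.
  rewrite addn1 [t ^+ m.+1]exprS /rho big_ord_recr /=.
  rewrite /hfac /bfac /=.
  have := @subXX_gt0 D.+1 l.+1 isT; have := @subXX_gt0 D l.+1; have := @subXX_gt0 D.+1 l isT.
  have := @subXX_gt0 D l.+2; rewrite !addnS => /(_ isT) a1 a2 /(_ isT) a3 a4.
  move: (1 - _) a1 => x1 a1; move: (1 - _) a2 => x2 a2; move: (1 - _) a3 => x3 a3.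
  move: (1 - _) a4 => x4 a4; move: (\prod_(s < D) _) => p.
  by field; rewrite ?gt_eqF.
- by rewrite !addn0 addKn.
Qed.

End Factors.

Section Pieri.
Variables (R : realFieldType) (q t : R).
Hypotheses (q0 : 0 < q) (q1 : q < 1) (t0 : 0 < t) (t1 : t < 1).
Variables (c : part -> part -> R) (N : part -> R).
Hypothesis H : macdata q t c N.
Implicit Types (pi : nat -> R) (lam mu nu kap : part).
Local Notation P := (Pf c).

Lemma Pf_nil pi : P (mkpart [::]) pi = 1.
Proof.
have cE pi' : P (mkpart [::]) pi' = c (mkpart [::]) (mkpart [::]).
  by rewrite /Pf sumn_mkpart PD0 big_seq1 /pm /= big_nil mulr1.
have E (n : nat) f g : Tri (@mm R n) f (mkpart [::]) -> Tri (@mm R n) g (mkpart [::]) -> f =1 g.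
  move=> [u [u1 _ uE]] [v [v1 _ vE]] x.
  by rewrite uE vE sumn_mkpart PD0 !big_seq1 u1 v1.
rewrite cE -(cE (px (fun i : 'I_0 => 0))).
by rewrite (E 0%N _ _ (Tri_Pf H 0 _) (@Tri_eb R 0 _)) eb0.
Qed.

Section Fixed.
Variable n : nat.
Implicit Types (x : 'I_n -> R) (I : {set 'I_n}).
Local Notation pt := (@pt R q t n).
Local Notation AI := (@AI R t n).
Local Notation Vf := (@Vf R q t n).
Local Notation psi := (@psi R q t n).

Lemma Pf_eigen_r r lam x : va x != 0 -> (size lam <= n)%N ->
  \sum_(I : {set 'I_n} | #|I| == r) AI I x * P lam (px (scl I q x)) =
  ee r (pt lam) * P lam (px x).
Proof.
move=> vx sl.
have E : \sum_(I : {set 'I_n}) (AI I x * P lam (px (scl I q x))) *: 'X^#|I| =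
    P lam (px x) *: \prod_i (1 + pt lam i *: 'X).
  apply: poly_eq_neg => z _; rewrite hornerZ horner_prod horner_sum.
  have E := Pf_eigen q0 q1 t0 t1 H z vx sl; rewrite /Dop /evl in E.
  transitivity (\sum_(I : {set 'I_n}) z ^+ #|I| * (va (scl I t x) / va x * P lam (px (scl I q x)))).
    by apply: eq_bigr => I _; rewrite hornerZ hornerXn mulrC.
  rewrite E mulrC; congr (_ * _); apply: eq_bigr => i _.
  rewrite hornerD hornerZ hornerX -polyC1 hornerC /pt /dlt.
  by move: (q ^+ _) (t ^+ _) => a b; ring.
have := congr1 (fun p : {poly R} => p`_r) E.
rewrite coefZ ee_coef mulrC coef_sum => <-; rewrite big_mkcond; apply: eq_bigr => I _.
rewrite coefZ coefXn eq_sym; case: eqP; by rewrite ?mulr1 ?mulr0.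
Qed.

Definition pv lam mu : R := P lam (px (pt mu)).
Definition vv lam := pv lam (mkpart [::]).

Lemma pv_rec r lam nu : (size lam <= n)%N -> (size nu <= n)%N ->
  ee r (pt lam) * pv lam nu =
  \sum_(I : {set 'I_n} | (#|I| == r) && good nu I) AI I (pt nu) * pv lam (vs nu I).
Proof.
move=> sl sn; rewrite -Pf_eigen_r ?(pt_dist q0 q1 t0 t1) //.
rewrite (bigID (good nu)) /= [X in _ + X]big1 ?addr0 => [|I /andP[_ b]]; last first.
  by rewrite (AI_bad q0 q1 t0 t1 b) mul0r.
apply: eq_bigr => I /andP[_ g]; congr (_ * P lam (px _)); apply: funext => i.
rewrite /scl /pt prow_vs // exprD mulrA; congr (_ * _).
by case: (i \in I); rewrite ?mul1r ?mulr1 // mulrC.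
Qed.

Definition Ak r nu kap : R := \sum_(I : {set 'I_n} | (#|I| == r) && good nu I && (vs nu I == kap)) AI I (pt nu).

Lemma pv_recA r lam nu : (size lam <= n)%N -> (size nu <= n)%N ->
  ee r (pt lam) * pv lam nu = \sum_(kap <- PD (sumn nu + r)%N) Ak r nu kap * pv lam kap.
Proof.
move=> sl sn; rewrite pv_rec // (sum_partition_seq (s := PD (sumn nu + r)%N)) //.
  exact: PD_uniq.
by move=> I /andP[/eqP cI g]; rewrite mem_PD sumn_vs // cI.
Qed.

Lemma Ak_supp r nu kap : (size nu <= r)%N -> (r <= n)%N -> Ak r nu kap != 0 ->
  dominates (addcol nu r) kap /\ (size kap <= n)%N.
Proof.
move=> sn rn; have sn' := leq_trans sn rn => ne.
case: (pickP (fun I : {set 'I_n} => (#|I| == r) && good nu I && (vs nu I == kap))) => [I|no].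
  move=> /andP[/andP[/eqP cI g] /eqP <-]; split; last exact: size_vs.
  by rewrite -cI; apply: vs_dom => //; rewrite cI.
by move: ne; rewrite /Ak big_pred0 ?eqxx.
Qed.

(** For the first r rows no pair has only its lower row in I, so [psi] is 1. *)
Lemma Ak_top r nu : (size nu <= r)%N -> (r <= n)%N ->
  Ak r nu (addcol nu r) * Vf nu = Vf (addcol nu r).
Proof.
move=> sn rn; have sn' := leq_trans sn rn.
have gt := good_top n nu r; have vt := vs_top sn' rn.
rewrite /Ak (big_pred1 (top n r)) => [|I]; last first.
  apply/idP/eqP => [/andP[/andP[_ g] /eqP e]|->].
    by apply: (vs_inj g gt); rewrite e vt.
  by rewrite card_top // eqxx gt vt eqxx.
rewrite (AI_Vf q0 q1 t0 t1 gt) vt -[RHS]mul1r; congr (_ * _).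
rewrite /psi big1 // => i _; rewrite big1 // => j ij.
by rewrite !inE; case: ifP => // /andP[h1 h2]; lia.
Qed.

Lemma Ak_top_neq0 r nu : (size nu <= r)%N -> (r <= n)%N -> Ak r nu (addcol nu r) != 0.
Proof.
move=> sn rn; have := Ak_top sn rn; apply: contra_eq_neq => ->.
by rewrite mul0r eq_sym gt_eqF // Vf_gt0.
Qed.

Lemma pt_trunc mu : exists2 mu' : part, (size mu' <= n)%N & pt mu' = pt mu.
Proof.
exists (eshape (fun i : 'I_n => prow mu i)); first exact: size_eshape.
apply: funext => i; rewrite /pt prow_eshape // => j k; exact: prow_anti.
Qed.

(** If P_lam vanished at u_0, then the recursion, solved for its leading point, would make it vanish
    at all u_mu, against independence. *)
Lemma vv_neq0 lam : (size lam <= n)%N -> vv lam != 0.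
Proof.
move=> sl; apply/eqP => v0.
have Z mu : (size mu <= n)%N -> pv lam mu = 0.
  elim/part_dom_ind: mu => mu IH1 IH2 sm.
  have [->|/addcol_ex[nu]] := eqVneq mu (mkpart [::]); first exact: v0.
  set r := size mu => -[e lt sn]; have sn' := leq_trans sn sm.
  apply: (mulfI (Ak_top_neq0 sn sm)); rewrite mulr0 -e.
  have := pv_recA r sl sn'; rewrite IH1 // mulr0 (bigD1_seq mu) ?PD_uniq //=; last first.
    by rewrite mem_PD [in X in X == _]e sumn_addcol.
  rewrite big1_seq ?addr0 => [<-//|kap /andP[ne _]].
  case: (eqVneq (Ak r nu kap) 0) => [->|/(Ak_supp sn sm)[D sk]]; first by rewrite mul0r.
  by rewrite IH2 ?mulr0 // ?[mu]e //; apply/eqP; rewrite -e.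
have := @Tri_indep R q t q0 q1 t0 t1 n (sumn lam) (fun mu x => P mu (px x))
  (fun mu => (mu == lam)%:R) (Tri_Pf H n) _ lam (leqnn _) sl.
rewrite eqxx => h; have /eqP := oner_neq0 R; apply; apply: h => mu.
have [mu' sm <-] := pt_trunc mu.
rewrite big1 // => kap _; case: eqP => [->|]; last by rewrite mul0r.
by rewrite mul1r; exact: Z.
Qed.

Lemma Tri_Pf_ee r nu : (size nu <= n)%N -> (r <= n)%N -> exists u : part -> R,
  [/\ u (addcol nu r) = 1, (forall mu, u mu != 0 -> dominates (addcol nu r) mu)
   & forall x, ee r x * P nu (px x) = \sum_(mu <- PD (sumn nu + r)%N) u mu * P mu (px x)].
Proof.
move=> sn rn; rewrite -(sumn_addcol nu r).
apply: (@Tri_trans R _ (fun mu x => P mu (px x)) (@mm R n)); last exact: Tri_ee (Tri_Pf H n nu).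
by move=> mu e; apply: (Tri_inv _ e) => ka _; exact: (Tri_Pf H).
Qed.

(* The points attached to [K = {lam | |lam| < |mu|} \cup {lam <= mu}] separate the [P kap] for
   [kap] in [K], and on all of these points the induction hypothesis applies with the two
   arguments exchanged. *)
Lemma pv_sym_Vf mu : (size mu <= n)%N -> vv mu = Vf mu /\
  forall lam, (size lam <= n)%N -> pv lam mu * vv mu = pv mu lam * vv lam.
Proof.
elim/part_dom_ind: mu => mu IH1 IH2 sm.
have [->|/addcol_ex[nu]] := eqVneq mu (mkpart [::]).
  split=> [|lam sl]; last by rewrite /vv /pv !Pf_nil mulr1 mul1r.
  rewrite /vv /pv Pf_nil /Vf big1 // => i _; rewrite big1 // => j _.
  by rewrite !(mkpart_nth (s := [::])) // !nth_nil /rho big_ord0 mulr1.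
set r := size mu => -[e lt sn]; have sn' := leq_trans sn sm.
have [vnu symnu] := IH1 nu lt sn'.
have [u [u1 u2 uE]] := Tri_Pf_ee sn' sm; rewrite -e in u1 u2.
have d : (sumn nu + r = sumn mu)%N by rewrite [in RHS]e sumn_addcol.
rewrite d in uE.
(* The [u kap] are the coefficients of e_r P_nu; the subtracted terms are what the symmetry predicts
   for them. *)
pose a kap := if (size kap <= n)%N && (sumn kap == sumn mu) then u kap - vv nu * Ak r nu kap / vv kap else 0.
have vn0 := vv_neq0 sn'; have vm0 := vv_neq0 sm.
have Asupp kap : Ak r nu kap != 0 -> dominates mu kap /\ (size kap <= n)%N.
  by rewrite {1}e; exact: Ak_supp.
(* By induction the terms with kap <> mu agree on both sides, so only the unknown symmetry between
   mu and lam is left. *)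
have key lam : (size lam <= n)%N -> \sum_(kap <- PD (sumn mu)) a kap * pv kap lam =
    vv nu * Ak r nu mu * (pv lam mu / vv lam - pv mu lam / vv mu).
  move=> sl; have vl0 := vv_neq0 sl.
  have E : \sum_(kap <- PD (sumn mu)) u kap * pv kap lam =
      \sum_(kap <- PD (sumn mu)) vv nu / vv lam * (Ak r nu kap * pv lam kap).
    transitivity (ee r (pt lam) * pv nu lam); first by rewrite /pv uE.
    rewrite -mulr_sumr -d -pv_recA // mulrCA [pv lam nu](canRL (mulfK vn0) (symnu lam sl)).
    move: (pv nu lam) (ee _ _) => p1 p2; field.
    by rewrite vn0 vl0.
  have D : \sum_(kap <- PD (sumn mu)) a kap * pv kap lam -
      (\sum_(kap <- PD (sumn mu)) u kap * pv kap lam -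
       \sum_(kap <- PD (sumn mu)) vv nu / vv lam * (Ak r nu kap * pv lam kap)) =
      vv nu * Ak r nu mu * (pv lam mu / vv lam - pv mu lam / vv mu).
    rewrite -!sumrB (bigD1_seq mu) ?PD_uniq ?mem_PD //= big1_seq ?addr0.
      rewrite /a sm eqxx /=; move: (u mu) (Ak _ _ _) (pv _ _) (pv _ _) => p1 p2 p3 p4.
      by field; rewrite vl0 vm0.
    move=> kap /andP[ne]; rewrite mem_PD => /eqP kd; rewrite /a kd eqxx andbT.
    case: ifP => sk; last first.
      have -> : pv kap lam = 0 by rewrite /pv (Pf_big H) // ltnNge sk.
      case: (eqVneq (Ak r nu kap) 0) => [->|/Asupp[_]]; last by rewrite sk.
      by ring.
    have vk0 := vv_neq0 sk.
    case: (eqVneq (Ak r nu kap) 0) => [->|/Asupp[D _]]; first by ring.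
    have [_ /(_ lam sl) s] := IH2 kap D (elimN eqP ne) sk.
    rewrite [pv lam kap](canRL (mulfK vk0) s).
    move: (u kap) (Ak _ _ _) (pv _ _) => p1 p2 p3.
    by field; rewrite vl0 vk0.
  by rewrite -D E subrr subr0.
have a0 : forall kap, a kap = 0.
  apply: (@Tri_separated R q t q0 q1 t0 t1 n (fun mu x => P mu (px x)) mu a (Tri_Pf H n)).
    move=> kap; rewrite /a; case: ifP => [/andP[sk /eqP kd]|]; last by rewrite eqxx.
    move=> ne; split=> //; right; apply: contrapT => nD; move: ne.
    have -> : u kap = 0 by apply/eqP; apply: contra_notT nD => /u2.
    have -> : Ak r nu kap = 0 by apply/eqP; apply: contra_notT nD => /Asupp[].
    by rewrite mulr0 mul0r subrr eqxx.
  move=> kap Kk sk; rewrite -[RHS](subrr (pv kap mu * vv mu)).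
  transitivity (\sum_(rho <- PD (sumn mu)) a rho * pv rho kap).
    rewrite sum_PD_PDle; apply: eq_bigr => rho _; rewrite /a /pv.
    by case: (sumn rho == _); rewrite ?andbF ?mul0r.
  rewrite key // subrr; have vk0 := vv_neq0 sk.
  suff -> : pv kap mu / vv kap = pv mu kap / vv mu by rewrite subrr mulr0.
  apply/eqP; rewrite eqr_div //; apply/eqP.
  have [->//|/eqP ne] := eqVneq kap mu.
  case: Kk => [lt'|D].
    by have [_ ->] := IH1 kap lt' sk.
  by have [_ ->] := IH2 kap D ne sk.
(* The leading coefficient of e_r P_nu is 1, which yields for the values at u_0 the recursion that
   [Vf] satisfies. *)
have vA : vv nu * Ak r nu mu = vv mu.
  have /eqP := a0 mu; rewrite /a sm eqxx /= u1 subr_eq0 eq_sym => /eqP h.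
  by rewrite -[LHS](divfK vm0) h mul1r.
split; first by rewrite -vA vnu mulrC {1 2}e Ak_top.
move=> lam sl; have vl0 := vv_neq0 sl.
have /esym/eqP := key lam sl; rewrite big1 => [|kap _]; last by rewrite a0 mul0r.
rewrite vA mulf_eq0 (negbTE vm0) /= subr_eq0 eqr_div // => /eqP -> //.
Qed.

(** The symmetry turns the recursion [pv_rec] in the second argument into an expansion in the
    first. *)
Lemma pieri_pt r nu lam : (size nu <= n)%N -> (size lam <= n)%N ->
  ee r (pt lam) * pv nu lam =
  \sum_(I : {set 'I_n} | (#|I| == r) && good nu I) psi nu I * pv (vs nu I) lam.
Proof.
move=> sn sl; have vn0 := vv_neq0 sn; have vl0 := vv_neq0 sl.
have [vnE /(_ lam sl) sy] := pv_sym_Vf sn.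
apply: (mulIf vl0); rewrite -mulrA -sy mulrA pv_rec // !mulr_suml; apply: eq_bigr => I /andP[_ g].
have sI := size_vs nu I; have [vIE /(_ lam sl) sy'] := pv_sym_Vf sI.
rewrite -[RHS]mulrA -sy' vIE vnE mulrAC AI_Vf //.
by rewrite -mulrA [Vf _ * _]mulrC.
Qed.

End Fixed.

(** Chosen so that qt_k om_k = (-1)^(k-1): setting one alphabet of the kernel to [om] gives the
    generating function of the e_r. *)
Definition om k : R := (-1) ^+ k.-1 * ((1 - q ^+ k) / (1 - t ^+ k)).
Definition Er r pi : R := Kd q t r pi om.
Definition eser pi : ps R := Ps (fun r => Er r pi).

Lemma wpoly_Er r : wpoly r (Er r).
Proof.
exists (fun be => pm be om / zz q t be) => pi; apply: eq_bigr => be _.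
by rewrite -mulrA mulrC.
Qed.

Lemma qt_om k : (0 < k)%N -> qt q t k * om k = (-1) ^+ k.-1.
Proof.
move=> k0; have := subX_gt0 q0 q1 k0; have := subX_gt0 t0 t1 k0 => h h'.
by rewrite /qt /om; field; rewrite !gt_eqF.
Qed.

Definition esl pi : ps R := Ps (fun k => if k == 0%N then 0 else (-1) ^+ k.-1 * pi k).

Lemma euler_eser pi : euler (eser pi) = esl pi * eser pi.
Proof.
have -> : eser pi = Ker q t pi om by [].
rewrite (euler_Ker q0 q1 t0 t1); congr (_ * _); apply: psP => k /=; case: eqP => // /eqP k0.
by rewrite mulrAC qt_om // lt0n.
Qed.

Lemma Er_px n r (x : 'I_n -> R) : Er r (px x) = ee r x.
Proof.
suff E : eser (px x) = \prod_i lin (- x i).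
  have := congr1 (fun f => co f r) E => /= ->.
  rewrite -ee_coef -ps_poly_prod /=; congr (polyseq _)`_r; apply: eq_bigr => i _.
  by rewrite scaleNr opprK.
apply: (@ode_uniq _ (esl (px x))) => //.
- by rewrite [LHS]Ker0 co0_prod // => i _; exact: lin0.
- exact: euler_eser.
rewrite (@euler_ode_prod _ _ _ _ _ (fun i => - geom (- x i))) => [|i _]; last exact: euler_lin.
congr (_ * _); apply: psP => k; rewrite co_sum /=.
case: k => [|k] /=; first by rewrite big1 // => i _; rewrite oppr0.
rewrite /px mulr_sumr; apply: eq_bigr => i _.
rewrite [(- x i) ^+ _]exprNn; move: (x i ^+ k.+1) => a; rewrite exprS.
by move: ((-1) ^+ k) => b; ring.
Qed.

(** Both sides are homogeneous of degree |nu| + r <= n in the power sums, so agreement at the points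
    in n variables suffices. *)
Lemma pieri n r nu pi : (sumn nu + r <= n)%N ->
  Er r pi * P nu pi =
  \sum_(I : {set 'I_n} | (#|I| == r) && good nu I) psi q t nu I * P (vs nu I) pi.
Proof.
move=> h; have sn : (size nu <= n)%N by have := size_le_sumn nu; lia.
apply/eqP; rewrite -subr_eq0; apply/eqP.
set f := fun pi => Er r pi * P nu pi - \sum_(I : {set 'I_n} | (#|I| == r) && good nu I) psi q t nu I * P (vs nu I) pi.
rewrite -[LHS]/(f pi).
have wf : wpoly (sumn nu + r)%N f.
  apply: (@eq_wpoly _ _ (fun pi => Er r pi * P nu pi + (-1) *
     \sum_(I : {set 'I_n} | (#|I| == r) && good nu I) psi q t nu I * P (vs nu I) pi)).
    by move=> pi'; rewrite /f mulN1r.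
  apply: wpolyD.
    by rewrite addnC; apply: wpolyM; [exact: wpoly_Er|exact: wpoly_Pf].
  apply: wpolyZ; apply: wpoly_sum => I /andP[/eqP cI g]; apply: wpolyZ.
  by rewrite -cI -(sumn_vs _ sn); exact: wpoly_Pf.
have [a Ha] := wpoly_expand H wf.
rewrite Ha big_seq big1 // => lam; rewrite mem_PD => /eqP ld.
pose a' (lam : part) := if sumn lam == (sumn nu + r)%N then a lam else 0.
suff : a' lam = 0 by rewrite /a' ld eqxx => ->; rewrite mul0r.
apply: (@Tri_indep R q t q0 q1 t0 t1 n (sumn nu + r)%N (fun mu x => P mu (px x)) a' (Tri_Pf H n)).
- move=> mu; have [mu' sm <-] := pt_trunc n mu.
  transitivity (f (px (@pt R q t n mu'))).
    by rewrite Ha sum_PD_PDle; apply: eq_bigr => ka _; rewrite /a'; case: eqP; rewrite ?mul0r.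
  by rewrite /f Er_px [X in X - _](pieri_pt r sn sm) subrr.
- by rewrite ld.
- by rewrite (leq_trans (size_le_sumn _)) // ld.
Qed.

End Pieri.

(** * Duality *)

Section DualCauchy.
Variable R : realFieldType.
Implicit Types lam kap : part.

Lemma eb_prod n lam (y : 'I_n -> R) : eb lam y = \prod_(r <- (cpart lam : seq nat)) ee r y.
Proof.
elim/part_dom_ind: lam => lam IH _.
have [->|/addcol_ex[nu [e lt sn]]] := eqVneq lam (mkpart [::]).
  have -> : cpart (mkpart [::]) = mkpart [::] by apply: sumn0_part; rewrite sumn_cpart sumn_mkpart.
  by rewrite eb0 big_nil.
have E : cpart lam = mkpart (size lam :: (cpart nu : seq nat)) by rewrite {1}e cpart_addcol.
have l0 : (0 < size lam)%N.
  rewrite lt0n; apply/eqP => /size0nil l0; move: lt.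
  by rewrite [X in (_ < X)%N](_ : _ = 0)%N //; case: lam l0 {e sn E IH} => /= s _ ->.
have -> : \prod_(r <- (cpart lam : seq nat)) ee r y = ee (size lam) y * \prod_(r <- (cpart nu : seq nat)) ee r y.
  rewrite E -[RHS](big_cons _ _ _ _ xpredT (fun r => ee r y)); apply: perm_big; apply: perm_mkpart0.
  by rewrite inE negb_or part_neq0 andbT eq_sym -lt0n.
case: (leqP (size lam) n) => ln; last by rewrite ee_big // mul0r /eb leqNgt ln.
by rewrite {1}e eb_addcol // ?IH // (leq_trans sn).
Qed.

(** The coefficient of x^al is the product of the e_(al_i)(y), which depends on the shape kap of al
    only; the columns of kap' are the rows of kap. *)
Lemma dual_cauchy m n d (x : 'I_m -> R) (y : 'I_n -> R) : (d <= m)%N ->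
  (\prod_(i < m) \prod_(k < n) (1 + (x i * y k) *: 'X))`_d =
  \sum_(kap <- PD d) eb (cpart kap) y * mm kap x.
Proof.
move=> dm; set B := (n + d)%N.
have pE i : \prod_(k < n) (1 + (x i * y k) *: 'X) = \sum_(r < B.+1) (x i ^+ r * ee r y) *: 'X^r.
  apply/polyP => r; rewrite (ee_coef r (fun k => x i * y k)) eeZ coef_sum.
  under eq_bigr do rewrite coefZ coefXn.
  case: (ltnP r B.+1) => rB.
    rewrite (bigD1 (Ordinal rB)) //= eqxx mulr1 big1 ?addr0 // => j ne.
    by rewrite -[_ == _]/(Ordinal rB == j) eq_sym (negbTE ne) mulr0.
  rewrite big1 => [|j _]; first by rewrite ee_big ?mulr0 //; move: rB; rewrite /B; lia.
  by rewrite gtn_eqF ?mulr0 // (leq_trans (ltn_ord j)).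
under eq_bigr do rewrite pE.
rewrite bigA_distr_bigA coef_sum /=.
pose c (al : {ffun 'I_m -> 'I_B.+1}) : R := if (\sum_i al i)%N == d then \prod_i ee (al i) y else 0.
transitivity (\sum_(al : {ffun 'I_m -> 'I_B.+1}) c al * mon x (fun i => al i)).
  apply: eq_bigr => al _.
  have -> : \prod_i ((x i ^+ al i * ee (al i) y) *: 'X^(al i)) =
      (\prod_i ee (al i) y * mon x (fun i => al i)) *: 'X^(\sum_i al i) :> {poly R}.
    rewrite scaler_prod prodrXr /mon big_split /= mulrC //.
  rewrite coefZ coefXn /c eq_sym; case: eqP => _; by rewrite ?mulr1 ?mulr0 ?mul0r.
rewrite (@group_shape _ _ d).
- rewrite big_seq [RHS]big_seq; apply: eq_bigr => kap; rewrite mem_PD => /eqP kd.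
  have sk : (size kap <= m)%N by apply: leq_trans (size_le_sumn kap) _; rewrite kd.
  have padE (i : 'I_m) : pad m B kap i = prow kap i :> nat.
    by rewrite ffunE inordK // ltnS (leq_trans (prow_le_sumn kap i)) // kd leq_addl.
  congr (_ * _); rewrite /c; under eq_bigr do rewrite padE.
  rewrite -sumn_eshape eshape_prow // kd eqxx eb_prod cpartK.
  under eq_bigr do rewrite padE.
  rewrite (big_nth 0%N) big_mkord [LHS](bigID (fun i : 'I_m => (i < size kap)%N)) /=.
  rewrite [X in _ * X]big1 ?mulr1 => [|i]; last first.
    by rewrite -leqNgt => h; rewrite nth_default // ee0.
  by rewrite (big_ord_widen _ (fun i => ee (prow kap i) y) sk).
- by rewrite /B leq_addl.
- move=> ga w; rewrite /c; under eq_bigr do rewrite ffunE.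
  have -> : (\sum_i ga (w i) = \sum_i ga i)%N by rewrite [RHS](reindex_inj (@perm_inj _ w)).
  case: eqP => // _; under eq_bigr do rewrite ffunE.
  by rewrite [RHS](reindex_inj (@perm_inj _ w)).
- by move=> ga; rewrite /c; case: ifP => [/eqP//|_]; rewrite eqxx.
Qed.

End DualCauchy.

Section Dual.
Variables (R : realFieldType) (q t : R).
Hypotheses (q0 : 0 < q) (q1 : q < 1) (t0 : 0 < t) (t1 : t < 1).
Variables (c : part -> part -> R) (N : part -> R).
Hypothesis H : macdata q t c N.
Implicit Types (pi : nat -> R) (lam mu nu kap : part).

(* Coordinates of the images of the Q_lam' under p_r -> om_r p_r, which exchanges q and t. *)
Definition dc lam be : R := c (cpart lam) be * pm be (om q t) / N (cpart lam).
Definition dN lam : R := (N (cpart lam))^-1.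

Lemma Pf_dc lam pi : Pf dc lam pi = Qf c N (cpart lam) (fun k => om q t k * pi k).
Proof.
rewrite /Qf /Pf sumn_cpart mulr_suml; apply: eq_bigr => be _.
have -> : pm be (fun k => om q t k * pi k) = pm be (om q t) * pm be pi by rewrite /pm big_split.
rewrite /dc.
by move: (pm _ _) (pm _ _) (_^-1) => a b e; ring.
Qed.

Lemma Ker_om m n (x : 'I_m -> R) (y : 'I_n -> R) :
  Ker q t (px x) (fun k => om q t k * px y k) = \prod_i \prod_k lin (- (x i * y k)).
Proof.
apply: (@ode_uniq _ (logK q t (px x) (fun k => om q t k * px y k))) => //.
- rewrite [LHS]Ker0 co0_prod // => i _; apply: co0_prod => k _; exact: lin0.
- exact: euler_Ker.
rewrite (@euler_ode_prod _ _ _ _ _ (fun i => \sum_k - geom (- (x i * y k)))) => [|i _]; last first.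
  by apply: euler_ode_prod => k _; exact: euler_lin.
congr (_ * _); apply: psP => k; rewrite co_sum.
case: k => [|k].
  by rewrite big1 // => i _; rewrite co_sum big1 // => j _; rewrite /= oppr0.
rewrite [RHS]/= mulrA [_ * om _ _ _]mulrAC qt_om // /px -mulrA big_distrlr mulr_sumr.
apply: eq_bigr => i _; rewrite co_sum mulr_sumr; apply: eq_bigr => j _ /=.
rewrite [(- _) ^+ k.+1]exprNn exprMn; move: (x i ^+ k.+1) (y j ^+ k.+1) => a b; rewrite exprS.
by move: ((-1) ^+ k) => s; ring.
Qed.

Lemma zz_swap be : zz t q be * pm be (om q t) ^+ 2 = zz q t be.
Proof.
rewrite /zz -mulrA; congr (_ * _); rewrite /pm -prodrXl -big_split big_seq [RHS]big_seq.
apply: eq_bigr => r rb; have r0 : (0 < r)%N by have /andP[] := part_le rb.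
have := subX_gt0 q0 q1 r0; have := subX_gt0 t0 t1 r0.
rewrite /om exprMn sqrr_sign mul1r; move: (1 - _) (1 - _) => a b a0 b0 /=.
by field; rewrite !gt_eqF.
Qed.

(** For triangularity, expand prod (1 + x_i y_k z) in the m_mu(x), directly and through the
    P_lam(x). This writes [eb (cpart mu)] in the dual functions of the lam', with the transpose of
    the matrix from the P to the m. Conjugation reverses dominance, so the transpose is
    unitriangular again; inverting it and passing from [eb] to the m finishes. *)
Lemma dual_macdata : macdata t q dc dN.
Proof.
split=> [lam|lam mu e|n lam].
- by rewrite invr_eq0 (mac_N0 H).
- have e' : sumn (cpart lam) = sumn (cpart mu) by rewrite !sumn_cpart.
  have := mac_orth H e'; rewrite sumn_cpart (inj_eq (can_inj cpartK)) => E.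
  transitivity ((\sum_(be <- PD (sumn lam)) c (cpart lam) be * c (cpart mu) be * zz q t be) /
     (N (cpart lam) * N (cpart mu))).
    rewrite mulr_suml; apply: eq_bigr => be _; rewrite -zz_swap /dc invfM.
    by move: (pm _ _) (zz _ _ _) (_^-1) (_^-1) => p z a b; ring.
  rewrite E /dN; case: eqP => [->|_]; last by rewrite !mul0r.
  by rewrite !mul1r invfM mulrA divff ?mul1r // (mac_N0 H).
pose g mu (y : 'I_n -> R) := Pf dc mu (px y).
have key kap : Tri g (@eb R n kap) kap.
  pose d := sumn kap; have /choice[u Hu] := Tri_Pf H d.
  have E y mu : sumn mu = d -> eb (cpart mu) y = \sum_(lam <- PD d) u lam mu * g (cpart lam) y.
    move=> md; apply/eqP; rewrite -subr_eq0; apply/eqP.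
    pose a (mu : part) := if sumn mu == d then
       eb (cpart mu) y - \sum_(lam <- PD d) u lam mu * g (cpart lam) y else 0.
    suff : a mu = 0 by rewrite /a md eqxx.
    apply: (@Tri_indep R q t q0 q1 t0 t1 d d (@mm R d) a (@Tri_refl _ _ _)); rewrite ?md //; last first.
      by rewrite -md size_le_sumn.
    move=> ka; set x := pt _ _ _.
    have := dual_cauchy x y (leqnn d).
    have -> : (\prod_(i < d) \prod_(k < n) (1 + (x i * y k) *: 'X))`_d =
        Kd q t d (px x) (fun k => om q t k * px y k).
      rewrite -[RHS]/(co (Ker _ _ _ _) d) Ker_om.
      rewrite -[LHS]/(co (ps_poly _) d) ps_poly_prod; congr (co _ d); apply: eq_bigr => i _.
      by rewrite ps_poly_prod; apply: eq_bigr => k _; rewrite /lin scaleNr opprK.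
    rewrite (Ker_Pf q0 q1 t0 t1 H) => /eqP; rewrite eq_sym -subr_eq0 => /eqP E; rewrite -[RHS]E.
    transitivity (\sum_(la <- PD d) a la * mm la x).
      by rewrite sum_PD_PDle; apply: eq_bigr => la _; rewrite /a; case: eqP; rewrite ?mul0r.
    have -> : \sum_(lam0 <- PD d) Pf c lam0 (px x) * Qf c N lam0 (fun k => om q t k * px y k) =
        \sum_(mu <- PD d) (\sum_(lam0 <- PD d) u lam0 mu * g (cpart lam0) y) * mm mu x.
      under [RHS]eq_bigr do rewrite mulr_suml.
      rewrite [RHS]exchange_big /= big_seq [RHS]big_seq; apply: eq_bigr => la.
      rewrite mem_PD => /eqP ld; have [_ _ ->] := Hu la; rewrite ld mulr_suml; apply: eq_bigr => mu' _.
      by rewrite /g Pf_dc cpartK; ring.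
    rewrite -sumrB big_seq [RHS]big_seq; apply: eq_bigr => la; rewrite mem_PD => /eqP ld.
    by rewrite /a ld eqxx mulrBl.
  exists (fun mu => u (cpart mu) (cpart kap)); split.
  - by have [-> _ _] := Hu (cpart kap).
  - move=> mu; have [_ h _] := Hu (cpart mu) => /h /dominates_cpart.
    by rewrite !cpartK.
  move=> y; rewrite -{1}[kap]cpartK E ?sumn_cpart //.
  have -> : \sum_(lam0 <- PD d) u lam0 (cpart kap) * g (cpart lam0) y =
     \sum_(mu <- [seq cpart la | la <- PD d]) u (cpart mu) (cpart kap) * g mu y.
    by rewrite big_map; apply: eq_bigr => la _; rewrite cpartK.
  apply: perm_big; apply: uniq_perm; rewrite ?PD_uniq ?map_inj_uniq ?PD_uniq //.
    exact: (can_inj cpartK).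
  move=> mu; apply/mapP/idP => [[la]|]; first by rewrite !mem_PD => ld ->; rewrite sumn_cpart.
  by exists (cpart mu); rewrite ?cpartK // mem_PD sumn_cpart -mem_PD.
apply: (Tri_trans _ (Tri_inv (fun mu _ => key mu) erefl)) => mu _; exact: Tri_eb.
Qed.

End Dual.

(** * Norms *)

Section AddBox.
Variables (n : nat) (lam : part) (i : 'I_n).
Hypotheses (sn : (size lam <= n)%N) (g : good lam [set i]).
Local Notation mu := (vs lam [set i]).
Local Notation c := (prow lam i).

Lemma prow_addbox m : prow mu m = (prow lam m + (m == i :> nat))%N.
Proof.
case: (ltnP m n) => mn.
  by rewrite -[m]/(val (Ordinal mn)) prow_vs // inE.
rewrite !nth_default ?(leq_trans _ mn) ?size_vs //.
by rewrite gtn_eqF // (leq_trans (ltn_ord i)).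
Qed.

Lemma lt_addbox m : (m < i)%N -> (c < prow lam m)%N.
Proof.
move=> mi; have mn := ltn_trans mi (ltn_ord i).
have /goodP/(_ (Ordinal mn) i (ltnW mi)) := g; rewrite !inE eqxx -(inj_eq val_inj) /=; lia.
Qed.

Lemma conj_addbox0 : conj_part lam c = i.
Proof.
apply: ltn_ext => m; rewrite conj_partP; case: (ltnP m i) => [/lt_addbox //|im].
by apply/negbTE; rewrite -leqNgt prow_anti.
Qed.

Lemma conj_addbox j : conj_part mu j = (conj_part lam j + (j == c))%N.
Proof.
apply: ltn_ext => m; rewrite conj_partP prow_addbox.
case: (eqVneq j c) => [->|ne].
  rewrite conj_addbox0; case: (ltngtP m i) => h.
  - by have := lt_addbox h; lia.
  - by have := prow_anti lam (ltnW h); lia.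
  - by rewrite h; lia.
rewrite addn0 conj_partP; case: (eqVneq m i) => [->|]; last by rewrite addn0.
by apply/idP/idP; move/eqP: ne; lia.
Qed.

Lemma vs_cpart (j : 'I_n) : j = c :> nat -> (prow lam 0 < n)%N ->
  good (cpart lam) [set j] /\ vs (cpart lam) [set j] = cpart mu.
Proof.
move=> jc ln.
have E (k : 'I_n) : (prow (cpart lam) k + (k \in [set j]) = prow (cpart mu) k)%N.
  by rewrite !prow_cpart conj_addbox inE -(inj_eq val_inj) /= jc.
have gj : good (cpart lam) [set j].
  by apply/goodP => k l kl; rewrite !E; exact: prow_anti.
split=> //; apply: part_eq => k; case: (ltnP k n) => kn.
  by rewrite -[k]/(val (Ordinal kn)) prow_vs // E.
rewrite !nth_default ?(leq_trans _ kn) ?size_vs // size_cpart prow_addbox.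
by case: eqP => _; lia.
Qed.

End AddBox.

Section BoxProducts.
Variables (R : realFieldType) (q t : R).
Hypotheses (q0 : 0 < q) (q1 : q < 1) (t0 : 0 < t) (t1 : t < 1).
Implicit Types (lam mu kap : part) (p : pred nat).
Local Notation bfac := (bfac q t).
Local Notation hfac := (hfac q t).

(** The predicate selects boxes by their arm: all of them for the norms, the odd ones for b^oa, the
    even ones for the complement. *)
Definition rowB p lam i : R :=
  \prod_(j < prow lam i | p (arm lam i j)) bfac (arm lam i j) (leg lam i j).
Definition Bp p lam : R := \prod_(i < size lam) rowB p lam i.

Lemma Bp_widen p lam n : (size lam <= n)%N -> Bp p lam = \prod_(i < n) rowB p lam i.
Proof.
move=> sn; rewrite /Bp (big_ord_widen _ (rowB p lam) sn) [RHS](bigID (fun i : 'I_n => (i < size lam)%N)) /=.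
rewrite [X in _ * X]big1 ?mulr1 // => i h.
by rewrite /rowB nth_default ?big_ord0 // leqNgt.
Qed.

Lemma Bp_gt0 p lam : 0 < Bp p lam.
Proof. by apply: prodr_gt0 => i _; apply: prodr_gt0 => j _; rewrite bfac_gt0. Qed.

Lemma bfac_leg a l : bfac a l = bfac a 0 * \prod_(1 <= k < l.+1) hfac a k.
Proof.
elim: l => [|l IH]; first by rewrite big_nil mulr1.
rewrite big_nat_recr //= mulrA -IH /hfac /= mulrC divfK //.
by rewrite gt_eqF // bfac_gt0.
Qed.

Lemma prod_between n i m (F : nat -> R) : (m <= n)%N ->
  \prod_(j < n | (i < j)%N && (j < m)%N) F (j - i)%N = \prod_(1 <= k < (m - i.+1).+1) F k.
Proof.
elim: m => [|m IH] mn.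
  by rewrite big_nil big_pred0 // => j; rewrite ltn0 andbF.
case: (ltnP i m) => im; last first.
  rewrite (_ : m.+1 - i.+1 = 0)%N; last by lia.
  by rewrite big_nil big_pred0 // => j; apply/negbTE; lia.
rewrite (_ : m.+1 - i.+1 = (m - i.+1).+1)%N; last by lia.
rewrite big_nat_recr //= -IH ?(ltnW mn) // (bigD1 (Ordinal mn)) /=; last by rewrite im ltnSn.
rewrite mulrC; congr (_ * F _); last by lia.
by apply: eq_bigl => j; rewrite -(inj_eq val_inj) /=; lia.
Qed.

Definition Gp p r : R := \prod_(a < r | p a) bfac a 0.
(** In a row of length r, the boxes above a lower row of length s are those with arm at least r -
    s. *)
Definition Hp p r s l : R := \prod_(a < r | p a && (r - s <= a)%N) hfac a l.

Lemma conj_part_size lam j : (conj_part lam j <= size lam)%N.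
Proof. exact: count_size. Qed.

(* Factoring b(a, l) as b(a, 0) h(a, 1) ... h(a, l) distributes the boxes of row [i] over
   the pairs of rows (i, j). *)
Lemma rowB_pairs p lam n (i : 'I_n) : (size lam <= n)%N ->
  rowB p lam i = Gp p (prow lam i) *
    \prod_(j < n | (i < j)%N) Hp p (prow lam i) (prow lam j) (j - i).
Proof.
move=> sn; rewrite /Gp /Hp (exchange_big_dep (fun a : 'I__ => p a)) /= => [|j a _ /andP[]//].
rewrite -big_split /= /rowB (reindex_inj rev_ord_inj) /=.
apply: eq_big => [c|c]; rewrite /arm; have lc := ltn_ord c.
  by congr p; lia.
move=> pc; rewrite (_ : prow lam i - (prow lam i - c.+1).+1 = c)%N in pc *; last by lia.
rewrite bfac_leg; congr (_ * _).
rewrite /leg -(@prod_between n i _ (fun k => hfac c k)) //; last first.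
  by rewrite (leq_trans (conj_part_size _ _)).
apply: eq_bigl => j; rewrite conj_partP pc /=; congr (_ && _).
by lia.
Qed.

Lemma Gp_S p r : ~~ p r -> Gp p r.+1 = Gp p r.
Proof. by move=> /negbTE pr; rewrite /Gp big_mkcond big_ord_recr /= pr mulr1 -big_mkcond. Qed.

Lemma Hp_SS p r s l : ~~ p r -> Hp p r.+1 s.+1 l = Hp p r s l.
Proof.
move=> /negbTE pr; rewrite /Hp big_mkcond big_ord_recr /= pr /= mulr1 -big_mkcond.
by apply: eq_bigl => a; rewrite subSS.
Qed.

Lemma Hp_Sl p r s l : (s <= r)%N -> ~~ p r -> ~~ p (r - s)%N -> Hp p r.+1 s l = Hp p r s l.
Proof.
move=> sr /negbTE pr prs; rewrite /Hp big_mkcond big_ord_recr /= pr /= mulr1 -big_mkcond.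
apply: eq_bigl => a; case pa: (p a) => //=.
case: (eqVneq (a : nat) (r - s)%N) => [e|ne]; first by rewrite -e pa in prs.
by move: ne; have := ltn_ord a; lia.
Qed.

Lemma Hp_Sr p r s l : (s < r)%N -> p (r - s).-1 -> Hp p r s.+1 l = hfac (r - s).-1 l * Hp p r s l.
Proof.
move=> sr pr; have lt : ((r - s).-1 < r)%N by lia.
rewrite /Hp (bigD1 (Ordinal lt)) /=; last by rewrite pr /=; lia.
congr (_ * _); apply: eq_bigl => a; rewrite -(inj_eq val_inj) /=.
by case: (p a) => //=; lia.
Qed.

(** A pair of rows of lengths r and s involves the arms from r - s to r - 1. By the three conditions
    on [p], the arms that enter or leave this range are not selected, except when only the lower row
    grows: then r - s - 1 enters, is selected, and gives the factor of [psi]. *)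
Lemma Bp_strip p n lam (J : {set 'I_n}) : (size lam <= n)%N -> good lam J ->
  (forall i, i \in J -> ~~ p (prow lam i)) ->
  (forall i j : 'I_n, (i < j)%N -> i \in J -> j \notin J -> ~~ p (prow lam i - prow lam j)%N) ->
  (forall i j : 'I_n, (i < j)%N -> i \notin J -> j \in J -> p (prow lam i - prow lam j).-1) ->
  Bp p (vs lam J) = psi q t lam J * Bp p lam.
Proof.
move=> sn g h1 h2 h3; rewrite !(@Bp_widen _ _ n) ?size_vs // /psi -big_split; apply: eq_bigr => i _ /=.
rewrite !rowB_pairs ?size_vs // mulrCA -big_split /= prow_vs //; congr (_ * _).
  by case iJ: (i \in J); rewrite ?addn0 // addn1 Gp_S // h1.
apply: eq_bigr => j ij; rewrite prow_vs //.
have le := prow_anti lam (ltnW ij); have /goodP/(_ i j (ltnW ij)) := g.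
case iJ: (i \in J); case jJ: (j \in J) => /=; rewrite ?addn0 ?addn1 ?mul1r => le' //.
- by rewrite Hp_SS // h1.
- by rewrite Hp_Sl ?h1 // h2 ?jJ.
- by rewrite Hp_Sr ?h3 ?iJ.
Qed.

Section AddBox.
Variables (n : nat) (lam : part) (i : 'I_n).
Hypotheses (sn : (size lam <= n)%N) (g : good lam [set i]).
Local Notation mu := (vs lam [set i]).
Local Notation c := (prow lam i).

(** Above row i the legs grow by one in the column of the new box, which gives [psi]. In row i all
    arms grow by one, and the new corner contributes [bfac 0 0]. *)
Lemma Bp_addbox : Bp xpredT mu = psi q t lam [set i] *
   (bfac 0 0 * \prod_(j < c) (bfac (c - j) (leg lam i j) / bfac (c - j.+1) (leg lam i j))) *
   Bp xpredT lam.
Proof.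
have leE j : (j < c)%N -> leg mu i j = leg lam i j.
  by move=> jc; rewrite /leg (conj_addbox sn g) (ltn_eqF jc) addn0.
rewrite !(@Bp_widen _ _ n) ?size_vs // (bigD1 i) //= [in RHS](bigD1 i) //=.
have -> : rowB xpredT mu i = bfac 0 0 * \prod_(j < c) bfac (c - j) (leg lam i j).
  rewrite /rowB (prow_addbox sn g) eqxx addn1 big_ord_recr [RHS]mulrC /=; congr (_ * _).
    apply: eq_bigr => j _; rewrite leE // /arm (prow_addbox sn g) eqxx.
    by congr bfac; lia.
  rewrite /arm /leg (prow_addbox sn g) eqxx (conj_addbox sn g) eqxx (conj_addbox0 sn g).
  by congr bfac; lia.
have -> : rowB xpredT lam i = \prod_(j < c) bfac (c - j.+1) (leg lam i j) by [].
set A := \prod_(j < c) bfac (c - j)%N (leg lam i j); set B := \prod_(j < c) bfac (c - j.+1)%N (leg lam i j).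
have -> : \prod_(j < c) (bfac (c - j)%N (leg lam i j) / bfac (c - j.+1)%N (leg lam i j)) = A / B.
  by rewrite -prodf_div.
have B0 : B != 0 by apply/prodf_neq0 => j _; rewrite gt_eqF // bfac_gt0.
suff -> : \prod_(i0 < n | i0 != i) rowB xpredT mu i0 =
     psi q t lam [set i] * \prod_(i0 < n | i0 != i) rowB xpredT lam i0.
  by field.
have -> : psi q t lam [set i] = \prod_(k < n | k != i)
    if (k < i)%N then hfac (prow lam k - c).-1 (i - k) else 1.
  rewrite /psi (bigD1 i) //= big1 ?mul1r => [|j _]; last by rewrite inE eqxx.
  apply: eq_bigr => k ki; rewrite inE ki /=; case: ifP => lt.
    rewrite (bigD1 i) //= inE eqxx big1 ?mulr1 // => j /andP[_ /negbTE ne].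
    by rewrite inE ne.
  rewrite big1 // => j kj; rewrite inE; case: eqP => // e; by rewrite -e kj in lt.
rewrite -big_split; apply: eq_bigr => k ki /=; rewrite !rowB_pairs ?size_vs // (prow_addbox sn g).
have kiF : (k == i :> nat) = false by rewrite (inj_eq val_inj) (negbTE ki).
rewrite kiF addn0 mulrCA; congr (_ * _); case: ifP => lt.
  rewrite (bigD1 i) //= [in RHS](bigD1 i) //= mulrA (prow_addbox sn g) eqxx addn1.
  rewrite Hp_Sr ?(lt_addbox sn g) //; congr (_ * _); apply: eq_bigr => j /andP[_ ne].
  by rewrite (prow_addbox sn g) (inj_eq val_inj) (negbTE ne) addn0.
rewrite mul1r; apply: eq_bigr => j kj; rewrite (prow_addbox sn g).
case: eqP => [e|_]; last by rewrite addn0.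
by move: lt; rewrite -e kj.
Qed.

End AddBox.

End BoxProducts.

Lemma Er1 (R : realFieldType) (q t : R) pi : 0 < q -> q < 1 -> 0 < t -> t < 1 ->
  Er q t 1 pi = pi 1%N.
Proof.
move=> q0 q1 t0 t1; have := congr1 (fun f => co f 1) (euler_eser q0 q1 t0 t1 pi).
rewrite /= mul1r big_ord_recl big_ord1 /= mul0r add0r !mul1r => ->.
by rewrite -[Er _ _ _ _]/(co (Ker q t pi (om q t)) 0) Ker0 mulr1.
Qed.

Section Norm.
Variables (R : realFieldType) (q t : R).
Hypotheses (q0 : 0 < q) (q1 : q < 1) (t0 : 0 < t) (t1 : t < 1).
Variables (c : part -> part -> R) (N : part -> R).
Hypothesis H : macdata q t c N.
Implicit Types (pi : nat -> R) (lam mu nu kap : part).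
Local Notation P := (Pf c).

Lemma Pf_free d (a : part -> R) : (forall pi, \sum_(lam <- PD d) a lam * P lam pi = 0) ->
  forall lam, sumn lam = d -> a lam = 0.
Proof. by move=> E; apply: (Pf_indep_eq q0 q1 t0 t1 H) => x; exact: E. Qed.

(** The indices [i0] and [j0] are the only ones with their common partition, so each side has a
    single term there and independence equates the two. *)
Lemma coef_extract d (I J : finType) (A : pred I) (B : pred J) (f : I -> part) (g : J -> part)
    (F : I -> R) (G : J -> R) i0 j0 :
  (forall i, A i -> sumn (f i) = d) -> (forall j, B j -> sumn (g j) = d) ->
  A i0 -> B j0 -> f i0 = g j0 -> (forall i, A i -> f i = f i0 -> i = i0) ->
  (forall j, B j -> g j = g j0 -> j = j0) ->
  (forall pi, \sum_(i | A i) F i * P (f i) pi = \sum_(j | B j) G j * P (g j) pi) -> F i0 = G j0.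
Proof.
move=> fd gd Ai Bj e fi gj E; apply/eqP; rewrite -subr_eq0; apply/eqP.
pose a kap := \sum_(i | A i && (f i == kap)) F i - \sum_(j | B j && (g j == kap)) G j.
have <- : a (f i0) = F i0 - G j0.
  rewrite /a (big_pred1 i0) => [|i]; last first.
    by apply/andP/eqP => [[Ai' /eqP]|->]; [exact: fi | rewrite Ai eqxx].
  rewrite (big_pred1 j0) // => j; rewrite e.
  by apply/andP/eqP => [[Bj' /eqP]|->]; [exact: gj | rewrite Bj eqxx].
apply: (@Pf_free d) => [pi|]; last exact: fd.
under eq_bigr do rewrite mulrBl; rewrite sumrB.
rewrite -(sum_partition_seq F (P^~ pi)) ?PD_uniq // => [|i Ai']; last by rewrite mem_PD fd.
rewrite -(sum_partition_seq G (P^~ pi)) ?PD_uniq // => [|j Bj']; last by rewrite mem_PD gd.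
by rewrite E subrr.
Qed.

Lemma om1 : om q t 1 * bfac q t 0 0 = 1.
Proof.
have := subX_gt0 q0 q1 (ltn0Sn 0); have := subX_gt0 t0 t1 (ltn0Sn 0).
rewrite /om /bfac !expr1 !expr0 !mul1r mulr1 => a b.
by field; rewrite !gt_eqF.
Qed.

Lemma om_neq0 k : (0 < k)%N -> om q t k != 0.
Proof.
by move=> k0; rewrite /om mulf_neq0 ?signr_eq0 // gt_eqF // divr_gt0 // subX_gt0.
Qed.

Lemma bfac_swap a l : bfac t q a l = (bfac q t l a)^-1.
Proof. by rewrite /bfac invf_div [t ^+ a * _]mulrC [t ^+ a.+1 * _]mulrC. Qed.

Lemma Pf_pos lam pi pi' : (forall k, (0 < k)%N -> pi k = pi' k) -> P lam pi = P lam pi'.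
Proof.
move=> E; apply: eq_bigr => be _; congr (_ * _); rewrite /pm big_seq [RHS]big_seq.
by apply: eq_bigr => r rb; rewrite E //; have /andP[] := part_le rb.
Qed.

(** The Pieri rule of the dual family for r = 1, transported back by dividing p_k by om_k. *)
Lemma pieri_dual n lam pi : (sumn lam < n)%N ->
  pi 1%N / om q t 1 * (P lam pi / N lam) =
  \sum_(J : {set 'I_n} | (#|J| == 1)%N && good (cpart lam) J)
     psi t q (cpart lam) J / N (cpart (vs (cpart lam) J)) * P (cpart (vs (cpart lam) J)) pi.
Proof.
move=> ln; have HD := dual_macdata q0 q1 t0 t1 H; pose pi' k := pi k / om q t k.
have sl : (sumn (cpart lam) + 1 <= n)%N by rewrite sumn_cpart addn1.
have := pieri t0 t1 q0 q1 HD pi' sl; rewrite Er1 // Pf_dc /Qf cpartK => E.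
have pE mu : P mu (fun k => om q t k * pi' k) = P mu pi.
  by apply: Pf_pos => k k0; rewrite /pi' mulrC divfK // om_neq0.
rewrite pE in E; transitivity (pi' 1%N * (P lam pi / N lam)); first by [].
rewrite E; apply: eq_bigr => J _.
by rewrite Pf_dc /Qf pE; ring.
Qed.

(** The coefficient of P_mu in p_1 P_lam is found from the Pieri rule and from the dual one. The
    dual rule contains the norms, so the comparison determines N mu / N lam; the two [psi] account
    for the column above the new box and for the row to its left. *)
Lemma norm_addbox n lam (i : 'I_n) : (sumn lam < n)%N -> good lam [set i] ->
  N (vs lam [set i]) * Bp q t xpredT (vs lam [set i]) = N lam * Bp q t xpredT lam.
Proof.
move=> ln g; have sl : (size lam <= n)%N by rewrite (leq_trans (size_le_sumn _)) // ltnW.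
have cn : (prow lam i < n)%N by rewrite (leq_ltn_trans (prow_le_sumn _ _)).
have c0 : (prow lam 0 < n)%N by rewrite (leq_ltn_trans (prow_le_sumn _ _)).
pose j := Ordinal cn; have [gj vj] := vs_cpart sl g (erefl : j = prow lam i :> nat) c0.
set mu := vs lam [set i] in vj *.
have E : psi q t lam [set i] / (om q t 1 * N lam) = psi t q (cpart lam) [set j] / N mu.
  have := @coef_extract (sumn lam).+1 _ _ (fun I : {set 'I_n} => (#|I| == 1%N) && good lam I)
    (fun J : {set 'I_n} => (#|J| == 1%N) && good (cpart lam) J)
    (fun I => vs lam I) (fun J => cpart (vs (cpart lam) J))
    (fun I => psi q t lam I / (om q t 1 * N lam))
    (fun J => psi t q (cpart lam) J / N (cpart (vs (cpart lam) J))) [set i] [set j].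
  rewrite /= vj cpartK; apply.
  - by move=> I /andP[/eqP cI _]; rewrite sumn_vs // cI addn1.
  - move=> J /andP[/eqP cJ _]; rewrite sumn_cpart sumn_vs ?cJ ?sumn_cpart ?addn1 //.
    by rewrite size_cpart ltnW.
  - by rewrite cards1 eqxx.
  - by rewrite cards1 eqxx.
  - by [].
  - by move=> I /andP[_ gI]; exact: vs_inj.
  - by move=> J /andP[_ gJ] e; apply: (vs_inj gJ gj); rewrite vj -e cpartK.
  move=> pi; apply: etrans (pieri_dual pi ln).
  have ln1 : (sumn lam + 1 <= n)%N by rewrite addn1.
  have := pieri q0 q1 t0 t1 H pi ln1; rewrite Er1 // => E.
  under eq_bigr do rewrite mulrAC.
  by rewrite -mulr_suml -E invfM; ring.
have psiE : psi t q (cpart lam) [set j] *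
    \prod_(k < prow lam i) (bfac q t (prow lam i - k) (leg lam i k) / bfac q t (prow lam i - k.+1) (leg lam i k)) = 1.
  rewrite /psi (exchange_big_dep xpredT) //= (bigD1 j) //= [X in _ * X * _]big1 ?mulr1; last first.
    by move=> k kj; rewrite big1 // => l _; rewrite !inE (negbTE kj) andbF.
  have -> : \prod_(k < n | (k < j)%N) (if (k \notin [set j]) && (j \in [set j]) then
       hfac t q (prow (cpart lam) k - prow (cpart lam) j).-1 (j - k) else 1) =
      \prod_(k < prow lam i) hfac t q (leg lam i k) (prow lam i - k).
    rewrite (big_ord_widen _ (fun k => hfac t q (leg lam i k) (prow lam i - k)) (ltnW cn)).
    apply: eq_bigr => k kj; rewrite !inE eqxx andbT -(inj_eq val_inj) /= (ltn_eqF kj) /=.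
    by congr hfac; rewrite !prow_cpart (conj_addbox0 sl g) /leg; lia.
  rewrite -big_split big1 //= => k _; rewrite /hfac !bfac_swap.
  have := bfac_gt0 q0 q1 t0 t1 (prow lam i - k) (leg lam i k).
  have := bfac_gt0 q0 q1 t0 t1 (prow lam i - k.+1) (leg lam i k).
  rewrite (_ : (prow lam i - k).-1 = prow lam i - k.+1)%N; last by lia.
  by move: (bfac _ _ _ _) (bfac _ _ _ _) => a b a0 b0; field; rewrite !gt_eqF.
rewrite (Bp_addbox q0 q1 t0 t1 sl g) -/mu.
have o0 := @om_neq0 1 isT; have N0 := mac_N0 H lam; have M0 := mac_N0 H mu.
have -> : psi q t lam [set i] = psi t q (cpart lam) [set j] / N mu * (om q t 1 * N lam).
  by rewrite -E divfK // mulf_neq0.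
have := om1; move: psiE.
move: (psi _ _ _ _) (\prod_(k < _) _) (om q t 1) (bfac _ _ _ _) (Bp _ _ _ _) => a b o u v ab ou.
transitivity (N lam * v * (a * b) * (o * u)); last by rewrite ab ou !mulr1.
by field.
Qed.

Lemma norm_Bp lam : N lam * Bp q t xpredT lam = 1.
Proof.
have [d] := ubnP (sumn lam); elim: d lam => // d IH lam; rewrite ltnS => ld.
have [->|ne] := eqVneq lam (mkpart [::]).
  have := mac_orth H (erefl (sumn (mkpart [::]))); rewrite eqxx mul1r sumn_mkpart PD0 big_seq1 => <-.
  have c1 : c (mkpart [::]) (mkpart [::]) = 1.
    rewrite -(Pf_nil H (fun=> 0)) /Pf sumn_mkpart PD0 big_seq1 /pm (_ : parts (mkpart [::]) = [::]) //.
    by rewrite big_nil mulr1.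
  by rewrite c1 /zz /Bp (_ : parts (mkpart [::]) = [::]) // !big_nil big_ord0 !mulr1.
have s0 : (0 < size lam)%N.
  rewrite lt0n; apply: contra ne => /eqP /size0nil e; apply/eqP/part_eq => k.
  by rewrite e -[RHS]/(prow (mkpart [::]) k) (mkpart_nth (s := [::])).
pose n := (sumn lam).+1; have sn : ((size lam).-1 < n)%N.
  by have := size_le_sumn lam; rewrite /n; lia.
(* Remove the last box of the last row. *)
pose i := Ordinal sn; pose nu := pof (fun k => prow lam k - (k == i))%N n.
have ls k : (prow lam k.+1 > 0)%N -> (k < i)%N by rewrite prow_gt0 /=; lia.
have nuE k : prow nu k = (prow lam k - (k == i))%N.
  rewrite prow_pof => [|m _]; last first.
    have := prow_anti lam (leqnSn m); have := ls m.
    by case: (prow lam m.+1) => [|r] // /(_ isT) mi; rewrite (ltn_eqF mi) subn0; lia.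
  case: (ltnP k n) => // kn; rewrite nth_default //.
  by apply: leq_trans kn; rewrite (leq_trans (size_le_sumn _)) // leqnSn.
have li : (0 < prow lam i)%N by rewrite prow_gt0 /=; lia.
have sE (k : 'I_n) : (prow nu k + (k \in [set i]) = prow lam k)%N.
  rewrite nuE inE -(inj_eq val_inj) /=; case: eqP => [->|_]; last by rewrite subn0 addn0.
  by move: li => /=; lia.
have g : good nu [set i] by apply/goodP => k l kl; rewrite !sE; exact: prow_anti.
have vE : vs nu [set i] = lam.
  rewrite /vs (@eq_eshape _ _ (fun k : 'I_n => prow lam k)); last exact: sE.
  by rewrite eshape_prow // /n (leq_trans (size_le_sumn _)).
have szn : (size nu <= n)%N by rewrite (leq_trans (size_mkpart _)) // size_mkseq.
have sumE : (sumn nu).+1 = sumn lam by rewrite -[in RHS]vE sumn_vs // cards1 addn1.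
rewrite -vE norm_addbox //; first by apply: IH; rewrite sumE.
by rewrite /n ltnS -sumE leqnSn.
Qed.

End Norm.

(** * The sum over odd arms *)

Section Substitution.
Variable R : comNzRingType.
Implicit Types f g A : ps R.

(* f(z^2) *)
Definition sq f : ps R := Ps (fun d => if odd d then 0 else co f d./2).

Lemma sum_even d (F : nat -> R) :
  \sum_(i < d.+1 | ~~ odd i) F i = \sum_(r < d.+1 | (r.*2 <= d)%N) F r.*2.
Proof.
transitivity (\sum_(r < d./2.+1) F r.*2); last first.
  have h : (d./2.+1 <= d.+1)%N by have := odd_double_half d; lia.
  rewrite (big_ord_widen_cond _ xpredT (fun r => F r.*2) h); apply: eq_bigl => r /=.
  by rewrite ltnS geq_half_double.
elim: d => [|d IH]; first by rewrite big_mkcond !big_ord1.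
rewrite big_mkcond big_ord_recr -big_mkcond IH [(d.+1)./2]/= uphalf_half /=.
case od: (odd d); last by rewrite /= addr0.
rewrite add1n [RHS]big_ord_recr /=; congr (_ + F _).
by rewrite doubleS -[in LHS](odd_double_half d) od.
Qed.

Lemma co_sqM f g d : co (f * sq g) d =
  \sum_(r < d.+1 | (r.*2 <= d)%N) co f (d - r.*2) * co g r.
Proof.
rewrite mulrC coM /=.
transitivity (\sum_(i < d.+1 | ~~ odd i) co f (d - i) * co g i./2).
  rewrite [RHS]big_mkcond; apply: eq_bigr => i _ /=.
  by case: (odd i); rewrite ?mul0r // mulrC.
rewrite (sum_even d (fun i => co f (d - i) * co g i./2)).
by apply: eq_bigr => r _; rewrite doubleK.
Qed.

Lemma sqM f g : sq (f * g) = sq f * sq g.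
Proof.
apply: psP => d; rewrite co_sqM /=; case od: (odd d).
  by rewrite big1 // => r h; rewrite oddB // od odd_double mul0r.
have [m ->] : exists m, d = m.*2 by exists d./2; rewrite -[LHS]odd_double_half od.
rewrite doubleK.
transitivity (\sum_(r < m.*2.+1 | (r < m.+1)%N) co f (m - r) * co g r).
  have mm : (m.+1 <= m.*2.+1)%N by lia.
  rewrite -(big_ord_widen_cond _ xpredT (fun r => co f (m - r) * co g r) mm).
  by rewrite -coM mulrC coM; apply: eq_bigr => r _; rewrite mulrC.
apply: eq_big => [r|r]; first by rewrite leq_double ltnS.
by move=> _; rewrite -doubleB odd_double doubleK.
Qed.

Lemma euler_sq f A : euler f = A * f -> euler (sq f) = (sq A + sq A) * sq f.
Proof.
move=> E; rewrite mulrDl -sqM -E; apply: psP => d /=; case od: (odd d).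
  by rewrite mulr0 addr0.
by rewrite -mulrDl -natrD addnn; congr (_%:R * _); rewrite -[LHS](odd_double_half d) od.
Qed.

Lemma euler_dil s f A : euler f = A * f -> euler (dil s f) = dil s A * dil s f.
Proof. by move=> E; rewrite -dilM -E; apply: psP => d /=; ring. Qed.

End Substitution.

Lemma sum_bij_seq (R : nmodType) (T U : eqType) (J : finType) (s : seq T) (u : seq U)
    (A : T -> pred J) (h : T -> J -> U) (f : U -> T) (g : U -> J) (F : T -> J -> R) :
  uniq s -> uniq u ->
  (forall x j, x \in s -> A x j -> [/\ h x j \in u, f (h x j) = x & g (h x j) = j]) ->
  (forall y, y \in u -> [/\ f y \in s, A (f y) (g y) & h (f y) (g y) = y]) ->
  \sum_(x <- s) \sum_(j | A x j) F x j = \sum_(y <- u) F (f y) (g y).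
Proof.
move=> us uu H1 H2.
transitivity (\sum_(x <- s) \sum_(j | A x j) \sum_(y <- u) if y == h x j then F x j else 0).
  rewrite big_seq [RHS]big_seq; apply: eq_bigr => x xs; apply: eq_bigr => j Aj.
  have [hu _ _] := H1 x j xs Aj.
  by rewrite (sum_seq_delta (h x j) (fun=> F x j)) // hu.
under eq_bigr do rewrite exchange_big /=.
rewrite exchange_big /= big_seq [RHS]big_seq; apply: eq_bigr => y yu.
have [fs Af hy] := H2 y yu.
transitivity (\sum_(x <- s) if x == f y then F x (g y) else 0); last first.
  by rewrite (sum_seq_delta (f y) (fun x => F x (g y))) // fs.
rewrite big_seq [RHS]big_seq; apply: eq_bigr => x xs; case: eqP => [->|ne].
  rewrite (bigD1 (g y)) //= hy eqxx big1 ?addr0 // => j /andP[Aj /eqP ne].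
  by case: eqP => // e; case: ne; have [_ _ <-] := H1 _ j fs Aj; rewrite -e.
rewrite big1 // => j Aj; case: eqP => // e; case: ne.
by have [_ <- _] := H1 x j xs Aj; rewrite -e.
Qed.

Section OddRows.
Implicit Types lam mu nu : part.

Definition od lam : nat := count odd lam.
Definition evenp lam := all (fun r => ~~ odd r) lam.

Lemma evenpP lam : reflect (forall i, ~~ odd (prow lam i)) (evenp lam).
Proof.
apply: (iffP (all_nthP 0%N)) => H i; last by move=> _; exact: H.
by case: (ltnP i (size lam)) => [/H//|h]; rewrite nth_default.
Qed.

Lemma od_le lam : (od lam <= sumn lam)%N.
Proof.
rewrite /od; elim: (lam : seq nat) => //= a s IH.
by apply: leq_add => //; case: a => // a; exact: leq_trans (leq_b1 _) _.
Qed.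

Variable n : nat.
Definition oddr lam : {set 'I_n} := [set i : 'I_n | odd (prow lam i)].
Definition down lam : part := eshape (fun i : 'I_n => (prow lam i - odd (prow lam i))%N).

Lemma card_oddr lam : (size lam <= n)%N -> #|oddr lam| = od lam.
Proof.
move=> sn; rewrite /od -sum1_count -sum1_card (big_nth 0%N) big_mkord.
rewrite (big_ord_widen_cond _ (fun i => odd (prow lam i)) (fun=> 1%N) sn).
apply: eq_bigl => i; rewrite inE; case: ltnP => h; rewrite ?andbT ?andbF //.
by rewrite nth_default.
Qed.

Lemma prow_down lam (i : 'I_n) : prow (down lam) i = (prow lam i - odd (prow lam i))%N.
Proof.
rewrite prow_eshape // => j k jk; have := prow_anti lam jk.
have := odd_double_half (prow lam j); have := odd_double_half (prow lam k).
by case: (odd (prow lam j)); case: (odd (prow lam k)); lia.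
Qed.

Lemma down_vs lam : (size lam <= n)%N ->
  [/\ good (down lam) (oddr lam), vs (down lam) (oddr lam) = lam & evenp (down lam)].
Proof.
move=> sn.
have E (i : 'I_n) : (prow (down lam) i + (i \in oddr lam) = prow lam i)%N.
  rewrite prow_down inE; have := odd_double_half (prow lam i).
  by case: (odd (prow lam i)); lia.
have g : good (down lam) (oddr lam) by apply/goodP => i j ij; rewrite !E prow_anti.
split=> //.
  by rewrite /vs -[RHS](eshape_prow sn); apply: eq_eshape => i; exact: E.
apply/evenpP => i; case: (ltnP i n) => h; last by rewrite nth_default // (leq_trans _ h) ?size_eshape.
rewrite -[i]/(val (Ordinal h)) prow_down /=.
by rewrite oddB ?oddb ?addbb //; case: (prow lam i) => // m; case: (odd _).
Qed.

Lemma vs_down nu J : (size nu <= n)%N -> good nu J -> evenp nu ->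
  down (vs nu J) = nu /\ oddr (vs nu J) = J.
Proof.
move=> sn g /evenpP ev.
have O (i : 'I_n) : odd (prow (vs nu J) i) = (i \in J).
  by rewrite prow_vs // oddD (negbTE (ev i)) oddb.
split; last by apply/setP => i; rewrite inE O.
rewrite -[RHS](eshape_prow sn); apply: eq_eshape => i.
by rewrite O prow_vs // addnK.
Qed.

Lemma good_oddr lam : good lam (oddr lam).
Proof.
apply/goodP => i j ij; rewrite !inE; have := prow_anti lam ij.
have := odd_double_half (prow lam i); have := odd_double_half (prow lam j).
by case: (odd (prow lam j)); case: (odd (prow lam i)); lia.
Qed.

(** A box must be added in every odd row and in no even one. *)
Lemma evenp_vs lam J : (size lam <= n)%N -> good lam J -> evenp (vs lam J) = (J == oddr lam).
Proof.
move=> sn g; apply/evenpP/eqP => [ev|-> i].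
  apply/setP => i; have := ev i; rewrite prow_vs // oddD oddb inE.
  by case: (i \in J); case: (odd _).
case: (ltnP i n) => h; last by rewrite nth_default // (leq_trans _ h) ?size_vs.
rewrite -[i]/(val (Ordinal h)) prow_vs ?good_oddr // inE oddD oddb.
by case: (odd _).
Qed.

End OddRows.

Section OddArms.
Variables (R : realFieldType) (q t : R).
Hypotheses (q0 : 0 < q) (q1 : q < 1) (t0 : 0 < t) (t1 : t < 1).
Variables (c : part -> part -> R) (N : part -> R).
Hypothesis H : macdata q t c N.
Implicit Types (pi : nat -> R) (lam mu nu kap : part).
Local Notation P := (Pf c).
Local Notation Q := (Qf c N).
Local Notation B := (Bp q t odd).

Definition evens d := [seq nu <- PD d | evenp nu].
Definition Phi (d : nat) pi : R := \sum_(nu <- evens d) B nu * P nu pi.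

(** Differences of even rows are even, hence not selected, and an arm one less than a positive such
    difference is odd: the conditions of [Bp_strip] hold. *)
Lemma Bp_even_up n nu (J : {set 'I_n}) : (size nu <= n)%N -> good nu J -> evenp nu ->
  B (vs nu J) = psi q t nu J * B nu.
Proof.
move=> sn g /evenpP ev; apply: Bp_strip => // i j ij iJ jJ.
  have le := prow_anti nu (ltnW ij); by rewrite oddB // (negbTE (ev i)) (negbTE (ev j)).
have /goodP/(_ i j (ltnW ij)) := g; rewrite (negbTE iJ) jJ addn0 addn1 => lt.
have : odd (prow nu i - prow nu j) = false by rewrite oddB ?(ltnW lt) // (negbTE (ev i)) (negbTE (ev j)).
have : (0 < prow nu i - prow nu j)%N by rewrite subn_gt0.
by case: (prow nu i - prow nu j)%N => //= m _ /negbFE.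
Qed.

Lemma Phi_Er a e pi : Phi a pi * Er q t e pi =
  \sum_(lam <- [seq lam <- PD (a + e)%N | od lam == e]) B lam * P lam pi.
Proof.
set n := (a + e)%N; rewrite mulr_suml.
transitivity (\sum_(nu <- evens a) \sum_(I : {set 'I_n} | (#|I| == e) && good nu I)
   B nu * (psi q t nu I * P (vs nu I) pi)).
  rewrite big_seq [RHS]big_seq; apply: eq_bigr => nu; rewrite mem_filter mem_PD => /andP[_ /eqP nd].
  rewrite -mulr_sumr -(@pieri R q t q0 q1 t0 t1 c N H n) ?nd //.
  by rewrite -mulrA [P _ _ * _]mulrC.
rewrite (@sum_bij_seq _ _ _ _ _ [seq lam <- PD n | od lam == e] _ (@vs n) (@down n) (@oddr n)).
- rewrite big_seq [RHS]big_seq; apply: eq_bigr => lam; rewrite mem_filter mem_PD => /andP[_ /eqP ld].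
  have sl : (size lam <= n)%N by rewrite (leq_trans (size_le_sumn _)) // ld.
  have [g vE ev] := down_vs sl.
  by rewrite mulrA [_ * psi _ _ _ _]mulrC -Bp_even_up ?vE // size_eshape.
- by rewrite filter_uniq // PD_uniq.
- by rewrite filter_uniq // PD_uniq.
- move=> nu I; rewrite mem_filter mem_PD => /andP[ev /eqP nd] /andP[/eqP cI g].
  have sn : (size nu <= n)%N by rewrite (leq_trans (size_le_sumn _)) // nd leq_addr.
  have [E1 E2] := vs_down sn g ev.
  rewrite E1 E2 mem_filter mem_PD sumn_vs // nd cI eqxx andbT.
  by rewrite -(@card_oddr n) ?size_vs // E2 cI eqxx.
- move=> lam; rewrite mem_filter mem_PD => /andP[/eqP lo /eqP ld].
  have sl : (size lam <= n)%N by rewrite (leq_trans (size_le_sumn _)) // ld.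
  have [g vE ev] := down_vs sl.
  rewrite vE g mem_filter ev mem_PD card_oddr // lo eqxx; split => //=.
  have := congr1 (fun la : part => sumn la) vE; rewrite sumn_vs ?size_eshape // card_oddr // lo ld.
  by rewrite /n => /addIn ->.
Qed.

(* The power sums of the "dual" variable y: they turn the kernel into the generating
   function of the e_r. *)
Definition eps (y : R) k : R := om q t k * y ^+ k.

Lemma Kd_eps r y pi : Kd q t r (eps y) pi = y ^+ r * Er q t r pi.
Proof.
rewrite /Kd mulr_sumr big_seq [RHS]big_seq; apply: eq_bigr => be; rewrite mem_PD => /eqP bd.
have -> : pm be (eps y) = y ^+ r * pm be (om q t).
  rewrite /pm /eps big_split mulrC; congr (_ * _) => /=.
  by rewrite prodrXr -bd sumnE.
by rewrite !mulrA; congr (_ / _); ring.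
Qed.

Lemma Kd_sym d pi pi' : Kd q t d pi pi' = Kd q t d pi' pi.
Proof. by apply: eq_bigr => be _; congr (_ / _); rewrite mulrC. Qed.

Lemma sum_strips n d (A : part -> pred {set 'I_n}) (F : part -> {set 'I_n} -> R) (G : part -> R) :
  (forall lam J, lam \in PDle d -> A lam J -> vs lam J \in PD d) ->
  \sum_(lam <- PDle d) \sum_(J | A lam J) F lam J * G (vs lam J) =
  \sum_(mu <- PD d) (\sum_(lam <- PDle d) \sum_(J | A lam J && (vs lam J == mu)) F lam J) * G mu.
Proof.
move=> HA; under [RHS]eq_bigr do rewrite mulr_suml.
rewrite [RHS]exchange_big /= big_seq [RHS]big_seq; apply: eq_bigr => lam ll.
by rewrite (@sum_partition_seq _ _ (PD d)) ?PD_uniq // => J; exact: HA.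
Qed.

Definition strip n d lam (J : {set 'I_n}) := good lam J && (#|J| == d - sumn lam)%N.

Lemma strip_PD n d lam (J : {set 'I_n}) : (d <= n)%N -> lam \in PDle d -> strip d lam J ->
  vs lam J \in PD d.
Proof.
rewrite mem_PDle mem_PD => dn ll /andP[_ /eqP cJ].
by rewrite sumn_vs ?cJ ?subnKC // (leq_trans (size_le_sumn _)) // (leq_trans ll).
Qed.

(** The Pieri rule seen through the kernel: adding y to one alphabet multiplies the kernel by the
    sum of the y^r e_r of the other, and the coefficients of P_mu are compared. *)
Lemma Qf_shift n d mu pi y : (d <= n)%N -> sumn mu = d -> Q mu (fun k => pi k + eps y k) =
  \sum_(lam <- PDle d) \sum_(J : {set 'I_n} | strip d lam J && (vs lam J == mu))
    psi q t lam J * (y ^+ #|J| * Q lam pi).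
Proof.
move=> dn md; apply/eqP; rewrite -subr_eq0; apply/eqP.
pose a mu := Q mu (fun k => pi k + eps y k) -
  \sum_(lam <- PDle d) \sum_(J : {set 'I_n} | strip d lam J && (vs lam J == mu))
    psi q t lam J * (y ^+ #|J| * Q lam pi).
rewrite -[LHS]/(a mu); apply: (Pf_free q0 q1 t0 t1 H (d := d)) => // pi''.
under eq_bigr do rewrite mulrBl; rewrite sumrB.
rewrite -(@sum_strips n d (fun lam J => strip d lam J) _ (P^~ pi'')); last first.
  by move=> lam J; exact: strip_PD.
have -> : \sum_(i <- PD d) Q i (fun k => pi k + eps y k) * P i pi'' =
    \sum_(i <- PD d) P i pi'' * Q i (fun k => pi k + eps y k) by apply: eq_bigr => i _; rewrite mulrC.
rewrite -(Ker_Pf q0 q1 t0 t1 H) Kd_sym.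
rewrite -[Kd _ _ _ _ _]/(co (Ker _ _ _ _) d) (KerD q0 q1 t0 t1) coM /=.
rewrite big_PDle -sumrB big1 // => i _; apply/eqP; rewrite subr_eq0; apply/eqP.
rewrite Kd_sym (Ker_Pf q0 q1 t0 t1 H) Kd_eps mulr_suml big_seq [RHS]big_seq.
apply: eq_bigr => lam; rewrite mem_PD => /eqP ld.
have li : (i <= d)%N by have := ltn_ord i.
have ln : (sumn lam + (d - i) <= n)%N by rewrite ld subnKC.
transitivity (y ^+ (d - i) * Q lam pi * (Er q t (d - i)%N pi'' * P lam pi'')); first by ring.
rewrite (@pieri R q t q0 q1 t0 t1 c N H n) // mulr_sumr /strip ld.
rewrite [RHS](eq_bigl (fun I : {set 'I_n} => (#|I| == d - i)%N && good lam I)); last first.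
  by move=> I; rewrite andbC.
by apply: eq_bigr => I /andP[/eqP -> _]; ring.
Qed.

Lemma Bp_odd_even lam : Bp q t xpredT lam = B lam * Bp q t (predC odd) lam.
Proof.
rewrite /Bp -big_split; apply: eq_bigr => i _ /=; rewrite /rowB.
by rewrite (bigID (fun j : 'I__ => odd (arm lam i j))) /=.
Qed.

(* The even arms give psi(lam, J) for the set J of odd rows of lam, so that the norms
   turn the odd arms of lam + J into those of lam. *)
Lemma Bp_odd_up n lam : (size lam <= n)%N ->
  B (vs lam (oddr n lam)) * N (vs lam (oddr n lam)) * psi q t lam (oddr n lam) / N lam = B lam.
Proof.
move=> sn; set J := oddr n lam; set mu := vs lam J.
have E : Bp q t (predC odd) mu = psi q t lam J * Bp q t (predC odd) lam.
  apply: Bp_strip => //=; first exact: good_oddr.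
  - by move=> i; rewrite inE negbK.
  - move=> i j ij; rewrite !inE => oi oj; have le := prow_anti lam (ltnW ij).
    by rewrite negbK oddB // oi (negbTE oj).
  - move=> i j ij; rewrite !inE => oi oj; have le := prow_anti lam (ltnW ij).
    have : odd (prow lam i - prow lam j) by rewrite oddB // (negbTE oi) oj.
    by case: (prow lam i - prow lam j)%N.
have Nl := norm_Bp q0 q1 t0 t1 H lam; have Nm := norm_Bp q0 q1 t0 t1 H mu.
have B0 p la : Bp q t p la != 0 by rewrite gt_eqF // Bp_gt0.
move: Nl Nm; rewrite !Bp_odd_even E => Nl Nm.
have b1 := B0 (predC odd) lam; have b2 := B0 odd lam.
have n0 := mac_N0 H lam.
transitivity (N mu * (B mu * (psi q t lam J * Bp q t (predC odd) lam)) / (N lam * Bp q t (predC odd) lam)).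
  by field; rewrite n0 b1.
have nb : N lam * Bp q t (predC odd) lam != 0 by rewrite mulf_neq0.
by apply: (mulIf nb); rewrite divfK // Nm -Nl; ring.
Qed.

(** Expand by [Qf_shift]: for given lam the only strip J leading to an even partition is the set of
    odd rows. [Bp_odd_up] turns the weight into b^oa of lam, and [Phi_Er] sums over the lam with
    exactly r odd rows. *)
Lemma Phi_shift d pi y : Phi d (fun k => pi k + eps y k) =
  \sum_(r < d.+1 | (r.*2 <= d)%N) Phi (d - r.*2)%N pi * (y ^+ r * Er q t r pi).
Proof.
pose w mu := if evenp mu then B mu * N mu else 0.
transitivity (\sum_(mu <- PD d) (\sum_(lam <- PDle d) \sum_(J : {set 'I_d} | strip d lam J && (vs lam J == mu))
    psi q t lam J * (y ^+ #|J| * Q lam pi)) * w mu).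
  rewrite /Phi big_filter big_mkcond big_seq [RHS]big_seq; apply: eq_bigr => mu; rewrite mem_PD => /eqP md.
  rewrite -(@Qf_shift d d mu pi y) // /w; case: ifP => _; last by rewrite mulr0.
  by rewrite /Qf; have n0 := mac_N0 H mu; field.
rewrite -(@sum_strips d d (fun lam J => strip d lam J)); last by move=> lam J; exact: strip_PD.
transitivity (\sum_(lam <- PDle d) if (sumn lam + od lam == d)%N then y ^+ od lam * (B lam * P lam pi) else 0).
  rewrite big_seq [RHS]big_seq; apply: eq_bigr => lam; rewrite mem_PDle => ll.
  have sl : (size lam <= d)%N by rewrite (leq_trans (size_le_sumn _)).
  transitivity (\sum_(J : {set 'I_d} | strip d lam J && (J == oddr d lam))
     psi q t lam J * (y ^+ #|J| * Q lam pi) * (B (vs lam J) * N (vs lam J))).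
    rewrite [RHS]big_mkcondr; apply: eq_bigr => J /andP[g _].
    by rewrite /w evenp_vs //; case: eqP; rewrite ?mulr0.
  rewrite (eq_bigl (fun J => (sumn lam + od lam == d)%N && (J == oddr d lam))); last first.
    move=> J; case: eqP => [->|_]; rewrite ?andbF // !andbT /strip good_oddr card_oddr //=.
    by rewrite -(eqn_add2l (sumn lam)) subnKC.
  case: eqP => e; last by rewrite big_pred0.
  rewrite (big_pred1 (oddr d lam)) // card_oddr // -[in RHS](Bp_odd_up sl) /Qf.
  by move: (psi _ _ _ _) (_^-1) => u v; ring.
rewrite big_PDle (reindex_inj rev_ord_inj) [RHS]big_mkcond /=; apply: eq_bigr => r _.
rewrite subSS; have rd : (r <= d)%N by have := ltn_ord r.
case: (leqP r.*2 d) => h; last first.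
  rewrite big_seq big1 // => lam; rewrite mem_PD => /eqP ld.
  by case: eqP => // e; have := od_le lam; rewrite ld in e *; lia.
rewrite mulrCA Phi_Er mulr_sumr [RHS]big_filter [RHS]big_mkcond /=.
rewrite (_ : d - r.*2 + r = d - r)%N; last by lia.
rewrite big_seq [RHS]big_seq; apply: eq_bigr => lam; rewrite mem_PD => /eqP ld.
rewrite ld; case: eqP => e; case: eqP => e' //; [by rewrite e' | lia | lia].
Qed.

Definition Phis pi : ps R := Ps (Phi^~ pi).

Lemma Phis_shift pi y :
  Phis (fun k => pi k + eps y k) = Phis pi * sq (dil y (eser q t pi)).
Proof. by apply: psP => d; rewrite co_sqM /= Phi_shift. Qed.

(** Determined by qt_m om_m^2 + gq_m om_(2m) = 0: the term of [Aev] in y alone must vanish, since y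
    enters [Phis_shift] only through the e_r. *)
Definition gq k : R := (1 + t ^+ k) / (1 + q ^+ k).
Definition Aev pi : ps R := Ps (fun k => if odd k || (k == 0)%N then 0 else
  qt q t k./2 * pi k./2 ^+ 2 + gq k./2 * pi k).

Lemma Aev_shift pi y :
  Aev (fun k => pi k + eps y k) = Aev pi + (sq (dil y (esl pi)) + sq (dil y (esl pi))).
Proof.
apply: psP => k; rewrite !coD /=; case ok: (odd k) => /=; first by rewrite !addr0.
have kE : k = (k./2).*2 by rewrite -[LHS]odd_double_half ok.
move: kE; move: (k./2) => m ->; rewrite double_eq0; case: (posnP m) => [->|m0]; first by rewrite /= mulr0 !addr0.
have E1 := qt_om q0 q1 t0 t1 m0.
have E2 : qt q t m * om q t m ^+ 2 + gq m * om q t m.*2 = 0.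
  rewrite expr2 mulrA E1 /gq /om.
  have := subX_gt0 q0 q1 m0; have := subX_gt0 t0 t1 m0.
  have qp : 0 < q ^+ m by rewrite exprn_gt0.
  have tp : 0 < t ^+ m by rewrite exprn_gt0.
  case: m m0 {E1} qp tp => // m _ qp tp tm qm.
  have dE (a : R) k' : a ^+ k'.*2 = (a ^+ k') ^+ 2 by rewrite -muln2 exprM.
  have -> : (-1) ^+ (m.+1).*2.-1 = -1 :> R by rewrite doubleS /= exprS dE sqrr_sign mulr1.
  rewrite [m.+1.-1]/= !dE.
  have -> (a b : R) : (-1) ^+ m * ((-1) ^+ m * (a / b)) = a / b.
    by rewrite mulrA -expr2 sqrr_sign mul1r.
  move: (q ^+ m.+1) (t ^+ m.+1) qp tp tm qm => u v up vp tm qm.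
  have h1 : 1 - v != 0 by rewrite gt_eqF.
  have h2 : 1 + u != 0 by rewrite gt_eqF // addr_gt0.
  have h3 : 1 - v ^+ 2 != 0.
    by rewrite -(expr1n _ 2) subr_sqr mulf_neq0 // gt_eqF // addr_gt0.
  by field; rewrite h1 h2 h3.
have -> : eps y m.*2 = om q t m.*2 * (y ^+ m) ^+ 2 by rewrite /eps -muln2 exprM.
rewrite /eps -E1; move: E2; move: (qt q t m) (gq m) (om q t m) (om q t m.*2) (y ^+ m) => a g o o2 z E2.
transitivity (a * pi m ^+ 2 + g * pi m.*2 + 2 * (z * (a * o * pi m)) + (a * o ^+ 2 + g * o2) * z ^+ 2).
  by ring.
by rewrite E2; ring.
Qed.

Lemma Phis0 pi : (forall k, (0 < k)%N -> pi k = 0) -> Phis pi = 1.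
Proof.
move=> p0; apply: psP => d; rewrite co1 /= /Phi /evens; case: d => [|d].
  rewrite PD0 /= big_seq1 (Pf_nil H) mulr1 /Bp (_ : parts (mkpart [::]) = [::]) //.
  by rewrite big_ord0.
rewrite big_seq big1 // => nu; rewrite mem_filter mem_PD => /andP[_ /eqP nd].
rewrite /Pf big_seq big1 ?mulr0 // => be; rewrite mem_PD nd => /eqP bd.
rewrite /pm; case E : (parts be) => [|r s]; first by rewrite E in bd.
rewrite big_cons p0 ?mul0r ?mulr0 //.
by have /andP[] : (0 < r <= sumn be)%N by apply: part_le; rewrite E inE eqxx.
Qed.

(** Induction on the number of dual variables: one more multiplies [Phis] by a factor whose
    logarithmic derivative is the increment of [Aev]. *)
Lemma Phis_ode_px n (y : 'I_n -> R) : let pi := fun k => om q t k * px y k in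
  euler (Phis pi) = Aev pi * Phis pi.
Proof.
elim: n y => [|n IH] y pi.
  have p0 k : pi k = 0 by rewrite /pi /px big_ord0 mulr0.
  rewrite Phis0 // euler1 (_ : Aev pi = 0) ?mul0r //.
  by apply: psP => k /=; rewrite !p0 expr0n /=; case: ifP => // _; ring.
have piE : pi = fun k => om q t k * px (fun i : 'I_n => y (widen_ord (leqnSn n) i)) k + eps (y ord_max) k.
  by apply: funext => k; rewrite /pi /px big_ord_recr /= mulrDr.
rewrite piE Phis_shift Aev_shift; set p := fun k => _.
have := IH (fun i : 'I_n => y (widen_ord (leqnSn n) i)); rewrite -/p => E.
apply: euler_odeM E _; apply: euler_sq; apply: euler_dil; exact: euler_eser.
Qed.

(** In each degree this is a polynomial identity in pi. Rescaling p_k by om_k turns the known case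
    into ordinary power sums of finitely many variables, where [wpoly_dense] applies. *)
Lemma Phis_ode pi : euler (Phis pi) = Aev pi * Phis pi.
Proof.
apply: psP => d; apply/eqP; rewrite -subr_eq0; apply/eqP.
pose f pi := co (euler (Phis pi)) d - co (Aev pi * Phis pi) d.
have wP m : wpoly m (Phi m).
  apply: wpoly_sum_seq => nu; rewrite mem_filter mem_PD => /andP[_ /eqP nd].
  by apply: wpolyZ; rewrite -nd; exact: wpoly_Pf.
have wA k : wpoly k (fun pi => co (Aev pi) k).
  case e : (odd k || (k == 0)%N).
    apply: (eq_wpoly (f := fun=> 0)); last exact: wpoly0.
    by move=> pi' /=; rewrite e.
  apply: (eq_wpoly (f := fun pi => qt q t k./2 * pi k./2 ^+ 2 + gq k./2 * pi k)).
    by move=> pi' /=; rewrite e.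
  move: e => /negbT; rewrite negb_or -lt0n => /andP[ok k0].
  have kE : k = (k./2).*2 by rewrite -[LHS]odd_double_half (negbTE ok).
  have h0 : (0 < k./2)%N by lia.
  apply: wpolyD; last by apply: wpolyZ; exact: wpoly_coord.
  apply: wpolyZ; rewrite {1}kE -addnn; apply: (eq_wpoly (f := fun pi => pi k./2 * pi k./2)) => //.
  by apply: wpolyM; exact: wpoly_coord.
have wf : wpoly d f.
  apply: (eq_wpoly (f := fun pi => d%:R * Phi d pi + (-1) * \sum_(i < d.+1) co (Aev pi) i * Phi (d - i)%N pi)).
    by move=> pi'; rewrite /f coM mulN1r.
  apply: wpolyD; first exact: wpolyZ.
  apply: wpolyZ; apply: wpoly_sum => i _.
  by rewrite -[d in wpoly d](subnKC (ltnSE (ltn_ord i))); apply: wpolyM.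
pose g pi := f (fun k => om q t k * pi k).
have g0 pi' : g pi' = 0.
  apply: (wpoly_dense q0 q1 t0 t1 H (d := d)); first exact: wpoly_scale.
  by move=> x; rewrite /g /f Phis_ode_px subrr.
rewrite -[LHS]/(f pi) -[RHS](g0 (fun k => pi k / om q t k)) /g.
have [cf Hf] := wf; rewrite !Hf; apply: eq_bigr => be _; congr (_ * _).
rewrite /pm big_seq [RHS]big_seq; apply: eq_bigr => r rb.
by rewrite mulrC divfK // om_neq0 //; have /andP[] := part_le rb.
Qed.

Definition Soa pi : ps R := Ps (fun d => \sum_(lam <- PD d) B lam * P lam pi).
Definition Aoa pi := Aev pi + esl pi.

(** Group the partitions by the number e of their odd rows and apply [Phi_Er]. *)
Lemma Soa_factor pi : Soa pi = Phis pi * eser q t pi.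
Proof.
apply: psP => d; rewrite coM /= (reindex_inj rev_ord_inj) /=.
transitivity (\sum_(e < d.+1) \sum_(lam <- PD d) if od lam == e then B lam * P lam pi else 0).
  rewrite exchange_big big_seq [RHS]big_seq; apply: eq_bigr => lam; rewrite mem_PD => /eqP ld.
  have lt : (od lam < d.+1)%N by rewrite ltnS -ld od_le.
  rewrite (bigD1 (Ordinal lt)) //= eqxx big1 ?addr0 // => e.
  by rewrite -(inj_eq val_inj) /= eq_sym => /negbTE ->.
apply: eq_bigr => e _; rewrite subSS; have ed : (e <= d)%N by have := ltn_ord e.
by rewrite subKn // Phi_Er (subnK ed) [RHS]big_filter [RHS]big_mkcond.
Qed.

Lemma Soa_ode pi : euler (Soa pi) = Aoa pi * Soa pi.
Proof. by rewrite Soa_factor; apply: euler_odeM (Phis_ode pi) (euler_eser _ _ _ _ _). Qed.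

Lemma Soa0 pi : co (Soa pi) 0 = 1.
Proof.
rewrite /= PD0 big_seq1 (Pf_nil H) mulr1 /Bp (_ : parts (mkpart [::]) = [::]) //.
by rewrite big_ord0.
Qed.

Lemma AoaD pi pi' : Aoa (fun k => pi k + pi' k) =
  Aoa pi + (Aoa pi' + (sq (logK q t pi pi') + sq (logK q t pi pi'))).
Proof.
apply: psP => k; rewrite !coD /=; case ok: (odd k) => /=.
  by rewrite !add0r !addr0; case: eqP => _; rewrite ?addr0 // mulrDr.
have kE : k = (k./2).*2 by rewrite -[LHS]odd_double_half ok.
move: kE; move: (k./2) => m ->; rewrite double_eq0; case: eqP => _; first by rewrite !addr0.
by move: (qt _ _ _) (gq _) (_ ^+ _.-1) => a b s; ring.
Qed.

Lemma SoaD pi pi' : Soa (fun k => pi k + pi' k) = Soa pi * (Soa pi' * sq (Ker q t pi pi')).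
Proof.
apply: (@ode_uniq _ (Aoa (fun k => pi k + pi' k))).
- by rewrite coD /= addr0.
- by rewrite !coM0 !Soa0 /= -[Kd _ _ _ _ _]/(co (Ker _ _ _ _) 0) Ker0 !mulr1.
- exact: Soa_ode.
rewrite AoaD; apply: euler_odeM (Soa_ode _) _; apply: euler_odeM (Soa_ode _) _.
by apply: euler_sq; exact: euler_Ker.
Qed.

End OddArms.

(** * The sum over even legs and the skew identity *)

Section EvenLegs.
Variables (R : realFieldType) (q t : R).
Hypotheses (q0 : 0 < q) (q1 : q < 1) (t0 : 0 < t) (t1 : t < 1).
Variables (c : part -> part -> R) (N : part -> R).
Hypothesis H : macdata q t c N.
Implicit Types (pi : nat -> R) (lam mu nu kap : part).
Local Notation P := (Pf c).
Local Notation Q := (Qf c N).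

Definition Bel lam : R := \prod_(i < size lam)
  \prod_(j < prow lam i | ~~ odd (leg lam i j)) bfac q t (arm lam i j) (leg lam i j).

Lemma prod_box_cpart lam (F : nat -> nat -> R) :
  \prod_(i < size (cpart lam)) \prod_(j < prow (cpart lam) i) F i j =
  \prod_(j < size lam) \prod_(i < prow lam j) F i j.
Proof.
have wd (mu : part) n (G : nat -> nat -> R) : (size mu <= n)%N -> (prow mu 0 <= n)%N ->
    \prod_(i < size mu) \prod_(j < prow mu i) G i j =
    \prod_(i < n) \prod_(j < n | (j < prow mu i)%N) G i j.
  move=> sn ln; have ri i : (prow mu i <= n)%N by rewrite (leq_trans (prow_anti mu (leq0n i))).
  rewrite (big_ord_widen _ (fun i => \prod_(j < prow mu i) G i j) sn) big_mkcond.
  apply: eq_bigr => i _; rewrite -(big_ord_widen _ (G i) (ri i)).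
  by case: ifP => // /negbT h; rewrite nth_default ?big_ord0 // leqNgt.
pose n := maxn (size lam) (prow lam 0).
have h1 : (size lam <= n)%N by rewrite leq_maxl.
have h2 : (prow lam 0 <= n)%N by rewrite leq_maxr.
have h3 : (prow (cpart lam) 0 <= n)%N by rewrite prow_cpart (leq_trans (conj_part_size _ _)).
have h4 : (size (cpart lam) <= n)%N by rewrite size_cpart.
rewrite (wd (cpart lam) n) // (wd lam n (fun j i => F i j)) // (exchange_big_dep xpredT) //=; apply: eq_bigr => j _.
by apply: eq_bigl => i; rewrite prow_cpart conj_partP.
Qed.

(** Conjugation exchanges arms and legs, and exchanging q and t as well inverts b: the boxes of odd
    leg cancel from the product over all boxes. *)
Lemma Bp_cpart lam : Bp t q odd (cpart lam) * Bp q t xpredT lam = Bel lam.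
Proof.
have Ea i j : arm (cpart lam) i j = leg lam j i by rewrite /arm /leg prow_cpart.
have El i j : leg (cpart lam) i j = arm lam j i by rewrite /arm /leg conj_part_cpart.
have -> : Bp t q odd (cpart lam) = \prod_(i < size (cpart lam)) \prod_(j < prow (cpart lam) i)
    (if odd (leg lam j i) then (bfac q t (arm lam j i) (leg lam j i))^-1 else 1).
  apply: eq_bigr => i _; rewrite /rowB big_mkcond; apply: eq_bigr => j _.
  by rewrite Ea El bfac_swap.
rewrite (prod_box_cpart lam (fun i j => if odd (leg lam j i) then (bfac q t (arm lam j i) (leg lam j i))^-1 else 1)) /Bp /Bel -big_split; apply: eq_bigr => i _ /=.
rewrite /rowB -big_split [RHS]big_mkcond; apply: eq_bigr => j _ /=.
by case: (odd _); rewrite ?mul1r // mulVf // gt_eqF // bfac_gt0.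
Qed.

Definition Sel pi : ps R := Ps (fun d => \sum_(lam <- PD d) Bel lam * P lam pi).

Definition undual pi : nat -> R := fun k => pi k / om q t k.

(** The dual functions are multiples of Q, not of P; the norm, which is the inverse of the product
    of b over all boxes, supplies the second factor in [Bp_cpart]. *)
Lemma Sel_dual pi : Sel pi = Soa t q (dc q t c N) (undual pi).
Proof.
apply: psP => d /=; transitivity (\sum_(mu <- [seq cpart la | la <- PD d]) Bel mu * P mu pi).
  apply: perm_big; apply: uniq_perm; rewrite ?PD_uniq ?map_inj_uniq ?PD_uniq //.
    exact: (can_inj cpartK).
  move=> mu; apply/idP/mapP => [|[la]]; last by rewrite !mem_PD => ld ->; rewrite sumn_cpart.
  by exists (cpart mu); rewrite ?cpartK // mem_PD sumn_cpart -mem_PD.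
rewrite big_map; apply: eq_bigr => la _.
have -> : Pf (dc q t c N) la (undual pi) = P (cpart la) pi / N (cpart la).
  rewrite Pf_dc /Qf; congr (_ / _); apply: Pf_pos => k k0.
  by rewrite /undual mulrC divfK // om_neq0.
rewrite -Bp_cpart cpartK -[Bp t q odd la * _ * _]mulrA; congr (_ * _).
have n0 := mac_N0 H (cpart la); apply: (mulfI n0).
by rewrite mulrA (norm_Bp q0 q1 t0 t1 H) mul1r mulrC divfK.
Qed.

Lemma SelD pi pi' : Sel (fun k => pi k + pi' k) = Sel pi * (Sel pi' * sq (Ker q t pi pi')).
Proof.
have HD := dual_macdata q0 q1 t0 t1 H.
rewrite !Sel_dual.
have -> : undual (fun k => pi k + pi' k) = fun k => undual pi k + undual pi' k.
  by apply: funext => k; rewrite /undual mulrDl.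
rewrite (SoaD t0 t1 q0 q1 HD); congr (_ * (_ * sq _)); apply: psP => d /=.
rewrite /Kd big_seq [RHS]big_seq; apply: eq_bigr => be _; rewrite -(zz_swap q0 q1 t0 t1).
have E pi1 : pm be (undual pi1) = pm be pi1 / pm be (om q t) by rewrite /pm /undual prodf_div.
have p0 : pm be (om q t) != 0.
  rewrite /pm prodf_seq_neq0; apply/allP => r rb; rewrite om_neq0 //.
  by have /andP[] := part_le rb.
have z0 : zz t q be != 0 by rewrite gt_eqF // zz_gt0.
by rewrite !E; field; rewrite z0 p0.
Qed.

Lemma Sel0 pi : co (Sel pi) 0 = 1.
Proof. by rewrite Sel_dual (Soa0 (dual_macdata q0 q1 t0 t1 H)). Qed.

(** Logarithmic derivative of the product over i < j common to both Theta: p_m^2 - p_(2m) is twice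
    the sum of the (x_i x_j)^m. *)
Definition Apair pi : ps R := Ps (fun k => if odd k || (k == 0)%N then 0 else
  qt q t k./2 * (pi k./2 ^+ 2 - pi k)).
Definition Alin (l : nat -> R) pi : ps R := Ps (fun k => if k == 0%N then 0 else l k * pi k).
(** From the one-variable factor of Theta_oa: 1 / (1 - x) gives 1, and for even k the two products
    in x^2 with base q^2 add 2 (q^k - (q t)^(k/2)) / (1 - q^k). *)
Definition loa k : R := if odd k then 1 else (1 + q ^+ k - 2 * (q * t) ^+ k./2) / (1 - q ^+ k).

Lemma sqX (a : R) m : a ^+ m.*2 = (a ^+ m) ^+ 2.
Proof. by rewrite -muln2 exprM. Qed.

Lemma sign_double_pred m : (0 < m)%N -> (-1) ^+ m.*2.-1 = -1 :> R.
Proof. by case: m => // m _; rewrite doubleS /= exprS sqX sqrr_sign mulr1. Qed.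

Lemma Sel_ode pi : euler (Sel pi) = (Alin (qt q t) pi + Apair pi) * Sel pi.
Proof.
rewrite Sel_dual (Soa_ode t0 t1 q0 q1 (dual_macdata q0 q1 t0 t1 H)); congr (_ * _).
apply: psP => k; rewrite !coD /=; case: (posnP k) => [->|k0]; first by rewrite /= !addr0.
rewrite orbF.
have E m : (0 < m)%N -> (-1) ^+ m.-1 * undual pi m = qt q t m * pi m.
  move=> m0; rewrite -(qt_om q0 q1 t0 t1 m0) -mulrA; congr (_ * _).
  by rewrite /undual mulrC divfK // om_neq0.
rewrite E // addrC; congr (_ + _); case ok: (odd k) => //.
have kE : k = (k./2).*2 by rewrite -[LHS]odd_double_half ok.
have m0 : (0 < k./2)%N by lia.
move: k0 m0; rewrite kE doubleK; move: (k./2) => m k0 m0.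
have u2 : undual pi m.*2 = - qt q t m.*2 * pi m.*2.
  by rewrite mulNr -E // sign_double_pred // mulN1r opprK.
have um : undual pi m ^+ 2 = (qt q t m * pi m) ^+ 2.
  by rewrite -E // [RHS]exprMn sqrr_sign mul1r.
rewrite um u2 /qt /gq !sqX.
have := subX_gt0 q0 q1 m0; have := subX_gt0 t0 t1 m0.
have qp : 0 < q ^+ m by rewrite exprn_gt0.
have tp : 0 < t ^+ m by rewrite exprn_gt0.
move: (q ^+ m) (t ^+ m) qp tp => u v up vp tm qm.
have h1 : 1 - v != 0 by rewrite gt_eqF.
have h3 : 1 - u != 0 by rewrite gt_eqF.
have h2 : 1 + v != 0 by rewrite gt_eqF // addr_gt0.
have h4 : 1 - u ^+ 2 != 0.
  by rewrite -(expr1n _ 2) subr_sqr mulf_neq0 // gt_eqF // addr_gt0.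
by field; rewrite h1 h2 h3 h4.
Qed.

Lemma Soa_ode' pi : euler (Soa q t c pi) = (Alin loa pi + Apair pi) * Soa q t c pi.
Proof.
rewrite (Soa_ode q0 q1 t0 t1 H); congr (_ * _).
apply: psP => k; rewrite !coD /=; case: (posnP k) => [->|k0]; first by rewrite /= !addr0.
rewrite orbF /loa; case ok: (odd k).
  rewrite add0r addr0 -[k in (-1) ^+ k.-1]odd_double_half ok /=; congr (_ * _).
  by rewrite add0n sqX sqrr_sign.
have kE : k = (k./2).*2 by rewrite -[LHS]odd_double_half ok.
have m0 : (0 < k./2)%N by lia.
move: k0 m0; rewrite kE doubleK; move: (k./2) => m k0 m0.
rewrite sign_double_pred // /qt /gq !sqX exprMn.
have := subX_gt0 q0 q1 m0.
have qp : 0 < q ^+ m by rewrite exprn_gt0.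
move: (q ^+ m) (t ^+ m) qp => u v up qm.
have h3 : 1 - u != 0 by rewrite gt_eqF.
have h2 : 1 + u != 0 by rewrite gt_eqF // addr_gt0.
have h4 : 1 - u ^+ 2 != 0 by rewrite -(expr1n _ 2) subr_sqr mulf_neq0.
by field; rewrite h2 h3 h4.
Qed.

End EvenLegs.

Section Skew.
Variables (R : realFieldType) (q t : R).
Hypotheses (q0 : 0 < q) (q1 : q < 1) (t0 : 0 < t) (t1 : t < 1).
Variables (c : part -> part -> R) (N : part -> R).
Hypothesis H : macdata q t c N.
Implicit Types (pi : nat -> R) (lam mu nu kap eta : part).
Local Notation P := (Pf c).
Local Notation Q := (Qf c N).

Variable g : part -> part -> part -> R.
Hypothesis gE : forall eta nu pi,
  P eta pi * P nu pi = \sum_(lam <- PD (sumn eta + sumn nu)%N) g eta nu lam * P lam pi.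

(** The coproduct of P_lam, dual to multiplication: the kernel of pi + pi' with pi'' factors, and
    the products of P in pi'' are expanded by [g]. The inner sum is P_(lam/eta)(pi). *)
Lemma Pf_add lam pi pi' : P lam (fun k => pi k + pi' k) =
  \sum_(eta <- PDle (sumn lam)) (\sum_(nu <- PD (sumn lam - sumn eta)%N)
     g eta nu lam * (N lam / (N eta * N nu)) * P nu pi) * P eta pi'.
Proof.
set d := sumn lam; apply/eqP; rewrite -subr_eq0; apply/eqP.
pose a lam := Q lam (fun k => pi k + pi' k) -
  \sum_(eta <- PDle d) \sum_(nu <- PD (d - sumn eta)%N) g eta nu lam * (Q nu pi * Q eta pi').
transitivity (N lam * a lam).
  rewrite /a mulrBr; have nl := mac_N0 H lam; congr (_ - _); first by rewrite /Qf; field.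
  rewrite mulr_sumr; apply: eq_bigr => eta _; rewrite mulr_suml mulr_sumr; apply: eq_bigr => nu _.
  have ne := mac_N0 H eta; have nn := mac_N0 H nu.
  by rewrite /Qf; field; rewrite nn ne.
rewrite (Pf_free q0 q1 t0 t1 H (d := d) (a := a)) ?mulr0 // => pi''.
under eq_bigr do rewrite mulrBl; rewrite sumrB.
have -> : \sum_(i <- PD d) Q i (fun k => pi k + pi' k) * P i pi'' =
    \sum_(i <- PD d) P i pi'' * Q i (fun k => pi k + pi' k) by apply: eq_bigr => i _; rewrite mulrC.
rewrite -(Ker_Pf q0 q1 t0 t1 H) Kd_sym -[Kd _ _ _ _ _]/(co (Ker _ _ _ _) d) (KerD q0 q1 t0 t1) mulrC coM.
under [X in _ - X]eq_bigr do rewrite mulr_suml.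
rewrite [X in _ - X]exchange_big /= big_PDle -sumrB big1 // => e _.
have ed : (e <= d)%N by have := ltn_ord e.
apply/eqP; rewrite subr_eq0; apply/eqP.
rewrite (Kd_sym q t e) (Kd_sym q t (d - e)%N) !(Ker_Pf q0 q1 t0 t1 H) big_distrlr.
rewrite big_seq [RHS]big_seq; apply: eq_bigr => eta; rewrite mem_PD => /eqP etad /=.
under [RHS]eq_bigr do rewrite mulr_suml.
rewrite [RHS]exchange_big /= etad big_seq [RHS]big_seq; apply: eq_bigr => nu; rewrite mem_PD => /eqP nud.
transitivity (P eta pi'' * P nu pi'' * (Q nu pi * Q eta pi')); first by ring.
rewrite gE etad nud subnKC // mulr_suml; apply: eq_bigr => la _.
by ring.
Qed.

Variable b : part -> R.
Definition Sb pi : ps R := Ps (fun d => \sum_(lam <- PD d) b lam * P lam pi).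
Hypothesis SbD : forall pi pi',
  Sb (fun k => pi k + pi' k) = Sb pi * (Sb pi' * sq (Ker q t pi pi')).

(** The degree d part of sum_lam b_lam P_(lam/eta). For sum_mu b_mu Q_(eta/mu) the whole series in z
    is kept in [skR], because it is multiplied by [Sb]; it stops at degree |eta|. *)
Definition skL eta d pi : R := \sum_(lam <- PD (sumn eta + d)%N) b lam *
  \sum_(nu <- PD d) g eta nu lam * (N lam / (N eta * N nu)) * P nu pi.
Definition skR eta pi : ps R := Ps (fun r => if (r <= sumn eta)%N then
  \sum_(mu <- PD (sumn eta - r)%N) b mu * \sum_(nu <- PD r) g mu nu eta * Q nu pi else 0).

Definition psX e : ps R := Ps (fun d => (d == e)%:R).
Lemma co_psXM e (f : ps R) d : co (psX e * f) d = if (e <= d)%N then co f (d - e) else 0.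
Proof.
rewrite coM /=; case: leqP => h.
  have lt : (e < d.+1)%N by [].
  rewrite (bigD1 (Ordinal lt)) //= eqxx mul1r big1 ?addr0 // => i.
  by rewrite -(inj_eq val_inj) /= => /negbTE ->; rewrite mul0r.
by rewrite big1 // => i _; rewrite ltn_eqF ?mul0r // (leq_ltn_trans _ h) // -ltnS.
Qed.

Lemma co_mul_trunc (f f1 f2 : ps R) d : (forall m, (m <= d)%N -> co f1 m = co f2 m) ->
  co (f * f1) d = co (f * f2) d.
Proof. by move=> E; rewrite !coM; apply: eq_bigr => i _; rewrite E // leq_subr. Qed.

(** Both sides are treated as coefficients of P_eta(pi') in total degree D = |eta| + d. Multiplied
    by P_eta(pi') and summed over eta, the left sides give S(pi + pi') by [Pf_add]; independence
    then separates the eta. *)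
Lemma skew_identity eta d pi : skL eta d pi = co (Sb pi * skR eta pi) d.
Proof.
pose D := (sumn eta + d)%N.
pose L (eta : part) := \sum_(lam <- PD D) b lam *
  \sum_(nu <- PD (D - sumn eta)%N) g eta nu lam * (N lam / (N eta * N nu)) * P nu pi.
pose a (eta : part) := L eta - co (Sb pi * skR eta pi) (D - sumn eta).
have De : (D - sumn eta = d)%N by rewrite /D addKn.
suff : a eta = 0 by rewrite /a /L De => /eqP; rewrite subr_eq0 => /eqP.
apply: (@Pf_indep R q t q0 q1 t0 t1 c N H D) => [x|]; last by rewrite /D leq_addr.
move: (px x) => pi' {x}; under eq_bigr do rewrite mulrBl; rewrite sumrB.
have -> : \sum_(eta <- PDle D) L eta * P eta pi' = co (Sb (fun k => pi k + pi' k)) D.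
  rewrite /L; under eq_bigr do rewrite mulr_suml.
  rewrite exchange_big /= big_seq [RHS]big_seq; apply: eq_bigr => lam; rewrite mem_PD => /eqP ld.
  rewrite Pf_add ld mulr_sumr; apply: eq_bigr => et _; by rewrite mulrA.
rewrite SbD; apply/eqP; rewrite subr_eq0; apply/eqP.
(* Up to degree D, S(pi') K(pi, pi') is the sum of the P_eta(pi') times [skR] of eta, by expanding
   P_mu(pi') P_nu(pi'); [psX] accounts for the degree of P_eta(pi'). *)
transitivity (co (Sb pi * (\sum_(eta <- PDle D) psC (P eta pi') * (psX (sumn eta) * skR eta pi))) D).
  apply: co_mul_trunc => m mD; rewrite co_sqM co_sum big_PDle.
  transitivity (\sum_(e < D.+1 | (e < m.+1)%N) \sum_(et <- PD e) P et pi' * co (skR et pi) (m - e)); last first.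
    rewrite [LHS]big_mkcond; apply: eq_bigr => e _; case: ifP => em.
      rewrite big_seq [RHS]big_seq; apply: eq_bigr => et; rewrite mem_PD => /eqP ed.
      by rewrite coCM co_psXM ed -ltnS em.
    rewrite big_seq big1 // => et; rewrite mem_PD => /eqP ed.
    by rewrite coCM co_psXM ed leqNgt -leqNgt -ltnS em mulr0.
  have mD' : (m.+1 <= D.+1)%N by [].
  rewrite -(big_ord_widen _ (fun e => \sum_(et <- PD e) P et pi' * co (skR et pi) (m - e)) mD').
  rewrite [RHS](reindex_inj rev_ord_inj) /= [LHS]big_mkcond; apply: eq_bigr => r _.
  rewrite subSS; have rm : (r <= m)%N by have := ltn_ord r.
  rewrite subKn //; case: leqP => h; last first.
    rewrite big_seq big1 // => et; rewrite mem_PD => /eqP ed.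
    by rewrite ed ifF ?mulr0 //; apply/negbTE; lia.
  have rm' : (r <= m - r)%N by lia.
  transitivity (\sum_(mu <- PD (m - r.*2)%N) \sum_(nu <- PD r) \sum_(et <- PD (m - r)%N)
      P et pi' * (b mu * (g mu nu et * Q nu pi))).
    rewrite Kd_sym (Ker_Pf q0 q1 t0 t1 H) big_distrlr big_seq [RHS]big_seq; apply: eq_bigr => mu.
    rewrite mem_PD => /eqP md /=; rewrite big_seq [RHS]big_seq; apply: eq_bigr => nu.
    rewrite mem_PD => /eqP nd.
    transitivity (b mu * Q nu pi * (P mu pi' * P nu pi')); first by ring.
    rewrite gE md nd (_ : m - r.*2 + r = m - r)%N; last by lia.
    by rewrite mulr_sumr; apply: eq_bigr => et _; ring.
  transitivity (\sum_(et <- PD (m - r)%N) \sum_(mu <- PD (m - r.*2)%N) \sum_(nu <- PD r)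
      P et pi' * (b mu * (g mu nu et * Q nu pi))).
    by rewrite [RHS]exchange_big; apply: eq_bigr => mu _; rewrite exchange_big.
  rewrite big_seq [RHS]big_seq; apply: eq_bigr => et; rewrite mem_PD => /eqP ed.
  rewrite ed rm' (_ : m - r - r = m - r.*2)%N; last by lia.
  by rewrite mulr_sumr; apply: eq_bigr => mu _; rewrite !mulr_sumr.
rewrite mulr_sumr co_sum big_seq [RHS]big_seq; apply: eq_bigr => et; rewrite mem_PDle => el.
rewrite mulrCA coCM mulrCA co_psXM el mulrC //.
Qed.

End Skew.

(** * Formal series and their evaluations *)

Lemma seq_row_inverse (F : fieldType) (T : choiceType) (s : seq T) (A : T -> T -> F) : uniq s ->
  (forall a : T -> F, (forall j, j \in s -> \sum_(i <- s) a i * A i j = 0) ->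
     forall i, i \in s -> a i = 0) ->
  exists B : T -> T -> F, forall i j, i \in s -> j \in s ->
    \sum_(k <- s) B i k * A k j = (i == j)%:R.
Proof.
move=> us H; case: (posnP (size s)) => [/size0nil ->|s0].
  by exists (fun _ _ => 0).
have [x0 x0s] : exists x0, x0 \in s by case: s s0 {us H} => // x s _; exists x; rewrite inE eqxx.
pose n := size s; pose e (i : 'I_n) := nth x0 s i.
have es i : e i \in s by rewrite mem_nth.
have lt i : i \in s -> (index i s < n)%N by rewrite index_mem.
pose ix i : 'I_n := insubd (Ordinal (lt _ x0s)) (index i s).
have ixK i : i \in s -> e (ix i) = i.
  by move=> si; rewrite /e /ix val_insubd lt // nth_index.
have eK : cancel e ix.
  move=> i; apply: val_inj; rewrite val_insubd lt //= index_uniq //.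
have bigE (G : T -> F) : \sum_(k <- s) G k = \sum_(k < n) G (e k).
  by rewrite (big_nth x0) big_mkord.
pose M : 'M[F]_n := \matrix_(i, j) A (e i) (e j).
have uM : M \in unitmx.
  rewrite -row_free_unit; apply/inj_row_free => v vM; apply/rowP => i; rewrite mxE.
  rewrite -[i]eK; apply: (H (fun k => v 0 (ix k))) => // j js.
  have /rowP/(_ (ix j)) := vM; rewrite !mxE => E; rewrite -[RHS]E bigE.
  by apply: eq_bigr => k _; rewrite !mxE eK ixK.
have ixE i j : i \in s -> j \in s -> (ix i == ix j) = (i == j).
  by move=> si sj; apply/eqP/eqP => [E|->//]; rewrite -(ixK i) // E ixK.
exists (fun i j => invmx M (ix i) (ix j)) => i j si sj; rewrite -ixE //.
have /matrixP/(_ (ix i) (ix j)) := mulVmx uM; rewrite !mxE => <-.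
by rewrite bigE; apply: eq_bigr => k _; rewrite mxE eK ixK.
Qed.

Section PowerSumBasis.
Variables (R : realFieldType) (q t : R).
Hypotheses (q0 : 0 < q) (q1 : q < 1) (t0 : 0 < t) (t1 : t < 1).
Implicit Types (lam be : part).

Lemma wpoly_prod_seq (s : seq nat) (F : nat -> (nat -> R) -> R) : (forall r, wpoly r (F r)) ->
  wpoly (sumn s) (fun pi => \prod_(r <- s) F r pi).
Proof.
move=> H; elim: s => [|r s IH] /=.
  by apply: (eq_wpoly (f := fun=> 1)); [move=> pi; rewrite big_nil | exact: wpoly1].
apply: (eq_wpoly (f := fun pi => F r pi * \prod_(r <- s) F r pi)).
  by move=> pi; rewrite big_cons.
exact: wpolyM.
Qed.

Lemma mm_wpoly n lam : exists a : part -> R,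
  forall x : 'I_n -> R, mm lam x = \sum_(be <- PD (sumn lam)) a be * pm be (px x).
Proof.
have [u [_ _ uE]] := Tri_inv (fun mu (_ : sumn mu = sumn lam) => @Tri_eb R n mu) erefl.
have : wpoly (sumn lam) (fun pi => \sum_(kap <- PD (sumn lam)) u kap * \prod_(r <- (cpart kap : seq nat)) Er q t r pi).
  apply: wpoly_sum_seq => kap; rewrite mem_PD => /eqP kd; apply: wpolyZ.
  rewrite -kd -sumn_cpart; apply: wpoly_prod_seq => r; exact: wpoly_Er.
move=> [a aE]; exists a => x; rewrite -aE uE; apply: eq_bigr => kap _; congr (_ * _).
by rewrite eb_prod; apply: eq_bigr => r _; rewrite Er_px.
Qed.

(** The matrix A from the m_lam to the p_be has trivial left kernel because the m_lam are
    independent. So it is invertible, and a relation between the p_be becomes one between the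
    m_lam. *)
Lemma pm_indep d (a : part -> R) :
  (forall x : 'I_d -> R, \sum_(be <- PD d) a be * pm be (px x) = 0) ->
  forall be, be \in PD d -> a be = 0.
Proof.
move=> H; have /choice[A AE] := mm_wpoly d.
have [|B BA] := @seq_row_inverse R part (PD d) A (PD_uniq d).
  move=> b bA lam ld; pose b' (lam : part) := if sumn lam == d then b lam else 0.
  move: ld; rewrite mem_PD => /eqP ld.
  suff : b' lam = 0 by rewrite /b' ld eqxx.
  apply: (@Tri_indep R q t q0 q1 t0 t1 d d (@mm R d) b' (@Tri_refl _ _ _)); rewrite ?ld //; last first.
    by rewrite -ld size_le_sumn.
  move=> mu; set x := pt _ _ _.
  transitivity (\sum_(la <- PD d) b la * mm la x).
    by rewrite sum_PD_PDle; apply: eq_bigr => la _; rewrite /b'; case: eqP; rewrite ?mul0r.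
  transitivity (\sum_(be <- PD d) (\sum_(la <- PD d) b la * A la be) * pm be (px x)).
    under [RHS]eq_bigr do rewrite mulr_suml.
    rewrite [RHS]exchange_big /= big_seq [RHS]big_seq; apply: eq_bigr => la; rewrite mem_PD => /eqP lad.
    by rewrite AE lad mulr_sumr; apply: eq_bigr => be _; rewrite mulrA.
  by rewrite big_seq big1 // => be bd; rewrite bA // mul0r.
pose b la := \sum_(be <- PD d) a be * B be la.
have b0 la : la \in PD d -> b la = 0.
  rewrite mem_PD => /eqP ld; pose b' (la : part) := if sumn la == d then b la else 0.
  suff : b' la = 0 by rewrite /b' ld eqxx.
  apply: (@Tri_indep R q t q0 q1 t0 t1 d d (@mm R d) b' (@Tri_refl _ _ _)); rewrite ?ld //; last first.
    by rewrite -ld size_le_sumn.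
  move=> mu; set x := pt _ _ _; rewrite -[RHS](H x).
  transitivity (\sum_(la <- PD d) b la * mm la x).
    by rewrite sum_PD_PDle; apply: eq_bigr => la' _; rewrite /b'; case: eqP; rewrite ?mul0r.
  under eq_bigr do rewrite mulr_suml.
  rewrite exchange_big /= big_seq [RHS]big_seq; apply: eq_bigr => be bd.
  under eq_bigr do rewrite -mulrA; rewrite -mulr_sumr; congr (_ * _).
  transitivity (\sum_(ga <- PD d) (be == ga)%:R * pm ga (px x)); last first.
    rewrite (bigD1_seq be) ?PD_uniq //= eqxx mul1r big1 ?addr0 // => ga /negbTE ne.
    by rewrite eq_sym ne mul0r.
  rewrite [RHS]big_seq; under [RHS]eq_bigr => ga gd do rewrite -BA // mulr_suml.
  rewrite -big_seq exchange_big /= big_seq [RHS]big_seq; apply: eq_bigr => la'.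
  rewrite mem_PD => /eqP lad; rewrite AE lad mulr_sumr; apply: eq_bigr => ga _; by rewrite mulrA.
move=> be bd; transitivity (\sum_(ga <- PD d) a ga * (ga == be)%:R).
  rewrite (bigD1_seq be) ?PD_uniq //= eqxx mulr1 big1 ?addr0 // => ga /negbTE ne.
  by rewrite ne mulr0.
rewrite big_seq; under eq_bigr => ga gd do rewrite -BA // mulr_sumr.
rewrite -big_seq exchange_big /= big_seq big1 // => la ld.
under eq_bigr do rewrite mulrA.
by rewrite -mulr_suml -/(b la) b0 // mul0r.
Qed.

End PowerSumBasis.

From mathcomp Require Import finmap multiset.
From mathcomp Require Import all_classical all_reals all_analysis.
Import numFieldNormedType.Exports.
Local Open Scope ring_scope.

Lemma fsum_seq (V : nmodType) (T : choiceType) (A : set T) (r : seq T) (F : T -> V) : uniq r ->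
  (forall i, i \in r -> A i) -> (forall i, A i -> i \notin r -> F i = 0) ->
  \sum_(i \in A) F i = \sum_(i <- r) F i.
Proof.
move=> ur rA F0; rewrite (fsbigE r) //.
rewrite big_mkcond big_seq [RHS]big_seq; apply: eq_bigr => i ir.
by rewrite mem_set //; exact: rA.
Qed.

Section Monomials.
Implicit Types (m a b : {mset nat}%mset).

Definition deg m : nat := size (m : seq nat).
Definition varlt n m : bool := all (fun i => i < n)%N (m : seq nat).

Lemma perm_msetD a b : perm_eq (a `+` b)%mset ((a : seq nat) ++ (b : seq nat)).
Proof.
by apply/allP => i _; rewrite /= count_cat !count_mem_mset msetE2.
Qed.

Lemma degD a b : deg (a `+` b)%mset = (deg a + deg b)%N.
Proof. by rewrite /deg (perm_size (perm_msetD a b)) size_cat. Qed.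

Lemma varltD n a b : varlt n (a `+` b)%mset = varlt n a && varlt n b.
Proof. by rewrite /varlt (perm_all _ (perm_msetD a b)) all_cat. Qed.

Lemma deg0 : deg mset0 = 0%N. Proof. by rewrite /deg enum_mset0. Qed.
Lemma deg_msetn k i : deg (msetn k i) = k.
Proof. by rewrite /deg enum_msetn size_nseq. Qed.
Lemma varlt0 n : varlt n mset0. Proof. by rewrite /varlt enum_mset0. Qed.
Lemma varlt_msetn n k i : (0 < k)%N -> varlt n (msetn k i) = (i < n)%N.
Proof. by rewrite /varlt enum_msetn all_nseq; case: k. Qed.

Lemma deg_eq0 m : deg m = 0%N -> m = mset0.
Proof. by move=> /size0nil h; rewrite -[m]seq_mset_id h; apply/msetP => i; rewrite mset_seqE mset0E. Qed.

Lemma ex_varlt m : exists n, varlt n m.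
Proof.
exists (\max_(i <- (m : seq nat)) i).+1; apply/allP => i im.
by rewrite ltnS (leq_bigmax_seq i im).
Qed.

Lemma varlt_widen n n' m : (n <= n')%N -> varlt n m -> varlt n' m.
Proof. by move=> nn /allP h; apply/allP => i /h /leq_trans; apply. Qed.

Lemma varlt_out n m i : varlt n m -> (n <= i)%N -> m i = 0%N.
Proof.
move=> /allP h ni; apply/eqP; rewrite mset_eq0; apply/negP => /h.
by rewrite ltnNge ni.
Qed.

Lemma deg_sum n m : varlt n m -> deg m = (\sum_(i < n) m i)%N.
Proof.
move=> /allP h; rewrite /deg -sum1_size.
under [RHS]eq_bigr do rewrite -count_mem_mset -sum1_count.
rewrite (exchange_big_dep xpredT) //= big_seq [RHS]big_seq; apply: eq_bigr => i im.
by rewrite (big_pred1 (Ordinal (h i im))) // => j; rewrite eq_sym.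
Qed.

Definition monoms n d : seq {mset nat}%mset :=
  undup [seq seq_mset [seq val i | i <- (w : d.-tuple 'I_n)] | w <- enum {: d.-tuple 'I_n}].

Lemma monoms_uniq n d : uniq (monoms n d). Proof. exact: undup_uniq. Qed.

Lemma mem_monoms n d m : (m \in monoms n d) = varlt n m && (deg m == d).
Proof.
rewrite mem_undup; apply/mapP/andP => [[tt _ ->]|[/allP h /eqP md]].
  rewrite /varlt (perm_all _ (perm_eq_seq_mset _)) /deg (perm_size (perm_eq_seq_mset _)).
  by rewrite size_map size_tuple; split=> //; apply/allP => _ /mapP[i _ ->]; exact: ltn_ord.
have sz : size (pmap (insub : nat -> option 'I_n) m) == d.
  by rewrite size_pmap_sub -[X in _ == X]md -all_count; apply/allP.
exists (Tuple sz); first by rewrite mem_enum.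
rewrite -[m in LHS]seq_mset_id; congr seq_mset.
rewrite /= (pmap_filter (@insubK _ _ _)); apply/esym/all_filterP/allP => i /h.
by rewrite /= isSome_insub.
Qed.

End Monomials.

Section Evaluation.
Variable R : realType.
Implicit Types (f g : fps R) (m a b : {mset nat}%mset).

Section Fixed.
Variables (n : nat) (x : 'I_n -> R).

Definition mx m : R := \prod_(i < n) x i ^+ m i.

Lemma mxD a b : mx (a `+` b)%mset = mx a * mx b.
Proof. by rewrite /mx -big_split; apply: eq_bigr => i _; rewrite msetE2 exprD. Qed.

Lemma mx0 : mx mset0 = 1.
Proof. by rewrite /mx big1 // => i _; rewrite mset0E. Qed.

Lemma mx_msetn k (i : 'I_n) : mx (msetn k (val i)) = x i ^+ k.
Proof.
rewrite /mx (bigD1 i) //= msetnxx big1 ?mulr1 // => j ne.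
by rewrite msetnE (inj_eq val_inj) (negbTE ne).
Qed.

(** The substitution of x_i z for the variable of index i < n and of 0 for the others. The grading
    by z makes every coefficient a finite sum, so the map is multiplicative on all formal series
    without any convergence. *)
Definition ev f : ps R := Ps (fun d => \sum_(m <- monoms n d) f m * mx m).

Lemma evM f g : ev (fmul f g) = ev f * ev g.
Proof.
apply: psP => d; rewrite coM /=.
pose L := flatten [seq monoms n i | i <- iota 0 d.+1].
have bigL (G : monom -> R) : \sum_(m <- L) G m = \sum_(i < d.+1) \sum_(m <- monoms n i) G m.
  by rewrite /L big_flatten big_map -(big_mkord xpredT (fun i => \sum_(m <- monoms n i) G m)) /index_iota subn0.
have memL m : (m \in L) = varlt n m && (deg m <= d)%N.
  apply/flattenP/andP => [[s /mapP[i]]|[vm md]].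
    by rewrite mem_iota add0n /= ltnS => id ->; rewrite mem_monoms => /andP[-> /eqP ->].
  by exists (monoms n (deg m)); [apply/mapP; exists (deg m); rewrite // mem_iota | rewrite mem_monoms vm eqxx].
have uL : uniq L.
  suff uk k i : uniq (flatten [seq monoms n j | j <- iota i k]) by exact: uk.
  elim: k i => [|k IH] i //=; rewrite cat_uniq monoms_uniq IH andbT /=.
  apply/hasPn => m /flattenP[s /mapP[j]]; rewrite mem_iota => /andP[ij _] ->.
  by rewrite !mem_monoms => /andP[_ /eqP ->]; rewrite gtn_eqF ?andbF.
transitivity (\sum_(b <- L) \sum_(c <- L) if deg (b `+` c)%mset == d then f b * g c * mx (b `+` c)%mset else 0).
  transitivity (\sum_(m <- monoms n d) \sum_(b <- L) \sum_(c <- L)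
      if m == (b `+` c)%mset then f b * g c * mx m else 0).
    rewrite big_seq [RHS]big_seq; apply: eq_bigr => m; rewrite mem_monoms => /andP[vm /eqP md].
    rewrite /fmul (@fsum_seq _ _ _ [seq p <- [seq (b, c) | b <- L, c <- L] | m == (p.1 `+` p.2)%mset]).
    - rewrite big_filter big_mkcond big_allpairs_dep /= mulr_suml; apply: eq_bigr => b _.
      by rewrite mulr_suml; apply: eq_bigr => c _; case: eqP; rewrite ?mul0r.
    - by rewrite filter_uniq // allpairs_uniq // => -[? ?] [? ?] _ _.
    - by move=> p; rewrite mem_filter => /andP[/eqP h _] /=; rewrite -h.
    move=> [b c] /= e; rewrite mem_filter /= e eqxx /= => /negP[].
    move: vm md; rewrite -e varltD degD => /andP[vb vc] bcd.
    by apply/allpairsP; exists (b, c); rewrite /= !memL vb vc /=; split=> //; lia.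
  rewrite exchange_big /= big_seq [RHS]big_seq; apply: eq_bigr => b; rewrite memL => /andP[vb _].
  rewrite exchange_big /= big_seq [RHS]big_seq; apply: eq_bigr => c; rewrite memL => /andP[vc _].
  rewrite (sum_seq_delta (b `+` c)%mset (fun m => f b * g c * mx m)) ?monoms_uniq //.
  by rewrite mem_monoms varltD vb vc.
rewrite bigL; apply: eq_bigr => i _; rewrite mulr_suml big_seq [RHS]big_seq; apply: eq_bigr => b.
rewrite mem_monoms => /andP[_ /eqP bi]; rewrite bigL.
have lt : (d - i < d.+1)%N by rewrite ltnS leq_subr.
have id : (i <= d)%N by have := ltn_ord i.
rewrite (bigD1 (Ordinal lt)) //= [X in _ + X]big1 ?addr0 => [|j ne].
  rewrite mulr_sumr big_seq [RHS]big_seq; apply: eq_bigr => c; rewrite mem_monoms => /andP[_ /eqP ci].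
  by rewrite degD bi ci subnKC // eqxx mxD; ring.
rewrite big_seq big1 // => c; rewrite mem_monoms => /andP[_ /eqP ci].
rewrite degD bi ci; case: eqP => // e; move: ne; rewrite -(inj_eq val_inj) /=.
by case: eqP => // h; case: h; lia.
Qed.

Lemma ev_fterm c m : ev (fterm c m) = if varlt n m then psC (c * mx m) * psX R (deg m) else 0.
Proof.
apply: psP => d /=; case: ifP => vm; last first.
  rewrite big_seq big1 // => a; rewrite mem_monoms => /andP[va _].
  by rewrite /fterm; case: eqP => [e|_]; rewrite ?mul0r //; rewrite e vm in va.
rewrite coCM /=.
transitivity (\sum_(a <- monoms n d) if a == m then c * mx a else 0).
  by apply: eq_bigr => a _; rewrite /fterm; case: eqP; rewrite ?mul0r.
rewrite sum_seq_delta ?monoms_uniq // mem_monoms vm /= eq_sym.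
by case: eqP; rewrite ?mulr1 ?mulr0.
Qed.

Lemma ev1 : ev (fone R) = 1.
Proof.
rewrite ev_fterm varlt0 mx0 deg0 mulr1; apply: psP => d; rewrite coCM mul1r /=.
by case: d.
Qed.

Lemma evB f g : ev (fun a => f a - g a) = ev f - ev g.
Proof. by apply: psP => d; rewrite coD coN /= -sumrB; apply: eq_bigr => m _; rewrite mulrBl. Qed.

Lemma ev_prod I (r : seq I) (P : pred I) (F : I -> fps R) :
  ev (\big[@fmul R/fone R]_(i <- r | P i) F i) = \prod_(i <- r | P i) ev (F i).
Proof.
elim: r => [|i r IH]; first by rewrite !big_nil ev1.
by rewrite !big_cons; case: (P i); rewrite ?evM IH.
Qed.

Lemma ev_sum I (r : seq I) (P : pred I) (F : I -> fps R) :
  ev (fun a => \sum_(i <- r | P i) F i a) = \sum_(i <- r | P i) ev (F i).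
Proof.
apply: psP => d; rewrite co_sum /= exchange_big /=; apply: eq_bigr => m _.
by rewrite mulr_suml.
Qed.

Lemma evZ c f : ev (fun a => c * f a) = psC c * ev f.
Proof. by apply: psP => d; rewrite coCM /= mulr_sumr; apply: eq_bigr => m _; rewrite mulrA. Qed.

Lemma ev_co0 f : co (ev f) 0 = f mset0.
Proof.
rewrite /=; have -> : monoms n 0 = [:: mset0].
  have u := monoms_uniq n 0; have h m : (m \in monoms n 0) = (m == mset0).
    rewrite mem_monoms; apply/andP/eqP => [[_ /eqP/deg_eq0]//|->].
    by rewrite varlt0 deg0.
  by apply: perm_small_eq => //; apply: uniq_perm => // m; rewrite h inE.
by rewrite big_seq1 mx0 mulr1.
Qed.

End Fixed.

(* Kronecker's substitution x_i = z^(K^i) separates the monomials of bounded degree. *)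
Definition kron K n m : nat := (\sum_(i < n) m i * K ^ i)%N.

Lemma kron_inj K n (u v : nat -> nat) : (forall i, u i < K)%N -> (forall i, v i < K)%N ->
  (\sum_(i < n) u i * K ^ i = \sum_(i < n) v i * K ^ i)%N -> forall i, (i < n)%N -> u i = v i.
Proof.
elim: n u v => // n IH u v uK vK; rewrite !big_ord_recl /= !muln1.
have E w : (\sum_(i < n) w (bump 0 i) * K ^ bump 0 i = (\sum_(i < n) w i.+1 * K ^ i) * K)%N.
  by rewrite big_distrl; apply: eq_bigr => i _; rewrite /bump /= add1n expnSr mulnA.
rewrite !E => e; have K0 : (0 < K)%N by apply: leq_trans (uK 0%N).
have e0 : u 0%N = v 0%N.
  have := congr1 (modn^~ K) e; by rewrite /= ![(_ + _ * K)%N]addnC !modnMDl !modn_small.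
move: e; rewrite e0 => /addnI/eqP; rewrite eqn_pmul2r // => /eqP e [|i] // lt.
exact: (IH (fun i => u i.+1) (fun i => v i.+1)).
Qed.

Lemma mx_indep n d (c : monom -> R) :
  (forall x : 'I_n -> R, \sum_(m <- monoms n d) c m * mx x m = 0) ->
  forall m, varlt n m -> deg m = d -> c m = 0.
Proof.
move=> H m vm md; pose K := d.+1.
pose p : {poly R} := \sum_(a <- monoms n d) c a *: 'X^(kron K n a).
have p0 : p = 0.
  apply: (@poly_eq_neg R) => z _; rewrite horner0 -[RHS](H (fun i => z ^+ (K ^ i))).
  rewrite horner_sum; apply: eq_bigr => a _; rewrite hornerZ hornerXn; congr (_ * _).
  rewrite /kron /mx -prodrXr; apply: eq_bigr => i _.
  by rewrite mulnC exprM.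
have := congr1 (fun r : {poly R} => r`_(kron K n m)) p0; rewrite coef0 coef_sum => <-.
transitivity (\sum_(a <- monoms n d) if a == m then c a else 0).
  by rewrite sum_seq_delta ?monoms_uniq // mem_monoms vm md eqxx.
rewrite big_seq [RHS]big_seq; apply: eq_bigr => a; rewrite mem_monoms => /andP[va /eqP ad].
rewrite coefZ coefXn; case: (eqVneq a m) => [->|ne]; first by rewrite eqxx mulr1.
case: eqP => [e|_]; last by rewrite mulr0.
case/eqP: ne; apply/msetP => i; case: (ltnP i n) => h; last by rewrite !(varlt_out _ h).
have bd b : varlt n b -> deg b = d -> forall i, (b i < K)%N.
  by move=> _ bd' j; rewrite ltnS -bd' -count_mem_mset count_size.
by apply: (@kron_inj K n a m) => //; exact: bd.
Qed.

Lemma ev_inj_at f g n a : (forall x : 'I_n -> R, ev x f = ev x g) -> varlt n a -> f a = g a.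
Proof.
move=> E va; apply/eqP; rewrite -subr_eq0; apply/eqP.
apply: (@mx_indep n (deg a) (fun m => f m - g m)) => // x.
have := congr1 (fun h => co h (deg a)) (E x) => /= /eqP; rewrite -subr_eq0 => /eqP h.
by rewrite -[RHS]h -sumrB; apply: eq_bigr => m _; rewrite mulrBl.
Qed.

Lemma ev_inj f g : (forall n (x : 'I_n -> R), ev x f = ev x g) -> f = g.
Proof. by move=> E; apply: funext => a; have [n] := ex_varlt a; apply: ev_inj_at. Qed.

End Evaluation.

Section SymmetricSeries.
Variable R : realType.
Implicit Types (f g : fps R) (m a b : {mset nat}%mset) (lam mu be : part).

Definition mof n (al : 'I_n -> nat) : {mset nat}%mset :=
  \big[@msetD nat/mset0]_(i < n) msetn (al i) (val i).

Lemma mof_at n (al : 'I_n -> nat) k : mof al k = (\sum_(i < n) if k == i :> nat then al i else 0)%N.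
Proof.
rewrite /mof; elim/big_ind2: _ => [|m1 n1 m2 n2 <- <-|i _]; first exact: mset0E.
  by rewrite msetE2.
by rewrite msetnE.
Qed.

Lemma mofE n (al : 'I_n -> nat) (i : 'I_n) : mof al i = al i.
Proof.
rewrite mof_at (bigD1 i) //= eqxx big1 ?addn0 // => j ne.
by rewrite (inj_eq val_inj) eq_sym (negbTE ne).
Qed.

Lemma varltP n m : (forall i, (n <= i)%N -> m i = 0%N) -> varlt n m.
Proof.
move=> H; apply/allP => i im; rewrite ltnNge; apply/negP => /H e.
by move: im; rewrite -mset_neq0 e.
Qed.

Lemma varlt_mof n (al : 'I_n -> nat) : varlt n (mof al).
Proof.
apply: varltP => k nk; rewrite mof_at big1 // => i _.
by case: eqP => // e; move: nk; rewrite e leqNgt ltn_ord.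
Qed.

Lemma varlt_eq n a b : varlt n a -> varlt n b -> (forall i : 'I_n, a i = b i) -> a = b.
Proof.
move=> va vb E; apply/msetP => k; case: (ltnP k n) => h; first exact: (E (Ordinal h)).
by rewrite !(varlt_out _ h).
Qed.

Lemma deg_mof n (al : 'I_n -> nat) : deg (mof al) = (\sum_i al i)%N.
Proof. by rewrite (deg_sum (varlt_mof al)); apply: eq_bigr => i _; rewrite mofE. Qed.

Definition shape n m : part := eshape (fun i : 'I_n => m i).

Lemma sumn_shape n m : varlt n m -> sumn (shape n m) = deg m.
Proof. by move=> vm; rewrite sumn_eshape -deg_sum. Qed.

Lemma msymE n lam m : varlt n m -> msym R lam m = (shape n m == lam)%:R.
Proof.
move=> vm; rewrite /msym; congr (nat_of_bool _)%:R.
rewrite -[in RHS](mkpart_id lam) mkpartP.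
have -> : [seq x <- lam | (0 < x)%N] = lam.
  apply/all_filterP/allP => x xl; rewrite lt0n; apply: contraTneq xl => ->.
  exact: part_neq0.
rewrite filter_map.
have E : perm_eq (finsupp m) [seq val i | i <- [seq i <- enum 'I_n | (0 < m (val i))%N]].
  apply: uniq_perm; rewrite ?fset_uniq ?(map_inj_uniq val_inj) ?(filter_uniq _ (enum_uniq _)) //.
  move=> k; rewrite mem_finsupp; apply/idP/mapP => [k0|[i]].
    have kn : (k < n)%N by rewrite ltnNge; apply/negP => /(varlt_out vm) e; rewrite e in k0.
    by exists (Ordinal kn); rewrite // mem_filter /= lt0n k0 mem_enum.
  by rewrite mem_filter => /andP[h _] ->; rewrite -lt0n.
have := perm_map (fun i => m i) E; rewrite -map_comp => /permPl ->.
by [].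
Qed.

Lemma eq_ev n (x : 'I_n -> R) f g : (forall m, varlt n m -> f m = g m) -> ev x f = ev x g.
Proof.
move=> E; apply: psP => d /=; rewrite big_seq [RHS]big_seq; apply: eq_bigr => m.
by rewrite mem_monoms => /andP[vm _]; rewrite E.
Qed.

Lemma big_monoms n d (F : {mset nat}%mset -> R) :
  \sum_(m <- monoms n d) F m =
  \sum_(al : {ffun 'I_n -> 'I_d.+1} | (\sum_i al i)%N == d) F (mof (fun i => al i)).
Proof.
pose e (al : {ffun 'I_n -> 'I_d.+1}) := mof (fun i => al i).
pose s := [seq e al | al <- enum [pred al : {ffun 'I_n -> 'I_d.+1} | (\sum_i al i)%N == d]].
have ei : injective e.
  move=> al al' E; apply/ffunP => i; apply: val_inj.
  by rewrite -[LHS](mofE (fun i => al i)) -[RHS](mofE (fun i => al' i)) -/(e al) -/(e al') E.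
rewrite (perm_big s) /=.
  by rewrite big_map big_filter.
apply: uniq_perm; rewrite ?monoms_uniq ?map_inj_uniq ?enum_uniq // => m.
rewrite mem_monoms; apply/andP/mapP => [[vm /eqP md]|[al]]; last first.
  by rewrite mem_enum inE => /eqP h ->; rewrite varlt_mof deg_mof h.
have lt (i : 'I_n) : (m i < d.+1)%N by rewrite ltnS -md -count_mem_mset count_size.
have E : m = e [ffun i => Ordinal (lt i)].
  by apply: (varlt_eq vm (varlt_mof _)) => i; rewrite mofE ffunE.
exists [ffun i => Ordinal (lt i)] => //.
rewrite mem_enum inE -[X in _ == X]md (deg_sum vm); apply/eqP.
by apply: eq_bigr => i _; rewrite ffunE.
Qed.

Lemma mx_mof n (x : 'I_n -> R) (al : 'I_n -> nat) : mx x (mof al) = mon x al.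
Proof. by apply: eq_bigr => i _; rewrite mofE. Qed.

Lemma ev_msym n (x : 'I_n -> R) lam : ev x (msym R lam) = psC (mm lam x) * psX R (sumn lam).
Proof.
apply: psP => d; rewrite coCM /= big_monoms.
transitivity (\sum_(al : {ffun 'I_n -> 'I_d.+1} | ((\sum_i al i)%N == d) && (eshape (fun i => al i : nat) == lam))
    mon x (fun i => al i)).
  rewrite [RHS]big_mkcondr; apply: eq_bigr => al _.
  rewrite (msymE _ (varlt_mof _)) mx_mof /shape (@eq_eshape n _ (fun i => al i : nat)).
    by case: eqP; rewrite ?mul1r ?mul0r.
  by move=> i; rewrite mofE.
case: (eqVneq d (sumn lam)) => [->|ne]; rewrite ?mulr1 ?mulr0; last first.
  rewrite big_pred0 // => al; apply/negbTE/negP => /andP[/eqP h /eqP e].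
  by move: ne; rewrite -e sumn_eshape h eqxx.
apply: eq_bigl => al; case: eqP => //= ne; apply/esym/negP => /eqP e.
by apply: ne; rewrite -[in RHS]e sumn_eshape.
Qed.

Lemma ev_psum n (x : 'I_n -> R) r : (0 < r)%N -> ev x (psum R r) = psC (px x r) * psX R r.
Proof.
move=> r0; rewrite (@eq_ev _ _ _ (fun a => \sum_(i < n) fterm 1 (msetn r (val i)) a)).
  rewrite ev_sum /px psC_sum mulr_suml; apply: eq_bigr => i _.
  by rewrite ev_fterm varlt_msetn // ltn_ord mul1r mx_msetn deg_msetn.
move=> m vm; rewrite /psum (@fsum_seq _ _ _ (iota 0 n)) ?iota_uniq //.
  by rewrite -[in LHS](subn0 n) -/(index_iota 0 n) big_mkord.
move=> i _; rewrite mem_iota add0n /= -leqNgt => ni; rewrite /fterm; case: eqP => // e.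
by move: vm; rewrite e varlt_msetn // ltnNge ni.
Qed.

Lemma psX_prod (s : seq nat) : \prod_(r <- s) psX R r = psX R (sumn s).
Proof.
elim: s => [|r s IH] /=.
  by rewrite big_nil; apply: psP => d; rewrite co1.
rewrite big_cons IH; apply: psP => d; rewrite co_psXM /=.
case: leqP => h; first by rewrite -(eqn_add2l r) subnKC.
by rewrite ltn_eqF // (leq_trans h) // leq_addr.
Qed.

Lemma ev_psym n (x : 'I_n -> R) be : ev x (psym R be) = psC (pm be (px x)) * psX R (sumn be).
Proof.
rewrite /psym ev_prod /pm -psX_prod.
have -> : psC (\prod_(r <- be) px x r) = \prod_(r <- be) psC (px x r).
  by elim: (parts be) => [|r s IH]; rewrite ?big_nil ?psC1 // !big_cons psCM IH.
rewrite -big_split big_seq [RHS]big_seq; apply: eq_bigr => r rb /=.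
by rewrite ev_psum //; have /andP[] := part_le rb.
Qed.

Lemma mm_perm n lam (x : 'I_n -> R) (w : 'S_n) : mm lam (fun i => x (w i)) = mm lam x.
Proof.
rewrite /mm (reindex_inj (h := fun al : {ffun 'I_n -> 'I_(sumn lam).+1} => [ffun i => al (w i)])) /=.
  apply: eq_big => [al|al _].
    rewrite (@eq_eshape n _ (fun i => al (w i) : nat)); last by move=> i; rewrite ffunE.
    by rewrite (eshape_perm (fun i => al i : nat)).
  rewrite /mon [RHS](reindex_inj (@perm_inj _ w)); apply: eq_bigr => i _; by rewrite ffunE.
move=> al al' /ffunP E; apply/ffunP => i.
by have := E (w^-1 i)%g; rewrite !ffunE permKV.
Qed.

Lemma px_perm n (x : 'I_n -> R) (w : 'S_n) : px (fun i => x (w i)) = px x.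
Proof. by apply: funext => r; rewrite /px [RHS](reindex_inj (@perm_inj _ w)). Qed.

(** The series [f'], obtained from f by permuting exponents, has the same values as f, hence the
    same coefficients on monomials in n variables. *)
Lemma sym_shape f n a b :
  (forall (x : 'I_n -> R) (w : 'S_n), ev (fun i => x (w i)) f = ev x f) ->
  varlt n a -> varlt n b -> shape n a = shape n b -> f a = f b.
Proof.
move=> H va vb /eshape_permP[w wE].
pose sg m := mof (fun i : 'I_n => m ((w^-1)%g i : nat)).
have sgV m : varlt n m -> mof (fun i : 'I_n => sg m (w i : nat)) = m.
  by move=> vm; apply: (varlt_eq (varlt_mof _) vm) => i; rewrite !mofE permK.
have abE : sg a = b.
  by apply: (varlt_eq (varlt_mof _) vb) => i; rewrite mofE wE permKV.
pose f' : fps R := fun m => f (mof (fun i : 'I_n => m (w i : nat))).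
have -> : f a = f' b by rewrite /f' -abE sgV.
apply: (@ev_inj_at R f' f n b) => // x; rewrite -(H x w); apply: psP => d /=.
have sgd m : varlt n m -> deg (sg m) = deg m.
  move=> vm; rewrite deg_mof (deg_sum vm) [RHS](reindex_inj (@perm_inj _ (w^-1)%g)).
  by [].
rewrite (perm_big [seq sg m | m <- monoms n d]) /=.
  rewrite big_map big_seq [RHS]big_seq; apply: eq_bigr => m; rewrite mem_monoms => /andP[vm _].
  rewrite /f' sgV //; congr (_ * _); rewrite /sg mx_mof /mon /mx.
  by rewrite (reindex_inj (@perm_inj _ w)); apply: eq_bigr => i _; rewrite permK.
apply: uniq_perm; rewrite ?monoms_uniq //.
  rewrite map_inj_in_uniq ?monoms_uniq // => m m'; rewrite !mem_monoms => /andP[vm _] /andP[vm' _] e.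
  by rewrite -(sgV m) // -(sgV m') // e.
move=> m; rewrite mem_monoms; apply/andP/mapP => [[vm /eqP md]|[m']]; last first.
  by rewrite mem_monoms => /andP[vm /eqP md] ->; rewrite varlt_mof sgd // md.
exists (mof (fun i : 'I_n => m (w i : nat))).
  rewrite mem_monoms varlt_mof deg_mof -md (deg_sum vm) [X in _ == X](reindex_inj (@perm_inj _ w)).
  by rewrite eqxx.
by apply: (varlt_eq vm (varlt_mof _)) => i; rewrite !mofE permKV.
Qed.

Variables q t : R.
Hypotheses (q0 : 0 < q) (q1 : q < 1) (t0 : 0 < t) (t1 : t < 1).

(** [mm_wpoly] gives the identity in |lam| variables only. Both sides are homogeneous and symmetric,
    and a monomial of degree |lam| involves at most |lam| variables, so a permutation brings it into
    range. *)
Lemma msym_psym lam : exists c : part -> R,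
  msym R lam = fun m => \sum_(be <- PD (sumn lam)) c be * psym R be m.
Proof.
set d := sumn lam; have [c cE] := mm_wpoly q0 q1 t0 t1 d lam; exists c.
set g : fps R := fun m => _.
have gE n (x : 'I_n -> R) : ev x g = psC (\sum_(be <- PD d) c be * pm be (px x)) * psX R d.
  rewrite /g ev_sum psC_sum mulr_suml big_seq [RHS]big_seq; apply: eq_bigr => be.
  by rewrite mem_PD => /eqP bd; rewrite evZ ev_psym psCM bd mulrA.
have symg n (x : 'I_n -> R) (w : 'S_n) : ev (fun i => x (w i)) g = ev x g by rewrite !gE px_perm.
have symm n (x : 'I_n -> R) (w : 'S_n) : ev (fun i => x (w i)) (msym R lam) = ev x (msym R lam).
  by rewrite !ev_msym mm_perm.
apply: funext => a.
case: (eqVneq (deg a) d) => [ad|ne]; last first.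
  have [n va] := ex_varlt a.
  have Z (f : fps R) : (forall x : 'I_n -> R, co (ev x f) (deg a) = 0) -> f a = 0.
    by move=> f0; apply: (@mx_indep R n (deg a) f) => // x; exact: f0.
  by rewrite !Z // => x; rewrite ?ev_msym ?gE coCM /= (negbTE ne) mulr0.
have [n0 va0] := ex_varlt a; pose n := maxn n0 d.
have va : varlt n a by apply: varlt_widen va0; rewrite leq_maxl.
pose b := mof (fun i : 'I_d => prow (shape n a) i).
have sz : (size (shape n a) <= d)%N by rewrite -ad -(sumn_shape va) size_le_sumn.
have vbd : varlt d b by exact: varlt_mof.
have vb : varlt n b by apply: varlt_widen vbd; rewrite leq_maxr.
have ab : shape n a = shape n b.
  rewrite -[LHS](@eshape_prow n); last by rewrite (leq_trans sz) // leq_maxr.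
  apply: eq_eshape => i; case: (ltnP i d) => h.
    by have := mofE (fun i : 'I_d => prow (shape n a) i) (Ordinal h) => /= <-.
  by rewrite nth_default ?(leq_trans sz) // (varlt_out vbd).
rewrite (sym_shape (symm n) va vb ab) (sym_shape (symg n) va vb ab).
apply: (@ev_inj_at R _ _ d b) => // x.
by rewrite ev_msym gE cE.
Qed.

Lemma co_ev_coords (c : part -> R) f n (x : 'I_n -> R) d : finite_set [set lam | c lam != 0]%classic ->
  f = (fun a => \sum_(lam \in [set: part]) c lam * psym R lam a) ->
  co (ev x f) d = \sum_(lam <- PD d) c lam * pm lam (px x).
Proof.
move=> fin ->; set s : seq part := fset_set [set lam | c lam != 0]%classic.
have sP lam : (lam \in s) = (c lam != 0).
  by rewrite /s in_fset_set // mem_setE.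
have -> : (fun a : monom => \sum_(lam \in [set: part]) c lam * psym R lam a) =
   (fun a => \sum_(lam <- s) c lam * psym R lam a).
  apply: funext => a; apply: fsum_seq => // [|lam _]; first exact: fset_uniq.
  by rewrite sP negbK => /eqP ->; rewrite mul0r.
rewrite ev_sum co_sum.
transitivity (\sum_(lam <- [seq lam : part <- s | sumn lam == d]) c lam * pm lam (px x)).
  rewrite big_filter [RHS]big_mkcond; apply: eq_bigr => lam _.
  by rewrite evZ coCM ev_psym coCM /= eq_sym; case: eqP; rewrite ?mulr1 ?mulr0.
rewrite [RHS](bigID (fun lam => c lam != 0)) /= [X in _ + X]big1 ?addr0; last first.
  by move=> lam; rewrite negbK => /eqP ->; rewrite mul0r.
rewrite -[RHS]big_filter; apply: perm_big; apply: uniq_perm.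
- by rewrite filter_uniq ?fset_uniq.
- by apply: filter_uniq; exact: PD_uniq.
by move=> lam; rewrite [LHS]mem_filter sP [RHS]mem_filter mem_PD andbC.
Qed.

Definition homog f d (c : part -> R) := f = fun m => \sum_(be <- PD d) c be * psym R be m.

Lemma ev_homog f d c n (x : 'I_n -> R) : homog f d c ->
  ev x f = psC (\sum_(be <- PD d) c be * pm be (px x)) * psX R d.
Proof.
move=> ->; rewrite ev_sum psC_sum mulr_suml big_seq [RHS]big_seq; apply: eq_bigr => be.
by rewrite mem_PD => /eqP bd; rewrite evZ ev_psym psCM bd mulrA.
Qed.

Lemma ev_homogP f d c : (forall n (x : 'I_n -> R),
   ev x f = psC (\sum_(be <- PD d) c be * pm be (px x)) * psX R d) -> homog f d c.
Proof.
by move=> E; apply: ev_inj => n x; rewrite E; apply/esym; apply: ev_homog.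
Qed.

(** [xget] returns some family of coordinates; by [pm_indep] there is only one. *)
Lemma pcoord_homog f d c : homog f d c -> pcoord f = fun be => if sumn be == d then c be else 0.
Proof.
move=> hf; set c' := fun be => _.
have fin : finite_set [set lam | c' lam != 0]%classic.
  apply: (@sub_finite_set _ _ [set` PD d]%classic); last exact: finite_seq.
  by move=> lam /=; rewrite mem_PD /c'; case: ifP => //; rewrite eqxx.
have fE : f = (fun a => \sum_(lam \in [set: part]) c' lam * psym R lam a).
  rewrite hf; apply: funext => a; rewrite (@fsum_seq _ _ _ (PD d)) ?PD_uniq // => [|lam _].
    by rewrite big_seq [RHS]big_seq; apply: eq_bigr => be; rewrite mem_PD /c' => ->.
  by rewrite mem_PD /c' => /negbTE ->; rewrite mul0r.
rewrite /pcoord; case: xgetP => [c'' _ [fin'' f''E]|/(_ c')]; last by case.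
apply: funext => be; apply/eqP; rewrite -subr_eq0; apply/eqP.
apply: (pm_indep q0 q1 t0 t1 (a := fun be => c'' be - c' be) (d := sumn be)); last by rewrite mem_PD.
move=> x; under eq_bigr do rewrite mulrBl; rewrite sumrB.
by rewrite -(co_ev_coords x _ fin fE) -(co_ev_coords x _ fin'' f''E) subrr.
Qed.

Lemma scal_homog f g d d' c c' : homog f d c -> homog g d' c' ->
  scal q t f g = if d == d' then \sum_(be <- PD d) c be * c' be * zz q t be else 0.
Proof.
move=> hf hg; rewrite /scal (pcoord_homog hf) (pcoord_homog hg).
rewrite (@fsum_seq _ _ _ (PD d)) ?PD_uniq // => [|be _]; last first.
  by rewrite mem_PD => /negbTE ->; rewrite !mul0r.
case: eqP => [e|ne]; last first.
  rewrite big_seq big1 // => be; rewrite mem_PD => /eqP ->; rewrite eqxx.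
  by case: eqP => // _; rewrite mulr0 mul0r.
by rewrite -e big_seq [RHS]big_seq; apply: eq_bigr => be; rewrite mem_PD => ->.
Qed.

End SymmetricSeries.

(** * Skew functions *)

Section Macdonald.
Variables (R : realType) (q t : R).
Hypotheses (q0 : 0 < q) (q1 : q < 1) (t0 : 0 < t) (t1 : t < 1).
Variable P : part -> fps R.
Hypothesis hP : is_macdonaldP q t P.
Implicit Types (lam mu nu eta be : part).

Lemma homog_deg f d (c : part -> R) a : homog f d c -> deg a <> d -> f a = 0.
Proof.
move=> hf ne; have [n va] := ex_varlt a.
apply: (@mx_indep R n (deg a) f) => // x; rewrite -[LHS]/(co (ev x f) (deg a)) (ev_homog x hf) coCM /=.
by case: eqP => // _; rewrite mulr0.
Qed.

Lemma macP_tri lam : exists u : part -> R, [/\ u lam = 1,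
  (forall mu, u mu != 0 -> dominates lam mu) &
  P lam = fun a => \sum_(mu <- PD (sumn lam)) u mu * msym R mu a].
Proof.
have [/(_ lam)[u uE] _] := hP.
pose u' mu := if mu == lam then 1 else if `[< dominates lam mu >] then u mu else 0.
exists u'; split; first by rewrite /u' eqxx.
  move=> mu; rewrite /u'; case: (eqVneq mu lam) => [->|_]; first by move=> _; exact: dominates_refl.
  by case: asboolP => //; rewrite eqxx.
rewrite uE; apply: funext => a.
rewrite [RHS](bigD1_seq lam) ?PD_uniq ?mem_PD //= {1}/u' eqxx mul1r; congr (_ + _).
rewrite (@fsum_seq _ _ _ [seq mu : part <- PD (sumn lam) | (mu != lam) && `[< dominates lam mu >]]).
- rewrite [LHS]big_filter [LHS]big_mkcondr; apply: eq_bigr => mu /negbTE ne.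
  by rewrite /u' ne; case: asboolP => // _; rewrite mul0r.
- by apply: filter_uniq; exact: PD_uniq.
- by move=> mu; rewrite mem_filter => /andP[/andP[/eqP ne /asboolP D] _].
move=> mu [D ne]; rewrite mem_filter mem_PD -(dominates_sumn D) eqxx andbT.
by case: eqP => //= _; case: asboolP.
Qed.

Definition cP lam : part -> R := pcoord (P lam).
Definition NP lam : R := scal q t (P lam) (P lam).

Lemma homog_P lam : homog (P lam) (sumn lam) (cP lam).
Proof.
have [u [_ _ uE]] := macP_tri lam; have /choice[c cE] := msym_psym q0 q1 t0 t1.
have h : homog (P lam) (sumn lam) (fun be => \sum_(mu <- PD (sumn lam)) u mu * c mu be).
  rewrite /homog uE; apply: funext => a; under [RHS]eq_bigr do rewrite mulr_suml.
  rewrite [RHS]exchange_big /= big_seq [RHS]big_seq; apply: eq_bigr => mu; rewrite mem_PD => /eqP md.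
  by rewrite cE md mulr_sumr; apply: eq_bigr => be _; rewrite mulrA.
rewrite /cP (pcoord_homog q0 q1 t0 t1 h) /homog {1}h; apply: funext => a.
by rewrite big_seq [RHS]big_seq; apply: eq_bigr => be; rewrite mem_PD => ->.
Qed.

Lemma ev_P n (x : 'I_n -> R) lam : ev x (P lam) = psC (Pf cP lam (px x)) * psX R (sumn lam).
Proof. by rewrite (ev_homog x (homog_P lam)). Qed.

Lemma P_tri n lam : Tri (@mm R n) (fun x => Pf cP lam (px x)) lam.
Proof.
have [u [u1 u2 uE]] := macP_tri lam; exists u; split=> // x.
have := congr1 (fun f => co f (sumn lam)) (ev_P x lam).
rewrite coCM /= eqxx mulr1 => <-; rewrite -[LHS]/(co (ev x (P lam)) _) uE ev_sum co_sum.
rewrite big_seq [RHS]big_seq; apply: eq_bigr => mu; rewrite mem_PD => /eqP md.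
by rewrite evZ coCM ev_msym coCM /= md eqxx mulr1.
Qed.

Lemma scal_P lam mu : scal q t (P lam) (P mu) = if sumn lam == sumn mu then
  \sum_(be <- PD (sumn lam)) cP lam be * cP mu be * zz q t be else 0.
Proof. by rewrite (scal_homog q0 q1 t0 t1 (homog_P lam) (homog_P mu)). Qed.

(** A norm is a sum of squares with the positive weights [zz]; if it were zero, P_lam would vanish,
    although its coefficient of m_lam is 1. *)
Lemma macdata_P : macdata q t cP NP.
Proof.
split=> [lam|lam mu e|]; last exact: P_tri.
  rewrite /NP scal_P eqxx; apply/eqP => E.
  have c0 be : be \in PD (sumn lam) -> cP lam be = 0.
    move=> bd; have z0 be' := zz_gt0 q0 q1 t0 t1 be'.
    have : cP lam be * cP lam be * zz q t be = 0.
      move: E => /eqP; rewrite psumr_eq0 => [/allP/(_ be bd)/eqP//|be' _].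
      by apply: mulr_ge0; [rewrite -expr2 sqr_ge0 | exact: ltW].
    by move=> /eqP; rewrite mulf_eq0 (gt_eqF (z0 be)) orbF mulf_eq0 orbb => /eqP.
  set d := sumn lam; have [u [u1 u2 uE]] := P_tri d lam.
  pose a (mu : part) := if sumn mu == d then u mu else 0.
  have : a lam = 0.
    apply: (@Tri_indep R q t q0 q1 t0 t1 d d (@mm R d) a (@Tri_refl _ _ _)); rewrite ?size_le_sumn //.
    move=> mu; set x := pt _ _ _; transitivity (Pf cP lam (px x)).
      by rewrite uE sum_PD_PDle; apply: eq_bigr => la _; rewrite /a; case: eqP; rewrite ?mul0r.
    by rewrite /Pf big_seq big1 // => be bd; rewrite c0 // mul0r.
  by rewrite /a eqxx u1 => /eqP; rewrite oner_eq0.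
have := scal_P lam mu; rewrite e eqxx -e => <-; case: eqP => [->|ne]; first by rewrite mul1r.
by rewrite mul0r; have [_ ->] := hP.
Qed.

Variable g : part -> part -> part -> R.
Hypothesis gE : forall eta nu pi,
  Pf cP eta pi * Pf cP nu pi = \sum_(lam <- PD (sumn eta + sumn nu)%N) g eta nu lam * Pf cP lam pi.

Definition gc eta nu be : R := \sum_(lam <- PD (sumn eta + sumn nu)%N) g eta nu lam * cP lam be.

Lemma homog_PP eta nu : homog (fmul (P eta) (P nu)) (sumn eta + sumn nu)%N (gc eta nu).
Proof.
apply: ev_homogP => n x; rewrite evM !ev_P mulrACA -psCM gE.
have -> : psX R (sumn eta) * psX R (sumn nu) = psX R (sumn eta + sumn nu).
  apply: psP => d; rewrite co_psXM /=; case: leqP => h; first by rewrite -(eqn_add2l (sumn eta)) subnKC.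
  by rewrite ltn_eqF // (leq_trans h) // leq_addr.
congr (psC _ * _); rewrite /gc; under [RHS]eq_bigr do rewrite mulr_suml.
rewrite [RHS]exchange_big /= big_seq [RHS]big_seq; apply: eq_bigr => lam; rewrite mem_PD => /eqP ld.
by rewrite /Pf ld mulr_sumr; apply: eq_bigr => be _; rewrite mulrA.
Qed.

(** The [else] branch repeats the left side, so the equation has content for matching degrees
    only. *)
Lemma scal_PPP lam eta nu : \sum_(be <- PD (sumn lam)) cP lam be * gc eta nu be * zz q t be =
  if sumn lam == (sumn eta + sumn nu)%N then g eta nu lam * NP lam else
  \sum_(be <- PD (sumn lam)) cP lam be * gc eta nu be * zz q t be.
Proof.
case: eqP => // e; rewrite /gc -e.
transitivity (\sum_(mu <- PD (sumn lam)) g eta nu mu *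
    \sum_(be <- PD (sumn lam)) cP lam be * cP mu be * zz q t be).
  under [RHS]eq_bigr do rewrite mulr_sumr.
  rewrite [RHS]exchange_big /=; apply: eq_bigr => be _; rewrite mulr_sumr mulr_suml.
  by apply: eq_bigr => mu _; ring.
rewrite (bigD1_seq lam) ?PD_uniq ?mem_PD //= [X in _ + X]big1_seq ?addr0 => [|mu /andP[ne]].
  by rewrite (mac_orth macdata_P) // eqxx mul1r.
rewrite mem_PD => /eqP md; rewrite (mac_orth macdata_P) ?md //.
by rewrite eq_sym (negbTE ne) mul0r mulr0.
Qed.

Lemma homogZ (f : fps R) d c k : homog f d c -> homog (fun a => k * f a) d (fun be => k * c be).
Proof.
by move=> ->; apply: funext => a; rewrite mulr_sumr; apply: eq_bigr => be _; rewrite mulrA.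
Qed.

Lemma scal_PQQ lam eta nu : scal q t (P lam) (fmul (macdonaldQ q t P eta) (macdonaldQ q t P nu)) =
  if sumn lam == (sumn eta + sumn nu)%N then g eta nu lam * (NP lam / (NP eta * NP nu)) else 0.
Proof.
have E : homog (fmul (macdonaldQ q t P eta) (macdonaldQ q t P nu)) (sumn eta + sumn nu)%N
    (fun be => (NP eta * NP nu)^-1 * gc eta nu be).
  apply: ev_homogP => n x; rewrite evM /macdonaldQ !evZ.
  transitivity (psC (NP eta * NP nu)^-1 * (ev x (P eta) * ev x (P nu))).
    by rewrite invfM psCM /NP; ring.
  rewrite -evM (ev_homog x (homog_PP eta nu)) mulrA -psCM mulr_sumr.
  by congr (psC _ * _); apply: eq_bigr => be _; rewrite mulrA.
rewrite (scal_homog q0 q1 t0 t1 (homog_P lam) E); case: eqP => // e.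
transitivity ((NP eta * NP nu)^-1 * \sum_(be <- PD (sumn lam)) cP lam be * gc eta nu be * zz q t be).
  by rewrite [RHS]mulr_sumr; apply: eq_bigr => be _; ring.
by rewrite scal_PPP e eqxx; ring.
Qed.

Lemma scal_QPP lam eta nu : scal q t (macdonaldQ q t P lam) (fmul (P eta) (P nu)) =
  if sumn lam == (sumn eta + sumn nu)%N then g eta nu lam else 0.
Proof.
rewrite (scal_homog q0 q1 t0 t1 (homogZ (NP lam)^-1 (homog_P lam)) (homog_PP eta nu)); case: eqP => // e.
transitivity ((NP lam)^-1 * \sum_(be <- PD (sumn lam)) cP lam be * gc eta nu be * zz q t be).
  by rewrite [RHS]mulr_sumr; apply: eq_bigr => be _; ring.
rewrite scal_PPP e eqxx mulrC mulfK //; exact: (mac_N0 macdata_P).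
Qed.

Lemma skewP_at lam eta a : skewP q t P lam eta a = \sum_(nu <- PD (deg a))
  (if sumn lam == (sumn eta + deg a)%N then g eta nu lam * (NP lam / (NP eta * NP nu)) else 0) * P nu a.
Proof.
rewrite /skewP (@fsum_seq _ _ _ (PD (deg a))) ?PD_uniq // => [|nu _]; last first.
  by rewrite mem_PD => /eqP ne; rewrite (homog_deg (homog_P nu)) ?mulr0 // => e; apply: ne.
by rewrite big_seq [RHS]big_seq; apply: eq_bigr => nu; rewrite mem_PD => /eqP nd; rewrite scal_PQQ nd.
Qed.

Lemma skewQ_at eta mu a : skewQ q t P eta mu a = \sum_(nu <- PD (deg a))
  (if sumn eta == (sumn mu + deg a)%N then g mu nu eta else 0) * ((NP nu)^-1 * P nu a).
Proof.
rewrite /skewQ (@fsum_seq _ _ _ (PD (deg a))) ?PD_uniq // => [|nu _]; last first.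
  by rewrite mem_PD => /eqP ne; rewrite /macdonaldQ (homog_deg (homog_P nu)) ?mulr0 // => e; apply: ne.
by rewrite big_seq [RHS]big_seq; apply: eq_bigr => nu; rewrite mem_PD => /eqP nd; rewrite scal_QPP nd.
Qed.

Variable b : part -> R.

Lemma ev_skewP_sum n (x : 'I_n -> R) eta d :
  co (ev x (fun a => \sum_(lam \in [set: part]) b lam * skewP q t P lam eta a)) d =
  skL cP NP g b eta d (px x).
Proof.
transitivity (co (ev x (fun a => \sum_(lam <- PD (sumn eta + d)%N) \sum_(nu <- PD d)
    (b lam * (g eta nu lam * (NP lam / (NP eta * NP nu)))) * P nu a)) d).
  rewrite /= big_seq [RHS]big_seq; apply: eq_bigr => m; rewrite mem_monoms => /andP[_ /eqP md].
  congr (_ * _); rewrite (@fsum_seq _ _ _ (PD (sumn eta + d)%N)) ?PD_uniq // => [|lam _]; last first.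
    by rewrite mem_PD skewP_at md => /negbTE ->; rewrite big1 ?mulr0 // => nu _; rewrite mul0r.
  rewrite big_seq [RHS]big_seq; apply: eq_bigr => lam; rewrite mem_PD skewP_at md => ->.
  by rewrite mulr_sumr; apply: eq_bigr => nu _; rewrite mulrA.
rewrite ev_sum co_sum /skL; apply: eq_bigr => lam _; rewrite ev_sum co_sum mulr_sumr.
rewrite big_seq [RHS]big_seq; apply: eq_bigr => nu; rewrite mem_PD => /eqP nd.
by rewrite evZ coCM ev_P coCM /= nd eqxx mulr1; ring.
Qed.

Lemma ev_skewQ_sum n (x : 'I_n -> R) eta :
  ev x (fun a => \sum_(mu \in [set: part]) b mu * skewQ q t P eta mu a) = skR cP NP g b eta (px x).
Proof.
apply: psP => d.
transitivity (co (ev x (fun a => if (d <= sumn eta)%N then \sum_(mu <- PD (sumn eta - d)%N) \sum_(nu <- PD d)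
    (b mu * (g mu nu eta / NP nu)) * P nu a else 0)) d).
  rewrite /= big_seq [RHS]big_seq; apply: eq_bigr => m; rewrite mem_monoms => /andP[_ /eqP md].
  congr (_ * _); case: leqP => h.
    rewrite (@fsum_seq _ _ _ (PD (sumn eta - d)%N)) ?PD_uniq // => [|mu _]; last first.
      rewrite mem_PD skewQ_at md => /eqP ne; rewrite big1 ?mulr0 // => nu _.
      by case: eqP => [e|]; rewrite ?mul0r //; case: ne; rewrite e addnK.
    rewrite big_seq [RHS]big_seq; apply: eq_bigr => mu; rewrite mem_PD skewQ_at md => /eqP ->.
    by rewrite subnK // eqxx mulr_sumr; apply: eq_bigr => nu _; rewrite !mulrA.
  rewrite (@fsum_seq _ _ _ [::]) ?big_nil // => mu _ _.
  rewrite skewQ_at md big1 ?mulr0 // => nu _; rewrite ifF ?mul0r //.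
  by apply/negbTE; rewrite neq_ltn (leq_trans h) // leq_addl.
case: (leqP d (sumn eta)) => h; last first.
  by rewrite /= leqNgt h /= big1 // => m _; rewrite mul0r.
rewrite [RHS]/= h ev_sum co_sum; apply: eq_bigr => mu _; rewrite ev_sum co_sum mulr_sumr.
rewrite big_seq [RHS]big_seq; apply: eq_bigr => nu; rewrite mem_PD => /eqP nd.
by rewrite evZ coCM ev_P coCM /= nd eqxx mulr1 /Qf; ring.
Qed.

Lemma skew_ev n (x : 'I_n -> R) eta (Th : fps R) :
  (forall pi pi', Sb cP b (fun k => pi k + pi' k) = Sb cP b pi * (Sb cP b pi' * sq (Ker q t pi pi'))) ->
  ev x Th = Sb cP b (px x) ->
  ev x (fun a => \sum_(lam \in [set: part]) b lam * skewP q t P lam eta a) =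
  ev x (fmul Th (fun a => \sum_(mu \in [set: part]) b mu * skewQ q t P eta mu a)).
Proof.
move=> SbD ThE; apply: psP => d; rewrite ev_skewP_sum evM ThE ev_skewQ_sum.
exact: (skew_identity q0 q1 t0 t1 macdata_P gE SbD).
Qed.

End Macdonald.

(** * The products Theta *)

Section Quotient.
Variable R : realType.
Implicit Types (f g : fps R) (m a : monom).

Lemma co_exp0 (w : ps R) j d : co w 0 = 0 -> (d < j)%N -> co (w ^+ j) d = 0.
Proof.
move=> w0; elim: j d => // j IH d dj.
rewrite exprS coM big_ord_recl w0 mul0r add0r big1 // => i _.
rewrite IH ?mulr0 // lift0; have := ltn_ord i; lia.
Qed.

(** The geometric series in 1 - g, cut at the degree of the monomial: if g has constant term 1,
    higher powers do not reach it. *)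
Definition finv g : fps R := fun a =>
  \sum_(j < (deg a).+1) (\big[@fmul R/fone R]_(k < j) (fun b => fone R b - g b)) a.

Lemma co_ev_finv n (x : 'I_n -> R) g d :
  co (ev x (finv g)) d = co (\sum_(j < d.+1) (1 - ev x g) ^+ j) d.
Proof.
rewrite co_sum /= (eq_big_seq (fun m => \sum_(j < d.+1)
    (\big[@fmul R/fone R]_(k < j) (fun b => fone R b - g b)) m * mx x m)); last first.
  by move=> m; rewrite mem_monoms => /andP[_ /eqP <-]; rewrite /finv mulr_suml.
rewrite exchange_big /=; apply: eq_bigr => j _.
rewrite -[LHS]/(co (ev x (\big[@fmul R/fone R]_(k < j) (fun b => fone R b - g b))) d).
by rewrite ev_prod prodr_const card_ord evB ev1.
Qed.

Lemma ev_finv n (x : 'I_n -> R) g : g mset0 = 1 -> ev x (finv g) * ev x g = 1.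
Proof.
move=> g0; have w0 : co (1 - ev x g) 0 = 0.
  by rewrite coD coN ev_co0 g0 co1 subrr.
apply: psP => d; rewrite mulrC.
rewrite (@co_mul_trunc _ _ _ (\sum_(j < d.+1) (1 - ev x g) ^+ j)); last first.
  move=> e ed; rewrite co_ev_finv !co_sum.
  rewrite -!(big_mkord xpredT (fun j => co ((1 - ev x g) ^+ j) e)).
  rewrite [RHS](@big_cat_nat _ _ _ e.+1) //= [X in _ = _ + X]big1_seq ?addr0 // => j.
  by rewrite mem_index_iota => /andP[_ /andP[ej _]]; apply: co_exp0.
have -> : ev x g * (\sum_(j < d.+1) (1 - ev x g) ^+ j) = 1 - (1 - ev x g) ^+ d.+1.
  by rewrite -[RHS]opprB subrX1 -mulNr; congr (_ * _); ring.
by rewrite coD coN co_exp0 // subr0.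
Qed.

Lemma ev_fdiv n (x : 'I_n -> R) f g : g mset0 = 1 -> ev x (fdiv f g) * ev x g = ev x f.
Proof.
move=> g0; rewrite -evM; congr (ev x _).
apply: (@xgetPex _ (fun=> 0) [set h : fps R | fmul h g = f]%classic).
exists (fmul f (finv g)) => /=; apply: ev_inj => k y.
by rewrite !evM -mulrA ev_finv // mulr1.
Qed.

(** Coefficients of monomials in n variables are constant from [N0] on, so their limit is
    attained. *)
Lemma ev_flim n (x : 'I_n -> R) (u : nat -> fps R) (F : ps R) N0 :
  (forall N (y : 'I_n -> R), (N0 <= N)%N -> ev y (u N) = ev y (u N0)) ->
  ev x (u N0) = F -> ev x (flim u) = F.
Proof.
move=> E <-; apply: eq_ev => m vm; apply/lim_near_cst => //.
by exists N0 => // N /= N0N; apply: (ev_inj_at (n := n)) vm => y; apply: E.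
Qed.

End Quotient.

(** * Infinite q-products as coefficientwise limits *)

Section Limits.
Variable R : realType.
Implicit Types (A L : ps R).
Local Open Scope classical_set_scope.

Lemma cvg_ext (u v : nat -> R) (l : R) : u =1 v -> v @ \oo --> l -> u @ \oo --> l.
Proof. by move/funext->. Qed.

Lemma cvg_inj (u v : nat -> R) (l l' : R) : u =1 v -> u @ \oo --> l -> v @ \oo --> l' -> l = l'.
Proof. by move/funext->; apply: cvg_unique. Qed.

Lemma cvg_coM (f g : nat -> ps R) (F G : ps R) d :
  (forall k, (k <= d)%N -> (fun N => co (f N) k) @ \oo --> co F k) ->
  (forall k, (k <= d)%N -> (fun N => co (g N) k) @ \oo --> co G k) ->
  (fun N => co (f N * g N) d) @ \oo --> co (F * G) d.
Proof.
move=> fF gG; rewrite coM; under eq_fun do rewrite coM.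
apply: cvg_big => [|i _]; first exact: add_continuous.
by apply: cvgM; [apply: fF; rewrite -ltnS | apply: gG; rewrite leq_subr].
Qed.

Definition pslim (f : nat -> ps R) : ps R := Ps (fun d => limn (fun N => co (f N) d)).

(* The solution of a linear equation depends continuously on its coefficients. *)
Lemma ode_cvg (f A : nat -> ps R) A' :
  (forall N, co (A N) 0 = 0) -> (forall N, co (f N) 0 = 1) ->
  (forall N, euler (f N) = A N * f N) ->
  (forall k, (fun N => co (A N) k) @ \oo --> co A' k) ->
  forall d, (fun N => co (f N) d) @ \oo --> co (pslim f) d.
Proof.
move=> A0 f0 ef cA.
have A'0 : co A' 0 = 0.
  apply: (cvg_inj A0 (cA 0%N)); exact: cvg_cst.
elim/ltn_ind => -[|d] IH; apply/cvg_ex => /=.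
  by exists 1; under eq_fun do rewrite f0; exact: cvg_cst.
exists (d.+1%:R^-1 * co (A' * Ps (fun k => if k == d.+1 then 0 else co (pslim f) k)) d.+1).
have E N : co (f N) d.+1 = d.+1%:R^-1 *
    co (A N * Ps (fun k => if k == d.+1 then 0 else co (f N) k)) d.+1.
  apply: (@mulfI _ d.+1%:R); first by rewrite pnatr_eq0.
  rewrite mulrA mulfV ?mul1r ?pnatr_eq0 // -[LHS]/(co (euler (f N)) d.+1) ef !coM.
  rewrite big_ord_recl [RHS]big_ord_recl A0 !mul0r; congr (_ + _); apply: eq_bigr => i _.
  by rewrite lift0 subSS /= ltn_eqF // ltnS leq_subr.
under eq_fun do rewrite E.
apply: cvgMr; apply: cvg_coM => [k _|k kd /=]; first exact: cA.
case: eqP => [_|/eqP kd']; first exact: cvg_cst.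
by apply: IH; rewrite ltn_neqAle kd'.
Qed.

Lemma ode_lim (f A : nat -> ps R) A' :
  (forall N, co (A N) 0 = 0) -> (forall N, co (f N) 0 = 1) ->
  (forall N, euler (f N) = A N * f N) ->
  (forall k, (fun N => co (A N) k) @ \oo --> co A' k) ->
  co (pslim f) 0 = 1 /\ euler (pslim f) = A' * pslim f.
Proof.
move=> A0 f0 ef cA; have cf := ode_cvg A0 f0 ef cA; split.
  by apply: (cvg_inj f0 (cf 0%N)); exact: cvg_cst.
apply: psP => d.
have h1 : (fun N => co (euler (f N)) d) @ \oo --> co (euler (pslim f)) d.
  by apply: cvgMr; apply: cf.
apply: (cvg_inj _ h1) => [N|]; first by rewrite ef.
by apply: cvg_coM.
Qed.

Variable q : R.
Hypotheses (q0 : 0 < q) (q1 : q < 1).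

Definition linprod c N : ps R := \prod_(k < N) lin (c * q ^+ k).
(** The logarithmic derivative of (c z; q)_oo, which is [linf] below: summing c^k q^(k j) over the
    factors j gives the denominator 1 - q^k. *)
Definition qA c : ps R := Ps (fun k => if k == 0%N then 0 else - (c ^+ k / (1 - q ^+ k))).
Definition qAN c N : ps R := \sum_(k < N) - geom (c * q ^+ k).

Lemma cvg_qAN c k : (fun N => co (qAN c N) k) @ \oo --> co (qA c) k.
Proof.
have [-> | k0] := eqVneq k 0%N.
  under eq_fun => N do rewrite /qAN co_sum big1 ?coN /= ?oppr0 //.
  exact: cvg_cst.
have qk1 : q ^+ k < 1 by rewrite exprn_ilt1 // ltW.
have E N : co (qAN c N) k = - (c ^+ k / (1 - q ^+ k)) * (1 - (q ^+ k) ^+ N).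
  rewrite /qAN co_sum.
  rewrite (eq_bigr (fun i : 'I_N => - c ^+ k * (q ^+ k) ^+ i)); last first.
    by move=> i _; rewrite coN /= (negPf k0) exprMn -!exprM mulnC mulNr.
  rewrite -mulr_sumr; move: (subrX1 (q ^+ k) N).
  set S := \sum_(i < N) _; set z := _ ^+ N => e.
  have u0 : 1 - q ^+ k != 0 by rewrite subr_eq0 eq_sym lt_eqF.
  have -> : 1 - z = (1 - q ^+ k) * S by rewrite -[1 - z]opprB e -mulNr opprB.
  by field.
apply: (cvg_ext E).
have -> : co (qA c) k = - (c ^+ k / (1 - q ^+ k)) * (1 - 0).
  by rewrite /qA /= (negPf k0) subr0 mulr1.
apply: cvgMr; apply: cvgB; first exact: cvg_cst.
by apply: cvg_expr; rewrite ger0_norm // exprn_ge0 // ltW.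
Qed.

Definition linf c : ps R := pslim (linprod c).

Lemma linprod_cvg c d : (fun N => co (linprod c N) d) @ \oo --> co (linf c) d.
Proof.
apply: (@ode_cvg _ (qAN c) (qA c)) => [N|N|N|k].
- by rewrite /qAN co_sum big1 // => i _; rewrite coN /= oppr0.
- by apply: co0_prod => i _; rewrite lin0.
- by apply: euler_ode_prod => i _; apply: euler_lin.
- exact: cvg_qAN.
Qed.

Lemma linf_ode c : co (linf c) 0 = 1 /\ euler (linf c) = qA c * linf c.
Proof.
apply: (@ode_lim _ (qAN c) (qA c)) => [N|N|N|k].
- by rewrite /qAN co_sum big1 // => i _; rewrite coN /= oppr0.
- by apply: co0_prod => i _; rewrite lin0.
- by apply: euler_ode_prod => i _; apply: euler_lin.
- exact: cvg_qAN.
Qed.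

End Limits.

Section QPochhammer.
Variable R : realType.
Implicit Types (f g : ps R) (m a : monom).
Local Open Scope classical_set_scope.

(* Exponents of z are doubled when the substituted monomial has degree 2. *)
Definition dbl (b : bool) f : ps R := if b then sq f else f.

Lemma dblM b f g : dbl b (f * g) = dbl b f * dbl b g.
Proof. by case: b => //=; rewrite sqM. Qed.

Lemma dbl_coE b f d : co (dbl b f) d = \sum_(k < d.+1) if (k * b.+1 == d)%N then co f k else 0.
Proof.
case: b => /=; last first.
  rewrite (bigD1 ord_max) //= muln1 eqxx big1 ?addr0 // => i ne.
  by rewrite muln1 ifN.
case: ifP => [od|/negbT ev].
  by rewrite big1 // => i _; case: eqP => // e; have := od; rewrite -[d in odd d]e muln2 odd_double.
have hd : (d./2 < d.+1)%N by rewrite ltnS -{2}(odd_double_half d) -addnn; lia.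
rewrite (bigD1 (Ordinal hd)) //= muln2 -{3}(odd_double_half d) (negPf ev) add0n eqxx.
rewrite big1 ?addr0 // => i ne; case: eqP => // e; case/eqP: ne; apply: val_inj => /=.
by rewrite -[in RHS]e muln2 doubleK.
Qed.

Definition mexp m k : monom := iter k (msetD m) mset0.

Lemma deg_mexp m k : deg (mexp m k) = (k * deg m)%N.
Proof. by elim: k => [|k IH]; rewrite ?deg0 //= degD IH mulSn. Qed.

Definition my n (x : 'I_n -> R) m : R := if varlt n m then mx x m else 0.

Lemma my_mexp n (x : 'I_n -> R) m k : my x (mexp m k) = my x m ^+ k.
Proof.
rewrite /my; case: ifP => [v|/negbT v].
  elim: k v => [|k IH]; first by rewrite mx0.
  by rewrite /= varltD => /andP[vm vk]; rewrite mxD exprS IH ?vm.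
case: k v => [|k] v; first by rewrite varlt0 in v.
elim: k v => [|k IH]; rewrite /= varltD.
  by rewrite varlt0 andbT => /negPf ->; rewrite expr1.
rewrite negb_and => /orP[/negPf -> |/IH h]; first by rewrite exprS mul0r.
by rewrite exprS -h mulr0.
Qed.

(* f(m) *)
Definition phi m f : fps R := fun a =>
  \sum_(k < (deg a).+1) if a == mexp m k then co f k else 0.

Lemma ev_phi n (x : 'I_n -> R) m f (b : bool) : deg m = b.+1 ->
  ev x (phi m f) = dbl b (dil (my x m) f).
Proof.
move=> dm; apply: psP => d; rewrite dbl_coE /=.
rewrite (eq_big_seq (fun a => \sum_(k < d.+1) if a == mexp m k then co f k * mx x a else 0)).
  rewrite exchange_big /=; apply: eq_bigr => k _.
  rewrite (eq_bigr (fun a => if a == mexp m k then co f k * mx x (mexp m k) else 0)); last first.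
    by move=> a _; case: eqP => // ->.
  rewrite sum_seq_delta ?monoms_uniq // mem_monoms deg_mexp dm -my_mexp /my.
  by case: varlt => /=; [rewrite mulrC | rewrite mul0r; case: ifP].
move=> a; rewrite mem_monoms => /andP[_ /eqP <-]; rewrite mulr_suml.
by apply: eq_bigr => k _; case: ifP; rewrite ?mul0r.
Qed.

Lemma ev_linear n (x : 'I_n -> R) m c (b : bool) : deg m = b.+1 ->
  ev x (fun a => fone R a - fterm c m a) = dbl b (dil (my x m) (lin c)).
Proof.
move=> dm; rewrite evB ev1 ev_fterm dm.
have -> : (if varlt n m then psC (c * mx x m) * psX R b.+1 else 0) =
    psC (c * my x m) * psX R b.+1.
  by rewrite /my; case: ifP; rewrite // mulr0 psC0 mul0r.
apply: psP => d; rewrite coD coN co1 coCM /=.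
have H e : co (dil (my x m) (lin c)) e = (e == 0%N)%:R - c * my x m * (e == 1%N)%:R.
  rewrite /dil; cbn [co]; rewrite co_lin.
  by case: e => [|[|e]] /=; rewrite ?mulr0 ?mulr1 ?subr0 ?expr0 ?expr1 ?sub0r // mulrN mulrC.
case: b {dm} => /=; last by rewrite -[RHS]/(co (dil (my x m) (lin c)) d) H.
case: ifP => od; first by case: d od => [|[|[|d]]] //=; rewrite mulr0 subr0.
rewrite -[RHS]/(co (dil (my x m) (lin c)) d./2) H.
by case: d od => [|[|[|[|d]]]].
Qed.

Lemma dbl_dil_prod b (y : R) I (r : seq I) (F : I -> ps R) :
  \prod_(i <- r) dbl b (dil y (F i)) = dbl b (dil y (\prod_(i <- r) F i)).
Proof.
elim: r => [|i r IH]; last by rewrite !big_cons IH dilM dblM.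
rewrite !big_nil.
have -> : dil y 1 = 1 :> ps R.
  by apply: psP => -[|d] /=; rewrite ?mulr0 ?mulr1.
case: b => //=; apply: psP => -[|[|d]] //=.
by case: ifP.
Qed.

Variable q : R.
Hypotheses (q0 : 0 < q) (q1 : q < 1).

Lemma partial_qpoch c m (b : bool) N : deg m = b.+1 ->
  \big[@fmul R/fone R]_(k < N) (fun a => fone R a - fterm (c * q ^+ k) m a) =
  phi m (linprod q c N).
Proof.
move=> dm; apply: ev_inj => n x; rewrite ev_prod (ev_phi x _ dm) -dbl_dil_prod.
by apply: eq_bigr => k _; apply: ev_linear.
Qed.

Lemma qpochE c m (b : bool) : deg m = b.+1 -> qpoch c m q = phi m (linf q c).
Proof.
move=> dm; apply/funext => a; apply/cvg_lim => //.
rewrite (_ : (fun N => _) = fun N => phi m (linprod q c N) a); last first.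
  by apply/funext => N; rewrite (partial_qpoch _ _ dm).
rewrite /phi; apply: cvg_big => [|k _]; first exact: add_continuous.
by case: ifP => _; [exact: linprod_cvg | exact: cvg_cst].
Qed.

Lemma ev_qpoch n (x : 'I_n -> R) c m (b : bool) : deg m = b.+1 ->
  ev x (qpoch c m q) = dbl b (dil (my x m) (linf q c)).
Proof. by move=> dm; rewrite (qpochE c dm) (ev_phi _ _ dm). Qed.

Lemma qpoch_mset0 c m (b : bool) : deg m = b.+1 -> qpoch c m q mset0 = 1.
Proof.
move=> dm; rewrite (qpochE c dm) /phi deg0 big_ord1 /= eqxx.
by have [] := linf_ode q0 q1 c.
Qed.

Lemma ode_dbl b f A : euler f = A * f ->
  euler (dbl b f) = (if b then sq A + sq A else A) * dbl b f.
Proof. by case: b => // /euler_sq. Qed.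

Lemma ode_qpoch n (x : 'I_n -> R) c m (b : bool) (A := dil (my x m) (qA q c)) : deg m = b.+1 ->
  euler (ev x (qpoch c m q)) = (if b then sq A + sq A else A) * ev x (qpoch c m q).
Proof.
move=> dm; rewrite (ev_qpoch x c dm); apply: ode_dbl; apply: euler_dil.
by have [] := linf_ode q0 q1 c.
Qed.

End QPochhammer.

Section Theta.
Variables (R : realType) (q t : R).
Hypotheses (q0 : 0 < q) (q1 : q < 1) (t0 : 0 < t) (t1 : t < 1).

Definition solves (A f : ps R) := co f 0 = 1 /\ euler f = A * f.

Lemma solves_div A B (F f g : ps R) : solves A f -> solves B g -> F * g = f -> solves (A - B) F.
Proof.
move=> [f0 ef] [g0 eg] e; split; first by rewrite -f0 -e coM0 g0 mulr1.
apply: (ps_mulI g0); have := eulerM F g; rewrite e ef eg => h.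
have -> : euler F * g = A * f - F * (B * g) by rewrite h; ring.
by rewrite -e; ring.
Qed.

Lemma solvesM A B f g : solves A f -> solves B g -> solves (A + B) (f * g).
Proof.
by move=> [f0 ef] [g0 eg]; split; [rewrite coM0 f0 g0 mulr1 | apply: euler_odeM].
Qed.

Lemma solves_prod I (r : seq I) (A f : I -> ps R) : (forall i, solves (A i) (f i)) ->
  solves (\sum_(i <- r) A i) (\prod_(i <- r) f i).
Proof.
move=> h; split; first by apply: co0_prod => i _; case: (h i).
by apply: euler_ode_prod => i _; case: (h i).
Qed.

Lemma solves_uniq A f g : co A 0 = 0 -> solves A f -> solves A g -> f = g.
Proof. by move=> A0 [f0 ef] [g0 eg]; apply: (ode_uniq A0) => //; rewrite f0 g0. Qed.

(** By uniqueness all partial products from N = n on take the same value, which is then the value of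
    the limit. *)
Lemma solves_flim n (A : ('I_n -> R) -> ps R) (u : nat -> fps R) (x : 'I_n -> R) :
  (forall y, co (A y) 0 = 0) ->
  (forall N y, (n <= N)%N -> solves (A y) (ev y (u N))) -> solves (A x) (ev x (flim u)).
Proof.
move=> A0 h; rewrite (@ev_flim _ _ x u (ev x (u n)) n) //; first exact: h.
by move=> N y nN; apply: (solves_uniq (A0 y)); apply: h.
Qed.

Lemma solves_qpoch n (x : 'I_n -> R) p c m (b : bool) (A := dil (my x m) (qA p c)) :
  0 < p -> p < 1 -> deg m = b.+1 ->
  solves (if b then sq A + sq A else A) (ev x (qpoch c m p)).
Proof.
move=> p0 p1 dm; split; first by rewrite ev_co0 (qpoch_mset0 p0 p1 c dm).
exact: ode_qpoch.
Qed.

Lemma deg2 i j : deg [mset i; j]%mset = 2.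
Proof. by rewrite degD !deg_msetn. Qed.

Section Eval.
Variables (n : nat).
Implicit Types (x : 'I_n -> R).

Definition xv x i : R := my x [mset i]%mset.

Lemma xvE x (i : 'I_n) : xv x i = x i.
Proof. by rewrite /xv /my varlt_msetn // ltn_ord (mx_msetn x 1) expr1. Qed.

Lemma xv_out x i : (n <= i)%N -> xv x i = 0.
Proof. by move=> ni; rewrite /xv /my varlt_msetn // ltnNge ni. Qed.

Lemma myD x a b : my x (a `+` b)%mset = my x a * my x b.
Proof.
by rewrite /my varltD; do 2!case: varlt; rewrite ?mxD ?mul0r ?mulr0.
Qed.

Lemma my_msetn2 x i : my x (msetn 2 i) = xv x i ^+ 2.
Proof.
have -> : msetn 2 i = ([mset i] `+` [mset i])%mset.
  by apply/msetP => j; rewrite msetE2 !msetnE; case: eqP.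
by rewrite myD expr2.
Qed.

Lemma sum_xv x N k : (n <= N)%N -> (0 < k)%N -> \sum_(i < N) xv x i ^+ k = px x k.
Proof.
move=> nN k0; rewrite /px; under [RHS]eq_bigr do rewrite -xvE.
rewrite (big_ord_widen N (fun i => xv x i ^+ k) nN) [RHS]big_mkcond /=.
by apply: eq_bigr => i _; case: ltnP => // ni; rewrite xv_out // expr0n (gtn_eqF k0).
Qed.

Lemma Alin_sum l x N : (n <= N)%N ->
  \sum_(i < N) Alin l (fun k => xv x i ^+ k) = Alin l (px x).
Proof.
move=> nN; apply: psP => k; rewrite co_sum /=; have [_|k0] := posnP k; first by rewrite big1.
by rewrite -(sum_xv x nN k0) mulr_sumr.
Qed.

Lemma solves_el1 x i : solves (Alin (qt q t) (fun k => xv x i ^+ k))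
  (ev x (fdiv (qpoch t [mset i]%mset q) (qpoch 1 [mset i]%mset q))).
Proof.
have d1 : deg [mset i]%mset = false.+1 by rewrite deg_msetn.
have /= S1 := solves_qpoch x t q0 q1 d1.
have /= S2 := solves_qpoch x 1 q0 q1 d1.
have := solves_div S1 S2 (ev_fdiv _ _ (qpoch_mset0 q0 q1 1 d1)).
congr solves; apply: psP => k; rewrite coD coN /= /qt.
case: posnP => [_|_]; first by rewrite mulr0 subrr.
by rewrite expr1n -/(xv x i); ring.
Qed.

Lemma q2_01 : 0 < q ^+ 2 < 1.
Proof. by rewrite exprn_gt0 // exprn_ilt1 // ltW. Qed.

Lemma solves_oa1 x i : solves (Alin (loa q t) (fun k => xv x i ^+ k))
  (ev x (fdiv (qpoch (q * t) (msetn 2 i) (q ^+ 2))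
      (fmul (fun a => fone R a - fterm 1 [mset i]%mset a)
            (qpoch (q ^+ 2) (msetn 2 i) (q ^+ 2))))).
Proof.
have [p0 p1] := andP q2_01.
have d1 : deg [mset i]%mset = false.+1 by rewrite deg_msetn.
have d2 : deg (msetn 2 i) = true.+1 by rewrite deg_msetn.
have /= S1 := solves_qpoch x (q * t) p0 p1 d2.
have /= S2 := solves_qpoch x (q ^+ 2) p0 p1 d2.
have S3 : solves (dil (xv x i) (- geom 1)) (ev x (fun a => fone R a - fterm 1 [mset i]%mset a)).
  rewrite (ev_linear x 1 d1) /=; split; first by rewrite -[LHS]/(1 * co (lin 1) 0) lin0 mulr1.
  by apply: euler_dil; apply: euler_lin.
have S4 := solvesM S3 S2; rewrite -evM in S4.
have g1 : fmul (fun a => fone R a - fterm 1 [mset i]%mset a)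
            (qpoch (q ^+ 2) (msetn 2 i) (q ^+ 2)) mset0 = 1.
  by have [h _] := S4; rewrite ev_co0 in h.
have := solves_div S1 S4 (ev_fdiv _ _ g1).
congr solves; apply: psP => k; rewrite !(coD, coN) /= my_msetn2 /loa.
have [->|k0] := posnP k; first by rewrite /= oppr0 !mulr0 !addr0 subr0.
case: ifP => od; first by rewrite expr1n; ring.
have k2 : k = k./2.*2 by rewrite -{1}(odd_double_half k) od.
have k20 : (0 < k./2)%N by lia.
have u : 1 - q ^+ k != 0 by rewrite subr_eq0 eq_sym lt_eqF // exprn_ilt1 ?ltW //; lia.
rewrite (gtn_eqF k20) expr1n -!exprM mul2n -k2; field.
exact: u.
Qed.

Lemma solves_pair x i j : solves (Ps (fun k => if odd k || (k == 0)%N then 0 else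
    2 * (qt q t k./2 * (xv x i * xv x j) ^+ k./2)))
  (ev x (fdiv (qpoch t [mset i; j]%mset q) (qpoch 1 [mset i; j]%mset q))).
Proof.
have d2 : deg [mset i; j]%mset = true.+1 by rewrite deg2.
have /= S1 := solves_qpoch x t q0 q1 d2.
have /= S2 := solves_qpoch x 1 q0 q1 d2.
have := solves_div S1 S2 (ev_fdiv _ _ (qpoch_mset0 q0 q1 1 d2)).
congr solves; apply: psP => k; rewrite !(coD, coN) /= /qt myD.
case: ifP => od /=; first by rewrite !addr0 subrr.
case: (posnP k) => [->|k0]; first by rewrite !mulr0 !addr0 subrr.
have k20 : (0 < k./2)%N by move: (odd_double_half k); rewrite od; lia.
by rewrite (gtn_eqF k20) expr1n -!/(xv x _); ring.
Qed.

Lemma sum_pairs (z : nat -> R) N :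
  \sum_(j < N) \sum_(i < j) 2 * (z i * z j) = (\sum_(i < N) z i) ^+ 2 - \sum_(i < N) z i ^+ 2.
Proof.
elim: N => [|N IH]; first by rewrite !big_ord0; ring.
rewrite big_ord_recr IH !big_ord_recr /= -mulr_sumr -mulr_suml; ring.
Qed.

Lemma solves_cross x : solves (Apair q t (px x)) (ev x (cross_factor q t)).
Proof.
apply: (@solves_flim _ (fun x => Apair q t (px x))) => // N y nN.
have -> : Apair q t (px y) = \sum_(j < N) \sum_(i < j)
    Ps (fun k => if odd k || (k == 0)%N then 0 else
      2 * (qt q t k./2 * (xv y i * xv y j) ^+ k./2)).
  apply: psP => k; rewrite co_sum; under eq_bigr do rewrite co_sum /=.
  rewrite /=; case: ifP => ok; first by rewrite big1 // => j _; rewrite big1.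
  have k20 : (0 < k./2)%N by move: (odd_double_half k) ok; case: odd => //=; lia.
  have k0 : (0 < k)%N by lia.
  rewrite -(sum_xv y nN k20) -(sum_xv y nN k0).
  have -> : \sum_(i < N) xv y i ^+ k = \sum_(i < N) (xv y i ^+ k./2) ^+ 2.
    apply: eq_bigr => i _; rewrite -exprM muln2 -{1}(odd_double_half k).
    by move: ok; case: odd.
  rewrite -(sum_pairs (fun i => xv y i ^+ k./2)) [LHS]mulr_sumr.
  apply: eq_bigr => j _; rewrite [LHS]mulr_sumr; apply: eq_bigr => i _.
  by rewrite exprMn; ring.
rewrite ev_prod; under eq_bigr do rewrite ev_prod.
by apply: solves_prod => j; apply: solves_prod => i; apply: solves_pair.
Qed.

Lemma solves_single x l (f : nat -> fps R) :
  (forall (y : 'I_n -> R) i, solves (Alin l (fun k => xv y i ^+ k)) (ev y (f i))) ->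
  solves (Alin l (px x)) (ev x (flim (fun N => \big[@fmul R/fone R]_(i < N) f i))).
Proof.
move=> h; apply: (@solves_flim _ (fun x => Alin l (px x))) => // N y nN.
by rewrite ev_prod -(Alin_sum l y nN); apply: solves_prod => i; apply: h.
Qed.

Lemma solves_Theta_el x :
  solves (Alin (qt q t) (px x) + Apair q t (px x)) (ev x (Theta_el q t)).
Proof.
rewrite /Theta_el evM; apply: solvesM; last exact: solves_cross.
by apply: (@solves_single x (qt q t) (fun i => fdiv (qpoch t [mset i]%mset q) (qpoch 1 [mset i]%mset q)));
  exact: solves_el1.
Qed.

Lemma solves_Theta_oa x :
  solves (Alin (loa q t) (px x) + Apair q t (px x)) (ev x (Theta_oa q t)).
Proof.
rewrite /Theta_oa evM; apply: solvesM; last exact: solves_cross.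
apply: (@solves_single x (loa q t) (fun i => fdiv (qpoch (q * t) (msetn 2 i) (q ^+ 2))
      (fmul (fun a => fone R a - fterm 1 [mset i]%mset a)
            (qpoch (q ^+ 2) (msetn 2 i) (q ^+ 2))))).
exact: solves_oa1.
Qed.

End Eval.

Variable P : part -> fps R.
Hypothesis hP : is_macdonaldP q t P.

Lemma structure_constants : exists g : part -> part -> part -> R, forall eta nu pi,
  Pf (cP P) eta pi * Pf (cP P) nu pi =
  \sum_(lam <- PD (sumn eta + sumn nu)%N) g eta nu lam * Pf (cP P) lam pi.
Proof.
have H := macdata_P q0 q1 t0 t1 hP.
have [g hg] := choice (fun en : part * part => wpoly_expand H
  (wpolyM (wpoly_Pf (cP P) en.1) (wpoly_Pf (cP P) en.2))).
by exists (fun e n => g (e, n)) => eta nu pi; apply: (hg (eta, nu)).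
Qed.

Lemma skew_identity_of (b : part -> R) (Th : fps R) (eta : part) :
  (forall pi pi', Sb (cP P) b (fun k => pi k + pi' k) =
     Sb (cP P) b pi * (Sb (cP P) b pi' * sq (Ker q t pi pi'))) ->
  (forall n (x : 'I_n -> R), ev x Th = Sb (cP P) b (px x)) ->
  (fun a => \sum_(lam \in [set: part]) b lam * skewP q t P lam eta a)
    = fmul Th (fun a => \sum_(mu \in [set: part]) b mu * skewQ q t P eta mu a).
Proof.
move=> SbD ThE; have [g gE] := structure_constants.
by apply: ev_inj => n x; apply: (skew_ev q0 q1 t0 t1 hP gE).
Qed.

End Theta.

Local Open Scope classical_set_scope.
Local Open Scope ring_scope.

Theorem lemma3p3 (R : realType) (q t : R)
  (hq0 : 0 < q) (hq1 : q < 1) (ht0 : 0 < t) (ht1 : t < 1)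
  (P : part -> fps R) (hP : is_macdonaldP q t P) (eta : part) :
  (fun a => \sum_(lam \in [set: part]) b_el q t lam * skewP q t P lam eta a)
    = fmul (Theta_el q t)
        (fun a => \sum_(mu \in [set: part]) b_el q t mu * skewQ q t P eta mu a)
  /\
  (fun a => \sum_(lam \in [set: part]) b_oa q t lam * skewP q t P lam eta a)
    = fmul (Theta_oa q t)
        (fun a => \sum_(mu \in [set: part]) b_oa q t mu * skewQ q t P eta mu a).
Proof.
have H := macdata_P hq0 hq1 ht0 ht1 hP.
split; apply: (skew_identity_of hq0 hq1 ht0 ht1 hP) => [pi pi'|n x].
(* [b_el] is convertible to [Bel], and [b_oa] to [Bp] for odd arms. *)
- exact: (SelD hq0 hq1 ht0 ht1 H).
- apply: (solves_uniq (A := Alin (qt q t) (px x) + Apair q t (px x))); first by rewrite /= addr0.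
  + exact: solves_Theta_el.
  + by split; [exact: (Sel0 hq0 hq1 ht0 ht1 H) | exact: (Sel_ode hq0 hq1 ht0 ht1 H)].
- exact: (SoaD hq0 hq1 ht0 ht1 H).
- apply: (solves_uniq (A := Alin (loa q t) (px x) + Apair q t (px x))); first by rewrite /= addr0.
  + exact: solves_Theta_oa.
  + by split; [exact: (Soa0 H) | exact: (Soa_ode' hq0 hq1 ht0 ht1 H)].
Qed.
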